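(* Let $s>1$ and let $B\in C_s(\mathbf R^{2d})$ be such that for every $\varepsilon>0$ there is some $h>0$ with $$\sup_{\alpha}\sup_{x,y\in\mathbf R^d} e^{-\varepsilon(|x|^{1/s}+|y|^{1/s})}\left(\frac{|D^\alpha (B(x,y))^{-1}|}{(\alpha!)^s h^{|\alpha|}}+\frac{|D^\alpha B(x,y)|}{(\alpha!)^s h^{|\alpha|}}\right)<\infty .$$ Then $\mathcal D_{B,s,+}'(\mathbf R^d)=\mathcal S_{B,s,+}'(\mathbf R^d)$. In particular, $\mathcal D_{s,+}'(\mathbf R^{2d})=\mathcal S_{s,+}'(\mathbf R^{2d})$.
   Context: Let $D=-i\partial$. $C_s(\mathbf R^{n})$ denotes the Gevrey class of order $s$: all $f\in C^\infty(\mathbf R^n)$ such that for every compact $K_0$ there is $h>0$ with $\sup_\alpha\sup_{x\in K_0}|D^\alpha f(x)|/((\alpha!)^s h^{|\alpha|})<\infty$. $(B(x,y))^{-1}$ is the function $1/B(x,y)$. Gelfand-Shilov spaces: for $s\ge 1/2$ and $h>0$, $\mathcal S_{s,h}(\mathbf R^n)$ is the set of $\varphi\in C^\infty(\mathbf R^n)$ with $\sup_{\alpha,\beta\in\mathbf N^n}\sup_{x}\frac{|x^\alpha D^\beta\varphi(x)|}{(\alpha!\beta!)^s h^{|\alpha+\beta|}}<\infty$. The space $\mathcal S_s(\mathbf R^n)$ is the inductive limit of these spaces as $h\to\infty$, and $\mathcal S_s'(\mathbf R^n)$ is its dual. For $s>1$, $\mathcal D_s(\mathbf R^n)$ is the space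 of compactly supported smooth functions $\varphi$ with $\sup_\beta\sup_x |D^\beta\varphi(x)|/((\beta!)^sh^{|\beta|})<\infty$ for some $h>0$, with its inductive limit topology over $h$ and over compact sets. $\mathcal D_s'(\mathbf R^n)$ is its dual (Roumieu ultradistributions). Since $\mathcal D_s$ is dense in $\mathcal S_s$ for $s>1$, $\mathcal S_s'$ is regarded as a subspace of $\mathcal D_s'$. $(\cdot,\cdot)$ is the sesquilinear duality extending the $L^2$ scalar product. For $a\in\mathcal D_s'(\mathbf R^d)$ and $\varphi\in\mathcal D_s(\mathbf R^d)$, set $(a\ast_B\varphi)(x)=\langle a(x-\cdot),B(x,\cdot)\varphi\rangle$, i.e. formally $\int a(x-y)\varphi(y)B(x,y)\,dy$. The map $\varphi\mapsto a\ast_B\varphi$ is the operator with kernel $a(x-y)B(x,y)\in\mathcal D_s'(\mathbf R^{2d})$. For $a\in\mathcal S_s'(\mathbf R^d)$ this kernel belongs to $\mathcal S_s'(\mathbf R^{2d})$, and the operator is continuous from $\mathcal S_s(\mathbf R^d)$ to $\mathcal S_s'(\mathbf R^d)$. $\mathcal D_{B,s,+}'(\mathbf R^d)$ is the set of $a\in\mathcal D_s'(\mathbf R^d)$ such that $\varphi\mapsto a\ast_B\varphi$ is positive, i.e. $(a\ast_B\varphi,\varphi)\ge0$ for all $\varphi\in\mathcal D_s(\mathbf R^d)$. $\mathcal S_{B,s,+}'(\mathbf R^d)$ is the set of $a\in\mathcal S_s'(\mathbf R^d)$ such that $\varphi\mapsto a\ast_B\varphi$ is positive, i.e. $(a\ast_B\varphi,\varphi)\ge0$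 for all $\varphi\in\mathcal S_s(\mathbf R^d)$. Twisted convolution on $\mathbf R^{2d}$: with $X=(x,\xi)$, $Y=(y,\eta)$ and $\sigma(X,Y)=\langle y,\xi\rangle-\langle x,\eta\rangle$, put $(a\ast_\sigma b)(X)=(2/\pi)^{d/2}\int a(X-Y)b(Y)e^{2i\sigma(X,Y)}\,dY$, interpreted by duality when $a$ is an ultradistribution and $b$ a test function. $\mathcal D_{s,+}'(\mathbf R^{2d})$ ($s>1$) is the set of $a\in\mathcal D_s'(\mathbf R^{2d})$ with $(a\ast_\sigma\varphi,\varphi)\ge0$ for every $\varphi\in\mathcal D_s(\mathbf R^{2d})$. $\mathcal S_{s,+}'(\mathbf R^{2d})$ is the set of $a\in\mathcal S_s'(\mathbf R^{2d})$ with $(a\ast_\sigma\varphi,\varphi)\ge0$ for every $\varphi\in\mathcal S_s(\mathbf R^{2d})$. *)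

(* Defs.v *)
From HB Require Import structures.
From mathcomp Require Import all_boot all_order all_algebra.
From mathcomp Require Import complex.
From mathcomp Require Import all_classical all_reals all_analysis.

Set Implicit Arguments.
Unset Strict Implicit.
Unset Printing Implicit Defensive.

Import Order.TTheory GRing.Theory Num.Theory.
Import numFieldNormedType.Exports.

Local Open Scope classical_set_scope.
Local Open Scope ring_scope.

(* The library norm on 'rV[R]_n is the sup norm; |x| is the Euclidean one. *)
Definition enorm (R : realType) (n : nat) (x : 'rV[R]_n) : R :=
  Num.sqrt (\sum_(i < n) x 0 i ^+ 2).

Definition dotr (R : realType) (n : nat) (x y : 'rV[R]_n) : R :=
  \sum_(i < n) x 0 i * y 0 i.

Definition cabs (R : realType) (z : R[i]) : R := Normc.normc z.

Definition multi_index (n : nat) : Type := {ffun 'I_n -> nat}.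

Definition mlen (n : nat) (al : multi_index n) : nat := (\sum_(i < n) al i)%N.

Definition mfact (n : nat) (al : multi_index n) : nat :=
  (\prod_(i < n) (al i)`!)%N.

Definition mpow (R : realType) (n : nat) (x : 'rV[R]_n) (al : multi_index n) : R :=
  \prod_(i < n) x 0 i ^+ al i.

(* Complex-valued functions are differentiated through their real and
   imaginary parts: D_i f = - i (d_i Re f + i d_i Im f). *)
Definition D1 (R : realType) (n : nat) (i : 'I_n)
    (f : 'rV[R]_n -> R[i]) : 'rV[R]_n -> R[i] := fun x =>
  - Complex 0 1 *
    Complex (derive (fun y => complex.Re (f y) : R^o) x (delta_mx 0 i))
            (derive (fun y => complex.Im (f y) : R^o) x (delta_mx 0 i)).

Definition Dmulti (R : realType) (n : nat) (al : multi_index n)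
    (f : 'rV[R]_n -> R[i]) : 'rV[R]_n -> R[i] :=
  foldr (fun i g => iter (al i) (D1 i) g) f (enum 'I_n).

(* All iterated partial derivatives, in any order, exist and are continuous. *)
Definition smooth (R : realType) (n : nat) (f : 'rV[R]_n -> R[i]) : Prop :=
  forall l : seq 'I_n, let g := foldr (@D1 R n) f l in
    continuous (fun x => complex.Re (g x) : R^o) /\
    continuous (fun x => complex.Im (g x) : R^o) /\
    forall (i : 'I_n) (x : 'rV[R]_n),
      derivable (fun y => complex.Re (g y) : R^o) x (delta_mx 0 i) /\
      derivable (fun y => complex.Im (g y) : R^o) x (delta_mx 0 i).

Definition gevrey (R : realType) (n : nat) (s : R) (f : 'rV[R]_n -> R[i]) : Prop :=
  smooth f /\
  forall K : set 'rV[R]_n, compact K -> exists2 h : R, 0 < h &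
    (ereal_sup [set z | exists (al : multi_index n) (x : 'rV[R]_n),
       K x /\
       z = (cabs (Dmulti al f x) /
            ((mfact al)%:R `^ s * h ^+ mlen al))%:E] < +oo)%E.

(* A family (step i, nrm i), for i in P, of normed spaces of functions is given
   by its carriers [step i] and its norms [nrm i].  The inductive limit is the
   union of the carriers with the finest locally convex topology for which all
   inclusions are continuous: a base of neighborhoods of 0 is given by the
   absolutely convex V containing, for each i, a ball around 0 of step i. *)
Definition ilim (E I : Type) (P : set I) (step : I -> set E) : set E :=
  \bigcup_(i in P) step i.

Definition absconvex (R : realType) (T : Type) (V : set (T -> R[i])) : Prop :=
  forall (f g : T -> R[i]) (c e : R[i]), V f -> V g -> cabs c + cabs e <= 1 ->
    V (fun x => c * f x + e * g x).

Definition ilim_nbhs0 (R : realType) (T I : Type) (P : set I)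
    (step : I -> set (T -> R[i])) (nrm : I -> (T -> R[i]) -> \bar R)
    (U : set (T -> R[i])) : Prop :=
  exists V : set (T -> R[i]),
    V `<=` U /\ V `<=` ilim P step /\ absconvex V /\
    forall i, P i -> exists2 dlt : R, 0 < dlt &
      forall f, step i f -> (nrm i f < dlt%:E)%E -> V f.

(* Continuous linear functionals.  They are total Rocq functions, extended by 0
   outside of the space of test functions, so that equal functionals are equal
   as Rocq functions. *)
Definition ilim_dual (R : realType) (T I : Type) (P : set I)
    (step : I -> set (T -> R[i])) (nrm : I -> (T -> R[i]) -> \bar R) :
    set ((T -> R[i]) -> R[i]) :=
  [set u |
    (forall f g c, ilim P step f -> ilim P step g ->
       u (fun x => c * f x + g x) = c * u f + u g) /\
    (forall eps : R, 0 < eps ->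
       ilim_nbhs0 P step nrm [set f | ilim P step f /\ cabs (u f) < eps]) /\
    (forall f, ~ ilim P step f -> u f = 0)].

Definition Dnorm (R : realType) (n : nat) (s h : R) (f : 'rV[R]_n -> R[i]) : \bar R :=
  ereal_sup [set z | exists (be : multi_index n) (x : 'rV[R]_n),
    z = (cabs (Dmulti be f x) / ((mfact be)%:R `^ s * h ^+ mlen be))%:E].

Definition Snorm (R : realType) (n : nat) (s h : R) (f : 'rV[R]_n -> R[i]) : \bar R :=
  ereal_sup [set z | exists (al be : multi_index n) (x : 'rV[R]_n),
    z = (cabs (Complex (mpow x al) 0 * Dmulti be f x) /
         ((mfact al * mfact be)%:R `^ s * h ^+ (mlen al + mlen be)))%:E].

Definition Dindex (R : realType) (n : nat) : set (set 'rV[R]_n * R) :=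
  [set Kh | compact Kh.1 /\ 0 < Kh.2].

Definition Dstep (R : realType) (n : nat) (s : R) (Kh : set 'rV[R]_n * R) :
    set ('rV[R]_n -> R[i]) :=
  [set f | smooth f /\ (forall x, ~ Kh.1 x -> f x = 0) /\
           (Dnorm s Kh.2 f < +oo)%E].

Definition Sindex (R : realType) : set R := [set h | 0 < h].

Definition Sstep (R : realType) (n : nat) (s h : R) : set ('rV[R]_n -> R[i]) :=
  [set f | smooth f /\ (Snorm s h f < +oo)%E].

Definition Dspace (R : realType) (n : nat) (s : R) : set ('rV[R]_n -> R[i]) :=
  ilim (@Dindex R n) (Dstep s).

Definition Sspace (R : realType) (n : nat) (s : R) : set ('rV[R]_n -> R[i]) :=
  ilim (@Sindex R) (Sstep s).

Definition Ddual (R : realType) (n : nat) (s : R) :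
    set (('rV[R]_n -> R[i]) -> R[i]) :=
  ilim_dual (@Dindex R n) (Dstep s) (fun Kh => Dnorm s Kh.2).

Definition Sdual (R : realType) (n : nat) (s : R) :
    set (('rV[R]_n -> R[i]) -> R[i]) :=
  ilim_dual (@Sindex R) (Sstep s) (@Snorm R n s).

(* The map S_s' -> D_s' (injective for s > 1) regarding S_s' as a subspace
   of D_s'. *)
Definition restrictD (R : realType) (n : nat) (s : R)
    (u : ('rV[R]_n -> R[i]) -> R[i]) : ('rV[R]_n -> R[i]) -> R[i] :=
  patch (fun=> 0) (@Dspace R n s) u.

(* Lebesgue integral over R^n of an integrable continuous function, as an
   iterated integral. *)
Fixpoint integralRn (R : realType) (n : nat) : ('rV[R]_n -> R) -> R :=
  match n with
  | 0 => fun f => f 0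
  | n'.+1 => fun f =>
      Rintegral (@lebesgue_measure R) setT
        (fun t : R => @integralRn R n' (fun y => f (row_mx (const_mx t : 'rV[R]_1) y)))
  end.

Definition integralC (R : realType) (n : nat) (f : 'rV[R]_n -> R[i]) : R[i] :=
  Complex (integralRn (fun x => complex.Re (f x)))
          (integralRn (fun x => complex.Im (f x))).

Definition regular_dual (R : realType) (n : nat) (u : 'rV[R]_n -> R[i]) :
    ('rV[R]_n -> R[i]) -> R[i] :=
  fun psi => integralC (fun x => u x * psi x).

(* The sesquilinear duality, (u, psi) = <u, conj psi>. *)
Definition sesqui_pair (R : realType) (n : nat) (u : ('rV[R]_n -> R[i]) -> R[i])
    (psi : 'rV[R]_n -> R[i]) : R[i] :=
  u (fun x => conjc (psi x)).

(* B : R^(2d) -> C; the value B(x, y) is B (row_mx x y).  Replacing y by x - z,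
   <a(x - .), psi> = <a, z |-> psi (x - z)>. *)
Definition convB (R : realType) (d : nat) (B : 'rV[R]_(d + d) -> R[i])
    (a : ('rV[R]_d -> R[i]) -> R[i]) (phi : 'rV[R]_d -> R[i]) :
    'rV[R]_d -> R[i] :=
  fun x => a (fun z => B (row_mx x (x - z)) * phi (x - z)).

(* On R[i], 0 <= z means that z is real and nonnegative. *)
Definition positive_convB (R : realType) (d : nat) (B : 'rV[R]_(d + d) -> R[i])
    (X : set ('rV[R]_d -> R[i])) (a : ('rV[R]_d -> R[i]) -> R[i]) : Prop :=
  forall phi, X phi -> 0 <= sesqui_pair (regular_dual (convB B a phi)) phi.

Definition DBplus (R : realType) (d : nat) (B : 'rV[R]_(d + d) -> R[i]) (s : R) :
    set (('rV[R]_d -> R[i]) -> R[i]) :=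
  [set a | Ddual s a /\ positive_convB B (Dspace s) a].

Definition SBplus (R : realType) (d : nat) (B : 'rV[R]_(d + d) -> R[i]) (s : R) :
    set (('rV[R]_d -> R[i]) -> R[i]) :=
  [set a | Sdual s a /\ positive_convB B (Sspace s) a].

Definition growthB (R : realType) (d : nat) (B : 'rV[R]_(d + d) -> R[i]) (s : R) :
    Prop :=
  forall eps : R, 0 < eps -> exists2 h : R, 0 < h &
    (ereal_sup [set w | exists (al : multi_index (d + d)) (x y : 'rV[R]_d),
       w = (expR (- (eps * (enorm x `^ s^-1 + enorm y `^ s^-1))) *
            (cabs (Dmulti al (fun Z => (B Z)^-1) (row_mx x y)) /
               ((mfact al)%:R `^ s * h ^+ mlen al) +
             cabs (Dmulti al B (row_mx x y)) /
               ((mfact al)%:R `^ s * h ^+ mlen al)))%:E] < +oo)%E.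

(* sigma (X, Y) = <y, xi> - <x, eta> for X = (x, xi), Y = (y, eta). *)
Definition symp (R : realType) (d : nat) (X Y : 'rV[R]_(d + d)) : R :=
  dotr (lsubmx Y) (rsubmx X) - dotr (lsubmx X) (rsubmx Y).

Definition cexpi (R : realType) (t : R) : R[i] := Complex (cos t) (sin t).

(* (a *_sigma b)(X) = (2/pi)^(d/2) <a(X - .), e^(2 i sigma(X, .)) b>. *)
Definition twisted_conv (R : realType) (d : nat)
    (a : ('rV[R]_(d + d) -> R[i]) -> R[i]) (b : 'rV[R]_(d + d) -> R[i]) :
    'rV[R]_(d + d) -> R[i] :=
  fun X => Complex ((2 / pi) `^ (d%:R / 2)) 0 *
           a (fun Z => b (X - Z) * cexpi (2 * symp X (X - Z))).

Definition Dplus (R : realType) (d : nat) (s : R) :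
    set (('rV[R]_(d + d) -> R[i]) -> R[i]) :=
  [set a | Ddual s a /\
     forall phi, Dspace s phi -> 0 <= sesqui_pair (regular_dual (twisted_conv a phi)) phi].

Definition Splus (R : realType) (d : nat) (s : R) :
    set (('rV[R]_(d + d) -> R[i]) -> R[i]) :=
  [set a | Sdual s a /\
     forall phi, Sspace s phi -> 0 <= sesqui_pair (regular_dual (twisted_conv a phi)) phi].

(* Main.v *)
Require Import Defs.
From mathcomp Require Import all_boot all_order all_algebra.
From mathcomp Require Import complex.
From mathcomp Require Import all_classical all_reals all_analysis.
From mathcomp Require Import ring lra zify.
From mathcomp Require Import measurable_realfun.

(** Restricting a functional from the larger dual to the smaller one is
    harmless, so the content of the theorem is that a positive ultradistribution
    [a] extends to the Gelfand-Shilov space, and that positivity persists.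

    Extension.  It suffices to bound [a f], for test functions [f], by the norms
    of the larger space ([positive_bound]).  Truncating [f] at radius [j] then
    gives Cauchy sequences, whose limits define the extension ([ext_Sdual]).
    The quadratic form of a function of the larger space is the limit of those
    of its truncations, since the integrands converge uniformly with respect to
    an integrable weight ([diag_form_trunc], [positive_extends]).

    The bound.  Let [Q (phi, psi)] be the sesquilinear form of [phi |-> a *_B phi].
    Positivity and polarization give
    [|Q (phi, psi)| <= |Q (phi, phi)| + |Q (psi, psi)|] ([Qf_le]).  For a bump at
    the position [t], modulated by a character, the diagonal value only involves
    [a] near the origin; it is therefore bounded uniformly in [t] and in the
    frequency, up to subexponential factors of arbitrarily small rate, those in
    [t] coming from the growth of [B] ([Qf_wave_le]).  So the kernel
    [B (x, y) a (x - y)], cut off around [x = t], [y = 0], is a functional with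
    the same bound on all characters, and hence, for each Gevrey radius, on all
    Gevrey functions supported in a box ([tensor_bound]).  Applied to
    [f (x - y) / B (x, y)], times another cutoff, this shows that the pairing [J t]
    of [a (x - y)] with [f (x - y)], localized around [(t, 0)], decays in [t] like
    [f] up to a smaller rate ([Jker_le]).  Integrating [J] over all positions
    gives a nonzero multiple of [a f], by translation invariance
    ([kernel_pair_Jker], [kernel_pair_spread], [mass_neq0]).

    From characters to functions.  [tensor_bound] is an induction on the number
    of variables, in which the first variable is expanded by trigonometric
    interpolation on finitely many points.  Summation by parts gives decay of
    the coefficients in the frequency, uniformly in the number of points, and the
    interpolation error tends to 0 with all its derivatives because it vanishes
    on the grid ([coef_gb], [grid_small]).

    Integrals.  All integrands are compactly supported Lipschitz functions or
    weighted uniform limits of such, so that integrals are limits of Riemann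
    sums, and a continuous functional commutes with them ([a_integral]).

    Twisted convolution.  Its kernel is the exponential of an imaginary quadratic
    form.  A derivative of order [k] at [Z] is at most [2 ^ k (|Z| + k) ^ k]
    ([phase_pow]), which is a Gevrey bound growing subexponentially in [Z], of any
    prescribed rate ([subexp_gb_phase]); so the second equality is a case of the first. *)

Set Implicit Arguments.
Unset Strict Implicit.
Unset Printing Implicit Defensive.

Import Order.TTheory GRing.Theory Num.Theory.
Import numFieldNormedType.Exports.

Local Open Scope classical_set_scope.
Local Open Scope ring_scope.

Local Notation Re := complex.Re.
Local Notation Im := complex.Im.

(** * Complex-valued functions and their directional derivatives *)

Section ComplexBasics.
Variable R : realType.
Implicit Types z w : R[i].

Lemma cabs0 : cabs (0 : R[i]) = 0.
Proof. exact: ComplexField.Normc.normc0. Qed.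

Lemma cabs1 : cabs (1 : R[i]) = 1.
Proof. exact: ComplexField.Normc.normc1. Qed.

Lemma cabsM z w : cabs (z * w) = cabs z * cabs w.
Proof. exact: ComplexField.Normc.normcM. Qed.

Lemma cabsD z w : cabs (z + w) <= cabs z + cabs w.
Proof. exact: le_normcD. Qed.

Lemma cabsN z : cabs (- z) = cabs z.
Proof. exact: normcN. Qed.

Lemma cabsB z w : cabs (z - w) <= cabs z + cabs w.
Proof. by rewrite (le_trans (cabsD _ _))// cabsN. Qed.

Lemma cabs_ge0 z : 0 <= cabs z.
Proof. by case: z => a b; exact: sqrtr_ge0. Qed.

Lemma cabs_real (a : R) : cabs (Complex a 0) = `|a|.
Proof. by rewrite /cabs /Normc.normc /= expr0n /= addr0 sqrtr_sqr. Qed.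

Lemma cabs_eq0 z : cabs z = 0 -> z = 0.
Proof. exact: ComplexField.Normc.eq0_normc. Qed.

Lemma cabs_conj z : cabs (conjc z) = cabs z.
Proof. by case: z => a b; rewrite /cabs /= sqrrN. Qed.

Lemma cabs_Re z : `|Re z| <= cabs z.
Proof.
case: z => a b; rewrite /cabs /= -sqrtr_sqr ler_wsqrtr//.
by rewrite lerDl sqr_ge0.
Qed.

Lemma cabs_Im z : `|Im z| <= cabs z.
Proof.
case: z => a b; rewrite /cabs /= -sqrtr_sqr ler_wsqrtr//.
by rewrite lerDr sqr_ge0.
Qed.

Lemma cabs_i : cabs (Complex 0 1 : R[i]) = 1.
Proof. by rewrite /cabs /Normc.normc /= expr0n expr1n add0r sqrtr1. Qed.

Lemma cabs_le_ReIm z : cabs z <= `|Re z| + `|Im z|.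
Proof.
have -> : z = Complex (Re z) 0 + Complex 0 1 * Complex (Im z) 0.
  by case: z => a b; apply/eqP; rewrite eq_complex /=; apply/andP; split; apply/eqP; ring.
rewrite (le_trans (cabsD _ _))// cabsM cabs_i mul1r !cabs_real.
by rewrite /= !(mul0r, mulr0, mul1r, addr0, subr0, add0r).
Qed.

Lemma cabs_sum (I : Type) (r : seq I) (P : pred I) (F : I -> R[i]) :
  cabs (\sum_(i <- r | P i) F i) <= \sum_(i <- r | P i) cabs (F i).
Proof.
elim/big_ind2: _ => [|x1 x2 y1 y2 h1 h2|//]; first by rewrite cabs0.
by rewrite (le_trans (cabsD _ _))// lerD.
Qed.

Lemma cabsX z k : cabs (z ^+ k) = cabs z ^+ k.
Proof. by elim: k => [|k IH]; rewrite ?expr0 ?cabs1// !exprS cabsM IH. Qed.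

Lemma iiN : - Complex 0 1 * Complex 0 1 = 1 :> R[i].
Proof. by apply/eqP; rewrite eq_complex /=; apply/andP; split; apply/eqP; ring. Qed.

Lemma Re_add z w : Re (z + w) = Re z + Re w.
Proof. by case: z w => a b [c d]. Qed.
Lemma Im_add z w : Im (z + w) = Im z + Im w.
Proof. by case: z w => a b [c d]. Qed.
Lemma Re_opp z : Re (- z) = - Re z.
Proof. by case: z => a b. Qed.
Lemma Im_opp z : Im (- z) = - Im z.
Proof. by case: z => a b. Qed.
Lemma Re_mul z w : Re (z * w) = Re z * Re w - Im z * Im w.
Proof. by case: z w => a b [c d]. Qed.
Lemma Im_mul z w : Im (z * w) = Re z * Im w + Im z * Re w.
Proof. by case: z w => a b [c d]. Qed.
Lemma Re_conj z : Re (conjc z) = Re z.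
Proof. by case: z. Qed.
Lemma Im_conj z : Im (conjc z) = - Im z.
Proof. by case: z. Qed.
Lemma ceq z w : Re z = Re w -> Im z = Im w -> z = w.
Proof. by case: z w => a b [c d] /= -> ->. Qed.

Definition cparts := (Re_add, Im_add, Re_opp, Im_opp, Re_mul, Im_mul, Re_conj, Im_conj).

End ComplexBasics.

Section Derivatives.
Variable R : realType.

Section OneDirection.
Variable V : normedModType R.
Implicit Types (f g : V -> R[i]) (x v : V) (z w : R[i]).

Definition cder f x v z :=
  is_derive x v (fun y => Re (f y) : R^o) (Re z) /\
  is_derive x v (fun y => Im (f y) : R^o) (Im z).

Definition ccont f :=
  continuous (fun y => Re (f y) : R^o) /\ continuous (fun y => Im (f y) : R^o).

Lemma cder_unique f x v z w : cder f x v z -> cder f x v w -> z = w.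
Proof.
by move=> [a b] [c d]; apply: ceq; rewrite -?(@derive_val _ _ _ _ _ _ _ a)
  -?(@derive_val _ _ _ _ _ _ _ b) -?(@derive_val _ _ _ _ _ _ _ c)
  -?(@derive_val _ _ _ _ _ _ _ d).
Qed.

Lemma cder_cst c x v : cder (fun=> c) x v 0.
Proof. by split; exact: is_derive_cst. Qed.

Lemma cder_add f g x v z w :
  cder f x v z -> cder g x v w -> cder (fun y => f y + g y) x v (z + w).
Proof.
move=> [a b] [c d]; split.
- rewrite Re_add (_ : (fun y => _) = (fun y => Re (f y) : R^o) + (fun y => Re (g y) : R^o)).
    exact: is_deriveD.
  by apply/funext => y; rewrite /= Re_add.
- rewrite Im_add (_ : (fun y => _) = (fun y => Im (f y) : R^o) + (fun y => Im (g y) : R^o)).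
    exact: is_deriveD.
  by apply/funext => y; rewrite /= Im_add.
Qed.

Lemma cder_mul f g x v z w :
  cder f x v z -> cder g x v w -> cder (fun y => f y * g y) x v (z * g x + f x * w).
Proof.
move=> [a b] [c d]; split.
- rewrite (_ : (fun y => _) = (fun y => Re (f y) : R) * (fun y => Re (g y) : R)
    - (fun y => Im (f y) : R) * (fun y => Im (g y) : R)); last first.
    by apply/funext => y; rewrite /= Re_mul.
  apply: (is_derive_eq (is_deriveB (is_deriveM a c) (is_deriveM b d))).
  rewrite !cparts /GRing.scale /=; ring.
- rewrite (_ : (fun y => _) = (fun y => Re (f y) : R) * (fun y => Im (g y) : R)
    + (fun y => Im (f y) : R) * (fun y => Re (g y) : R)); last first.
    by apply/funext => y; rewrite /= Im_mul.
  apply: (is_derive_eq (is_deriveD (is_deriveM a d) (is_deriveM b c))).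
  rewrite !cparts /GRing.scale /=; ring.
Qed.

Lemma cder_conj f x v z : cder f x v z -> cder (fun y => conjc (f y)) x v (conjc z).
Proof.
move=> [a b]; split.
- rewrite Re_conj (_ : (fun y => _) = (fun y => Re (f y) : R^o))//.
  by apply/funext => y; rewrite /= Re_conj.
- rewrite Im_conj (_ : (fun y => _) = - (fun y => Im (f y) : R^o)).
    exact: is_deriveN.
  by apply/funext => y; rewrite /= Im_conj.
Qed.

Lemma cder_eq f x v z w : cder f x v z -> z = w -> cder f x v w.
Proof. by move=> + <-. Qed.

Lemma is_derive_inv (g : V -> R) x v (dg : R) : g x != 0 ->
  is_derive x v g dg -> is_derive x v (fun y => (g y)^-1) (- (g x) ^- 2 * dg).
Proof.
move=> gx a; split; first by apply: derivableV => //; exact: ex_derive.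
by rewrite deriveV// derive_val.
Qed.

Lemma cder_inv f x v z : f x != 0 -> cder f x v z ->
  cder (fun y => (f y)^-1) x v (- (z * ((f x)^-1 * (f x)^-1))).
Proof.
move=> fx [a b].
set p := fun y => Re (f y) : R; set q := fun y => Im (f y) : R.
have pq0 : p x ^+ 2 + q x ^+ 2 != 0.
  apply: contra fx; rewrite paddr_eq0 ?sqr_ge0// !sqrf_eq0 eq_complex => /andP[].
  by rewrite /p /q => /eqP -> /eqP ->; rewrite !eqxx.
have dN : is_derive x v (p * p + q * q)
    (2 * (p x * Re z) + 2 * (q x * Im z)).
  apply: (is_derive_eq (is_deriveD (is_deriveM a a) (is_deriveM b b))).
  by rewrite /GRing.scale /=; ring.
have Ny y : (p * p + q * q) y = p y ^+ 2 + q y ^+ 2.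
  by rewrite (_ : (p * p + q * q) y = p y * p y + q y * q y)// !expr2.
have N0 : (p * p + q * q) x != 0 by rewrite Ny.
have dV := @is_derive_inv _ _ _ _ N0 dN.
have E y : (f y)^-1 = Complex (p y * ((p * p + q * q) y)^-1) (- (q y * ((p * p + q * q) y)^-1)).
  by rewrite Ny /p /q; case: (f y).
have fxE : (f x)^-1 = Complex (p x / (p x ^+ 2 + q x ^+ 2)) (- (q x / (p x ^+ 2 + q x ^+ 2))).
  by rewrite E Ny.
split.
- rewrite (_ : (fun y => _) = p * (fun y => ((p * p + q * q) y)^-1)); last first.
    by apply/funext => y; rewrite E /=.
  apply: (is_derive_eq (is_deriveM a dV)).
  rewrite fxE /GRing.scale !cparts /= Ny; field.
  exact: pq0.
- rewrite (_ : (fun y => _) = - (q * (fun y => ((p * p + q * q) y)^-1))); last first.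
    by apply/funext => y; rewrite E /=.
  apply: (is_derive_eq (is_deriveN (is_deriveM b dV))).
  rewrite fxE /GRing.scale !cparts /= Ny; field.
  exact: pq0.
Qed.

Lemma is_derive_line (g : V -> R^o) x v (d : R^o) :
  is_derive x v g d <-> is_derive (0 : R^o) (1 : R^o) (fun h : R => g (h *: v + x)) d.
Proof.
have E : (fun h : R => h^-1 *: ((g \o shift x) (h *: v) - g x)) =
   (fun h : R => h^-1 *: (((fun h : R => g (h *: v + x)) \o shift (0:R)) (h *: (1:R)) - (fun h : R => g (h *: v + x)) 0)).
  by apply/funext => h; rewrite /= scale0r add0r addr0 /GRing.scale /= mulr1.
have E2 : 'D_v g x = 'D_(1:R^o) (fun h : R => g (h *: v + x)) (0 : R^o).
  by rewrite /derive E.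
split=> -[a b].
  split; last by rewrite -E2.
  exact: (proj1 (derivable1P _ _ _) a).
split; last by rewrite E2.
exact: (proj2 (derivable1P _ _ _) a).
Qed.

Lemma ccont_cst c : ccont (fun _ : V => c).
Proof. by split=> x; exact: cvg_cst. Qed.

Lemma ccont_add f g : ccont f -> ccont g -> ccont (fun y => f y + g y).
Proof.
move=> [a b] [c d]; split=> x.
- rewrite (_ : (fun y => _) = (fun y => (Re (f y) : R^o) + (Re (g y) : R^o))).
    by apply: cvgD; [exact: a|exact: c].
  by apply/funext => y; rewrite Re_add.
- rewrite (_ : (fun y => _) = (fun y => (Im (f y) : R^o) + (Im (g y) : R^o))).
    by apply: cvgD; [exact: b|exact: d].
  by apply/funext => y; rewrite Im_add.
Qed.

Lemma ccont_mul f g : ccont f -> ccont g -> ccont (fun y => f y * g y).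
Proof.
move=> [a b] [c d]; split=> x.
- rewrite (_ : (fun y => _) = (fun y => (Re (f y) : R) * (Re (g y) : R)
      - (Im (f y) : R) * (Im (g y) : R))).
    by apply: cvgB; apply: cvgM; [exact: a|exact: c|exact: b|exact: d].
  by apply/funext => y; rewrite Re_mul.
- rewrite (_ : (fun y => _) = (fun y => (Re (f y) : R) * (Im (g y) : R)
      + (Im (f y) : R) * (Re (g y) : R))).
    by apply: cvgD; apply: cvgM; [exact: a|exact: d|exact: b|exact: c].
  by apply/funext => y; rewrite Im_mul.
Qed.

Lemma ccont_conj f : ccont f -> ccont (fun y => conjc (f y)).
Proof.
move=> [a b]; split=> x.
- rewrite (_ : (fun y => _) = (fun y => (Re (f y) : R^o))); first exact: a.
  by apply/funext => y; rewrite Re_conj.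
- rewrite (_ : (fun y => _) = (fun y => - (Im (f y) : R^o))).
    by apply: cvgN; exact: b.
  by apply/funext => y; rewrite Im_conj.
Qed.

Lemma ccont_inv f : (forall y, f y != 0) -> ccont f -> ccont (fun y => (f y)^-1).
Proof.
move=> f0 [a b].
pose N y := Re (f y) * Re (f y) + Im (f y) * Im (f y) : R.
have N0 y : N y != 0.
  apply: contra (f0 y); rewrite /N -!expr2 paddr_eq0 ?sqr_ge0// !sqrf_eq0 eq_complex => /andP[].
  by move=> /eqP -> /eqP ->; rewrite !eqxx.
have cN x : N y @[y --> x] --> N x.
  by apply: cvgD; apply: cvgM; [exact: a|exact: a|exact: b|exact: b].
have E y : (f y)^-1 = Complex (Re (f y) * (N y)^-1) (- (Im (f y) * (N y)^-1)).
  by rewrite /N -!expr2; case: (f y).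
split=> x.
- rewrite (_ : (fun y => _) = (fun y => (Re (f y) : R) * (N y)^-1)).
    by rewrite /continuous_at; apply: cvgM; [exact: a| apply: cvgV; [exact: N0|exact: cN]].
  by apply/funext => y; rewrite E /=.
- rewrite (_ : (fun y => _) = (fun y => - ((Im (f y) : R) * (N y)^-1))).
    rewrite /continuous_at; apply: cvgN.
    by apply: cvgM; [exact: b| apply: cvgV; [exact: N0|exact: cN]].
  by apply/funext => y; rewrite E /=.
Qed.

End OneDirection.

(** A directional derivative only sees the line through the base point. *)
Lemma cder_pullback (V W : normedModType R) (f : W -> R[i]) (T : V -> W) x v w (c : R) z :
  (forall h : R, T (h *: v + x) = (h * c) *: w + T x) ->
  cder f (T x) w z -> cder (f \o T) x v (Complex c 0 * z).
Proof.
move=> HT [a b].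
have key (g : W -> R^o) (d : R^o) : is_derive (T x) w g d ->
    is_derive x v (fun y => g (T y)) (c * d : R^o).
  move=> /is_derive_line gd; apply/is_derive_line.
  rewrite (_ : (fun h : R => _) = (fun h : R => g (h *: w + T x)) \o (fun h : R => h * c)); last first.
    by apply/funext => h; rewrite /= HT.
  rewrite mulrC; apply: is_derive1_comp; first by rewrite mul0r.
  rewrite (_ : (fun h : R => h * c) = (c *: (@id R))); last first.
    by apply/funext => h; rewrite /= /GRing.scale /= mulrC.
  by apply: is_derive_eq; rewrite /GRing.scale /= mulr1.
split.
- by rewrite Re_mul /= mul0r subr0; exact: (key (fun y => Re (f y) : R^o)).
- by rewrite Im_mul /= mul0r addr0; exact: (key (fun y => Im (f y) : R^o)).
Qed.

Lemma ccont_comp (V W : normedModType R) (f : W -> R[i]) (T : V -> W) :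
  continuous T -> ccont f -> ccont (f \o T).
Proof.
move=> cT [a b]; split=> x.
- by apply: (@continuous_comp _ _ _ T (fun y => Re (f y) : R^o)); [exact: cT|exact: a].
- by apply: (@continuous_comp _ _ _ T (fun y => Im (f y) : R^o)); [exact: cT|exact: b].
Qed.

End Derivatives.

(** * Smooth functions and iterated derivatives *)

Lemma eq_ler (R : realType) (x y : R) : x = y -> x <= y.
Proof. by move=> ->. Qed.

Section MeanValue.
Variable R : realType.

Lemma mvt_le (f df : R -> R) (a b M : R) :
  (forall t : R, is_derive t 1 f (df t)) ->
  (forall t, Num.min a b <= t <= Num.max a b -> `|df t| <= M) ->
  `|f b - f a| <= M * `|b - a|.
Proof.
move=> fd.
have main c d : c <= d -> (forall t, c <= t <= d -> `|df t| <= M) ->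
    `|f d - f c| <= M * `|d - c|.
  move=> cd H.
  have [|x xcd ->] := @MVT_segment R f df c d cd (fun t _ => fd t).
    apply: continuous_in_subspaceT => t _.
    by apply: differentiable_continuous; apply/derivable1_diffP; exact: ex_derive.
  rewrite normrM ler_wpM2r//; apply: H.
  by move: xcd; rewrite in_itv.
have [ab|ba] := leP a b => H.
  by apply: main.
by rewrite distrC (distrC b); apply: main => //; exact: ltW.
Qed.

Lemma cder_mvt (f df : R -> R[i]) (a b M : R) :
  (forall t : R, cder (f : R^o -> R[i]) t 1 (df t)) ->
  (forall t, Num.min a b <= t <= Num.max a b -> cabs (df t) <= M) ->
  cabs (f b - f a) <= 2 * M * `|b - a|.
Proof.
move=> fd H; apply: (le_trans (cabs_le_ReIm _)).
rewrite !cparts -mulrA mulr_natl mulr2n lerD//.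
- apply: (@mvt_le (fun t => Re (f t)) (fun t => Re (df t))) => t.
    by have [] := fd t.
  by move=> /H; apply: le_trans; exact: cabs_Re.
- apply: (@mvt_le (fun t => Im (f t)) (fun t => Im (df t))) => t.
    by have [] := fd t.
  by move=> /H; apply: le_trans; exact: cabs_Im.
Qed.

(** A remainder bound without limits, hence stable under pointwise limits of
    [f] and [d]. *)
Lemma is_derive_quad (V : normedModType R) (f : V -> R^o) x v (d K : R) :
  (forall t : R, `|f (t *: v + x) - f x - t * d| <= K * t ^+ 2) ->
  is_derive x v f d.
Proof.
move=> H.
have cv : h^-1 *: ((f \o shift x) (h *: v) - f x) @[h --> 0^'] --> (d : R^o).
  apply/cvgrPdist_le => e e0.
  have K0 : 0 < `|K| + 1 by rewrite ltr_wpDl.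
  near=> h.
  have h0 : h != 0 by near: h; exact: nbhs_dnbhs_neq.
  have hs : `|h| <= e / (`|K| + 1).
    near: h; apply: (@dnbhs0_le R R^o); exact: divr_gt0.
  rewrite /= distrC.
  rewrite (_ : _ - d = h^-1 * (f (h *: v + x) - f x - h * d)); last first.
    by rewrite /GRing.scale /= -/(shift x _); field.
  rewrite normrM normfV ler_pdivrMl ?normr_gt0//.
  apply: (le_trans (H h)); rewrite -(@real_normK _ h) ?num_real//.
  rewrite expr2 mulrA mulrC ler_wpM2l//.
  apply: (@le_trans _ _ ((`|K| + 1) * `|h|)).
    by rewrite ler_wpM2r// (le_trans (ler_norm K))// lerDl.
  by rewrite mulrC -ler_pdivlMr.
split; first by apply/cvg_ex; exists d.
exact: cvg_lim cv.
Unshelve. all: by end_near. Qed.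

Lemma ccontP (V : normedModType R) (f : V -> R[i]) : ccont f <->
  forall x e, 0 < e -> exists2 dl : R, 0 < dl &
    forall y, `|x - y| < dl -> cabs (f x - f y) <= e.
Proof.
split.
  move=> [a b] x e e0.
  have e20 : 0 < e / 2 by rewrite divr_gt0.
  move/cvgrPdist_le : (a x) => /(_ _ e20) /nbhs_ballP[d1 /= d10 h1].
  move/cvgrPdist_le : (b x) => /(_ _ e20) /nbhs_ballP[d2 /= d20 h2].
  exists (Num.min d1 d2); first by rewrite lt_min d10.
  move=> y; rewrite lt_min => /andP[y1 y2].
  apply: (le_trans (cabs_le_ReIm _)).
  rewrite !cparts (splitr e) lerD//.
    by apply: h1; rewrite -ball_normE.
  by apply: h2; rewrite -ball_normE.
move=> H; split=> x; apply/cvgrPdist_le => e e0.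
  have [d d0 hd] := H x _ e0.
  apply/nbhs_ballP; exists d => // y; rewrite -ball_normE /= => /hd.
  by apply: le_trans; rewrite (le_trans _ (cabs_Re _))// !cparts.
have [d d0 hd] := H x _ e0.
apply/nbhs_ballP; exists d => // y; rewrite -ball_normE /= => /hd.
by apply: le_trans; rewrite (le_trans _ (cabs_Im _))// !cparts.
Qed.

Lemma lip_ccont (V : normedModType R) (f : V -> R[i]) (L : R) :
  (forall x y, cabs (f x - f y) <= L * `|x - y|) -> ccont f.
Proof.
move=> H; apply/ccontP => x e e0.
have L0 : 0 < `|L| + 1 by rewrite ltr_wpDl.
exists (e / (`|L| + 1)); first exact: divr_gt0.
move=> y; rewrite ltr_pdivlMr// => /ltW; apply: le_trans.
apply: (le_trans (H x y)); rewrite mulrC ler_wpM2l//.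
by rewrite (le_trans (ler_norm L))// lerDl.
Qed.

End MeanValue.

Lemma norm_delta_le (R : realType) (n : nat) (i : 'I_n) :
  `|delta_mx 0 i : 'rV[R]_n| <= 1.
Proof.
rewrite /Num.norm /= mx_normrE; apply: bigmax_le => // -[j k] _ /=.
by rewrite mxE; case: (_ && _); rewrite /= ?normr1 ?normr0 ?ler01.
Qed.

Lemma coord_le (R : realType) (n : nat) (x : 'rV[R]_n) (i : 'I_n) : `|x 0 i| <= `|x|.
Proof.
rewrite [leRHS]/Num.norm /= mx_normrE.
by apply: (le_bigmax _ (fun j => `|x j.1 j.2|) (0, i)).
Qed.

Lemma norm_coordP (R : realType) (n : nat) (x : 'rV[R]_n) (M : R) : 0 <= M ->
  (forall i, `|x 0 i| <= M) -> `|x| <= M.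
Proof.
move=> M0 H; rewrite /Num.norm /= mx_normrE; apply: bigmax_le => // -[j k] _ /=.
by rewrite ord1.
Qed.

Section Smooth.
Variables (R : realType) (n : nat).
Implicit Types (f g : 'rV[R]_n -> R[i]) (l : seq 'I_n).

(** The factor [i] undoes the normalization [D = - i d/dx] of [D1]. *)
Definition isD (i : 'I_n) f g :=
  forall x, cder f x (delta_mx 0 i) (Complex 0 1 * g x).

Definition dl l f := foldr (@D1 R n) f l.

Lemma isD_D1 i f g : isD i f g -> D1 i f = g.
Proof.
move=> H; apply/funext => x; have [a b] := H x.
rewrite /D1 (@derive_val _ _ _ _ _ _ _ a) (@derive_val _ _ _ _ _ _ _ b).
rewrite (_ : Complex (Re _) (Im _) = Complex 0 1 * g x); last exact: ceq.
by rewrite mulrA iiN mul1r.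
Qed.

(** The derivatives are quantified existentially, so that closure under the
    algebraic operations is proved without computing iterated [D1]. *)
Fixpoint Cs (k : nat) f : Prop :=
  match k with
  | 0%N => ccont f
  | k'.+1 => ccont f /\ forall i, exists2 g, isD i f g & Cs k' g
  end.

Lemma CsS k f : Cs k.+1 f -> Cs k f.
Proof.
elim: k f => [|k IH] f; first by case.
case=> cf H; split=> // i; have [g fg Cg] := H i.
by exists g => //; exact: IH.
Qed.

Lemma Cs_ccont k f : Cs k f -> ccont f.
Proof. by case: k => [//|k] []. Qed.

Lemma smooth_ccont_raw f : smooth f -> ccont f.
Proof. by move=> /(_ [::])[a [b _]]. Qed.

Lemma smooth_D1_raw i f : smooth f -> smooth (D1 i f).
Proof. by move=> H l; have := H (rcons l i); rewrite foldr_rcons. Qed.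

Lemma smooth_isD_raw i f : smooth f -> isD i f (D1 i f).
Proof.
move=> /(_ [::])[_ [_ H]] x; have [/= a b] := H i x.
rewrite /D1 mulrA mulrN -mulNr iiN mul1r; split => /=; exact: derivableP.
Qed.

Lemma smoothP f : smooth f <-> forall k, Cs k f.
Proof.
split.
  move=> H k; elim: k f H => [|k IH] f H; first exact: smooth_ccont_raw.
  split; first exact: smooth_ccont_raw.
  move=> i; exists (D1 i f); first exact: smooth_isD_raw.
  by apply: IH; exact: smooth_D1_raw.
move=> H l; move: {H}(H (size l).+1).
elim/last_ind: l f => [|l i IH] f.
  move=> [[a b] H]; split=> //; split=> // i x.
  by have [g gD _] := H i; have [c d] := gD x; split; [exact: (@ex_derive _ _ _ _ _ _ _ c)|exact: (@ex_derive _ _ _ _ _ _ _ d)].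
rewrite size_rcons foldr_rcons => -[_ /(_ i)[g /isD_D1 <-]].
exact: IH.
Qed.

(** An inductive copy of [smooth]: it keeps the quantification over all
    iterated derivatives folded. *)
Variant csmooth f : Prop := CSmooth of smooth f.

Lemma csmoothE f : csmooth f <-> smooth f.
Proof. by split=> [[]|]. Qed.

Lemma csmoothP f : csmooth f <-> forall k, Cs k f.
Proof. by rewrite csmoothE; exact: smoothP. Qed.

Lemma smooth_ccont f : csmooth f -> ccont f.
Proof. by case=> /smooth_ccont_raw. Qed.

Lemma smooth_D1 i f : csmooth f -> csmooth (D1 i f).
Proof. by case=> /(smooth_D1_raw i). Qed.

Lemma smooth_isD i f : csmooth f -> isD i f (D1 i f).
Proof. by case=> /(smooth_isD_raw i). Qed.

Lemma dl_cons i l f : dl (i :: l) f = D1 i (dl l f). Proof. by []. Qed.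

Lemma dl_rcons i l f : dl (rcons l i) f = dl l (D1 i f).
Proof. by rewrite /dl foldr_rcons. Qed.

Lemma dl_cat l1 l2 f : dl (l1 ++ l2) f = dl l1 (dl l2 f).
Proof. by rewrite /dl foldr_cat. Qed.

Lemma smooth_dl l f : csmooth f -> csmooth (dl l f).
Proof. by move=> H; elim: l => [|i l IH]; [exact: H|exact: (smooth_D1 i IH)]. Qed.

Lemma isD_cst i (c : R[i]) : isD i (fun=> c) (fun=> 0).
Proof. by move=> x; rewrite mulr0; exact: cder_cst. Qed.

Lemma isD_add i f g f' g' : isD i f f' -> isD i g g' ->
  isD i (fun x => f x + g x) (fun x => f' x + g' x).
Proof. by move=> a b x; rewrite mulrDr; exact: cder_add. Qed.

Lemma isD_mul i f g f' g' : isD i f f' -> isD i g g' ->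
  isD i (fun x => f x * g x) (fun x => f' x * g x + f x * g' x).
Proof. by move=> a b x; apply: (cder_eq (cder_mul (a x) (b x))); ring. Qed.

Lemma isD_conj i f f' : isD i f f' ->
  isD i (fun x => conjc (f x)) (fun x => - conjc (f' x)).
Proof.
move=> a x; apply: (cder_eq (cder_conj (a x))).
by apply: ceq; rewrite !cparts /=; ring.
Qed.

Lemma isD_inv i f f' : (forall x, f x != 0) -> isD i f f' ->
  isD i (fun x => (f x)^-1) (fun x => - 1 * (f' x * ((f x)^-1 * (f x)^-1))).
Proof. by move=> f0 a x; apply: (cder_eq (cder_inv (f0 x) (a x))); ring. Qed.

Lemma Cs_cst k (c : R[i]) : Cs k (fun=> c).
Proof.
elim: k c => [|k IH] c; first exact: ccont_cst.
split=> [|i]; first exact: ccont_cst.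
by exists (fun=> 0); [exact: isD_cst|exact: IH].
Qed.

Lemma Cs_add k f g : Cs k f -> Cs k g -> Cs k (fun x => f x + g x).
Proof.
elim: k f g => [|k IH] f g; first exact: ccont_add.
move=> [cf Df] [cg Dg]; split=> [|i]; first exact: ccont_add.
have [f' ff' Cf'] := Df i; have [g' gg' Cg'] := Dg i.
by exists (fun x => f' x + g' x); [exact: isD_add|exact: IH].
Qed.

Lemma Cs_mul k f g : Cs k f -> Cs k g -> Cs k (fun x => f x * g x).
Proof.
elim: k f g => [|k IH] f g; first exact: ccont_mul.
move=> Cf Cg; have := Cf; have := Cg; move=> [cg Dg] [cf Df].
split=> [|i]; first exact: ccont_mul.
have [f' ff' Cf'] := Df i; have [g' gg' Cg'] := Dg i.
exists (fun x => f' x * g x + f x * g' x); first exact: isD_mul.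
by apply: Cs_add; apply: IH => //; exact: CsS.
Qed.

Lemma smooth_cst (c : R[i]) : csmooth (fun _ : 'rV[R]_n => c).
Proof. by apply/csmoothP => k; exact: Cs_cst. Qed.

Lemma smooth_add f g : csmooth f -> csmooth g -> csmooth (fun x => f x + g x).
Proof. by move=> /csmoothP a /csmoothP b; apply/csmoothP => k; exact: Cs_add. Qed.

Lemma smooth_mul f g : csmooth f -> csmooth g -> csmooth (fun x => f x * g x).
Proof. by move=> /csmoothP a /csmoothP b; apply/csmoothP => k; exact: Cs_mul. Qed.

Lemma smooth_scale (c : R[i]) f : csmooth f -> csmooth (fun x => c * f x).
Proof. by move=> a; apply: smooth_mul => //; exact: smooth_cst. Qed.

Lemma smooth_conj f : csmooth f -> csmooth (fun x => conjc (f x)).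
Proof.
move=> /csmoothP a; apply/csmoothP => k; move: {a}(a k).
elim: k f => [|k IH] f; first exact: ccont_conj.
move=> [cf Df]; split=> [|i]; first exact: ccont_conj.
have [f' ff' Cf'] := Df i; exists (fun x => - 1 * conjc (f' x)).
  by move=> x; rewrite mulN1r; exact: (isD_conj ff').
by apply: Cs_mul; [exact: Cs_cst|exact: IH].
Qed.

Lemma smooth_inv f : (forall x, f x != 0) -> csmooth f -> csmooth (fun x => (f x)^-1).
Proof.
move=> f0 /csmoothP a; apply/csmoothP => k; move: {a}(a k).
elim: k => [|k IH]; first exact: ccont_inv.
move=> Cf; have [cf Df] := Cf; split=> [|i]; first exact: ccont_inv.
have [f' ff' Cf'] := Df i.
exists (fun x => - 1 * (f' x * ((f x)^-1 * (f x)^-1))); first exact: isD_inv.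
apply: Cs_mul; first exact: Cs_cst.
by apply: Cs_mul => //; apply: Cs_mul; apply: IH; exact: CsS.
Qed.

Lemma smooth_sum (I : Type) (r : seq I) (F : I -> 'rV[R]_n -> R[i]) :
  (forall k, csmooth (F k)) -> csmooth (fun x => \sum_(k <- r) F k x).
Proof.
move=> H; elim: r => [|k r IH].
  rewrite (_ : (fun x => _) = fun=> 0); first exact: smooth_cst.
  by apply/funext => x; rewrite big_nil.
rewrite (_ : (fun x => _) = fun x => F k x + \sum_(k <- r) F k x).
  exact: smooth_add.
by apply/funext => x; rewrite big_cons.
Qed.

Lemma smooth_prod (I : Type) (r : seq I) (F : I -> 'rV[R]_n -> R[i]) :
  (forall k, csmooth (F k)) -> csmooth (fun x => \prod_(k <- r) F k x).
Proof.
move=> H; elim: r => [|k r IH].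
  rewrite (_ : (fun x => _) = fun=> 1); first exact: smooth_cst.
  by apply/funext => x; rewrite big_nil.
rewrite (_ : (fun x => _) = fun x => F k x * \prod_(k <- r) F k x).
  exact: smooth_mul.
by apply/funext => x; rewrite big_cons.
Qed.

Lemma D1_add i f g : csmooth f -> csmooth g ->
  D1 i (fun x => f x + g x) = (fun x => D1 i f x + D1 i g x).
Proof. by move=> a b; apply: isD_D1; apply: isD_add; exact: smooth_isD. Qed.

Lemma D1_mul i f g : csmooth f -> csmooth g ->
  D1 i (fun x => f x * g x) = (fun x => D1 i f x * g x + f x * D1 i g x).
Proof. by move=> a b; apply: isD_D1; apply: isD_mul; exact: smooth_isD. Qed.

Lemma D1_conj i f : csmooth f ->
  D1 i (fun x => conjc (f x)) = (fun x => - conjc (D1 i f x)).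
Proof. by move=> a; apply: isD_D1; apply: isD_conj; exact: smooth_isD. Qed.

Lemma D1_cst i (c : R[i]) : D1 i (fun _ : 'rV[R]_n => c) = (fun=> 0).
Proof. by apply: isD_D1; exact: isD_cst. Qed.

Lemma D1_scale i (c : R[i]) f : csmooth f ->
  D1 i (fun x => c * f x) = (fun x => c * D1 i f x).
Proof.
move=> a; rewrite (D1_mul _ (smooth_cst c) a) D1_cst.
by apply/funext => x; rewrite mul0r add0r.
Qed.

Lemma dl_add l f g : csmooth f -> csmooth g ->
  dl l (fun x => f x + g x) = (fun x => dl l f x + dl l g x).
Proof.
by move=> a b; elim: l => //= i l ->; rewrite D1_add//; exact: smooth_dl.
Qed.

Lemma dl_scale l (c : R[i]) f : csmooth f ->
  dl l (fun x => c * f x) = (fun x => c * dl l f x).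
Proof. by move=> a; elim: l => //= i l ->; rewrite D1_scale//; exact: smooth_dl. Qed.

Lemma dl_sub l f g : csmooth f -> csmooth g ->
  dl l (fun x => f x - g x) = (fun x => dl l f x - dl l g x).
Proof.
move=> a b; rewrite (_ : (fun x => f x - g x) = fun x => f x + (- 1) * g x); last first.
  by apply/funext => x; rewrite mulN1r.
rewrite dl_add//; last exact: smooth_scale.
by rewrite dl_scale//; apply/funext => x; rewrite mulN1r.
Qed.

Lemma smooth_sub f g : csmooth f -> csmooth g -> csmooth (fun x => f x - g x).
Proof.
move=> a b; rewrite (_ : (fun x => f x - g x) = fun x => f x + (- 1) * g x).
  by apply: smooth_add => //; exact: smooth_scale.
by apply/funext => x; rewrite mulN1r.
Qed.

Lemma dl_conj l f x : csmooth f ->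
  cabs (dl l (fun x => conjc (f x)) x) = cabs (dl l f x).
Proof.
move=> a.
have : (dl l (fun x => conjc (f x)) = (fun x => conjc (dl l f x))) \/
  (dl l (fun x => conjc (f x)) = (fun x => - conjc (dl l f x))).
  elim: l => [|i l IH]; first by left.
  have sl := smooth_dl l a.
  case: IH => E; rewrite !dl_cons E; [right|left].
    by rewrite D1_conj.
  rewrite (_ : (fun x => - _) = fun x => (- 1) * conjc (dl l f x)); last first.
    by apply/funext => y; rewrite mulN1r.
  rewrite D1_scale; last exact: smooth_conj.
  by rewrite D1_conj//; apply/funext => y; rewrite mulN1r opprK.
by case=> ->; rewrite ?cabsN cabs_conj.
Qed.

Lemma dl_cst l (c : R[i]) : dl l (fun=> c) = fun=> (if l is [::] then c else 0).
Proof.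
elim: l => // i l IH; rewrite dl_cons IH.
exact: D1_cst.
Qed.

Lemma dl_sum (I : Type) (r : seq I) (F : I -> 'rV[R]_n -> R[i]) l :
  (forall k, csmooth (F k)) ->
  dl l (fun x => \sum_(k <- r) F k x) = (fun x => \sum_(k <- r) dl l (F k) x).
Proof.
move=> H; elim: r => [|k r IH].
  rewrite (_ : (fun x => _) = fun=> 0); last by apply/funext => x; rewrite big_nil.
  by rewrite dl_cst; apply/funext => x; rewrite big_nil; case: l.
rewrite (_ : (fun x => _) = fun x => F k x + \sum_(k <- r) F k x); last first.
  by apply/funext => x; rewrite big_cons.
rewrite dl_add//; last exact: smooth_sum.
by rewrite IH; apply/funext => x; rewrite big_cons.
Qed.

Lemma cder_slice f i (x : 'rV[R]_n) (t : R) : csmooth f ->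
  cder (fun t : R^o => f (t *: delta_mx 0 i + x)) t 1
    (Complex 0 1 * D1 i f (t *: delta_mx 0 i + x)).
Proof.
move=> sf.
have := @cder_pullback R R^o 'rV[R]_n f (fun t : R^o => t *: delta_mx 0 i + x)
  t 1 (delta_mx 0 i) 1 _ _ (smooth_isD i sf (t *: delta_mx 0 i + x)).
rewrite (_ : Complex 1 0 = 1)// mul1r; apply => h.
change ((h * 1 + t) *: delta_mx 0 i + x = (h * 1) *: delta_mx 0 i + (t *: delta_mx 0 i + x)).
by rewrite !mulr1 scalerDl addrA.
Qed.

Lemma smooth_slice_lip f i (x : 'rV[R]_n) (t M : R) : csmooth f ->
  (forall y, cabs (D1 i f y) <= M) ->
  cabs (f (t *: delta_mx 0 i + x) - f x) <= 2 * M * `|t|.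
Proof.
move=> sf H.
have := @cder_mvt R (fun t => f (t *: delta_mx 0 i + x))
  (fun t => Complex 0 1 * D1 i f (t *: delta_mx 0 i + x)) 0 t M
  (fun t => cder_slice i x t sf).
rewrite scale0r add0r subr0; apply => u _.
by rewrite cabsM cabs_i mul1r.
Qed.

Lemma smooth_lip f (M : R) (x y : 'rV[R]_n) : csmooth f ->
  (forall i z, cabs (D1 i f z) <= M) ->
  cabs (f x - f y) <= n%:R * (2 * M) * `|x - y|.
Proof.
move=> sf H.
pose p (k : nat) : 'rV[R]_n := \row_(i < n) (if (i < k)%N then x 0 i else y 0 i).
have p0 : p 0%N = y by apply/rowP => i; rewrite mxE.
have pn : p n = x by apply/rowP => i; rewrite mxE ltn_ord.
have step (k : 'I_n) : cabs (f (p k.+1) - f (p k)) <= 2 * M * `|x - y|.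
  have -> : p k.+1 = (x 0 k - y 0 k) *: delta_mx 0 k + p k.
    apply/rowP => i; rewrite !mxE eqxx /= ltnS.
    have [->|ik] := eqVneq i k.
      by rewrite leqnn ltnn mulr1 subrK.
    by rewrite mulr0 add0r leq_eqVlt (inj_eq val_inj) (negbTE ik).
  apply: (le_trans (smooth_slice_lip _ _ sf (H k))).
  have M0 : 0 <= M := le_trans (cabs_ge0 _) (H k x).
  apply: ler_wpM2l; first by rewrite mulr_ge0.
  by have := coord_le (x - y) k; rewrite !mxE.
have -> : f x - f y = \sum_(k < n) (f (p k.+1) - f (p k)).
  rewrite -pn -p0.
  by rewrite -(telescope_sumr (fun k => f (p k)) (leq0n n)) big_mkord.
apply: (le_trans (cabs_sum _ _ _)).
apply: (le_trans (ler_sum _ (fun k _ => step k))).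
by rewrite sumr_const card_ord -[X in X <= _]mulr_natl !mulrA.
Qed.

Lemma smooth_taylor f i (x : 'rV[R]_n) (t M : R) : csmooth f ->
  (forall y, cabs (D1 i (D1 i f) y) <= M) ->
  cabs (f (t *: delta_mx 0 i + x) - f x - Complex t 0 * (Complex 0 1 * D1 i f x))
    <= 4 * M * t ^+ 2.
Proof.
move=> sf H; have M0 : 0 <= M := le_trans (cabs_ge0 _) (H x).
pose w := Complex 0 1 * D1 i f x.
have dlin (u : R) : cder (fun u : R^o => - w * Complex u 0) u 1 (- w).
  have h : cder (fun u : R^o => Complex u 0) u 1 (1 : R[i]).
    by split => /=; [exact: is_derive_id|exact: is_derive_cst].
  by apply: (cder_eq (cder_mul (cder_cst (- w) u 1) h)); ring.
have := @cder_mvt R (fun u => f (u *: delta_mx 0 i + x) + (- w * Complex u 0))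
  (fun u => Complex 0 1 * D1 i f (u *: delta_mx 0 i + x) + (- w)) 0 t (2 * M * `|t|)
  (fun u => cder_add (cder_slice i x u sf) (dlin u)).
rewrite scale0r add0r subr0.
have -> : f (t *: delta_mx 0 i + x) + - w * Complex t 0 - (f x + - w * Complex 0 0)
  = f (t *: delta_mx 0 i + x) - f x - Complex t 0 * w.
  by rewrite (_ : Complex 0 0 = 0)//; ring.
move=> /(_ _)/le_trans; apply.
  move=> u ut; rewrite /w -mulrBr cabsM cabs_i mul1r.
  apply: (le_trans (smooth_slice_lip _ _ (smooth_D1 i sf) H)).
  apply: ler_wpM2l; first by rewrite mulr_ge0.
  rewrite ler_norml; move: ut; have [t0|t0] := leP 0 t => /andP[a b].
    by rewrite (ger0_norm t0) b (le_trans _ a)// oppr_le0.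
  by rewrite (ltr0_norm t0) opprK a (le_trans b)// oppr_ge0 ltW.
rewrite -[t ^+ 2]real_normK ?num_real//.
by apply: eq_ler; ring.
Qed.

(** Both mixed derivatives are limits of the same second difference [S], by
    Taylor expansion along one coordinate after the other. *)
Lemma D1_comm i j f : csmooth f -> D1 i (D1 j f) = D1 j (D1 i f).
Proof.
move=> sf.
pose S (x : 'rV[R]_n) (h : R) := f (h *: delta_mx 0 i + (h *: delta_mx 0 j + x))
  - f (h *: delta_mx 0 i + x) - f (h *: delta_mx 0 j + x) + f x.
have main i' j' x e : 0 < e -> exists2 d : R, 0 < d & forall h, 0 < h < d ->
    cabs (f (h *: delta_mx 0 i' + (h *: delta_mx 0 j' + x))
      - f (h *: delta_mx 0 i' + x) - f (h *: delta_mx 0 j' + x) + f x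
      + Complex (h ^+ 2) 0 * D1 j' (D1 i' f) x) <= 4 * e * h ^+ 2.
  move=> e0.
  have [d d0 Hd] := (ccontP _).1 (smooth_ccont (smooth_D1 j' (smooth_D1 i' sf))) x e e0.
  exists (d / 2) => [|h /andP[h0 hd]]; first by rewrite divr_gt0.
  pose w := D1 j' (D1 i' f) x.
  have dlin (c : R[i]) (u : R) : cder (fun u : R^o => c * Complex u 0) u 1 c.
    have h' : cder (fun u : R^o => Complex u 0) u 1 (1 : R[i]).
      by split => /=; [exact: is_derive_id|exact: is_derive_cst].
    by apply: (cder_eq (cder_mul (cder_cst c u 1) h')); ring.
  have H1 (a : R) : 0 <= a <= h ->
    cabs (Complex 0 1 * D1 i' f (h *: delta_mx 0 j' + (a *: delta_mx 0 i' + x))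
       - Complex 0 1 * D1 i' f (a *: delta_mx 0 i' + x) + Complex h 0 * w) <= 2 * e * h.
    move=> /andP[a0 ah].
    have K := @cder_mvt R (fun u => Complex 0 1 * D1 i' f (u *: delta_mx 0 j' + (a *: delta_mx 0 i' + x)) + w * Complex u 0)
      (fun u => Complex 0 1 * (Complex 0 1 * D1 j' (D1 i' f) (u *: delta_mx 0 j' + (a *: delta_mx 0 i' + x))) + w) 0 h e.
    rewrite subr0 (gtr0_norm h0) scale0r add0r in K.
    apply: (le_trans (eq_ler _) (le_trans (K _ _) (eq_ler _))).
    - by congr (cabs _); rewrite (_ : Complex 0 0 = 0)//; ring.
    - move=> u; apply: cder_add; last exact: dlin.
      by apply: (cder_eq (cder_mul (cder_cst (Complex 0 1) u 1)
        (cder_slice j' (a *: delta_mx 0 i' + x) u (smooth_D1 i' sf)))); ring.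
    - rewrite (min_l (ltW h0)) (max_r (ltW h0)) => u /andP[u0 uh].
      rewrite mulrA -[Complex 0 1 * Complex 0 1]opprK -mulNr iiN mulN1r addrC.
      apply: Hd; rewrite opprD addrC opprD addrA addrNK -opprD normrN.
      apply: (le_lt_trans (ler_normD _ _)); rewrite !normrZ.
      apply: (@le_lt_trans _ _ (h + h)); last by lra.
      rewrite (ger0_norm u0) (ger0_norm a0).
      apply: lerD; rewrite -[leRHS]mulr1; apply: ler_pM => //; exact: norm_delta_le.
    - by [].
  have K := @cder_mvt R (fun u => f (u *: delta_mx 0 i' + (h *: delta_mx 0 j' + x))
       + - 1 * f (u *: delta_mx 0 i' + x) + Complex h 0 * w * Complex u 0)
      (fun u => Complex 0 1 * D1 i' f (u *: delta_mx 0 i' + (h *: delta_mx 0 j' + x))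
       - 1 * (Complex 0 1 * D1 i' f (u *: delta_mx 0 i' + x)) + Complex h 0 * w) 0 h (2 * e * h).
  rewrite subr0 (gtr0_norm h0) !scale0r !add0r in K.
  apply: (le_trans (eq_ler _) (le_trans (K _ _) (eq_ler _))).
  - congr cabs.
    rewrite (_ : Complex (h ^+ 2) 0 = Complex h 0 * Complex h 0); last first.
      by apply: ceq; rewrite !cparts /=; ring.
    by rewrite (_ : Complex 0 0 = 0)// /w; ring.
  - move=> u; apply: cder_add; last exact: dlin.
    apply: cder_add; first exact: cder_slice.
    by apply: (cder_eq (cder_mul (cder_cst (- 1) u 1) (cder_slice i' x u sf))); ring.
  - rewrite (min_l (ltW h0)) (max_r (ltW h0)) => u /H1; rewrite mul1r.
    by rewrite addrCA.
  - by ring.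
apply/funext => x; apply/eqP; rewrite -subr_eq0; apply/eqP/cabs_eq0/eqP.
rewrite eq_le cabs_ge0 andbT; apply/ler_addgt0Pr => e e0; rewrite add0r.
have e80 : 0 < e / 8 by rewrite divr_gt0.
have [d1 d10 H1] := main i j x _ e80.
have [d2 d20 H2] := main j i x _ e80.
pose h := Num.min d1 d2 / 2.
have m0 : 0 < Num.min d1 d2 by rewrite lt_min d10.
have h0 : 0 < h by rewrite divr_gt0.
have hm : h < Num.min d1 d2 by rewrite /h; lra.
have := hm; rewrite lt_min => /andP[hd1 hd2].
have {}H1 := H1 h; have {}H2 := H2 h; rewrite h0 hd1 in H1; rewrite h0 hd2 in H2.
have {}H1 := H1 isT; have {}H2 := H2 isT.
have hh : 0 < h ^+ 2 by rewrite exprn_gt0.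
rewrite -(ler_pM2l hh).
have -> : h ^+ 2 * cabs (D1 i (D1 j f) x - D1 j (D1 i f) x) =
   cabs (Complex (h ^+ 2) 0 * (D1 i (D1 j f) x - D1 j (D1 i f) x)).
  by rewrite cabsM cabs_real ger0_norm// ltW.
rewrite [h *: delta_mx 0 j + (_ + _)]addrCA in H2.
move: H1 H2; move: (f (_ + (_ + _))) (f (h *: delta_mx 0 i + x))
  (f (h *: delta_mx 0 j + x)) (f x) (D1 j (D1 i f) x) (D1 i (D1 j f) x).
move=> A A' A'' z w w' H1 H2.
have -> : Complex (h ^+ 2) 0 * (w' - w) =
  (A - A'' - A' + z + Complex (h ^+ 2) 0 * w') -
  (A - A' - A'' + z + Complex (h ^+ 2) 0 * w) by ring.
apply: (le_trans (cabsB _ _)); apply: (le_trans (lerD H2 H1)).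
by apply: eq_ler; field.
Qed.

Lemma dl_move l1 i l2 f : csmooth f -> dl (l1 ++ i :: l2) f = dl (i :: l1 ++ l2) f.
Proof.
move=> sf; elim: l1 => // j l1 IH.
rewrite cat_cons dl_cons IH !dl_cons D1_comm//.
exact: smooth_dl.
Qed.

Lemma dl_perm l l' f : csmooth f -> perm_eq l l' -> dl l f = dl l' f.
Proof.
move=> sf; elim: l l' => [|i l IH] l'.
  by rewrite perm_sym => /perm_nilP ->.
move=> pl; have il' : i \in l' by rewrite -(perm_mem pl) mem_head.
move: pl; case/splitPr: il' => l1 l2 pl; rewrite dl_move//.
rewrite !dl_cons; congr D1; apply: IH.
by rewrite -(perm_cons i) (perm_trans pl)//; apply/permEl; exact: (perm_catCA l1 [:: i] l2).
Qed.

End Smooth.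

(** * Leibniz bounds, affine substitutions, limits of smooth functions *)

Section Leibniz.
Variables (R : realType) (n : nat).
Implicit Types (f g : 'rV[R]_n -> R[i]) (l : seq 'I_n).

(** The induction differentiates first by the innermost index, so that no
    commutation of derivatives is involved and only Pascal's rule is needed. *)
Lemma leibniz_bound f g x (a b : nat -> R) l : csmooth f -> csmooth g ->
  (forall l', cabs (dl l' f x) <= a (size l')) ->
  (forall l', cabs (dl l' g x) <= b (size l')) ->
  cabs (dl l (fun y => f y * g y) x) <=
  \sum_(j < (size l).+1) 'C(size l, j)%:R * a j * b (size l - j)%N.
Proof.
elim/last_ind: l f g a b => [|l i IH] f g a b sf sg fa gb.
  rewrite big_ord1 bin0 mul1r /= cabsM; apply: ler_pM; rewrite ?cabs_ge0//.
    exact: (fa [::]).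
  exact: (gb [::]).
rewrite dl_rcons D1_mul//.
rewrite (dl_add _ (smooth_mul (smooth_D1 i sf) sg) (smooth_mul sf (smooth_D1 i sg))).
apply: (le_trans (cabsD _ _)).
have fa' l' : cabs (dl l' (D1 i f) x) <= a (size l').+1.
  by rewrite -dl_rcons -(size_rcons l' i).
have gb' l' : cabs (dl l' (D1 i g) x) <= b (size l').+1.
  by rewrite -dl_rcons -(size_rcons l' i).
apply: (le_trans (lerD
  (IH _ _ (fun k => a k.+1) b (smooth_D1 i sf) sg fa' gb)
  (IH _ _ a (fun k => b k.+1) sf (smooth_D1 i sg) fa gb'))).
rewrite size_rcons; set k := size l.
rewrite [leRHS]big_ord_recl /= bin0 mul1r.
under [X in _ <= _ + X]eq_bigr => j _ do
  rewrite /bump /= add1n subSS binS natrD mulrDl mulrDl.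
rewrite big_split /= addrA addrC; apply: lerD => //.
rewrite big_ord_recl /= bin0 mul1r subn0; apply: lerD => //.
rewrite [leRHS]big_ord_recr /= bin_small// !mul0r addr0.
by apply: ler_sum => j _; rewrite /bump /= add1n subnSK.
Qed.

End Leibniz.

Section AffinePullback.
Variables (R : realType) (m n : nat).
Implicit Types (T : 'rV[R]_m -> 'rV[R]_n) (c : 'I_m -> R) (tau : 'I_m -> 'I_n).

(** Substituting such a map turns one partial derivative into a multiple of one
    partial derivative, so words of derivatives stay words. *)
Definition axis_map T c tau := continuous T /\
  forall x j (h : R), T (h *: delta_mx 0 j + x) = (h * c j) *: delta_mx 0 (tau j) + T x.

Lemma isD_pull T c tau (f g : 'rV[R]_n -> R[i]) j : axis_map T c tau ->
  isD (tau j) f g -> isD j (fun x => f (T x)) (fun x => Complex (c j) 0 * g (T x)).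
Proof.
move=> [_ HT] fg x.
by apply: (cder_eq (cder_pullback (HT x j) (fg (T x)))); ring.
Qed.

Lemma smooth_pull T c tau (f : 'rV[R]_n -> R[i]) : axis_map T c tau ->
  csmooth f -> csmooth (fun x => f (T x)).
Proof.
move=> HT /csmoothP a; apply/csmoothP => k; move: {a}(a k).
have cT := HT.1.
elim: k f => [|k IH] f; first exact: ccont_comp.
move=> [cf Df]; split=> [|j]; first exact: ccont_comp.
have [g fg Cg] := Df (tau j).
exists (fun x => Complex (c j) 0 * g (T x)); first exact: (isD_pull HT fg).
by apply: Cs_mul; [exact: Cs_cst|exact: IH].
Qed.

Lemma dl_pull T c tau (f : 'rV[R]_n -> R[i]) l : axis_map T c tau -> csmooth f ->
  dl l (fun x => f (T x)) =
  (fun x => Complex (\prod_(j <- l) c j) 0 * dl (map tau l) f (T x)).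
Proof.
move=> HT sf; elim: l => [|j l IH].
  by apply/funext => x; rewrite big_nil (_ : Complex 1 0 = 1)// mul1r.
rewrite dl_cons IH D1_scale; last first.
  by apply: (smooth_pull HT); exact: smooth_dl.
rewrite (isD_D1 (isD_pull HT (smooth_isD (tau j) (smooth_dl (map tau l) sf)))).
apply/funext => x; rewrite mulrA big_cons; congr (_ * _).
by apply: ceq; rewrite !cparts /=; ring.
Qed.

Lemma dl_pull_le T c tau (f : 'rV[R]_n -> R[i]) l x : axis_map T c tau -> csmooth f ->
  (forall j, `|c j| <= 1) ->
  cabs (dl l (fun x => f (T x)) x) <= cabs (dl (map tau l) f (T x)).
Proof.
move=> HT sf c1; rewrite (dl_pull l HT sf) cabsM cabs_real -[leRHS]mul1r.
apply: ler_wpM2r; first exact: cabs_ge0.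
elim: l => [|j l IH]; first by rewrite big_nil normr1.
by rewrite big_cons normrM mulr_ile1.
Qed.

End AffinePullback.

Section SmoothLimit.
Variables (R : realType) (n : nat).

(** Locally bounded second derivatives turn pointwise convergence of all
    derivatives into differentiability of the limit: Taylor's inequality passes
    to the limit. *)
Lemma smooth_limit (F : nat -> 'rV[R]_n -> R[i]) (g : seq 'I_n -> 'rV[R]_n -> R[i]) :
  (forall N, csmooth (F N)) ->
  (forall l, exists M : R, forall N x, cabs (dl l (F N) x) <= M) ->
  (forall l x e, 0 < e -> exists N0, forall N, (N0 <= N)%N ->
     cabs (dl l (F N) x - g l x) <= e) ->
  csmooth (g [::]) /\ forall l, dl l (g [::]) = g l.
Proof.
move=> sF HM Hg.
have lim_le (l1 l2 l3 : seq 'I_n) x1 x2 x3 (c1 c2 c3 : R[i]) M :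
  (forall N, cabs (c1 * dl l1 (F N) x1 + c2 * dl l2 (F N) x2 + c3 * dl l3 (F N) x3) <= M) ->
  cabs (c1 * g l1 x1 + c2 * g l2 x2 + c3 * g l3 x3) <= M.
  move=> H; apply/ler_addgt0Pr => e e0.
  pose C := cabs c1 + cabs c2 + cabs c3 + 1.
  have C0 : 0 < C by rewrite ltr_wpDl// !addr_ge0// cabs_ge0.
  have eC : 0 < e / C by rewrite divr_gt0.
  have [N1 h1] := Hg l1 x1 _ eC; have [N2 h2] := Hg l2 x2 _ eC.
  have [N3 h3] := Hg l3 x3 _ eC; pose N := maxn N1 (maxn N2 N3).
  have {}h1 := h1 N (leq_maxl _ _).
  have {}h2 : cabs (dl l2 (F N) x2 - g l2 x2) <= e / C.
    by apply: h2; rewrite /N !leq_max leqnn !orbT.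
  have {}h3 : cabs (dl l3 (F N) x3 - g l3 x3) <= e / C.
    by apply: h3; rewrite /N !leq_max leqnn !orbT.
  move: (H N) h1 h2 h3; move: (dl l1 _ _) (dl l2 _ _) (dl l3 _ _) => u1 u2 u3.
  move: (g l1 x1) (g l2 x2) (g l3 x3) => v1 v2 v3 HN h1 h2 h3.
  have -> : c1 * v1 + c2 * v2 + c3 * v3 = (c1 * u1 + c2 * u2 + c3 * u3)
     - (c1 * (u1 - v1) + c2 * (u2 - v2) + c3 * (u3 - v3)) by ring.
  apply: (le_trans (cabsB _ _)); apply: lerD => //.
  apply: (@le_trans _ _ (cabs c1 * (e / C) + cabs c2 * (e / C) + cabs c3 * (e / C))).
    apply: (le_trans (cabsD _ _)); apply: lerD; last first.
      by rewrite cabsM ler_wpM2l// cabs_ge0.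
    apply: (le_trans (cabsD _ _)); apply: lerD.
      by rewrite cabsM ler_wpM2l// cabs_ge0.
    by rewrite cabsM ler_wpM2l// cabs_ge0.
  rewrite -!mulrDl mulrA ler_pdivrMr// mulrC; apply: ler_wpM2l; first exact: ltW.
  by rewrite /C lerDl.
have gder i l : isD i (g l) (g (i :: l)).
  move=> x; have [M hM] := HM (i :: i :: l).
  have T t : cabs (g l (t *: delta_mx 0 i + x) - g l x
      - Complex t 0 * (Complex 0 1 * g (i :: l) x)) <= 4 * M * t ^+ 2.
    have E (u v w : R[i]) : u - v - Complex t 0 * (Complex 0 1 * w) =
      1 * u + (- 1) * v + (- (Complex t 0 * Complex 0 1)) * w by ring.
    rewrite E; apply: lim_le => N; rewrite -E.
    by apply: smooth_taylor; [exact: smooth_dl|exact: hM].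
  split.
  - apply: (@is_derive_quad _ _ _ _ _ _ (4 * M)) => t.
    apply: le_trans (T t); apply: le_trans (cabs_Re _).
    by apply: eq_ler; rewrite !cparts /=; congr `|_|; ring.
  - apply: (@is_derive_quad _ _ _ _ _ _ (4 * M)) => t.
    apply: le_trans (T t); apply: le_trans (cabs_Im _).
    by apply: eq_ler; rewrite !cparts /=; congr `|_|; ring.
have gcont l : ccont (g l).
  have HMi (i : 'I_n) := HM (i :: l).
  have [M hM] : exists M : R, forall i N x, cabs (dl (i :: l) (F N) x) <= M.
    have [M hM] := choice HMi; exists (\sum_i `|M i|) => i N x.
    apply: (le_trans (hM i N x)); apply: (le_trans (ler_norm _)).
    by rewrite (bigD1 i)//= lerDl sumr_ge0.
  apply: (@lip_ccont _ _ _ (n%:R * (2 * M))) => x y.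
  have E (u v : R[i]) : u - v = 1 * u + (- 1) * v + 0 * v by ring.
  rewrite E; apply: lim_le => N; rewrite -E.
  by apply: smooth_lip; [exact: smooth_dl|move=> i z; exact: hM].
have dlg l : dl l (g [::]) = g l.
  by elim: l => // i l IH; rewrite dl_cons IH; exact: isD_D1.
split=> //; apply/csmoothP => k.
have : forall l, Cs k (g l); last exact.
elim: k => [|k IH] l; first exact: gcont.
by split=> [|i]; [exact: gcont|exists (g (i :: l)) => //; exact: IH].
Qed.

End SmoothLimit.

(** * Gevrey factorials and subexponential weights *)

Section GevreyNumbers.
Variables (R : realType) (s : R).
Hypothesis hs : 1 < s.

Definition Fs (k : nat) : R := (k`!)%:R `^ s.
Definition wexp (c X : R) : R := expR (c * X `^ s^-1).

Let s0 : 0 < s. Proof. exact: lt_trans hs. Qed.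
Let sn0 : s != 0. Proof. by rewrite gt_eqF. Qed.

Lemma Fs_gt0 k : 0 < Fs k.
Proof. by rewrite powR_gt0// ltr0n fact_gt0. Qed.

Lemma Fs0 : Fs 0 = 1.
Proof. by rewrite /Fs fact0 powR1. Qed.

Lemma ler_pow (x y : R) : 0 <= x -> x <= y -> x `^ s <= y `^ s.
Proof.
move=> x0 xy; apply: ge0_ler_powR => //; rewrite ?ltW// nnegrE//.
exact: le_trans xy.
Qed.

Lemma powRXn (x r : R) k : 0 <= x -> (x ^+ k) `^ r = (x `^ r) ^+ k.
Proof. by move=> x0; rewrite -powR_mulrn// powRAC powR_mulrn ?powR_ge0. Qed.

Lemma FsM j k : Fs j * Fs k <= Fs (j + k).
Proof.
rewrite /Fs -powRM// ler_pow ?mulr_ge0// -natrM ler_nat.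
have := bin_fact (leq_addr k j); rewrite addKn => <-.
by rewrite leq_pmull// bin_gt0 leq_addr.
Qed.

Lemma fact_addn_le j k : ((j + k)`! <= 2 ^ (j + k) * (j`! * k`!))%N.
Proof.
have := bin_fact (leq_addr k j); rewrite addKn => <-.
rewrite leq_mul2r; apply/orP; right.
have -> : (2 ^ (j + k) = \sum_(i < (j + k).+1) 'C(j + k, i))%N.
  by rewrite -[2%N]/(1 + 1)%N expnDn; apply: eq_bigr => i _; rewrite !exp1n !muln1.
rewrite (bigD1 (Ordinal (leq_addr k j : (j < (j + k).+1)%N)))//=.
exact: leq_addr.
Qed.

(** The constant in the submultiplicativity of the Gevrey factorials. *)
Definition s2 : R := 2 `^ s.

Lemma s2_ge1 : 1 <= s2.
Proof. by have := @ler_pow 1 2 ler01 (ler1n _ 2); rewrite powR1. Qed.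

Lemma FsD j k : Fs (j + k) <= s2 ^+ (j + k) * (Fs j * Fs k).
Proof.
rewrite /Fs -powRM// /s2 -powRXn// -powRM//.
apply: ler_pow => //; rewrite -natrM -natrX -natrM ler_nat.
exact: fact_addn_le.
Qed.

Lemma Fs_ge1 k : 1 <= Fs k.
Proof.
have := @ler_pow 1 (k`!)%:R ler01; rewrite powR1; apply.
by rewrite ler1n fact_gt0.
Qed.

Lemma wexp_gt0 c X : 0 < wexp c X. Proof. exact: expR_gt0. Qed.

Lemma wexpD c c' X : wexp (c + c') X = wexp c X * wexp c' X.
Proof. by rewrite /wexp mulrDl expRD. Qed.

Lemma wexpN c X : wexp (- c) X = (wexp c X)^-1.
Proof. by rewrite /wexp mulNr expRN. Qed.

Lemma wexp_ge1 c X : 0 <= c -> 1 <= wexp c X.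
Proof. by move=> c0; rewrite -expR0 ler_expR mulr_ge0// powR_ge0. Qed.

Lemma wexp_le_c c c' X : c <= c' -> wexp c X <= wexp c' X.
Proof. by move=> cc; rewrite ler_expR ler_wpM2r// powR_ge0. Qed.

Lemma wexp_mono c X Y : 0 <= c -> 0 <= X -> X <= Y -> wexp c X <= wexp c Y.
Proof.
move=> c0 X0 XY; rewrite ler_expR ler_wpM2l//.
apply: ge0_ler_powR => //; rewrite ?nnegrE ?invr_ge0 ?(ltW s0)//.
exact: le_trans XY.
Qed.

Lemma wexp_add c X Y : 0 <= c -> 0 <= X -> 0 <= Y ->
  wexp c (X + Y) <= wexp (2 * c) X * wexp (2 * c) Y.
Proof.
move=> c0 X0 Y0.
have key Z : 0 <= Z -> wexp c (2 * Z) <= wexp (2 * c) Z.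
  move=> Z0; rewrite ler_expR powRM// mulrA ler_wpM2r ?powR_ge0//.
  rewrite mulrC ler_wpM2r//; apply: ler1_powR; rewrite ?ler1n// invf_le1//.
  exact: ltW.
have [XY|YX] := leP X Y.
  apply: (@le_trans _ _ (wexp c (2 * Y))).
    by apply: wexp_mono => //; rewrite ?addr_ge0// mulr_natl mulr2n lerD2r.
  apply: (le_trans (key _ Y0)); rewrite -[leLHS]mul1r; apply: ler_wpM2r.
    exact: ltW (wexp_gt0 _ _).
  by apply: wexp_ge1; rewrite mulr_ge0.
apply: (@le_trans _ _ (wexp c (2 * X))).
  by apply: wexp_mono => //; rewrite ?addr_ge0// mulr_natl mulr2n lerD2l ltW.
apply: (le_trans (key _ X0)); rewrite -[leLHS]mulr1; apply: ler_wpM2l.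
  exact: ltW (wexp_gt0 _ _).
by apply: wexp_ge1; rewrite mulr_ge0.
Qed.

Lemma expr_le_fact_expR (y : R) k : 0 <= y -> y ^+ k <= (k`!)%:R * expR y.
Proof.
move=> y0; rewrite mulrC -ler_pdivrMr ?ltr0n ?fact_gt0//.
case: k => [|k]; first by rewrite expr0 fact0 divr1 -expR0 ler_expR.
by apply: le_trans (expR_ge1Dxn k y0); rewrite lerDr.
Qed.

Definition gK (e : R) : R := (s / e) `^ s.

Lemma gK_ge0 e : 0 <= gK e. Proof. exact: powR_ge0. Qed.

(** This is [y ^ k <= k! exp y] at [y = (e / s) X ^ (1 / s)], raised to the
    power [s]. *)
Lemma pow_le_wexp e X k : 0 < e -> 0 <= X -> X ^+ k <= gK e ^+ k * Fs k * wexp e X.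
Proof.
move=> e0 X0; pose y := e / s * X `^ s^-1.
have y0 : 0 <= y by rewrite mulr_ge0 ?powR_ge0// divr_ge0// ltW.
have := ler_pow (exprn_ge0 k y0) (expr_le_fact_expR k y0).
rewrite powRM// ?expR_ge0// -expRM powRXn//.
have -> : y * s = e * X `^ s^-1 by rewrite /y; field.
rewrite -/(wexp e X) -/(Fs k) {1}/y powRM ?powR_ge0//; last first.
  by rewrite divr_ge0// ltW.
rewrite -powRrM mulVf// powRr1// exprMn.
have es : 0 < (e / s) `^ s by rewrite powR_gt0// divr_gt0.
have -> : gK e = ((e / s) `^ s)^-1.
  have h : (e / s) `^ s * (s / e) `^ s = 1.
    rewrite -powRM ?divr_ge0 ?ltW// (_ : e / s * (s / e) = 1) ?powR1//.
    by field; rewrite gt_eqF//= gt_eqF.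
  by apply: (mulfI (lt0r_neq0 es)); rewrite mulfV ?gt_eqF.
move=> H; rewrite exprVn -mulrA mulrC -ler_pdivrMr ?invr_gt0 ?exprn_gt0//.
by rewrite invrK mulrC.
Qed.

(** Comparison of the exponential series with a geometric one. *)
Lemma expR_le_geom (z D : R) :
  (forall k, z ^+ k / (k`!)%:R <= D * 2^-1 ^+ k) -> expR z <= 2 * D.
Proof.
move=> H; apply: limr_le; first exact: is_cvg_series_exp_coeff.
near=> m; rewrite /series /=.
have D0 : 0 <= D by have := H 0%N; rewrite !expr0 fact0 divr1 mulr1; apply: le_trans.
apply: (@le_trans _ _ (\sum_(0 <= k < m) D * 2^-1 ^+ k)).
  by apply: ler_sum => k _; exact: H.
rewrite -mulr_sumr mulrC ler_wpM2r// big_mkord.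
have -> : \sum_(i < m) (2^-1 : R) ^+ i = 2 - 2 * 2^-1 ^+ m.
  elim: (m) => [|k IH]; first by rewrite big_ord0 expr0 mulr1 subrr.
  by rewrite big_ord_recr /= IH exprS; field.
by rewrite gerBl mulr_ge0// exprn_ge0.
Unshelve. all: by end_near. Qed.

(** The converse: [s]-th roots of the hypothesis bound the terms of the
    exponential series, and the factor [s / 2] makes the bound geometric. *)
Lemma wexp_le_of_pow X H c A : 0 <= X -> 0 < H -> 0 <= c ->
  (forall k, X ^+ k * c <= A * H ^+ k * Fs k) ->
  c * wexp (s / 2 * H^-1 `^ s^-1) X <= s2 * A.
Proof.
move=> X0 H0 c0 hk.
have cA : c <= A by have := hk 0%N; rewrite !expr0 Fs0 !mulr1 mul1r.
have [->|cn0] := eqVneq c 0.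
  by rewrite mul0r mulr_ge0 ?powR_ge0// (le_trans c0).
have cp : 0 < c by rewrite lt_neqAle eq_sym cn0.
have A0 : 0 <= A / c by rewrite divr_ge0// (le_trans c0).
pose y := (H^-1 * X) `^ s^-1.
have y0 : 0 <= y by exact: powR_ge0.
pose D := (A / c) `^ s^-1.
have yk k : y ^+ k <= D * (k`!)%:R.
  have si0 : 0 <= s^-1 by rewrite invr_ge0 ltW.
  have HX0 : 0 <= H^-1 * X by rewrite mulr_ge0// invr_ge0 ltW.
  have h1 : (H^-1 * X) ^+ k <= A / c * Fs k.
    rewrite exprMn exprVn mulrC ler_pdivrMr ?exprn_gt0//.
    rewrite -(ler_pM2r cp); apply: (le_trans (hk k)); apply: eq_ler; field.
    by rewrite gt_eqF.
  have -> : y ^+ k = ((H^-1 * X) ^+ k) `^ s^-1.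
    by rewrite powRXn.
  have -> : D * (k`!)%:R = (A / c * Fs k) `^ s^-1.
    by rewrite (powRM _ A0 (ltW (Fs_gt0 k))) /Fs -powRrM mulfV// powRr1.
  apply: ge0_ler_powR => //; rewrite nnegrE ?exprn_ge0//.
  by rewrite mulr_ge0// ltW// Fs_gt0.
have e1 : expR (y / 2) <= 2 * D.
  apply: expR_le_geom => k; rewrite exprMn mulrAC ler_wpM2r ?exprn_ge0//.
  by rewrite ler_pdivrMr ?ltr0n ?fact_gt0.
have D0 : 0 <= D by exact: powR_ge0.
have := ler_pow (expR_ge0 _) e1; rewrite -expRM powRM// /D -powRrM mulVf// powRr1//.
have -> : y / 2 * s = s / 2 * H^-1 `^ s^-1 * X `^ s^-1.
  have Hi : 0 <= H^-1 by rewrite invr_ge0 ltW.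
  by rewrite /y (powRM _ Hi X0); ring.
by rewrite -/(wexp _ X) -/s2 mulrA ler_pdivlMr// [_ * c]mulrC.
Qed.

End GevreyNumbers.

Section MultiIndex.
Variable n : nat.
Implicit Types al : multi_index n.

Definition mseq al : seq 'I_n := flatten [seq nseq (al i) i | i <- enum 'I_n].

Lemma size_mseq al : size (mseq al) = mlen al.
Proof.
rewrite /mseq /mlen size_flatten /shape -map_comp sumnE big_map big_enum /=.
by apply: eq_bigr => i _; rewrite size_nseq.
Qed.

Definition mcount (l : seq 'I_n) : multi_index n := [ffun i => count_mem i l].

(** By Schwarz's theorem a word of derivatives is determined by this count. *)
Lemma perm_mseq l : perm_eq l (mseq (mcount l)).
Proof.
apply/allP => i _ /=; apply/eqP; rewrite /mseq count_flatten -map_comp sumnE big_map.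
rewrite big_enum /= (bigD1 i)//= count_nseq /= eqxx mul1n ffunE big1 ?addn0//.
by move=> j ji; rewrite count_nseq /= (negbTE ji).
Qed.

Lemma fact_sum_le (I : Type) (r : seq I) (a : I -> nat) :
  ((\sum_(i <- r) a i)`! <= 2 ^ (size r * \sum_(i <- r) a i) * \prod_(i <- r) (a i)`!)%N.
Proof.
elim: r => [|i r IH]; first by rewrite !big_nil.
rewrite !big_cons /=; set b := (\sum_(i <- r) a i)%N in IH *; set p := (\prod_(i <- r) _)%N in IH *.
apply: (leq_trans (fact_addn_le _ _)).
rewrite mulSn [in leqRHS]expnD -!mulnA leq_mul2l; apply/orP; right.
rewrite [leqRHS]mulnCA leq_mul2l; apply/orP; right.
apply: (leq_trans IH); rewrite leq_mul2r; apply/orP; right.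
by rewrite leq_exp2l// leq_mul2l leq_addl orbT.
Qed.

Lemma mfact_le al : (mfact al <= (mlen al)`!)%N.
Proof.
rewrite /mfact /mlen; elim/big_ind2: _ => // [x1 x2 y1 y2 h1 h2].
apply: (leq_trans (leq_mul h1 h2)).
have := bin_fact (leq_addr y1 x1); rewrite addKn => <-.
by rewrite leq_pmull// bin_gt0 leq_addr.
Qed.

Lemma fact_mlen_le al : ((mlen al)`! <= (2 ^ n) ^ mlen al * mfact al)%N.
Proof.
have := fact_sum_le (index_enum 'I_n) al; rewrite -/(mlen al) -/(mfact al).
by rewrite -expnM /index_enum -enumT size_enum_ord.
Qed.

Lemma mfact_gt0 al : (0 < mfact al)%N.
Proof. by rewrite /mfact prodn_gt0// => i; exact: fact_gt0. Qed.

End MultiIndex.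

(** * Gevrey bounds and the norms of the test spaces *)

Lemma ler_expn (R : realType) (x y : R) k : 0 <= x -> x <= y -> x ^+ k <= y ^+ k.
Proof.
by move=> x0 xy; apply: lerXn2r => //; rewrite nnegrE//; exact: le_trans xy.
Qed.

Section GevreyBounds.
Variables (R : realType) (s : R).
Hypothesis hs : 1 < s.
Variable n : nat.
Implicit Types (f g : 'rV[R]_n -> R[i]) (l : seq 'I_n).

(** Gevrey bounds at a point, over all words of derivatives; Schwarz's theorem
    makes them equivalent to the bounds over multi-indices, and words are better
    adapted to inductions. *)
Definition gb (h A : R) f x := forall l,
  cabs (dl l f x) <= A * h ^+ size l * Fs s (size l).

Lemma gb_ge0 h A f x : gb h A f x -> 0 <= A.
Proof.
by move=> /(_ [::]); rewrite expr0 Fs0 !mulr1; apply: le_trans; exact: cabs_ge0.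
Qed.

Lemma gb_le h h' A A' f x : 0 <= h -> h <= h' -> A <= A' -> gb h A f x -> gb h' A' f x.
Proof.
move=> h0 hh AA H l; have A0 := gb_ge0 H; apply: (le_trans (H l)).
apply: ler_wpM2r; first exact: ltW (Fs_gt0 _ _).
by apply: ler_pM => //; [exact: exprn_ge0|exact: ler_expn].
Qed.

Lemma gb_mul h1 h2 A1 A2 f g x : 0 <= h1 -> 0 <= h2 ->
  csmooth f -> csmooth g -> gb h1 A1 f x -> gb h2 A2 g x ->
  gb (h1 + h2) (A1 * A2) (fun y => f y * g y) x.
Proof.
move=> h10 h20 sf sg H1 H2 l.
have A10 := gb_ge0 H1; have A20 := gb_ge0 H2.
have := @leibniz_bound R n f g x (fun k => A1 * h1 ^+ k * Fs s k)
  (fun k => A2 * h2 ^+ k * Fs s k) l sf sg H1 H2.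
move/le_trans; apply.
rewrite addrC exprDn mulr_sumr mulr_suml; apply: ler_sum => -[j jl] _ /=.
rewrite ltnS in jl.
apply: (@le_trans _ _ (('C(size l, j)%:R * A1 * h1 ^+ j * (A2 * h2 ^+ (size l - j))) * (Fs s j * Fs s (size l - j)))).
  by apply: eq_ler; ring.
have P0 : 0 <= 'C(size l, j)%:R * A1 * h1 ^+ j * (A2 * h2 ^+ (size l - j)).
  by rewrite !mulr_ge0// exprn_ge0.
apply: (le_trans (ler_wpM2l P0 (FsM hs _ _))); rewrite subnKC//.
by apply: eq_ler; rewrite -mulr_natl; ring.
Qed.

Lemma gb_add h A1 A2 f g x : csmooth f -> csmooth g -> gb h A1 f x -> gb h A2 g x ->
  gb h (A1 + A2) (fun y => f y + g y) x.
Proof.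
move=> sf sg H1 H2 l; rewrite dl_add//.
by apply: (le_trans (cabsD _ _)); rewrite !mulrDl lerD.
Qed.

Lemma gb_scale h A (c : R[i]) f x : csmooth f -> gb h A f x ->
  gb h (cabs c * A) (fun y => c * f y) x.
Proof.
move=> sf H l; rewrite dl_scale// cabsM -!mulrA ler_wpM2l ?cabs_ge0//.
by rewrite mulrA; exact: H.
Qed.

Lemma gb_conj h A f x : csmooth f -> gb h A f x -> gb h A (fun y => conjc (f y)) x.
Proof. by move=> sf H l; rewrite dl_conj. Qed.

Lemma gb_cst h (c : R[i]) x : 0 <= h -> gb h (cabs c) (fun=> c) x.
Proof.
move=> h0 l; rewrite dl_cst; case: l => [|i l]; first by rewrite Fs0 !mulr1.
by rewrite cabs0 !mulr_ge0 ?cabs_ge0 ?exprn_ge0 ?(ltW (Fs_gt0 _ _)).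
Qed.

End GevreyBounds.

Lemma gb_pull (R : realType) (s : R) (m n : nat) (T : 'rV[R]_m -> 'rV[R]_n) c tau f h A x :
  axis_map T c tau -> csmooth f -> (forall j, `|c j| <= 1) ->
  gb s h A f (T x) -> gb s h A (fun y => f (T y)) x.
Proof.
move=> HT sf c1 H l; apply: (le_trans (dl_pull_le l x HT sf c1)).
by apply: (le_trans (H _)); rewrite size_map.
Qed.

Section Norms.
Variables (R : realType) (s : R).
Hypothesis hs : 1 < s.
Variable n : nat.
Implicit Types (f g : 'rV[R]_n -> R[i]) (l : seq 'I_n).

Let s0 : 0 < s. Proof. exact: lt_trans hs. Qed.

Lemma Dmulti_dl (al : multi_index n) f : Dmulti al f = dl (mseq al) f.
Proof.
rewrite /Dmulti /mseq; elim: (enum 'I_n) => //= i r ->; rewrite dl_cat.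
by elim: (al i) => //= k ->.
Qed.

Lemma dl_Dmulti l f : csmooth f -> dl l f = Dmulti (mcount l) f.
Proof. by move=> sf; rewrite Dmulti_dl; apply: dl_perm => //; exact: perm_mseq. Qed.

Lemma mlen_mcount l : mlen (mcount l) = size l.
Proof. by rewrite -size_mseq; apply/esym/perm_size/perm_mseq. Qed.

Definition snf : R := (2 ^ n)%:R `^ s.

Lemma snf_gt0 : 0 < snf.
Proof. by rewrite powR_gt0// ltr0n expn_gt0. Qed.

Lemma Fs_mlen (al : multi_index n) :
  Fs s (mlen al) <= snf ^+ mlen al * (mfact al)%:R `^ s.
Proof.
rewrite /Fs /snf -powRXn// -powRM//; apply: ler_pow => //.
by rewrite -natrX -natrM ler_nat fact_mlen_le.
Qed.

Lemma mfact_Fs (al : multi_index n) : (mfact al)%:R `^ s <= Fs s (mlen al).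
Proof. by apply: ler_pow => //; rewrite ler_nat mfact_le. Qed.

Lemma mfact_pow_gt0 (al : multi_index n) : 0 < (mfact al)%:R `^ s :> R.
Proof. by rewrite powR_gt0// ltr0n mfact_gt0. Qed.

(** Stated at one point, so that it applies under any weighted supremum. *)
Lemma gb_of_Dmulti h A f x : 0 < h -> csmooth f ->
  (forall al, cabs (Dmulti al f x) / ((mfact al)%:R `^ s * h ^+ mlen al) <= A) ->
  gb s h A f x.
Proof.
move=> h0 sf H l; rewrite dl_Dmulti//; have := H (mcount l).
rewrite ler_pdivrMr ?mulr_gt0 ?exprn_gt0 ?mfact_pow_gt0// mlen_mcount => {}H.
have A0 : 0 <= A.
  have := le_trans (cabs_ge0 _) H.
  by rewrite pmulr_lge0// mulr_gt0 ?exprn_gt0 ?mfact_pow_gt0.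
apply: (le_trans H); rewrite mulrA mulrAC.
apply: ler_wpM2l; first by rewrite mulr_ge0// exprn_ge0 ?(ltW h0).
by rewrite -(mlen_mcount l) mfact_Fs.
Qed.

Lemma Dmulti_of_gb h A f x al : 0 < h -> gb s h A f x ->
  cabs (Dmulti al f x) <= A * (h * snf) ^+ mlen al * (mfact al)%:R `^ s.
Proof.
move=> h0 H; rewrite Dmulti_dl; apply: (le_trans (H _)); rewrite size_mseq.
have A0 := gb_ge0 H.
rewrite exprMn mulrA -[leRHS]mulrA; apply: ler_wpM2l; last exact: Fs_mlen.
by rewrite mulr_ge0// exprn_ge0// ltW.
Qed.

Lemma gb_of_Dnorm h A f x : 0 < h -> csmooth f -> (Dnorm s h f <= A%:E)%E -> gb s h A f x.
Proof.
move=> h0 sf H; apply: gb_of_Dmulti => // al; rewrite -lee_fin.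
by apply: le_trans H; apply: ereal_sup_ubound; exists al, x.
Qed.

Lemma Dnorm_of_gb h A f : 0 < h -> (forall x, gb s h A f x) ->
  (Dnorm s (h * snf) f <= A%:E)%E.
Proof.
move=> h0 H; apply: ge_ereal_sup => _ [al [x ->]]; rewrite lee_fin.
rewrite ler_pdivrMr; last first.
  by rewrite mulr_gt0 ?mfact_pow_gt0// exprn_gt0// mulr_gt0// snf_gt0.
by apply: (le_trans (Dmulti_of_gb _ h0 (H x))); apply: eq_ler; ring.
Qed.

(** Bounds on all [x ^ alpha D ^ beta f] amount to Gevrey bounds that decay
    subexponentially. *)
Definition decay_gb (c h A : R) f := forall x, gb s h (A * wexp s (- c) `|x|) f x.

(** The rate of decay that [wexp_le_of_pow] extracts from a norm with parameter
    [h]. *)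
Definition sdec (h : R) : R := s / 2 * h^-1 `^ s^-1.

Lemma sdec_gt0 h : 0 < h -> 0 < sdec h.
Proof. by move=> h0; rewrite mulr_gt0 ?divr_gt0// powR_gt0// invr_gt0. Qed.

Lemma decay_gb_of_Snorm h A f : 0 < h -> csmooth f -> (Snorm s h f <= A%:E)%E ->
  decay_gb (sdec h) h (s2 s * A) f.
Proof.
move=> h0 sf H x l.
have ub (al be : multi_index n) : `|mpow x al| * cabs (Dmulti be f x) <=
    A * ((mfact al)%:R `^ s * (mfact be)%:R `^ s * h ^+ (mlen al + mlen be)).
  have : cabs (Complex (mpow x al) 0 * Dmulti be f x) /
         ((mfact al * mfact be)%:R `^ s * h ^+ (mlen al + mlen be)) <= A.
    by rewrite -lee_fin; apply: le_trans H; apply: ereal_sup_ubound; exists al, be, x.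
  rewrite natrM powRM// cabsM cabs_real ler_pdivrMr//.
  by rewrite !mulr_gt0 ?exprn_gt0 ?mfact_pow_gt0.
have ub' (i : 'I_n) k : `|x 0 i| ^+ k * cabs (dl l f x) <=
    (A * h ^+ size l * Fs s (size l)) * h ^+ k * Fs s k.
  pose al : multi_index n := [ffun j => if j == i then k else 0%N].
  have := ub al (mcount l); rewrite -dl_Dmulti// mlen_mcount.
  have -> : mpow x al = x 0 i ^+ k.
    rewrite /mpow (bigD1 i)//= big1 ?mulr1 ?ffunE ?eqxx// => j ji.
    by rewrite ffunE (negbTE ji).
  have -> : mlen al = k.
    rewrite /mlen (bigD1 i)//= big1 ?addn0 ?ffunE ?eqxx// => j ji.
    by rewrite ffunE (negbTE ji).
  have -> : mfact al = (k`!)%N.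
    rewrite /mfact (bigD1 i)//= big1 ?muln1 ?ffunE ?eqxx// => j ji.
    by rewrite ffunE (negbTE ji).
  rewrite normrX => /le_trans; apply; rewrite -/(Fs s k).
  have A0 : 0 <= A.
    have /le_trans := ub [ffun=> 0%N] [ffun=> 0%N]; move=> /(_ _ (lexx _)) h1.
    have : 0 <= A * ((mfact ([ffun=> 0%N] : multi_index n))%:R `^ s * (mfact ([ffun=> 0%N] : multi_index n))%:R `^ s * h ^+ (mlen ([ffun=> 0%N] : multi_index n) + mlen ([ffun=> 0%N] : multi_index n))).
      by apply: le_trans h1; rewrite mulr_ge0// cabs_ge0.
    by rewrite pmulr_lge0// !mulr_gt0 ?exprn_gt0 ?mfact_pow_gt0.
  apply: (@le_trans _ _ (A * Fs s k * h ^+ (k + size l) * (mfact (mcount l))%:R `^ s)).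
    by apply: eq_ler; ring.
  apply: (@le_trans _ _ (A * Fs s k * h ^+ (k + size l) * Fs s (size l))); last first.
    by apply: eq_ler; rewrite exprD; ring.
  apply: ler_wpM2l; last by rewrite -(mlen_mcount l) mfact_Fs.
  by rewrite !mulr_ge0 ?exprn_ge0 ?(ltW (Fs_gt0 _ _)) ?(ltW h0).
have fin : cabs (dl l f x) * wexp s (sdec h) `|x| <= s2 s * (A * h ^+ size l * Fs s (size l)).
  have [x0|xn0] := eqVneq x 0.
    rewrite x0 normr0 /wexp powR0 ?invr_neq0 ?gt_eqF// mulr0 expR0 mulr1.
    have : cabs (dl l f x) <= A * h ^+ size l * Fs s (size l).
      have := ub [ffun=> 0%N] (mcount l); rewrite -dl_Dmulti// mlen_mcount.
      have -> : mpow x [ffun=> 0%N] = 1 by rewrite /mpow big1// => i _; rewrite ffunE.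
      have -> : mlen ([ffun=> 0%N] : multi_index n) = 0%N.
        by rewrite /mlen big1// => i _; rewrite ffunE.
      have -> : mfact ([ffun=> 0%N] : multi_index n) = 1%N.
        by rewrite /mfact big1// => i _; rewrite ffunE.
      rewrite normr1 mul1r powR1 mul1r add0n => H1; apply: (le_trans H1).
      have A0 : 0 <= A.
        have := le_trans (cabs_ge0 _) H1.
        by rewrite pmulr_lge0// mulr_gt0 ?exprn_gt0 ?mfact_pow_gt0.
      rewrite mulrA mulrAC; apply: ler_wpM2l; first by rewrite mulr_ge0// exprn_ge0 ?(ltW h0).
      by rewrite -(mlen_mcount l) mfact_Fs.
    rewrite x0 => H1; apply: (le_trans H1); rewrite ler_peMl ?s2_ge1//.
    by apply: le_trans H1; exact: cabs_ge0.
  have nx : mx_norm x != 0 by move: xn0; rewrite -normr_eq0.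
  have [[a i] /= Hi] := mx_norm_neq0 nx.
  have -> : `|x| = `|x 0 i| by rewrite [LHS]Hi ord1.
  exact: (wexp_le_of_pow hs (normr_ge0 (x 0 i)) h0 (cabs_ge0 _) (ub' i)).
rewrite wexpN mulrAC -mulrA mulrAC ler_pdivlMr ?wexp_gt0//.
by apply: (le_trans fin); apply: eq_ler; ring.
Qed.

Lemma mpow_le (x : 'rV[R]_n) al : `|mpow x al| <= `|x| ^+ mlen al.
Proof.
rewrite /mpow /mlen normr_prod expr_sum; apply: ler_prod => i _.
by rewrite normr_ge0 normrX ler_expn// coord_le.
Qed.

Definition sstep (c h : R) : R := (gK s c + h) * snf.

Lemma sstep_gt0 c h : 0 < h -> 0 < sstep c h.
Proof. by move=> h0; rewrite mulr_gt0 ?snf_gt0// ltr_wpDl// gK_ge0. Qed.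

Lemma Snorm_of_decay_gb c h A f : 0 < c -> 0 < h -> decay_gb c h A f ->
  (Snorm s (sstep c h) f <= A%:E)%E.
Proof.
move=> c0 h0 H; apply: ge_ereal_sup => _ [al [be [x ->]]]; rewrite lee_fin.
have st := sstep_gt0 c h0.
rewrite ler_pdivrMr; last first.
  by rewrite natrM powRM// !mulr_gt0 ?exprn_gt0 ?mfact_pow_gt0.
rewrite cabsM cabs_real.
have E1 : `|mpow x al| <= wexp s c `|x| * (sstep c h) ^+ mlen al * (mfact al)%:R `^ s.
  apply: (le_trans (mpow_le _ _)).
  apply: (le_trans (pow_le_wexp hs (mlen al) c0 (normr_ge0 x))).
  rewrite [leLHS]mulrC -[leRHS]mulrA; apply: ler_wpM2l; first exact: ltW (wexp_gt0 _ _ _).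
  apply: (@le_trans _ _ (gK s c ^+ mlen al * (snf ^+ mlen al * (mfact al)%:R `^ s))).
    by apply: ler_wpM2l (Fs_mlen al); rewrite exprn_ge0// gK_ge0.
  rewrite mulrA; apply: ler_wpM2r; first exact: ltW (mfact_pow_gt0 _).
  rewrite -exprMn; apply: ler_expn; first exact: mulr_ge0 (gK_ge0 _ _) (ltW snf_gt0).
  by apply: ler_wpM2r; [exact: ltW snf_gt0|rewrite lerDl ltW].
have A0 : 0 <= A.
  by have := gb_ge0 (H x); rewrite pmulr_lge0// wexp_gt0.
have E2 : cabs (Dmulti be f x) <=
    A * wexp s (- c) `|x| * (sstep c h) ^+ mlen be * (mfact be)%:R `^ s.
  apply: (le_trans (Dmulti_of_gb be h0 (H x))).
  apply: ler_wpM2r; first exact: ltW (mfact_pow_gt0 _).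
  apply: ler_wpM2l; first by rewrite mulr_ge0// ltW// wexp_gt0.
  apply: ler_expn; first exact: mulr_ge0 (ltW h0) (ltW snf_gt0).
  by apply: ler_wpM2r; [exact: ltW snf_gt0|rewrite lerDr gK_ge0].
apply: (le_trans (ler_pM _ _ E1 E2)) => //; first exact: cabs_ge0.
rewrite wexpN natrM powRM// exprD; apply: eq_ler; field.
by rewrite gt_eqF// wexp_gt0.
Qed.

End Norms.

(** * Duals of inductive limits *)

Section InductiveLimitDual.
Variables (R : realType) (T I : Type) (P : set I) (step : I -> set (T -> R[i])).
Variable nrm : I -> (T -> R[i]) -> \bar R.
Implicit Types (u : (T -> R[i]) -> R[i]) (f g : T -> R[i]).

(** The sublevel sets of the functional are absolutely convex and contain a ball
    of each step. *)
Lemma ilim_dual_intro u :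
  (forall f g c e, ilim P step f -> ilim P step g ->
     ilim P step (fun x => c * f x + e * g x)) ->
  (forall f g c, ilim P step f -> ilim P step g ->
     u (fun x => c * f x + g x) = c * u f + u g) ->
  (forall i, P i -> exists C : R, forall f A, step i f -> (nrm i f <= A%:E)%E ->
     cabs (u f) <= C * A) ->
  (forall f, ~ ilim P step f -> u f = 0) ->
  ilim_dual P step nrm u.
Proof.
move=> clos lin bnd off; split; [exact: lin|split; last exact: off] => eps e0.
exists [set f | ilim P step f /\ cabs (u f) < eps]; split=> //; split.
  by move=> f [].
split.
  move=> f g c e [Lf uf] [Lg ug] ce; split; first exact: clos.
  have Lz : ilim P step (fun=> 0).
    rewrite (_ : (fun=> 0) = fun x => 0 * f x + 0 * f x); first exact: clos.
    by apply/funext => x; rewrite mul0r addr0.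
  have uz : u (fun=> 0) = 0.
    have := lin _ _ 1 Lz Lz; rewrite (_ : (fun x => _) = (fun=> 0)).
      by rewrite mul1r => /(congr1 (fun z => z - u (fun=> 0))); rewrite addrK subrr.
    by apply/funext => x; rewrite mulr0 addr0.
  have ueg : u (fun x => e * g x) = e * u g.
    have := lin _ _ e Lg Lz; rewrite uz addr0 => <-; congr u.
    by apply/funext => x; rewrite addr0.
  have Leg : ilim P step (fun x => e * g x).
    rewrite (_ : (fun x => _) = fun x => e * g x + 0 * g x); first exact: clos.
    by apply/funext => x; rewrite mul0r addr0.
  rewrite (lin _ _ c Lf Leg) ueg; apply: (le_lt_trans (cabsD _ _)).
  rewrite !cabsM; have [c0|c0] := eqVneq (cabs c) 0.
    rewrite c0 mul0r add0r; have [e00|e00] := eqVneq (cabs e) 0.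
      by rewrite e00 mul0r.
    apply: (@lt_le_trans _ _ (cabs e * eps)).
      by rewrite ltr_pM2l// lt_neqAle eq_sym e00 cabs_ge0.
    by rewrite ler_piMl ?(ltW e0)//; move: ce; rewrite c0 add0r.
  apply: (@lt_le_trans _ _ (cabs c * eps + cabs e * eps)).
    apply: ltr_leD; first by rewrite ltr_pM2l// lt_neqAle eq_sym c0 cabs_ge0.
    by rewrite ler_wpM2l ?cabs_ge0// ltW.
  by rewrite -mulrDl ler_piMl// ltW.
move=> i Pi; have [C HC] := bnd i Pi.
have C0 : 0 < `|C| + 1 by rewrite ltr_wpDl.
exists (eps / (`|C| + 1)); first by rewrite divr_gt0.
move=> f fi nf; split; first by exists i.
have d0 : 0 < eps / (`|C| + 1) by rewrite divr_gt0.
apply: (le_lt_trans (HC f _ fi (ltW nf))).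
rewrite mulrA ltr_pdivrMr// mulrC ltr_pM2l//.
by rewrite (le_lt_trans (ler_norm C))// ltrDl.
Qed.

(** Continuity at [eps = 1] gives the bound on a small ball, and scaling spreads
    it to the whole step. *)
Lemma ilim_dual_bound u i : ilim_dual P step nrm u -> P i ->
  (forall f (c A : R), step i f -> (nrm i f <= A%:E)%E -> 0 < c ->
     step i (fun x => Complex c 0 * f x) /\
     (nrm i (fun x => Complex c 0 * f x)%R <= (c * A)%:E)%E) ->
  exists C : R, 0 <= C /\ forall f (A : R), 0 <= A -> step i f -> (nrm i f <= A%:E)%E ->
     cabs (u f) <= C * A.
Proof.
move=> [lin [cont off]] Pi hom.
have [V [VU [_ [_ VN]]]] := cont 1 ltr01.
have [d d0 Hd] := VN i Pi.
exists (2 / d); split=> [|f A A0 fi nf]; first by rewrite divr_ge0// ltW.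
apply/ler_addgt0Pr => e e0.
pose B := A + e * d / 2.
have B0 : 0 < B by rewrite ltr_wpDl// !mulr_gt0.
pose c := d / (2 * B).
have c0 : 0 < c by rewrite divr_gt0// mulr_gt0.
have nB : (nrm i f <= B%:E)%E.
  apply: (le_trans nf); rewrite lee_fin lerDl; apply: ltW.
  by rewrite divr_gt0// mulr_gt0.
have [si ni] := hom f c B fi nB c0.
have Lf : ilim P step f by exists i.
have Lcf : ilim P step (fun x => Complex c 0 * f x) by exists i.
have : (nrm i (fun x => Complex c 0 * f x)%R < d%:E)%E.
  apply: (le_lt_trans ni); rewrite lte_fin /c.
  have -> : d / (2 * B) * B = d / 2 by field; rewrite gt_eqF.
  by rewrite ltr_pdivrMr// ltr_pMr// ltr1n.
move=> /(Hd _ si)/VU [_].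
have -> : u (fun x => Complex c 0 * f x) = Complex c 0 * u f.
  have L0 : u (fun x => - 1 * f x + f x) = - 1 * u f + u f by exact: lin.
  have Z : (fun x => - 1 * f x + f x) = (fun=> 0).
    by apply/funext => x; rewrite mulN1r addNr.
  have [Lz|nLz] := pselect (ilim P step (fun=> 0)); last first.
    have h := lin f f (Complex c 0 - 1) Lf Lf.
    rewrite (_ : (fun x => _) = (fun x => Complex c 0 * f x)) in h.
      by rewrite h; ring.
    by apply/funext => x; ring.
  have h := lin f (fun=> 0) (Complex c 0) Lf Lz.
  rewrite (_ : (fun x => _) = (fun x => Complex c 0 * f x)) in h.
    rewrite h; move: L0; rewrite Z => ->; ring.
  by apply/funext => x; rewrite addr0.
rewrite cabsM cabs_real (gtr0_norm c0) => h.
have : cabs (u f) < c^-1 by rewrite -[c^-1]mulr1 ltr_pdivlMl.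
move=> /ltW/le_trans; apply.
by apply: eq_ler; rewrite /c invf_div /B; field; rewrite gt_eqF.
Qed.

End InductiveLimitDual.

Lemma lty_bound (R : realType) (x : \bar R) : (x < +oo)%E ->
  exists2 A : R, 0 <= A & (x <= A%:E)%E.
Proof.
case: x => [r| |]// _; last by exists 0; rewrite ?leNye.
by exists `|r|; rewrite ?lee_fin ?ler_norm.
Qed.

Section TestSpaces.
Variables (R : realType) (s : R).
Hypothesis hs : 1 < s.
Variable n : nat.
Implicit Types (f g : 'rV[R]_n -> R[i]) (a : ('rV[R]_n -> R[i]) -> R[i]).

Let s0 : 0 < s. Proof. exact: lt_trans hs. Qed.

Definition supp_in (r : R) f := forall x : 'rV[R]_n, r < `|x| -> f x = 0.

Lemma closed_ball_compact (r : R) : compact [set x : 'rV[R]_n | `|x| <= r].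
Proof.
apply: bounded_closed_compact.
  exists r; split; first exact: num_real.
  by move=> M rM x /= xr; apply: ltW; exact: le_lt_trans rM.
rewrite (_ : [set x | _] = (fun x : 'rV[R]_n => `|x|) @^-1` [set y | y <= r])//.
apply: closed_comp => [x _|]; first exact: norm_continuous.
exact: closed_le.
Qed.

Lemma compact_norm_bound (K : set 'rV[R]_n) : compact K ->
  exists r : R, forall x, K x -> `|x| <= r.
Proof.
move=> /compact_bounded[M [_ HM]]; exists (M + 1) => x Kx.
by apply: HM Kx; rewrite ltrDl.
Qed.

Lemma supp_in_le r r' f : r <= r' -> supp_in r f -> supp_in r' f.
Proof. by move=> rr H x rx; apply: H; exact: le_lt_trans rx. Qed.

Lemma dl_ball0 f x (e : R) l y : csmooth f ->
  (forall z, `|x - z| < e -> f z = 0) -> `|x - y| < e -> dl l f y = 0.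
Proof.
move=> sf f0; elim: l y => [|i l IH] y xy; first exact: f0.
rewrite dl_cons.
have near0 : \forall z \near y, (fun=> 0) z = dl l f z.
  apply/nbhs_ballP; exists (e - `|x - y|); first by rewrite /= subr_gt0.
  move=> z; rewrite -ball_normE /= => h1; rewrite IH//.
  by have := ler_distD y x z; lra.
have c0 : cder (dl l f) y (delta_mx 0 i) 0.
  have [p q] := @cder_cst R 'rV[R]_n 0 y (delta_mx 0 i).
  split; [apply: near_eq_is_derive p|apply: near_eq_is_derive q];
    by apply: filterS near0 => z <-.
have := cder_unique (smooth_isD i (smooth_dl l sf) y) c0.
by move=> /(congr1 (fun z => - Complex 0 1 * z)); rewrite mulr0 mulrA iiN mul1r.
Qed.

Lemma dl_supp r f l x : csmooth f -> supp_in r f -> r < `|x| -> dl l f x = 0.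
Proof.
move=> sf fr rx; apply: (@dl_ball0 f x (`|x| - r)) => //.
  by move=> z xz; apply: fr; have := lerB_dist x z; lra.
by rewrite subrr normr0 subr_gt0.
Qed.

Lemma DspaceP f : Dspace s f <->
  csmooth f /\ (exists r, supp_in r f) /\
  exists h A, 0 < h /\ forall x, gb s h A f x.
Proof.
split.
  move=> [[K h] [/= cK h0] [/= sf [Kf nf]]]; split; first exact: CSmooth.
  split.
    have [r Kr] := compact_norm_bound cK.
    exists r => x rx; apply: Kf => /Kr; apply/negP; by rewrite -ltNge.
  have [A A0 HA] := lty_bound nf.
  by exists h, A; split=> // x; apply: gb_of_Dnorm => //; exact: CSmooth.
move=> [sf [[r fr] [h [A [h0 fA]]]]].
exists ([set x : 'rV[R]_n | `|x| <= r], h * snf s n).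
  split => /=; first exact: closed_ball_compact.
  by rewrite mulr_gt0// snf_gt0.
split => /=; first by case: sf.
split; first by move=> x /negP; rewrite -ltNge; exact: fr.
apply: (@le_lt_trans _ _ A%:E); last exact: ltry.
exact: Dnorm_of_gb.
Qed.

Lemma SspaceP f : Sspace s f <->
  csmooth f /\ exists c h A, [/\ 0 < c, 0 < h & decay_gb s c h A f].
Proof.
split.
  move=> [h /= h0 [sf nf]]; split; first exact: CSmooth.
  have [A A0 HA] := lty_bound nf.
  exists (sdec s h), h, (s2 s * A); split=> //; first exact: sdec_gt0.
  by apply: decay_gb_of_Snorm => //; exact: CSmooth.
move=> [sf [c [h [A [c0 h0 fA]]]]].
exists (sstep s n c h); first exact: sstep_gt0.
split; first by case: sf.
apply: (@le_lt_trans _ _ A%:E); last exact: ltry.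
exact: Snorm_of_decay_gb.
Qed.

Lemma decay_gb_le c c' h h' A A' f : c' <= c -> 0 <= h -> h <= h' -> A <= A' ->
  decay_gb s c h A f -> decay_gb s c' h' A' f.
Proof.
move=> cc h0 hh AA H x; have A0 : 0 <= A.
  by have := gb_ge0 (H x); rewrite pmulr_lge0// wexp_gt0.
apply: gb_le (H x) => //; apply: ler_pM => //; first exact: ltW (wexp_gt0 _ _ _).
by apply: wexp_le_c; rewrite lerN2.
Qed.

Lemma Dspace_comb f g c e : Dspace s f -> Dspace s g ->
  Dspace s (fun x => c * f x + e * g x).
Proof.
move=> /DspaceP[sf [[r fr] [h [A [h0 fA]]]]] /DspaceP[sg [[r' gr] [h' [A' [h0' gA]]]]].
apply/DspaceP; split; first by apply: smooth_add; exact: smooth_scale.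
split.
  exists (Num.max r r') => x; rewrite gt_max => /andP[rx rx'].
  by rewrite fr// gr// !mulr0 addr0.
exists (Num.max h h'), (cabs c * A + cabs e * A'); split; first by rewrite lt_max h0.
move=> x; apply: gb_add; [exact: smooth_scale|exact: smooth_scale| |].
  apply: (gb_le (ltW h0) _ (lexx _) (gb_scale _ sf (fA x))).
  by rewrite le_max lexx.
apply: (gb_le (ltW h0') _ (lexx _) (gb_scale _ sg (gA x))).
by rewrite le_max lexx orbT.
Qed.

Lemma Sspace_comb f g c e : Sspace s f -> Sspace s g ->
  Sspace s (fun x => c * f x + e * g x).
Proof.
move=> /SspaceP[sf [c1 [h [A [c10 h0 fA]]]]] /SspaceP[sg [c2 [h' [A' [c20 h0' gA]]]]].
apply/SspaceP; split; first by apply: smooth_add; exact: smooth_scale.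
exists (Num.min c1 c2), (Num.max h h'), (cabs c * A + cabs e * A'); split.
- by rewrite lt_min c10.
- by rewrite lt_max h0.
have {}fA : decay_gb s (Num.min c1 c2) (Num.max h h') A f.
  by apply: decay_gb_le fA => //; rewrite ?ge_min ?le_max ?lexx// ltW.
have {}gA : decay_gb s (Num.min c1 c2) (Num.max h h') A' g.
  by apply: decay_gb_le gA => //; rewrite ?ge_min ?le_max ?lexx ?orbT// ltW.
move=> x; rewrite mulrDl -!mulrA.
by apply: gb_add; [exact: smooth_scale|exact: smooth_scale|exact: gb_scale|exact: gb_scale].
Qed.

Lemma D_sub_S f : Dspace s f -> Sspace s f.
Proof.
move=> /DspaceP[sf [[r fr] [h [A [h0 fA]]]]]; apply/SspaceP; split=> //.
exists 1, h, (A * wexp s 1 `|r|); split=> //.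
move=> x l; have [xr|rx] := leP `|x| r.
  have A0 := gb_ge0 (fA x).
  apply: (le_trans (fA x l)); apply: ler_wpM2r; first exact: ltW (Fs_gt0 _ _).
  apply: ler_wpM2r; first by rewrite exprn_ge0// ltW.
  rewrite -mulrA ler_peMr// wexpN ler_pdivlMr ?wexp_gt0// mul1r.
  apply: wexp_mono => //; exact: le_trans xr (ler_norm _).
rewrite (dl_supp l sf fr rx).
rewrite cabs0 !mulr_ge0 ?exprn_ge0 ?(ltW h0) ?(ltW (Fs_gt0 _ _)) ?(ltW (wexp_gt0 _ _ _))//.
exact: gb_ge0 (fA x).
Qed.

Lemma Dlin a : Ddual s a -> forall f g c, Dspace s f -> Dspace s g ->
  a (fun x => c * f x + g x) = c * a f + a g.
Proof. by case. Qed.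

Lemma Slin a : Sdual s a -> forall f g c, Sspace s f -> Sspace s g ->
  a (fun x => c * f x + g x) = c * a f + a g.
Proof. by case. Qed.

Lemma Ddual_bound a r h : Ddual s a -> 0 < h -> exists C, 0 <= C /\
  forall f A, csmooth f -> supp_in r f -> (forall x, gb s h A f x) -> cabs (a f) <= C * A.
Proof.
move=> aD h0.
pose Kh := ([set x : 'rV[R]_n | `|x| <= r], h * snf s n).
have PK : Dindex Kh.
  by split => /=; [exact: closed_ball_compact|rewrite mulr_gt0// snf_gt0].
have hom f (c A : R) : Dstep s Kh f -> (Dnorm s Kh.2 f <= A%:E)%E -> 0 < c ->
     Dstep s Kh (fun x => Complex c 0 * f x) /\
     (Dnorm s Kh.2 (fun x => Complex c 0 * f x)%R <= (c * A)%:E)%E.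
  move=> [sf [Kf nf]] fA c0.
  have sf' := CSmooth sf.
  have nA : (Dnorm s Kh.2 (fun x => Complex c 0 * f x)%R <= (c * A)%:E)%E.
    apply: ge_ereal_sup => _ [al [x ->]]; rewrite lee_fin.
    rewrite Dmulti_dl dl_scale// cabsM cabs_real (gtr0_norm c0) -mulrA.
    rewrite ler_wpM2l ?(ltW c0)// -lee_fin.
    by apply: le_trans fA; apply: ereal_sup_ubound; exists al, x; rewrite Dmulti_dl.
  split=> //; split; first by have [] := smooth_scale (Complex c 0) sf'.
  split; first by move=> x /Kf ->; rewrite mulr0.
  by apply: (le_lt_trans nA); exact: ltry.
have [C [C0 HC]] := ilim_dual_bound aD PK hom.
exists C; split=> // f A sf fr fA.
have A0 : 0 <= A := gb_ge0 (fA 0).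
apply: HC => //; last exact: Dnorm_of_gb.
split; first by case: sf.
split; first by move=> x /negP; rewrite -ltNge; exact: fr.
by apply: (@le_lt_trans _ _ A%:E); [exact: Dnorm_of_gb|exact: ltry].
Qed.

Lemma Sdual_bound a c h : Sdual s a -> 0 < c -> 0 < h -> exists C, 0 <= C /\
  forall f A, csmooth f -> decay_gb s c h A f -> cabs (a f) <= C * A.
Proof.
move=> aS c0 h0.
have PK : @Sindex R (sstep s n c h) by exact: sstep_gt0.
have hom f (e A : R) : Sstep s (sstep s n c h) f -> (Snorm s (sstep s n c h) f <= A%:E)%E ->
    0 < e -> Sstep s (sstep s n c h) (fun x => Complex e 0 * f x) /\
     (Snorm s (sstep s n c h) (fun x => Complex e 0 * f x)%R <= (e * A)%:E)%E.
  move=> [sf nf] fA e0.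
  have sf' := CSmooth sf.
  have nA : (Snorm s (sstep s n c h) (fun x => Complex e 0 * f x)%R <= (e * A)%:E)%E.
    apply: ge_ereal_sup => _ [al [be [x ->]]]; rewrite lee_fin.
    rewrite Dmulti_dl dl_scale// mulrCA cabsM [cabs (Complex e 0)]cabs_real (gtr0_norm e0) -mulrA.
    rewrite ler_wpM2l ?(ltW e0)// -lee_fin.
    by apply: le_trans fA; apply: ereal_sup_ubound; exists al, be, x; rewrite Dmulti_dl.
  split=> //; split; first by have [] := smooth_scale (Complex e 0) sf'.
  by apply: (le_lt_trans nA); exact: ltry.
have [C [C0 HC]] := ilim_dual_bound aS PK hom.
exists C; split=> // f A sf fA.
have A0 : 0 <= A.
  by have := gb_ge0 (fA 0); rewrite pmulr_lge0// wexp_gt0.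
apply: HC => //; last exact: Snorm_of_decay_gb.
split; first by case: sf.
by apply: (@le_lt_trans _ _ A%:E); [exact: Snorm_of_decay_gb|exact: ltry].
Qed.

Lemma Sdual_intro a :
  (forall f g c, Sspace s f -> Sspace s g -> a (fun x => c * f x + g x) = c * a f + a g) ->
  (forall c h, 0 < c -> 0 < h -> exists C, forall f A, csmooth f -> decay_gb s c h A f ->
     cabs (a f) <= C * A) ->
  (forall f, ~ Sspace s f -> a f = 0) -> Sdual s a.
Proof.
move=> lin bnd off; apply: ilim_dual_intro => //.
  by move=> f g c e; exact: Sspace_comb.
move=> h h0; have [C HC] := bnd (sdec s h) h (sdec_gt0 hs h0) h0.
exists (C * s2 s) => f A [sf _] fA; rewrite -mulrA; apply: HC; first exact: CSmooth.
by apply: decay_gb_of_Snorm => //; exact: CSmooth.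
Qed.

Lemma Ddual_intro a :
  (forall f g c, Dspace s f -> Dspace s g -> a (fun x => c * f x + g x) = c * a f + a g) ->
  (forall r h, 0 < h -> exists C, forall f A, csmooth f -> supp_in r f ->
     (forall x, gb s h A f x) -> cabs (a f) <= C * A) ->
  (forall f, ~ Dspace s f -> a f = 0) -> Ddual s a.
Proof.
move=> lin bnd off; apply: ilim_dual_intro => //.
  by move=> f g c e; exact: Dspace_comb.
move=> [K h] [/= cK h0]; have [r Kr] := compact_norm_bound cK.
have [C HC] := bnd r h h0.
exists C => f A [sf [/= Kf _]] fA; apply: HC; first exact: CSmooth.
  by move=> x rx; apply: Kf => /Kr; apply/negP; rewrite -ltNge.
by move=> x; apply: gb_of_Dnorm => //; exact: CSmooth.
Qed.

End TestSpaces.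

(** * Compactly supported Gevrey functions *)

Section FlatFunction.
Variables (R : realType) (p : nat).
Hypothesis p0 : (0 < p)%N.

(** The [k]-th derivative of [exp (- t ^ - p)] is [v ^ k Q_k (v ^ p) exp (- v ^ p)],
    [v = 1 / t]; these are the coefficients of the polynomial [Q_k]. *)
Fixpoint flat_coef (k j : nat) : R :=
  match k with
  | 0%N => (j == 0%N)%:R
  | k'.+1 => - (k' + p * j)%:R * flat_coef k' j +
      p%:R * (if j is j'.+1 then flat_coef k' j' else 0)
  end.

Lemma flat_coef_gt k j : (k < j)%N -> flat_coef k j = 0.
Proof.
elim: k j => [|k IH] [|j]//= kj; rewrite IH ?mulr0 ?add0r; last exact: ltnW.
by rewrite IH ?mulr0.
Qed.

Let C : R := (1 + 2 * p)%:R.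

Lemma flat_coef_le k j : `|flat_coef k j| <= C ^+ k * (k`!)%:R / (j`!)%:R.
Proof.
elim: k j => [|k IH] j.
  rewrite /= expr0 mul1r fact0 mul1r; case: j => [|j] /=.
    by rewrite fact0 invr1 normr1.
  by rewrite normr0 invr_ge0.
have fj0 i : 0 < (i`!)%:R :> R by rewrite ltr0n fact_gt0.
have [kj|kj] := ltnP k.+1 j.
  rewrite flat_coef_gt// normr0 divr_ge0// mulr_ge0// exprn_ge0//.
have Ck : 0 <= C ^+ k * (k`!)%:R by rewrite mulr_ge0// exprn_ge0.
have E1 : (k + p * j)%:R * `|flat_coef k j| <=
    ((1 + p) * k.+1)%:R * (C ^+ k * (k`!)%:R / (j`!)%:R).
  have [kj'|kj'] := ltnP k j.
    by rewrite flat_coef_gt// normr0 mulr0 mulr_ge0// divr_ge0.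
  apply: ler_pM => //; rewrite ler_nat mulnDl mul1n leq_add//.
  by rewrite leq_mul2l (leq_trans kj')// orbT.
have E2 : p%:R * `|if j is j'.+1 then flat_coef k j' else 0| <=
    (p * k.+1)%:R * (C ^+ k * (k`!)%:R / (j`!)%:R).
  case: j kj {E1} => [|j] kj.
    by rewrite normr0 mulr0 mulr_ge0// divr_ge0.
  rewrite natrM -mulrA ler_wpM2l//; apply: (le_trans (IH j)).
  rewrite mulrCA; apply: ler_wpM2l => //.
  rewrite factS natrM invfM mulrA -[leLHS]mul1r ler_wpM2r ?invr_ge0//.
  by rewrite ler_pdivlMr ?ltr0n// mul1r ler_nat.
rewrite /=; apply: (le_trans (ler_normD _ _)).
rewrite !normrM normrN !normr_nat; apply: (le_trans (lerD E1 E2)).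
rewrite -mulrDl -natrD -mulnDl factS exprS natrM natrM.
apply: eq_ler; rewrite /C (_ : 1 + p + p = 1 + 2 * p)%N; last by lia.
by ring.
Qed.

Definition flat (k : nat) (t : R) : R :=
  if 0 < t then \sum_(j < k.+1) flat_coef k j * t^-1 ^+ (k + p * j) * expR (- t^-1 ^+ p)
  else 0.

Lemma flat_le0 k t : t <= 0 -> flat k t = 0.
Proof. by move=> t0; rewrite /flat ltNge t0. Qed.

(** Half of the exponential absorbs the sum over [j]. *)
Lemma flat_bound k t : 0 < t ->
  `|flat k t| <= (4 * C) ^+ k * (k`!)%:R * (t^-1 ^+ k * expR (- (t^-1 ^+ p / 2))).
Proof.
move=> t0; rewrite /flat t0; set v := t^-1; have v0 : 0 < v by rewrite invr_gt0.
set w := v ^+ p; have w0 : 0 < w by rewrite exprn_gt0.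
have fj0 i : 0 < (i`!)%:R :> R by rewrite ltr0n fact_gt0.
apply: (le_trans (ler_norm_sum _ _ _)).
apply: (@le_trans _ _ (\sum_(j < k.+1) (C ^+ k * (k`!)%:R) * 2 ^+ k *
    (v ^+ k * expR (- (w / 2))))).
  apply: ler_sum => -[j jk] _ /=; rewrite ltnS in jk.
  rewrite !normrM (gtr0_norm (expR_gt0 _)) (ger0_norm (exprn_ge0 _ (ltW v0))).
  rewrite exprD exprM -/w.
  have -> : expR (- w) = expR (- (w / 2)) * expR (- (w / 2)) by rewrite -expRD; congr expR; field.
  have H : w ^+ j / (j`!)%:R * expR (- (w / 2)) <= 2 ^+ k.
    have w2 : 0 <= w / 2 by rewrite divr_ge0// ltW.
    have := expr_le_fact_expR j w2; rewrite expr_div_n ler_pdivrMr ?exprn_gt0// => h.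
    rewrite expRN ler_pdivrMr ?expR_gt0// ler_pdivrMr// (le_trans h)//.
    rewrite [leLHS]mulrC -mulrA [(j`!)%:R * _]mulrC; apply: ler_wpM2r.
      by rewrite mulr_ge0// expR_ge0.
    by rewrite ler_eXn2l// ltr1n.
  have P : 0 <= v ^+ k * expR (- (w / 2)) * (C ^+ k * (k`!)%:R).
    by rewrite !mulr_ge0 ?expR_ge0 ?exprn_ge0// ltW.
  apply: (@le_trans _ _ (C ^+ k * (k`!)%:R / (j`!)%:R * (v ^+ k * w ^+ j) *
     (expR (- (w / 2)) * expR (- (w / 2))))).
    apply: ler_wpM2r; first by rewrite mulr_ge0// expR_ge0.
    apply: ler_wpM2r; first by rewrite mulr_ge0// exprn_ge0// ltW.
    exact: flat_coef_le.
  apply: (@le_trans _ _ (v ^+ k * expR (- (w / 2)) * (C ^+ k * (k`!)%:R) *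
     (w ^+ j / (j`!)%:R * expR (- (w / 2))))).
    by apply: eq_ler; ring.
  by apply: (le_trans (ler_wpM2l P H)); apply: eq_ler; ring.
rewrite sumr_const card_ord -[X in X <= _]mulr_natl exprMn.
have k2 : (k.+1)%:R <= 2 ^+ k :> R.
  by rewrite -natrX ler_nat ltn_expl.
have -> : (4 : R) ^+ k = 2 ^+ k * 2 ^+ k by rewrite -exprMn; congr (_ ^+ _); ring.
have P : 0 <= C ^+ k * (k`!)%:R * 2 ^+ k * (v ^+ k * expR (- (w / 2))).
  by rewrite !mulr_ge0 ?expR_ge0 ?exprn_ge0// ltW.
by apply: (le_trans (ler_wpM2r P k2)); apply: eq_ler; ring.
Qed.

(** The source of the exponent [1 + 1 / p]: the maximum over [v]. *)
Lemma pow_expN_le (v : R) k : 0 < v ->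
  v ^+ k * expR (- (v ^+ p / 2)) <= 2 ^+ k * (k`!)%:R `^ (p%:R^-1).
Proof.
move=> v0; set w := v ^+ p; have w0 : 0 < w by rewrite exprn_gt0.
set a := v ^+ k * _.
have a0 : 0 <= a by rewrite mulr_ge0 ?expR_ge0 ?exprn_ge0// ltW.
have pn : p%:R != 0 :> R by rewrite pnatr_eq0 -lt0n.
have ap : a ^+ p <= (2 ^+ k) ^+ p * (k`!)%:R.
  rewrite /a exprMn -[v ^+ k ^+ p]exprM mulnC exprM -/w -expRM_natl.
  have w2 : 0 <= w / 2 by rewrite divr_ge0// ltW.
  have h := expr_le_fact_expR k w2.
  rewrite expr_div_n ler_pdivrMr ?exprn_gt0// in h.
  apply: (@le_trans _ _ (w ^+ k * expR (- (w / 2)))).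
    apply: ler_wpM2l; first by rewrite exprn_ge0// ltW.
    by rewrite ler_expR mulrN lerN2 ler_peMl// ler1n.
  rewrite expRN ler_pdivrMr ?expR_gt0//; apply: (le_trans h).
  rewrite [leLHS]mulrC -mulrA; apply: ler_wpM2r; first by rewrite mulr_ge0// expR_ge0.
  rewrite -exprM; apply: ler_weXn2l; first by rewrite ler1n.
  by rewrite leq_pmulr.
have b0 : 0 <= 2 ^+ k * (k`!)%:R `^ (p%:R^-1) :> R by rewrite mulr_ge0 ?exprn_ge0 ?powR_ge0.
rewrite -(@ler_pXn2r _ p)// ?nnegrE//; apply: (le_trans ap).
by rewrite exprMn -[X in _ <= _ * X]powR_mulrn ?powR_ge0// -powRrM mulVf// powRr1.
Qed.

(** Flatness at 0 in the quantitative form from which all derivatives extend by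
    0 across the origin. *)
Lemma flat_quad k : exists K : R, forall t, `|flat k t| <= K * t ^+ 2.
Proof.
exists ((4 * C) ^+ k * (k`!)%:R * (2 ^+ k.+2 * ((k.+2)`!)%:R `^ (p%:R^-1))) => t.
have P : 0 <= (4 * C) ^+ k * (k`!)%:R by rewrite mulr_ge0// exprn_ge0// mulr_ge0.
have [t0|t0] := leP t 0.
  rewrite flat_le0// normr0; apply: mulr_ge0 (sqr_ge0 _); apply: mulr_ge0 P _.
  by apply: mulr_ge0; [exact: exprn_ge0|exact: powR_ge0].
apply: (le_trans (flat_bound k t0)); rewrite -[leRHS]mulrA; apply: (ler_wpM2l P).
have v0 : 0 < t^-1 by rewrite invr_gt0.
rewrite -ler_pdivrMr ?exprn_gt0//; apply: le_trans (pow_expN_le k.+2 v0).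
by apply: eq_ler; rewrite -exprVn -[k.+2]addn2 exprD; ring.
Qed.

Lemma is_derive_invX (t : R) m : 0 < t ->
  is_derive t 1 (fun t : R => t^-1 ^+ m : R) (- (m%:R * t^-1 ^+ m.+1)).
Proof.
move=> t0.
have di : is_derive t 1 (fun t : R => t^-1 : R) (- t^-1 ^+ 2).
  have := @is_derive_inv R R^o id t 1 1 (lt0r_neq0 t0) (is_derive_id t 1).
  by rewrite mulr1 exprVn.
elim: m => [|m IH].
  rewrite mul0r oppr0 (_ : (fun t => _) = cst 1); first exact: is_derive_cst.
  by apply/funext => u; rewrite expr0.
rewrite (_ : (fun t => _) = (fun t : R => t^-1 : R) * (fun t : R => t^-1 ^+ m : R)); last first.
  by apply/funext => u; rewrite exprS.
apply: (is_derive_eq (is_deriveM di IH)).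
by rewrite /GRing.scale /= -natr1 !exprS; ring.
Qed.

Lemma flat_derive_pos k (t : R) : 0 < t -> is_derive t 1 (flat k) (flat k.+1 t).
Proof.
move=> t0.
have dE : is_derive t 1 (fun t : R => expR (- t^-1 ^+ p) : R)
    (p%:R * t^-1 ^+ p.+1 * expR (- t^-1 ^+ p)).
  have dn : is_derive t 1 (fun t : R => - t^-1 ^+ p : R) (p%:R * t^-1 ^+ p.+1).
    by apply: (is_derive_eq (is_deriveN (is_derive_invX p t0))); rewrite opprK.
  by apply: (is_derive_eq (is_derive1_comp (is_derive_expR _) dn)); rewrite mulrC.
pose term j (t : R) : R := flat_coef k j * t^-1 ^+ (k + p * j) * expR (- t^-1 ^+ p).
pose dterm j : R := (- (k + p * j)%:R * flat_coef k j * t^-1 ^+ (k.+1 + p * j) +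
   p%:R * flat_coef k j * t^-1 ^+ (k.+1 + p * j.+1)) * expR (- t^-1 ^+ p).
have dt j : is_derive t 1 (term j) (dterm j).
  rewrite (_ : term j = ((cst (flat_coef k j) : R -> R) * (fun t : R => t^-1 ^+ (k + p * j) : R)) *
      (fun t : R => expR (- t^-1 ^+ p) : R)); last by apply/funext.
  apply: (is_derive_eq (is_deriveM (is_deriveM (is_derive_cst _ _ _) (is_derive_invX (k + p * j) t0)) dE)).
  rewrite /GRing.scale /= /dterm.
  rewrite (_ : (k.+1 + p * j.+1 = p.+1 + (k + p * j))%N); last by lia.
  rewrite (_ : (k.+1 + p * j = (k + p * j).+1)%N)//.
  rewrite (_ : (cst _ * _) t = flat_coef k j * t^-1 ^+ (k + p * j))//.
  rewrite [t^-1 ^+ (p.+1 + _)]exprD [t^-1 ^+ p.+1]exprS [t^-1 ^+ (k + p * j).+1]exprS.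
  move: (t^-1 ^+ (k + p * j)) (t^-1 ^+ p) (expR _) (flat_coef k j).
  move: ((k + p * j)%N) => N A0 A1 A2 A3.
  by move: (N%:R : R) (p%:R : R) (t^-1) => A4 A5 A6; ring.
have ds m : is_derive t 1 (fun u => \sum_(j < m) term j u) (\sum_(j < m) dterm j).
  elim: m => [|m IH].
    rewrite big_ord0 (_ : (fun u => _) = cst 0); first exact: is_derive_cst.
    by apply/funext => u; rewrite big_ord0.
  rewrite big_ord_recr /= (_ : (fun u => _) = (fun u => \sum_(j < m) term j u) + term m).
    exact: is_deriveD.
  by apply/funext => u; rewrite big_ord_recr.
apply: (@near_eq_is_derive _ _ _ (fun u => \sum_(j < k.+1) term j u)).
  have : \forall u \near t, 0 < u by exact: lt_nbhsr.
  by apply: filterS => u u0; rewrite /flat u0.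
apply: (is_derive_eq (ds k.+1)).
rewrite /flat t0 -!mulr_suml big_split /=; congr (_ * _).
rewrite [in RHS]big_ord_recl [in RHS]/=.
under [in RHS]eq_bigr => j _ do rewrite /bump /= add1n mulrDl.
rewrite [in RHS]big_split /= addrA mulr0 addr0; congr (_ + _).
rewrite [in RHS]big_ord_recr /= [flat_coef k k.+1]flat_coef_gt// mulr0 mul0r addr0.
by rewrite big_ord_recl /=.
Qed.

Lemma flat_derive k (t : R) : is_derive t 1 (flat k) (flat k.+1 t).
Proof.
have [t0|t0|->] := ltgtP t 0; last 2 first.
- exact: flat_derive_pos.
- have [K HK] := flat_quad k.
  apply: (@is_derive_quad R R^o (flat k) 0 1 _ K) => t'.
  rewrite [flat k.+1 0]flat_le0// [flat k 0]flat_le0// mulr0 !subr0 addr0.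
  by rewrite /GRing.scale/= mulr1.
rewrite flat_le0 ?(ltW t0)//.
have near0 : \forall u \near t, cst (0 : R) u = flat k u.
  have : \forall u \near t, u < 0 by exact: lt_nbhsl.
  by apply: filterS => u u0; rewrite flat_le0// ltW.
exact: (near_eq_is_derive near0 (is_derive_cst (0 : R) t (1 : R))).
Qed.

Lemma flat_gevrey (s : R) k t : 1 + p%:R^-1 <= s ->
  `|flat k t| <= (8 * C) ^+ k * Fs s k.
Proof.
move=> ps; have [t0|t0] := leP t 0.
  rewrite flat_le0// normr0 mulr_ge0 ?exprn_ge0 ?mulr_ge0//.
  exact: ltW (Fs_gt0 _ _).
apply: (le_trans (flat_bound k t0)).
have v0 : 0 < t^-1 by rewrite invr_gt0.
have P : 0 <= (4 * C) ^+ k * (k`!)%:R by rewrite mulr_ge0// exprn_ge0// mulr_ge0.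
apply: (le_trans (ler_wpM2l P (pow_expN_le k v0))).
have f1 : 1 <= (k`!)%:R :> R by rewrite ler1n fact_gt0.
apply: (@le_trans _ _ ((8 * C) ^+ k * ((k`!)%:R * (k`!)%:R `^ p%:R^-1))).
  apply: eq_ler; rewrite (_ : 8 * C = (4 * C) * 2); last by ring.
  by rewrite [in RHS]exprMn; ring.
apply: ler_wpM2l; first by rewrite exprn_ge0// mulr_ge0.
rewrite /Fs -(@mulr_powRB1 _ (k`!)%:R s)//; last first.
  by apply: lt_le_trans ps; rewrite ltr_wpDr// invr_ge0.
by rewrite ler_wpM2l// ler_powR// lerBrDl.
Qed.

Lemma flat0_gt0 t : 0 < t -> 0 < flat 0 t.
Proof.
move=> t0; rewrite /flat t0 big_ord1 /= mulr_gt0 ?expR_gt0// muln0 addn0 expr0.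
by rewrite mul1r ltr01.
Qed.

Lemma flat0_ge0 t : 0 <= flat 0 t.
Proof.
have [t0|t0] := leP t 0; first by rewrite flat_le0.
exact: ltW (flat0_gt0 t0).
Qed.

End FlatFunction.

Section Bump.
Variables (R : realType) (s : R).
Hypothesis hs : 1 < s.

Lemma gevrey_exponent : exists2 p : nat, (0 < p)%N & 1 + p%:R^-1 <= s.
Proof.
have d0 : 0 < s - 1 by rewrite subr_gt0.
pose p := (Num.trunc (s - 1)^-1).+1; exists p => //.
rewrite -lerBrDl invf_ple ?posrE ?ltr0n//.
have h0 : 0 <= (s - 1)^-1 by rewrite invr_ge0 ltW.
by have /andP[_ /ltW] := Num.Theory.truncn_itv h0.
Qed.

Section Factor.
Variables (n p : nat) (i : 'I_n) (c b : R).
Hypotheses (p0 : (0 < p)%N) (c1 : `|c| <= 1).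

Let F k (z : R[i]) (x : 'rV[R]_n) : R[i] := z * Complex (flat p k (c * x 0 i + b)) 0.

Lemma isD_flat j k z : isD j (F k z)
  (F k.+1 (if j == i then - Complex 0 1 * Complex c 0 * z else 0)).
Proof.
move=> x.
have dl0 : cder (fun u : R^o => Complex (flat p k u) 0) (c * x 0 i + b) 1
    (Complex (flat p k.+1 (c * x 0 i + b)) 0).
  by split => /=; [exact: flat_derive|exact: is_derive_cst].
have HT (h : R) : c * (h *: delta_mx 0 j + x) 0 i + b =
    (h * (if j == i then c else 0)) *: (1 : R^o) + (c * x 0 i + b).
  rewrite !mxE eqxx /= [i == j]eq_sym /GRing.scale /=.
  by case: (j == i); rewrite /= ?mulr1n ?mulr0n; ring.
have pb := @cder_pullback R 'rV[R]_n R^o (fun u : R^o => Complex (flat p k u) 0)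
  (fun x : 'rV[R]_n => c * x 0 i + b) x (delta_mx 0 j) 1 _ _ HT dl0.
apply: (cder_eq (cder_mul (cder_cst z x (delta_mx 0 j)) pb)).
rewrite /F; case: ifP => _.
  rewrite mul0r add0r !mulrA [Complex 0 1 * _]mulrN -mulNr iiN mul1r; ring.
by rewrite (_ : Complex 0 0 = 0)//; ring.
Qed.

Lemma ccont_flat k z : ccont (F k z).
Proof.
apply: ccont_mul; first exact: ccont_cst.
have cc : ccont (fun u : R^o => Complex (flat p k u) 0).
  split=> u; last exact: cvg_cst.
  apply: differentiable_continuous; apply/derivable1_diffP.
  exact: (@ex_derive _ _ _ _ _ _ _ (flat_derive p0 k u)).
apply: (ccont_comp _ cc) => x.
have H : (c * y 0 i + b) @[y --> x] --> (c * x 0 i + b).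
  apply: cvgD; last exact: cvg_cst.
  by apply: cvgM; [exact: cvg_cst|exact: coord_continuous].
exact: H.
Qed.

Lemma smooth_flat k z : csmooth (F k z).
Proof.
apply/csmoothP => m; elim: m k z => [|m IH] k z; first exact: ccont_flat.
split=> [|j]; first exact: ccont_flat.
exists (F k.+1 (if j == i then - Complex 0 1 * Complex c 0 * z else 0)).
  exact: isD_flat.
exact: IH.
Qed.

Lemma gb_flat x : 1 + p%:R^-1 <= s -> gb s (8 * (1 + 2 * p)%:R) 1 (F 0 1) x.
Proof.
move=> ps l.
have [z z1 ->] : exists2 z : R[i], cabs z <= 1 & dl l (F 0 1) = F (size l) z.
  elim: l => [|j l [z z1 E]]; first by exists 1; rewrite ?cabs1.
  rewrite dl_cons E (isD_D1 (isD_flat j _ _)).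
  exists (if j == i then - Complex 0 1 * Complex c 0 * z else 0) => //.
  case: ifP => _; last by rewrite cabs0.
  rewrite !cabsM cabsN cabs_i cabs_real mul1r.
  by apply: mulr_ile1 => //; exact: cabs_ge0.
rewrite /F cabsM cabs_real mul1r -[leRHS]mul1r.
by apply: ler_pM => //; [exact: cabs_ge0|exact: flat_gevrey].
Qed.

End Factor.

Lemma gb_prod (n : nat) (I : Type) (r : seq I) (F : I -> 'rV[R]_n -> R[i]) (h : R) x :
  0 <= h -> (forall k, csmooth (F k)) -> (forall k, gb s h 1 (F k) x) ->
  gb s ((size r)%:R * h) 1 (fun y => \prod_(k <- r) F k y) x.
Proof.
move=> h0 sF gF; elim: r => [|k r IH].
  rewrite mul0r (_ : (fun y => _) = fun=> 1); last by apply/funext => y; rewrite big_nil.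
  by rewrite -[X in gb _ _ X]cabs1; apply: gb_cst.
rewrite (_ : (fun y => _) = fun y => F k y * \prod_(k <- r) F k y); last first.
  by apply/funext => y; rewrite big_cons.
rewrite [size _]/= -natr1 mulrDl mul1r addrC -[X in gb _ _ X]mulr1.
by apply: gb_mul => //; [rewrite mulr_ge0|exact: smooth_prod].
Qed.

Definition cx (n : nat) (r : 'rV[R]_n -> R) : 'rV[R]_n -> R[i] := fun x => Complex (r x) 0.

(** The product over the coordinates of [flat (1 + x_i) * flat (1 - x_i)], with
    [p] so large that [1 + 1 / p <= s]. *)
Lemma bump_exists n : exists (r : 'rV[R]_n -> R) (h : R),
  [/\ 0 < h, csmooth (cx r), forall x, gb s h 1 (cx r) x &
   [/\ forall x, 0 <= r x, 0 < r 0 & forall x, 1 <= `|x| -> r x = 0]].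
Proof.
have [p p0 ps] := gevrey_exponent.
pose F (k : 'I_n * bool) (x : 'rV[R]_n) : R[i] :=
  1 * Complex (flat p 0 ((-1) ^+ k.2 * x 0 k.1 + 1)) 0.
pose r (x : 'rV[R]_n) := \prod_k flat p 0 ((-1) ^+ (k : 'I_n * bool).2 * x 0 k.1 + 1).
have rE : cx r = fun x => \prod_(k <- index_enum ('I_n * bool)%type) F k x.
  apply/funext => x; rewrite /cx /r.
  elim: (index_enum _) => [|k q IH]; first by rewrite !big_nil.
  by rewrite !big_cons -IH /F mul1r; apply: ceq; rewrite !cparts /=; ring.
have h0 : 0 < 8 * (1 + 2 * p)%:R :> R by rewrite mulr_gt0// ltr0n.
have c1 (b : bool) : `|(-1) ^+ b : R| <= 1 by rewrite normrX normrN1 expr1n.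
have sF k : csmooth (F k) by exact: smooth_flat.
exists r, ((size (index_enum ('I_n * bool)%type))%:R * (8 * (1 + 2 * p)%:R) + 1); split.
- by rewrite ltr_wpDl// mulr_ge0// ltW.
- by rewrite rE; exact: smooth_prod.
- move=> x; rewrite rE.
  have gF k : gb s (8 * (1 + 2 * p)%:R) 1 (F k) x by exact: gb_flat.
  apply: (gb_le _ _ (lexx _) (gb_prod _ (ltW h0) sF gF)); last by rewrite lerDl.
  by rewrite mulr_ge0// ltW.
split.
- by move=> x; rewrite prodr_ge0// => k _; exact: flat0_ge0.
- by rewrite prodr_gt0// => k _; rewrite mxE mulr0 add0r flat0_gt0.
move=> x x1.
have nx : mx_norm x != 0.
  by apply/negP => /eqP x0; move: x1; rewrite [`|x|]x0 ler10.
have [[a i] /= Hi] := mx_norm_neq0 nx; rewrite ord1 in Hi.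
have {}x1 : 1 <= `|x 0 i| by rewrite -Hi.
have [x0|x0] := leP 0 (x 0 i).
  rewrite /r (bigD1 (i, true))//= flat_le0 ?mul0r//.
  by rewrite expr1 mulN1r addrC subr_le0; rewrite ger0_norm in x1.
rewrite /r (bigD1 (i, false))//= flat_le0 ?mul0r//.
by rewrite expr0 mul1r; rewrite ltr0_norm// in x1; lra.
Qed.

End Bump.

(** * One-dimensional integrals of Lipschitz functions *)

Section OneDimIntegral.
Variable R : realType.
Implicit Types (f g : R -> R).
Local Notation mu := (@lebesgue_measure R).

Definition lip1 (L r : R) f := (forall x y, `|f x - f y| <= L * `|x - y|) /\
  forall x, r < `|x| -> f x = 0.

Lemma lip1_cont L r f : lip1 L r f -> continuous f.
Proof.
move=> [fL _].
have : ccont (fun x : R^o => Complex (f x) 0).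
  apply: (@lip_ccont R R^o _ L) => x y.
  rewrite (_ : _ - _ = Complex (f x - f y) 0); first by rewrite cabs_real.
  by apply: ceq; rewrite !cparts /= ?subrr.
by move=> [] /=.
Qed.

Lemma lip1_integrable L r f : lip1 L r f -> mu.-integrable setT (EFin \o f).
Proof.
move=> Hf; have cf := lip1_cont Hf.
have fE : f \_ `[- `|r|, `|r|] = f.
  apply/funext => x; rewrite patchE; case: ifPn => //.
  rewrite notin_setE /= in_itv /= => /negP; rewrite -ler_norml -ltNge => rx.
  by apply/esym/Hf.2; exact: le_lt_trans (ler_norm r) rx.
have iD : mu.-integrable `[- `|r|, `|r|] (EFin \o f).
  apply: continuous_compact_integrable; first exact: segment_compact.
  exact: continuous_subspaceT.
rewrite -fE -restrict_EFin; apply/integrable_restrict => //=.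
by rewrite setTI.
Qed.

Lemma mvt_eq (G g : R -> R) a b : (forall t : R, is_derive t 1 G (g t)) -> a <= b ->
  exists2 c, a <= c <= b & G b - G a = g c * (b - a).
Proof.
move=> dG ab; have [|c cab ->] := @MVT_segment R G g a b ab (fun t _ => dG t).
  apply: continuous_in_subspaceT => t _.
  by apply: differentiable_continuous; apply/derivable1_diffP; exact: ex_derive.
by exists c => //; move: cab; rewrite in_itv.
Qed.

(** A primitive on the whole line reduces integrals of compactly supported
    Lipschitz functions to the mean value theorem. *)
Lemma lip1_primitive L r f : lip1 L r f -> exists2 G : R -> R,
  (forall t : R, is_derive t 1 G (f t)) &
  forall a b, a < - r -> r < b -> Rintegral mu setT f = G b - G a.
Proof.
move=> Hf; have cf := lip1_cont Hf; have intf := lip1_integrable Hf.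
pose G x := Rintegral mu [set` `]-oo, x]] f.
have dG (t : R) : is_derive t 1 G (f t).
  have intu : mu.-integrable [set` Interval -oo%O (BRight (t + 1))] (EFin \o f).
    exact: integrableS intf.
  have [] := @continuous_FTC1 R f -oo%O t (t + 1) _ intu _ (cf t).
  - by rewrite ltrDl.
  - by rewrite ltNyr.
  - by move=> d1 d2; split; [exact: d1|rewrite -derive1E; exact: d2].
exists G => // a b ar rb.
have Gb : G b = Rintegral mu setT f.
  rewrite /G Rintegral_mkcond; congr (Rintegral mu setT _); apply/funext => x.
  rewrite patchE; case: ifPn => //; rewrite notin_setE /= in_itv /= => /negP.
  rewrite -ltNge => bx; apply/esym/Hf.2.
  by apply: (lt_trans rb); apply: lt_le_trans bx (ler_norm x).
have Ga : G a = 0.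
  rewrite /G Rintegral_mkcond (_ : f \_ _ = cst 0); last first.
    apply/funext => x; rewrite patchE; case: ifPn => //.
    rewrite inE /= in_itv /= => xa; apply: Hf.2.
    apply: (@lt_le_trans _ _ (- x)); first by rewrite ltrNr; exact: le_lt_trans ar.
    by rewrite -normrN ler_norm.
  by rewrite /Rintegral (_ : (fun x => _) = cst 0%E)// integral0.
by rewrite Gb Ga subr0.
Qed.

Lemma lip1_int_le L r f M : 0 <= r -> lip1 L r f -> (forall x, `|f x| <= M) ->
  `|Rintegral mu setT f| <= M * (2 * (r + 1)).
Proof.
move=> r0 Hf fM; have [G dG IG] := lip1_primitive Hf.
rewrite (IG (- (r + 1)) (r + 1)); [|by lra|by lra].
apply: (le_trans (mvt_le dG _)); first by move=> t _; exact: fM.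
by rewrite opprK ger0_norm; [apply: eq_ler; ring|lra].
Qed.

Lemma lip1_shift L r f c : lip1 L r f -> lip1 L (r + `|c|) (fun x => f (x + c)).
Proof.
move=> [fL f0]; split=> [x y|x rx].
  by apply: (le_trans (fL _ _)); rewrite opprD addrACA subrr addr0.
apply: f0; have := lerB_normD x c; lra.
Qed.

Lemma lip1_int_shift L r f c : lip1 L r f ->
  Rintegral mu setT (fun x => f (x + c)) = Rintegral mu setT f.
Proof.
move=> Hf; have [G dG IG] := lip1_primitive Hf.
have [G' dG' IG'] := lip1_primitive (lip1_shift c Hf).
have dGc (t : R) : is_derive t 1 (fun u : R => G (u + c)) (f (t + c)).
  have ds : is_derive t 1 (fun u : R => u + c) (1 : R).
    by apply: (is_derive_eq (is_deriveD (is_derive_id t 1) (is_derive_cst c t 1))); rewrite addr0.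
  have h := @is_derive1_comp R G (fun u : R => u + c) t _ _ (dG (t + c)) ds.
  by rewrite mulr1 in h; exact: h.
have d0 (t : R) : is_derive t 1 (fun u : R => G' u - G (u + c)) (0 : R).
  by apply: (is_derive_eq (is_deriveB (dG' t) (dGc t))); rewrite subrr.
pose a := - (`|r| + `|c| + 1); pose b := `|r| + `|c| + 1.
have rr := ler_norm r; have cc := ler_norm c; have cc' := ler_norm (- c).
rewrite normrN in cc'.
rewrite (IG' a b); [|rewrite /a; lra|rewrite /b; lra].
rewrite (IG (a + c) (b + c)); [|rewrite /a; lra|rewrite /b; lra].
have := @mvt_le R _ _ a b 0 d0 (fun t _ => eq_ler (normr0 _)).
rewrite mul0r normr_le0 => /eqP; lra.
Qed.

(** On each cell the mean value theorem is applied to the primitive minus its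
    tangent at the left end point. *)
Lemma lip1_riemann L r f N : 0 <= r -> 0 <= L -> (0 < N)%N -> lip1 L r f ->
  `|Rintegral mu setT f -
    2 * (r + 1) / N%:R * \sum_(k < N) f (- (r + 1) + k%:R * (2 * (r + 1) / N%:R))|
  <= L * (2 * (r + 1)) ^+ 2 / N%:R.
Proof.
move=> r0 L0 N0 Hf; have [G dG IG] := lip1_primitive Hf.
set D := 2 * (r + 1); have D0 : 0 < D by rewrite /D; lra.
set d := D / N%:R; have d0 : 0 < d by rewrite divr_gt0// ltr0n.
pose x (k : nat) : R := - (r + 1) + k%:R * d.
rewrite (IG (x 0%N) (x N)); last 2 first.
- by rewrite /x mul0r addr0; lra.
- by rewrite /x /d mulrCA mulfV ?mulr1 /D ?pnatr_eq0 -?lt0n//; lra.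
rewrite -(telescope_sumr (fun k => G (x k)) (leq0n N)) big_mkord mulr_sumr -sumrB.
apply: (le_trans (ler_norm_sum _ _ _)).
apply: (@le_trans _ _ (\sum_(k < N) L * d * d)); last first.
  rewrite sumr_const card_ord -[X in X <= _]mulr_natl /d; apply: eq_ler.
  by field; rewrite pnatr_eq0 -lt0n.
apply: ler_sum => k _.
have xk : x k.+1 - x k = d by rewrite /x -natr1; ring.
have dH (t : R) : is_derive t 1 (fun u : R => G u - u * f (x k)) (f t - f (x k)).
  have ds : is_derive t 1 (fun u : R => u * f (x k)) (f (x k)).
    by apply: (is_derive_eq (is_deriveM (is_derive_id t 1) (is_derive_cst (f (x k)) t 1)));
       rewrite /GRing.scale /= mulr0 add0r mulr1.
  exact: (is_deriveB (dG t) ds).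
have xle : x k <= x k.+1 by rewrite -subr_ge0 xk ltW.
have := @mvt_le R _ _ (x k) (x k.+1) (L * d) dH _.
rewrite xk (gtr0_norm d0) => H.
have E y : G (x k.+1) - G (x k) - d * y = G (x k.+1) - x k.+1 * y - (G (x k) - x k * y).
  by rewrite -xk; ring.
rewrite E; apply: H => t; rewrite (min_l xle) (max_r xle) => /andP[t1 t2].
apply: (le_trans (Hf.1 _ _)); apply: ler_wpM2l => //.
by rewrite ger0_norm ?subr_ge0// -xk; lra.
Qed.

Lemma lip1_int_gt0 L r f : 0 <= r -> lip1 L r f -> (forall x, 0 <= f x) -> 0 < f 0 ->
  0 < Rintegral mu setT f.
Proof.
move=> r0 Hf f0 fp; have [G dG IG] := lip1_primitive Hf.
have L0 : 0 < `|L| + 1 by rewrite ltr_wpDl.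
pose e := Num.min (f 0 / (2 * (`|L| + 1))) (r + 1).
have e0 : 0 < e by rewrite lt_min divr_gt0 ?mulr_gt0//=; lra.
have er : e <= r + 1 by rewrite ge_min lexx orbT.
have ef : e * (`|L| + 1) <= f 0 / 2.
  apply: (@le_trans _ _ (f 0 / (2 * (`|L| + 1)) * (`|L| + 1))).
    by apply: ler_wpM2r; [exact: ltW|rewrite ge_min lexx].
  by apply: eq_ler; field; rewrite gt_eqF.
rewrite (IG (- (r + 1)) (r + 1)); [|by lra|by lra].
have mono a b : a <= b -> G a <= G b.
  move=> ab; have [c _ E] := mvt_eq dG ab.
  by rewrite -subr_ge0 E mulr_ge0// subr_ge0.
have h1 : G (- (r + 1)) <= G 0 by apply: mono; lra.
have h2 : G e <= G (r + 1) by exact: mono.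
have [c /andP[c0 ce] E] := mvt_eq dG (ltW e0).
rewrite subr0 in E.
have fc : 0 < f c.
  have := Hf.1 0 c; rewrite sub0r normrN (ger0_norm c0) => H.
  have := ler_norm (f 0 - f c) => H2.
  have : L * c <= (`|L| + 1) * e.
    apply: (@le_trans _ _ (`|L| * c)); first by rewrite ler_wpM2r// ler_norm.
    apply: (@le_trans _ _ (`|L| * e)); first by rewrite ler_wpM2l.
    by rewrite ler_wpM2r ?(ltW e0)// lerDl.
  by rewrite mulrC => H3; lra.
have : 0 < f c * e by rewrite mulr_gt0.
lra.
Qed.

(** An integrable weight.  Functions that are limits of compactly supported
    Lipschitz functions uniformly with respect to it can be integrated through
    their approximations, without any convergence theorem. *)
Definition w1 (t : R) : R := (oneDsqr t)^-1.

Lemma w1_gt0 t : 0 < w1 t.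
Proof. by rewrite invr_gt0 (lt_le_trans _ (oneDsqr_ge1 t)). Qed.

Lemma w1_le1 t : w1 t <= 1.
Proof. exact: oneDsqrV_le1. Qed.

Lemma w1_cont : continuous w1.
Proof. exact: continuous_oneDsqrV. Qed.

Lemma w1_integrable : mu.-integrable setT (EFin \o w1).
Proof.
apply/integrableP; split.
  by apply/measurable_EFinP; apply: continuous_measurable_fun; exact: w1_cont.
rewrite (_ : (fun x => _) = (fun x => (w1 x)%:E)); last first.
  by apply/funext => x /=; rewrite ger0_norm// ltW// w1_gt0.
rewrite ge0_symfun_integralT; last 3 first.
- by move=> x; rewrite ltW// w1_gt0.
- exact: w1_cont.
- by move=> x /=; rewrite /w1 /oneDsqr sqrrN.
by rewrite -set_itvcy integral0y_oneDsqr -EFinM ltry.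
Qed.

Definition W1 : R := Rintegral mu setT w1.

Lemma W1_ge0 : 0 <= W1.
Proof. by apply: Rintegral_ge0 => x _; rewrite ltW// w1_gt0. Qed.

Lemma approx1_cont f : (forall e, 0 < e -> exists g L r, lip1 L r g /\
    forall x, `|f x - g x| <= e * w1 x) -> continuous f.
Proof.
move=> H.
have : ccont (fun x : R^o => Complex (f x) 0).
  apply/ccontP => x e e0.
  have e3 : 0 < e / 3 by rewrite divr_gt0.
  have [g [L [r [Hg fg]]]] := H _ e3.
  have fg1 y : `|f y - g y| <= e / 3.
    apply: (le_trans (fg y)); rewrite ler_piMr ?w1_le1//; exact: ltW.
  have L0 : 0 < `|L| + 1 by rewrite ltr_wpDl.
  exists (e / 3 / (`|L| + 1)); first by rewrite divr_gt0.
  move=> y; rewrite ltr_pdivlMr// => xy.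
  rewrite (_ : _ - _ = Complex (f x - f y) 0); last first.
    by apply: ceq; rewrite !cparts /= ?subrr.
  rewrite cabs_real (_ : f x - f y = (f x - g x) + (g x - g y) - (f y - g y)); last by ring.
  apply: (le_trans (ler_normB _ _)); apply: (le_trans (lerD (ler_normD _ _) (lexx _))).
  have h1 := fg1 x; have h2 := fg1 y; have h3 := Hg.1 x y.
  have h4 : L * `|x - y| <= e / 3.
    apply: le_trans (ltW xy); rewrite mulrC ler_wpM2l//.
    by apply: (le_trans (ler_norm L)); rewrite lerDl.
  lra.
by move=> [] /=.
Qed.

Lemma approx1_integrable f : (forall e, 0 < e -> exists g L r, lip1 L r g /\
    forall x, `|f x - g x| <= e * w1 x) -> mu.-integrable setT (EFin \o f).
Proof.
move=> H; have cf := approx1_cont H.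
have [g [L [r [Hg fg]]]] := H 1 ltr01.
have ig := lip1_integrable Hg.
have mf : measurable_fun setT (EFin \o f).
  by apply/measurable_EFinP; exact: continuous_measurable_fun.
have mg : measurable_fun setT (EFin \o g).
  by apply/measurable_EFinP; apply: continuous_measurable_fun; exact: lip1_cont Hg.
have inorm : mu.-integrable setT (EFin \o (fun x => `|g x| + w1 x)).
  rewrite (_ : EFin \o _ = ((fun x => `|(EFin \o g) x|) \+ (EFin \o w1)))%E; last first.
    by apply/funext => x /=.
  by apply: integrableD => //; [exact: integrable_norm|exact: w1_integrable].
have H1 x : setT x -> (`|(EFin \o f) x| <= `|(EFin \o (fun x => `|g x| + w1 x)%R) x|)%E.
  move=> _ /=; rewrite lee_fin [leRHS]ger0_norm; last first.
    by apply: addr_ge0 => //; exact: ltW (w1_gt0 x).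
  have := fg x; rewrite mul1r => h; have := ler_normD (f x - g x) (g x).
  by rewrite subrK; lra.
exact: (@le_integrable _ _ _ mu setT measurableT _ _ mf H1 inorm).
Qed.

Lemma approx1_int f g L r e :
  (forall e, 0 < e -> exists g L r, lip1 L r g /\ forall x, `|f x - g x| <= e * w1 x) ->
  lip1 L r g -> (forall x, `|f x - g x| <= e * w1 x) ->
  `|Rintegral mu setT f - Rintegral mu setT g| <= e * W1.
Proof.
move=> Hf Hg fg; have intf := approx1_integrable Hf; have ig := lip1_integrable Hg.
rewrite -RintegralB//; have iw := w1_integrable.
have ifg : mu.-integrable setT (EFin \o (fun x => f x - g x)).
  rewrite (_ : EFin \o _ = ((EFin \o f) \- (EFin \o g))%E); last by apply/funext.
  exact: integrableB.
have iew : mu.-integrable setT (EFin \o (fun x => e * w1 x)).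
  rewrite (_ : EFin \o _ = (fun x => e%:E * (EFin \o w1) x)%E); last by apply/funext.
  exact: integrableZl.
apply: (le_trans (le_normr_Rintegral _ ifg)) => //.
rewrite /W1 -RintegralZl//; apply: le_Rintegral => //.
by apply: integrable_norm ifg.
Qed.

End OneDimIntegral.

(** * Iterated integrals *)

Lemma rowB (R : realType) (n : nat) (x y : 'rV[R]_n) i : (x - y) 0 i = x 0 i - y 0 i.
Proof. by rewrite !mxE. Qed.

Lemma rowD (R : realType) (n : nat) (x y : 'rV[R]_n) i : (x + y) 0 i = x 0 i + y 0 i.
Proof. by rewrite !mxE. Qed.

Section IteratedIntegral.
Variable R : realType.
Local Notation mu := (@lebesgue_measure R).

Definition cons1 n (t : R) (y : 'rV[R]_n) : 'rV[R]_n.+1 :=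
  row_mx (const_mx t : 'rV_1) y.

Lemma cons1_case n (i : 'I_n.+1) :
  (forall t (y : 'rV[R]_n), cons1 t y 0 i = t) \/
  exists j, forall t (y : 'rV[R]_n), cons1 t y 0 i = y 0 j.
Proof.
case: (@split_ordP 1 n i) => j ->; [left|right; exists j] => t y.
  by rewrite /cons1 (@row_mxEl _ 1 1 n) mxE.
by rewrite /cons1 (@row_mxEr _ 1 1 n).
Qed.

Lemma cons1_head n t (y : 'rV[R]_n) : cons1 t y 0 (@lshift 1 n 0) = t.
Proof. by rewrite /cons1 (@row_mxEl _ 1 1 n) mxE. Qed.

Lemma cons1_tail n t (y : 'rV[R]_n) j : cons1 t y 0 (@rshift 1 n j) = y 0 j.
Proof. by rewrite /cons1 (@row_mxEr _ 1 1 n). Qed.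

Lemma cons1_distl n t t' (y : 'rV[R]_n) : `|cons1 t y - cons1 t' y| <= `|t - t'|.
Proof.
apply: norm_coordP => // i; rewrite rowB.
by case: (cons1_case i) => [E|[j E]]; rewrite !E// subrr normr0.
Qed.

Lemma cons1_distr n t (y y' : 'rV[R]_n) : `|cons1 t y - cons1 t y'| <= `|y - y'|.
Proof.
apply: norm_coordP => // i; rewrite rowB.
case: (cons1_case i) => [E|[j E]]; rewrite !E ?subrr ?normr0//.
by rewrite -rowB coord_le.
Qed.

Lemma cons1_norml n t (y : 'rV[R]_n) : `|t| <= `|cons1 t y|.
Proof. by rewrite -{1}(cons1_head t y) coord_le. Qed.

Lemma cons1_normr n t (y : 'rV[R]_n) : `|y| <= `|cons1 t y|.
Proof. by apply: norm_coordP => // i; rewrite -(cons1_tail t y i) coord_le. Qed.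

Lemma cons1_eta n (x : 'rV[R]_n.+1) :
  x = cons1 (x 0 (@lshift 1 n 0)) (\row_j x 0 (@rshift 1 n j)).
Proof.
apply/rowP => i; case: (@split_ordP 1 n i) => j ->.
  by rewrite (ord1 j) cons1_head.
by rewrite cons1_tail mxE.
Qed.

Lemma cons1_add n t t' (y y' : 'rV[R]_n) :
  cons1 t y + cons1 t' y' = cons1 (t + t') (y + y').
Proof.
apply/rowP => i; rewrite rowD.
by case: (cons1_case i) => [E|[j E]]; rewrite !E// rowD.
Qed.

Lemma cons1_00 n : cons1 0 (0 : 'rV[R]_n) = 0.
Proof.
apply/rowP => i; rewrite [RHS]mxE.
by case: (cons1_case i) => [E|[j E]]; rewrite !E// mxE.
Qed.

Definition lipn n (L r : R) (f : 'rV[R]_n -> R) :=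
  (forall x y, `|f x - f y| <= L * `|x - y|) /\ forall x, r < `|x| -> f x = 0.

Lemma lipn_slice n L r (f : 'rV[R]_n.+1 -> R) t : 0 <= L -> lipn L r f ->
  lipn L r (fun y => f (cons1 t y)).
Proof.
move=> L0 [fL f0]; split=> [x y|x rx].
  by apply: (le_trans (fL _ _)); rewrite ler_wpM2l// cons1_distr.
by apply: f0; apply: lt_le_trans rx (cons1_normr _ _).
Qed.

Lemma lip1_comb L L' r r' (f g : R -> R) a b : lip1 L r f -> lip1 L' r' g ->
  lip1 (`|a| * L + `|b| * L') (Num.max r r') (fun x => a * f x + b * g x).
Proof.
move=> [fL f0] [gL g0]; split=> [x y|x].
  rewrite (_ : _ - _ = a * (f x - f y) + b * (g x - g y)); last by ring.
  apply: (le_trans (ler_normD _ _)); rewrite !normrM mulrDl -!mulrA.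
  by apply: lerD; apply: ler_wpM2l.
by rewrite gt_max => /andP[rx rx']; rewrite f0// g0// !mulr0 addr0.
Qed.

Lemma lipn_comb n L L' r r' (f g : 'rV[R]_n -> R) a b : lipn L r f -> lipn L' r' g ->
  lipn (`|a| * L + `|b| * L') (Num.max r r') (fun x => a * f x + b * g x).
Proof.
move=> [fL f0] [gL g0]; split=> [x y|x].
  rewrite (_ : _ - _ = a * (f x - f y) + b * (g x - g y)); last by ring.
  apply: (le_trans (ler_normD _ _)); rewrite !normrM mulrDl -!mulrA.
  by apply: lerD; apply: ler_wpM2l.
by rewrite gt_max => /andP[rx rx']; rewrite f0// g0// !mulr0 addr0.
Qed.

Lemma lip1_int_comb L L' r r' (f g : R -> R) a b : lip1 L r f -> lip1 L' r' g ->
  Rintegral mu setT (fun x => a * f x + b * g x) =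
  a * Rintegral mu setT f + b * Rintegral mu setT g.
Proof.
move=> Hf Hg; have Hz : lip1 0 0 (cst 0 : R -> R).
  by split=> // x y; rewrite subrr normr0 mul0r.
have scal c L0 r0 h : lip1 L0 r0 h -> mu.-integrable setT (EFin \o (fun x => c * h x)).
  move=> Hh; have := lip1_integrable (lip1_comb c 0 Hh Hz).
  by under [X in EFin \o X]eq_fun => x do rewrite mul0r addr0.
rewrite RintegralD//; [|exact: scal Hf|exact: scal Hg].
by rewrite !RintegralZl//; [exact: lip1_integrable Hg|exact: lip1_integrable Hf].
Qed.

Definition vol n (r : R) : R := (2 * (r + 1)) ^+ n.

Lemma vol_ge0 n r : 0 <= r -> 0 <= vol n r.
Proof. by move=> r0; rewrite exprn_ge0// mulr_ge0// addr_ge0. Qed.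

Let lin_n n := forall L L' r r' (f g : 'rV[R]_n -> R) a b, 0 <= L -> 0 <= L' ->
  0 <= r -> 0 <= r' -> lipn L r f -> lipn L' r' g ->
  integralRn (fun x => a * f x + b * g x) = a * integralRn f + b * integralRn g.
Let bnd_n n := forall L r (f : 'rV[R]_n -> R) M, 0 <= L -> 0 <= r -> lipn L r f ->
  (forall x, `|f x| <= M) -> `|integralRn f| <= M * vol n r.

Let inner n L r (f : 'rV[R]_n.+1 -> R) : lin_n n -> bnd_n n -> 0 <= L -> 0 <= r ->
  lipn L r f -> lip1 (L * vol n r) r (fun t => integralRn (fun y => f (cons1 t y))).
Proof.
move=> lin bnd L0 r0 Hf; split=> [t t'|t rt].
  have Ht := lipn_slice t L0 Hf; have Ht' := lipn_slice t' L0 Hf.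
  have := lin _ _ _ _ _ _ 1 (- 1) L0 L0 r0 r0 Ht Ht'; rewrite mul1r mulN1r => <-.
  have Hc := lipn_comb 1 (- 1) Ht Ht'; rewrite maxxx in Hc.
  rewrite mulrAC; apply: (bnd _ _ _ _ _ r0 Hc).
  - by rewrite addr_ge0// mulr_ge0.
  - move=> y; rewrite mul1r mulN1r; apply: (le_trans (Hf.1 _ _)).
    by rewrite ler_wpM2l// cons1_distl.
have := bnd L r (fun y => f (cons1 t y)) 0 L0 r0 (lipn_slice t L0 Hf).
rewrite mul0r normr_le0 => H; apply/eqP/H => y.
by rewrite Hf.2 ?normr0//; exact: lt_le_trans rt (cons1_norml _ _).
Qed.

Let pack n : lin_n n /\ bnd_n n.
Proof.
elim: n => [|n [lin bnd]].
  split=> [L L' r r' f g a b _ _ _ _ _ _ //|L r f M _ _ _ H /=].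
  by rewrite /vol expr0 mulr1.
split=> [L L' r r' f g a b L0 L0' r0 r0' Hf Hg|L r f M L0 r0 Hf fM].
  rewrite /= -(lip1_int_comb a b (inner lin bnd L0 r0 Hf) (inner lin bnd L0' r0' Hg)).
  congr (Rintegral mu setT _); apply/funext => t.
  exact: (lin _ _ _ _ _ _ a b L0 L0' r0 r0' (lipn_slice t L0 Hf) (lipn_slice t L0' Hg)).
have -> : M * vol n.+1 r = M * vol n r * (2 * (r + 1)) by rewrite /vol exprSr; ring.
apply: (lip1_int_le r0 (inner lin bnd L0 r0 Hf)) => t.
by apply: (bnd _ _ _ _ L0 r0 (lipn_slice t L0 Hf)) => y; exact: fM.
Qed.

Lemma lipn_int_comb n L L' r r' (f g : 'rV[R]_n -> R) a b : 0 <= L -> 0 <= L' ->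
  0 <= r -> 0 <= r' -> lipn L r f -> lipn L' r' g ->
  integralRn (fun x => a * f x + b * g x) = a * integralRn f + b * integralRn g.
Proof. by move=> L0 L0' r0 r0'; apply: (pack n).1. Qed.

Lemma lipn_int_le n L r (f : 'rV[R]_n -> R) M : 0 <= L -> 0 <= r -> lipn L r f ->
  (forall x, `|f x| <= M) -> `|integralRn f| <= M * vol n r.
Proof. exact: (pack n).2. Qed.

Lemma lipn_inner n L r (f : 'rV[R]_n.+1 -> R) : 0 <= L -> 0 <= r ->
  lipn L r f -> lip1 (L * vol n r) r (fun t => integralRn (fun y => f (cons1 t y))).
Proof. by apply: inner; have [] := pack n. Qed.

Lemma lipn_int_shift n L r (f : 'rV[R]_n -> R) c : 0 <= L -> 0 <= r -> lipn L r f ->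
  integralRn (fun x => f (x + c)) = integralRn f.
Proof.
elim: n f c => [|n IH] f c L0 r0 Hf.
  by rewrite /=; congr f; apply/rowP => -[].
rewrite /= -(lip1_int_shift (c 0 (@lshift 1 n 0)) (lipn_inner L0 r0 Hf)).
congr (Rintegral mu setT _); apply/funext => t.
rewrite -(IH _ (\row_j c 0 (@rshift 1 n j)) L0 r0 (lipn_slice _ L0 Hf)).
congr integralRn; apply/funext => y.
by rewrite {1}(cons1_eta c) -/(cons1 t y) cons1_add.
Qed.

Lemma lipn_int_gt0 n L r (f : 'rV[R]_n -> R) : 0 <= L -> 0 <= r -> lipn L r f ->
  (forall x, 0 <= f x) -> 0 < f 0 -> 0 < integralRn f.
Proof.
elim: n f => [|n IH] f L0 r0 Hf f0 fp; first by [].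
apply: (lip1_int_gt0 r0 (lipn_inner L0 r0 Hf)).
  move=> t; have ge0 m (g : 'rV[R]_m -> R) : (forall x, 0 <= g x) -> 0 <= integralRn g.
    elim: m g => [|m IHm] g g0; first exact: g0.
    by apply: Rintegral_ge0 => u _; exact: IHm.
  exact: ge0.
by apply: IH => //; [exact: lipn_slice|rewrite cons1_00].
Qed.

(** The cube has half side [r + 1], which leaves a margin around the support. *)
Definition gstep (r : R) (N : nat) : R := 2 * (r + 1) / N%:R.
Fixpoint grid (r : R) (N n : nat) : seq 'rV[R]_n :=
  match n with
  | 0%N => [:: 0]
  | n'.+1 => [seq cons1 (- (r + 1) + k%:R * gstep r N) y | k <- iota 0 N, y <- grid r N n']
  end.
Definition riemann n (r : R) (N : nat) (f : 'rV[R]_n -> R) : R :=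
  gstep r N ^+ n * \sum_(p <- grid r N n) f p.
Fixpoint rconst n (r : R) : R :=
  if n is n'.+1 then vol n' r * (2 * (r + 1)) ^+ 2 + 2 * (r + 1) * rconst n' r else 0.

Lemma lipn_riemann n L r (f : 'rV[R]_n -> R) N : 0 <= L -> 0 <= r -> (0 < N)%N ->
  lipn L r f -> `|integralRn f - riemann r N f| <= L * rconst n r / N%:R.
Proof.
move=> L0 r0 N0; elim: n f => [|n IH] f Hf.
  by rewrite /riemann /= big_seq1 expr0 mul1r subrr normr0 mulr0 mul0r.
have D0 : 0 <= 2 * (r + 1) by rewrite mulr_ge0// addr_ge0.
have d0 : 0 <= gstep r N by rewrite divr_ge0.
pose x (k : nat) : R := - (r + 1) + k%:R * gstep r N.
have Hi := lipn_inner L0 r0 Hf.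
have V0 : 0 <= L * vol n r by rewrite mulr_ge0// vol_ge0.
have H1 := lip1_riemann r0 V0 N0 Hi; rewrite -/(gstep r N) in H1.
have -> : riemann r N f =
    gstep r N * \sum_(k < N) riemann r N (fun y => f (cons1 (x k) y)).
  rewrite /riemann exprS -mulrA -mulr_sumr; congr (_ * (_ * _)).
  by rewrite /= big_allpairs_dep /= -[in RHS](big_mkord xpredT (fun k => \sum_(p <- grid r N n) f (cons1 (x k) p))) /index_iota subn0.
set S1 := gstep r N * \sum_(k < N) _ in H1.
rewrite (_ : _ - _ = integralRn f - S1 + (S1 - gstep r N * \sum_(k < N) riemann r N (fun y => f (cons1 (x k) y)))); last by ring.
apply: (le_trans (ler_normD _ _)); rewrite /= mulrDr mulrDl; apply: lerD.
  by apply: (le_trans H1); apply: eq_ler; ring.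
rewrite /S1 -mulrBr -sumrB normrM (ger0_norm d0).
apply: (@le_trans _ _ (gstep r N * \sum_(k < N) L * rconst n r / N%:R)).
  apply: ler_wpM2l => //; apply: (le_trans (ler_norm_sum _ _ _)); apply: ler_sum => k _.
  exact: IH (lipn_slice _ L0 Hf).
rewrite sumr_const card_ord -[X in _ * X <= _]mulr_natl /gstep; apply: eq_ler.
by field; rewrite pnatr_eq0 -lt0n.
Qed.

Definition wn n (x : 'rV[R]_n) : R := \prod_i w1 (x 0 i).

Lemma wn_gt0 n (x : 'rV[R]_n) : 0 < wn x.
Proof. by rewrite prodr_gt0// => i _; exact: w1_gt0. Qed.

Lemma wn_cons n t (y : 'rV[R]_n) : wn (cons1 t y) = w1 t * wn y.
Proof.
rewrite /wn (@big_split_ord _ _ _ 1 n) /= big_ord1 cons1_head; congr (_ * _).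
by apply: eq_bigr => i _; rewrite cons1_tail.
Qed.

Definition lip_limit n (f : 'rV[R]_n -> R) := forall e, 0 < e ->
  exists g L r, [/\ 0 <= L, 0 <= r, lipn L r g & forall x, `|f x - g x| <= e * wn x].

Lemma lip_limit_slice n (f : 'rV[R]_n.+1 -> R) t : lip_limit f -> lip_limit (fun y => f (cons1 t y)).
Proof.
move=> H e e0; have [g [L [r [L0 r0 Hg fg]]]] := H e e0.
exists (fun y => g (cons1 t y)), L, r; split=> //; first exact: lipn_slice.
move=> y; apply: (le_trans (fg _)); rewrite wn_cons ler_wpM2l ?(ltW e0)//.
by rewrite ler_piMl ?w1_le1// ltW// wn_gt0.
Qed.

(** Fubini is built into the iterated integral: the error is integrated one
    variable at a time, with the weight [w1] in each of them. *)
Lemma lip_limit_int n (f g : 'rV[R]_n -> R) L r e : lip_limit f -> 0 <= L -> 0 <= r -> 0 <= e ->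
  lipn L r g -> (forall x, `|f x - g x| <= e * wn x) ->
  `|integralRn f - integralRn g| <= e * W1 R ^+ n.
Proof.
elim: n f g L r e => [|n IH] f g L r e Hf L0 r0 e0 Hg fg.
  by have := fg 0; rewrite /wn big_ord0 expr0.
have W0 := W1_ge0 R.
rewrite exprSr mulrA; apply: (@approx1_int R _ _ (L * vol n r) r).
- move=> e' e'0; have W0' : 0 < W1 R ^+ n + 1 by rewrite ltr_wpDl// exprn_ge0.
  have [g' [L' [r' [L0' r0' Hg' fg']]]] := Hf (e' / (W1 R ^+ n + 1)) (divr_gt0 e'0 W0').
  exists (fun t => integralRn (fun y => g' (cons1 t y))), (L' * vol n r'), r'; split.
    exact: lipn_inner.
  move=> t.
  apply: (@le_trans _ _ (e' / (W1 R ^+ n + 1) * w1 t * W1 R ^+ n)).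
    have e1 := mulr_ge0 (ltW (divr_gt0 e'0 W0')) (ltW (w1_gt0 t)).
    apply: (IH _ _ L' r' _ (lip_limit_slice t Hf) L0' r0' e1 (lipn_slice t L0' Hg')) => y.
    by have := fg' (cons1 t y); rewrite wn_cons mulrA.
  rewrite mulrAC; apply: ler_wpM2r; first exact: ltW (w1_gt0 _).
  rewrite -mulrA ler_piMr ?(ltW e'0)//.
  by rewrite mulrC ler_pdivrMr// mul1r lerDl.
- exact: lipn_inner.
- move=> t.
  apply: (@le_trans _ _ (e * w1 t * W1 R ^+ n)); last by apply: eq_ler; ring.
  have e1 := mulr_ge0 e0 (ltW (w1_gt0 t)).
  apply: (IH _ _ L r _ (lip_limit_slice t Hf) L0 r0 e1 (lipn_slice t L0 Hg)) => y.
  by have := fg (cons1 t y); rewrite wn_cons mulrA.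
Qed.

End IteratedIntegral.

Section ComplexIntegral.
Variables (R : realType) (n : nat).
Implicit Types (f g : 'rV[R]_n -> R[i]).

Definition clip (L r : R) f :=
  [/\ 0 <= L, 0 <= r, forall x y, cabs (f x - f y) <= L * `|x - y| &
   forall x, r < `|x| -> f x = 0].

Lemma clip_Re L r f : clip L r f -> lipn L r (fun x => Re (f x)).
Proof.
move=> [_ _ fL f0]; split=> [x y|x /f0 ->//].
by apply: le_trans (fL x y); rewrite -Re_opp -Re_add cabs_Re.
Qed.

Lemma clip_Im L r f : clip L r f -> lipn L r (fun x => Im (f x)).
Proof.
move=> [_ _ fL f0]; split=> [x y|x /f0 ->//].
by apply: le_trans (fL x y); rewrite -Im_opp -Im_add cabs_Im.
Qed.

Lemma intC_lin L L' r r' f g c : clip L r f -> clip L' r' g ->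
  integralC (fun x => c * f x + g x) = c * integralC f + integralC g.
Proof.
move=> Hf Hg; have [L0 r0 _ _] := Hf; have [L0' r0' _ _] := Hg.
have fr := clip_Re Hf; have fi := clip_Im Hf; have gr := clip_Re Hg; have gi := clip_Im Hg.
have cr (a b : R) := lipn_comb a b fr fi.
have Lc (a b : R) : 0 <= `|a| * L + `|b| * L by rewrite addr_ge0// mulr_ge0.
have rc : 0 <= Num.max r r by rewrite maxxx.
apply: ceq; rewrite /integralC /= !cparts /=.
- rewrite -mulNr -(lipn_int_comb (Re c) (- Im c) L0 L0 r0 r0 fr fi).
  rewrite -[X in _ + X]mul1r -[X in X + _]mul1r.
  rewrite -(lipn_int_comb 1 1 (Lc _ _) L0' rc r0' (cr (Re c) (- Im c)) gr).
  by congr integralRn; apply/funext => x; rewrite !cparts; ring.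
- rewrite -(lipn_int_comb (Re c) (Im c) L0 L0 r0 r0 fi fr).
  rewrite -[X in _ + X]mul1r -[X in X + _]mul1r.
  rewrite -(lipn_int_comb 1 1 (Lc _ _) L0' rc r0' (lipn_comb (Re c) (Im c) fi fr) gi).
  by congr integralRn; apply/funext => x; rewrite !cparts; ring.
Qed.

Lemma intC_shift L r f c : clip L r f ->
  integralC (fun x => f (x + c)) = integralC f.
Proof.
move=> Hf; have [L0 r0 _ _] := Hf; rewrite /integralC.
by rewrite (lipn_int_shift c L0 r0 (clip_Re Hf)) (lipn_int_shift c L0 r0 (clip_Im Hf)).
Qed.

Lemma intC_le L r f M : clip L r f -> (forall x, cabs (f x) <= M) ->
  cabs (integralC f) <= 2 * M * vol n r.
Proof.
move=> Hf fM; have [L0 r0 _ _] := Hf.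
apply: (le_trans (cabs_le_ReIm _)); rewrite /= -mulrA mulr_natl mulr2n; apply: lerD.
  apply: (lipn_int_le L0 r0 (clip_Re Hf)) => x.
  by apply: le_trans (fM x); exact: cabs_Re.
apply: (lipn_int_le L0 r0 (clip_Im Hf)) => x.
by apply: le_trans (fM x); exact: cabs_Im.
Qed.

Lemma clip_shift L r f r' c : 0 <= r' -> clip L r f ->
  (forall x, r' < `|x - c| -> f x = 0) -> clip L r' (fun x => f (x + c)).
Proof.
move=> r0' [L0 r0 fL f0] fc; split=> // [x y|x rx]; last by apply: fc; rewrite addrK.
by apply: (le_trans (fL _ _)); rewrite opprD addrACA subrr addr0.
Qed.

Lemma intC_le_at L r f M r' c : clip L r f -> 0 <= r' ->
  (forall x, r' < `|x - c| -> f x = 0) -> (forall x, cabs (f x) <= M) ->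
  cabs (integralC f) <= 2 * M * vol n r'.
Proof.
move=> Hf r0' fc fM; rewrite -(intC_shift c Hf).
by apply: (intC_le (clip_shift r0' Hf fc)) => x; exact: fM.
Qed.

Definition riemannC (r : R) (N : nat) f : R[i] :=
  Complex (gstep r N ^+ n) 0 * \sum_(p <- grid r N n) f p.

Lemma intC_riemann L r f N : (0 < N)%N -> clip L r f ->
  cabs (integralC f - riemannC r N f) <= 2 * (L * rconst n r / N%:R).
Proof.
move=> N0 Hf; have [L0 r0 _ _] := Hf.
apply: (le_trans (cabs_le_ReIm _)); rewrite mulr_natl mulr2n; apply: lerD.
  apply: le_trans (lipn_riemann L0 r0 N0 (clip_Re Hf)).
  rewrite !cparts /= mul0r subr0 /riemann.
  by apply: eq_ler; congr `|_ - _ * _|; exact: (big_morph (fun z : R[i] => Re z) (@Re_add R) erefl).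
apply: le_trans (lipn_riemann L0 r0 N0 (clip_Im Hf)).
rewrite !cparts /= mul0r addr0 /riemann.
by apply: eq_ler; congr `|_ - _ * _|; exact: (big_morph (fun z : R[i] => Im z) (@Im_add R) erefl).
Qed.

Lemma intC_approx f g L r e :
  (forall e, 0 < e -> exists g L r, clip L r g /\ forall x, cabs (f x - g x) <= e * wn x) ->
  0 <= e -> clip L r g -> (forall x, cabs (f x - g x) <= e * wn x) ->
  cabs (integralC f - integralC g) <= 2 * (e * W1 R ^+ n).
Proof.
move=> H e0 Hg fg; have [L0 r0 _ _] := Hg.
apply: (le_trans (cabs_le_ReIm _)); rewrite mulr_natl mulr2n; apply: lerD; rewrite !cparts /=.
  apply: (lip_limit_int _ L0 r0 e0 (clip_Re Hg)).
    move=> e' /H[g' [L' [r' [Hg' fg']]]]; have [L0' r0' _ _] := Hg'.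
    exists (fun x => Re (g' x)), L', r'; split=> //; first exact: clip_Re.
    by move=> x; apply: le_trans (fg' x); rewrite -Re_opp -Re_add cabs_Re.
  by move=> x; apply: le_trans (fg x); rewrite -Re_opp -Re_add cabs_Re.
apply: (lip_limit_int _ L0 r0 e0 (clip_Im Hg)).
  move=> e' /H[g' [L' [r' [Hg' fg']]]]; have [L0' r0' _ _] := Hg'.
  exists (fun x => Im (g' x)), L', r'; split=> //; first exact: clip_Im.
  by move=> x; apply: le_trans (fg' x); rewrite -Im_opp -Im_add cabs_Im.
by move=> x; apply: le_trans (fg x); rewrite -Im_opp -Im_add cabs_Im.
Qed.

End ComplexIntegral.

(** * Integrals of families of test functions *)

Section ExchangeIntegral.
Variables (R : realType) (s : R).
Hypothesis hs : 1 < s.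
Variables (d : nat) (a : ('rV[R]_d -> R[i]) -> R[i]).
Hypothesis aD : Ddual s a.

Lemma Dspace0 : Dspace s (fun _ : 'rV[R]_d => 0 : R[i]).
Proof.
apply/(DspaceP hs); split; first exact: smooth_cst.
split; first by exists 0.
exists 1, (cabs 0); split=> // x; exact: gb_cst.
Qed.

Lemma a_zero : a (fun=> 0) = 0.
Proof.
have := Dlin aD 1 Dspace0 Dspace0.
rewrite (_ : (fun x => _) = (fun=> 0)); last by apply/funext => x; rewrite mulr0 addr0.
by rewrite mul1r => /(congr1 (fun z => z - a (fun=> 0))); rewrite addrK subrr.
Qed.

Lemma a_scale c f : Dspace s f -> a (fun x => c * f x) = c * a f.
Proof.
move=> Df; have := Dlin aD c Df Dspace0; rewrite a_zero addr0 => <-.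
by congr a; apply/funext => x; rewrite addr0.
Qed.

Lemma a_sub f g : Dspace s f -> Dspace s g -> a (fun x => f x - g x) = a f - a g.
Proof.
move=> Df Dg; have := Dlin aD (- 1) Dg Df; rewrite mulN1r addrC => <-.
by congr a; apply/funext => x; rewrite mulN1r addrC.
Qed.

Lemma Dspace_scale (c : R[i]) f : Dspace s f -> Dspace s (fun x : 'rV[R]_d => c * f x).
Proof.
move=> Df; have := Dspace_comb hs c 0 Df Dspace0; congr (Dspace s).
by apply/funext => x; rewrite mulr0 addr0.
Qed.

Lemma Dspace_add f g : Dspace s f -> Dspace s g -> Dspace s (fun x : 'rV[R]_d => f x + g x).
Proof.
move=> Df Dg; have := Dspace_comb hs 1 1 Df Dg; congr (Dspace s).
by apply/funext => x; rewrite !mul1r.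
Qed.

Lemma a_sum (I : Type) (r : seq I) (F : I -> 'rV[R]_d -> R[i]) :
  (forall i, Dspace s (F i)) ->
  Dspace s (fun x => \sum_(i <- r) F i x) /\
  a (fun x => \sum_(i <- r) F i x) = \sum_(i <- r) a (F i).
Proof.
move=> DF; elim: r => [|i r [IH1 IH2]].
  rewrite (_ : (fun x => _) = (fun=> 0)); last by apply/funext => x; rewrite big_nil.
  by rewrite big_nil a_zero; split=> //; exact: Dspace0.
rewrite (_ : (fun x => _) = (fun x => F i x + \sum_(i <- r) F i x)); last first.
  by apply/funext => x; rewrite big_cons.
split; first exact: Dspace_add.
have := Dlin aD 1 (DF i) IH1; rewrite mul1r big_cons IH2 => <-.
by congr a; apply/funext => x; rewrite mul1r.
Qed.

(** Lipschitz dependence in one fixed Gevrey norm makes Riemann sums converge as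
    test functions, not only pointwise. *)
Definition lipfam p (h A L r r' : R) (Phi : 'rV[R]_p -> 'rV[R]_d -> R[i]) :=
  [/\ 0 < h, 0 <= L & 0 <= r] /\
  [/\ forall x, csmooth (Phi x), forall x, supp_in r' (Phi x),
      forall x z, gb s h A (Phi x) z,
      forall x y z, gb s h (L * `|x - y|) (fun z => Phi x z - Phi y z) z &
      forall x z, r < `|x| -> Phi x z = 0].

Lemma lipfam_D p h A L r r' Phi x : @lipfam p h A L r r' Phi -> Dspace s (Phi x).
Proof.
move=> [[h0 L0 r0] [sP suP gP lP zP]]; apply/(DspaceP hs); split=> //.
by split; [exists r'|exists h, A].
Qed.

Lemma lipfam_clip p h A L r r' Phi l z : @lipfam p h A L r r' Phi ->
  clip (L * (h ^+ size l * Fs s (size l))) r (fun x => dl l (Phi x) z).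
Proof.
move=> [[h0 L0 r0] [sP suP gP lP zP]]; split=> //.
- by rewrite !mulr_ge0// ?exprn_ge0 ?(ltW h0)//; exact: ltW (Fs_gt0 _ _).
- move=> x y; have := lP x y z l; rewrite dl_sub// => /le_trans; apply.
  by apply: eq_ler; ring.
- move=> x rx; have := gP x; rewrite (_ : Phi x = fun=> 0); last first.
    by apply/funext => w; exact: zP.
  by rewrite dl_cst; case: l.
Qed.

Lemma riemannC_le p h A L r r' Phi l z N : (0 < N)%N -> @lipfam p h A L r r' Phi ->
  cabs (integralC (fun x => dl l (Phi x) z) - riemannC r N (fun x => dl l (Phi x) z)) <=
  2 * (L * rconst p r / N%:R) * h ^+ size l * Fs s (size l).
Proof.
move=> N0 HP; have := intC_riemann N0 (lipfam_clip l z HP).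
by move=> /le_trans; apply; apply: eq_ler; ring.
Qed.

(** Differentiation under the integral: Riemann sums and all their derivatives
    converge, and [smooth_limit] applies. *)
Lemma lipfam_int_dl p h A L r r' Phi : @lipfam p h A L r r' Phi ->
  csmooth (fun z => integralC (fun x => Phi x z)) /\
  forall l z, dl l (fun z => integralC (fun x => Phi x z)) z =
    integralC (fun x => dl l (Phi x) z).
Proof.
move=> HP; have [[h0 L0 r0] [sP suP gP lP zP]] := HP.
pose F N z := riemannC r N.+1 (fun x => Phi x z).
have sF N : csmooth (F N).
  by apply: smooth_scale; apply: smooth_sum => x; exact: sP.
have dF N l z : dl l (F N) z = riemannC r N.+1 (fun x => dl l (Phi x) z).
  rewrite /F /riemannC dl_scale; last by apply: smooth_sum => x; exact: sP.
  by rewrite dl_sum.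
have [||sP' dP'] := @smooth_limit R d F (fun l z => integralC (fun x => dl l (Phi x) z)) sF.
- move=> l; exists (2 * (A * h ^+ size l * Fs s (size l)) * vol p r +
     2 * (L * rconst p r) * h ^+ size l * Fs s (size l) * 1) => N z.
  rewrite dF -[riemannC _ _ _](subKr (integralC (fun x => dl l (Phi x) z))).
  apply: (le_trans (cabsB _ _)); apply: lerD.
    by apply: (intC_le (lipfam_clip l z HP)) => x; exact: gP.
  apply: (le_trans (riemannC_le l z (ltn0Sn N) HP)).
  have P : 0 <= 2 * (L * rconst p r) * h ^+ size l * Fs s (size l).
    have rc : 0 <= rconst p r.
      elim: (p) => [|q IH] //=; rewrite addr_ge0// mulr_ge0 ?sqr_ge0 ?vol_ge0//.
      by rewrite mulr_ge0// addr_ge0.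
    by rewrite !mulr_ge0// ?exprn_ge0 ?(ltW h0)//; exact: ltW (Fs_gt0 _ _).
  have N1 : (N.+1%:R : R)^-1 <= 1 by rewrite invf_le1 ?ltr0n// ler1n.
  by apply: le_trans (ler_wpM2l P N1); apply: eq_ler; ring.
- move=> l z e e0.
  pose B := 2 * (L * rconst p r) * h ^+ size l * Fs s (size l).
  exists (Num.trunc (`|B| / e)) => N hN.
  rewrite dF -cabsN opprB; apply: (le_trans (riemannC_le l z (ltn0Sn N) HP)).
  rewrite (_ : _ * _ = B / N.+1%:R); last by rewrite /B; ring.
  rewrite ler_pdivrMr ?ltr0n// (le_trans (ler_norm B))// mulrC -ler_pdivrMr//.
  have B0 : 0 <= `|B| / e by rewrite divr_ge0// ltW.
  have /andP[_ /ltW/le_trans] := Num.Theory.truncn_itv B0; apply.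
  by rewrite ler_nat ltnS.
by split=> // l z; rewrite dP'.
Qed.

Lemma lipfam_int p h A L r r' Phi : @lipfam p h A L r r' Phi ->
  supp_in r' (fun z => integralC (fun x => Phi x z)) /\
  forall z, gb s h (2 * A * vol p r) (fun z => integralC (fun x => Phi x z)) z.
Proof.
move=> HP; have [[h0 L0 r0] [sP suP gP lP zP]] := HP.
have [sI dI] := lipfam_int_dl HP.
split=> [z rz|z l].
  apply: cabs_eq0; apply/eqP; rewrite eq_le cabs_ge0 andbT.
  have := intC_le (M := 0) (lipfam_clip [::] z HP); rewrite mulr0 mul0r; apply => x.
  by rewrite /= suP// cabs0.
rewrite dI; apply: (le_trans (intC_le (lipfam_clip l z HP) (fun x => gP x z l))).
by apply: eq_ler; ring.
Qed.

Lemma a_clip p h A L r r' Phi C : @lipfam p h A L r r' Phi -> 0 <= C ->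
  (forall f A, csmooth f -> supp_in r' f -> (forall x, gb s h A f x) -> cabs (a f) <= C * A) ->
  clip (C * L) r (fun x => a (Phi x)).
Proof.
move=> HP C0 HC; have [[h0 L0 r0] [sP suP gP lP zP]] := HP.
split=> //; first exact: mulr_ge0.
- move=> x y; rewrite -a_sub; [|exact: lipfam_D HP|exact: lipfam_D HP].
  rewrite -mulrA; apply: HC; first exact: smooth_sub.
    by move=> z rz; rewrite !suP// subrr.
  exact: lP.
- move=> x rx; rewrite (_ : Phi x = fun=> 0) ?a_zero//.
  by apply/funext => z; exact: zP.
Qed.

(** Riemann sums converge in the Gevrey norm, so a continuous functional
    commutes with the integral of a Lipschitz family. *)
Lemma a_integral p h A L r r' Phi : @lipfam p h A L r r' Phi ->
  a (fun z => integralC (fun x => Phi x z)) = integralC (fun x => a (Phi x)).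
Proof.
move=> HP; have [[h0 L0 r0] [sP suP gP lP zP]] := HP.
have [C [C0 HC]] := Ddual_bound hs r' aD h0.
have [sI dI] := lipfam_int_dl HP; have [suI gI] := lipfam_int HP.
have cl := a_clip HP C0 HC.
pose Psi z := integralC (fun x => Phi x z).
have DPsi : Dspace s Psi.
  apply/(DspaceP hs); split=> //; split; first by exists r'.
  by exists h, (2 * A * vol p r).
apply/eqP; rewrite -subr_eq0; apply/eqP/cabs_eq0/eqP.
rewrite eq_le cabs_ge0 andbT; apply/ler_addgt0Pr => e e0; rewrite add0r.
pose B := 4 * (C * L * rconst p r).
pose N := (Num.trunc (`|B| / e)).+1.
pose F z := riemannC r N (fun x => Phi x z).
have DPhi x := lipfam_D x HP.
have [DS aS] := a_sum (grid r N p) DPhi.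
have DF : Dspace s F by exact: Dspace_scale.
have aF : a F = riemannC r N (fun x => a (Phi x)).
  by rewrite /F /riemannC a_scale// aS.
have E1 : cabs (a Psi - a F) <= C * (2 * (L * rconst p r / N%:R)).
  rewrite -a_sub//.
  have sF : csmooth F by have /(DspaceP hs)[] := DF.
  apply: HC; first exact: smooth_sub.
    move=> z rz; rewrite /Psi suI// /F /riemannC big1 ?mulr0 ?subr0// => x _.
    by rewrite suP.
  move=> z l; rewrite dl_sub// dI.
  have -> : dl l F z = riemannC r N (fun x => dl l (Phi x) z).
    rewrite /F /riemannC dl_scale; last by apply: smooth_sum => x; exact: sP.
    by rewrite dl_sum.
  exact: riemannC_le HP.
have E2 := intC_riemann (isT : (0 < N)%N) cl.
rewrite -/Psi (_ : a Psi - _ = (a Psi - a F) -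
   (integralC (fun x => a (Phi x)) - riemannC r N (fun x => a (Phi x)))); last first.
  by rewrite aF; ring.
apply: (le_trans (cabsB _ _)); apply: (le_trans (lerD E1 E2)).
rewrite (_ : _ + _ = B / N%:R); last by rewrite /B; ring.
rewrite ler_pdivrMr ?ltr0n// (le_trans (ler_norm B))// mulrC -ler_pdivrMr//.
have B0 : 0 <= `|B| / e by rewrite divr_ge0// ltW.
by have /andP[_ /ltW] := Num.Theory.truncn_itv B0.
Qed.

End ExchangeIntegral.

(** * Kernels depending on a difference *)

Lemma rowZ (R : realType) (n : nat) (c : R) (x : 'rV[R]_n) i : (c *: x) 0 i = c * x 0 i.
Proof. by rewrite mxE. Qed.

Lemma rowE (R : realType) (n : nat) (i j : 'I_n) :
  (delta_mx 0 j : 'rV[R]_n) 0 i = (i == j)%:R.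
Proof. by rewrite mxE eqxx. Qed.

Lemma lipmap_cont (R : realType) (V W : normedModType R) (T : V -> W) (L : R) :
  (forall x y, `|T x - T y| <= L * `|x - y|) -> continuous T.
Proof.
move=> H x; apply/cvgrPdist_le => e e0.
have L0 : 0 < `|L| + 1 by rewrite ltr_wpDl.
apply/nbhs_ballP; exists (e / (`|L| + 1)); first exact: divr_gt0.
move=> y; rewrite -ball_normE /= ltr_pdivlMr// => /ltW; apply: le_trans.
apply: (le_trans (H x y)); rewrite mulrC ler_wpM2l//.
by rewrite (le_trans (ler_norm L))// lerDl.
Qed.

Section RowNorms.
Variables (R : realType) (m n : nat).
Implicit Types (x : 'rV[R]_m) (y : 'rV[R]_n).

Lemma norm_row_le x y M : `|x| <= M -> `|y| <= M -> `|row_mx x y| <= M.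
Proof.
move=> xM yM; apply: norm_coordP; first exact: le_trans (normr_ge0 _) xM.
move=> i; case: (split_ordP i) => j ->; rewrite ?row_mxEl ?row_mxEr.
  exact: le_trans (coord_le _ _) xM.
exact: le_trans (coord_le _ _) yM.
Qed.

Lemma norm_row_l x y : `|x| <= `|row_mx x y|.
Proof.
by apply: norm_coordP => // i; rewrite -(row_mxEl x y) coord_le.
Qed.

Lemma norm_row_r x y : `|y| <= `|row_mx x y|.
Proof.
by apply: norm_coordP => // i; rewrite -(row_mxEr x y) coord_le.
Qed.

Lemma row_mx_sub x y x' y' : row_mx x y - row_mx x' y' = row_mx (x - x') (y - y').
Proof. by rewrite opp_row_mx add_row_mx. Qed.

End RowNorms.

Section Kernels.
Variables (R : realType) (s : R).
Hypothesis hs : 1 < s.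
Variables (d : nat) (a : ('rV[R]_d -> R[i]) -> R[i]).
Hypothesis aD : Ddual s a.
Implicit Types (G : 'rV[R]_(d + d) -> R[i]).

Lemma slice_axis (x : 'rV[R]_d) :
  axis_map (fun z => row_mx x (x - z)) (fun=> -1) (@rshift d d).
Proof.
split.
  apply: (@lipmap_cont _ _ _ _ 1) => z z'; rewrite mul1r row_mx_sub subrr.
  apply: norm_row_le; first by rewrite normr0.
  by rewrite opprD opprK addrACA subrr add0r addrC distrC.
move=> z j h; apply/rowP => i; rewrite rowD.
case: (split_ordP i) => k ->.
  by rewrite !row_mxEl rowZ rowE eq_lrshift mulr0 add0r.
rewrite !row_mxEr !rowB rowD !rowZ !rowE eq_rshift.
by case: (k == j); rewrite ?mulr1n ?mulr0n; ring.
Qed.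

Definition kslice G (x : 'rV[R]_d) : 'rV[R]_d -> R[i] := fun z => G (row_mx x (x - z)).
(** The pairing of the kernel [a (x - y)] with [G (x, y)]. *)
Definition kernel_pair G : R[i] := integralC (fun x => a (kslice G x)).

Lemma kslice_smooth G x : csmooth G -> csmooth (kslice G x).
Proof. exact: smooth_pull (slice_axis x). Qed.

Lemma kslice_gb G x z h A : csmooth G -> gb s h A G (row_mx x (x - z)) ->
  gb s h A (kslice G x) z.
Proof.
move=> sG H; apply: (gb_pull (slice_axis x)) => // j.
by rewrite normrN1.
Qed.

Lemma kslice_lipfam G h A r : 0 < h -> 0 <= r -> csmooth G ->
  (forall Z, gb s h A G Z) -> supp_in r G ->
  lipfam s (s2 s * h) A ((d + d)%:R * (2 * (A * (s2 s * h)))) r (2 * r) (kslice G).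
Proof.
move=> h0 r0 sG gG zG.
have A0 : 0 <= A := gb_ge0 (gG 0).
have s20 : 0 < s2 s := lt_le_trans ltr01 (s2_ge1 hs).
have sh0 : 0 < s2 s * h by rewrite mulr_gt0.
have hsh : h <= s2 s * h by rewrite ler_peMl ?(s2_ge1 hs)// ltW.
have zero x z : r < `|x| -> kslice G x z = 0.
  by move=> rx; apply: zG; exact: lt_le_trans rx (norm_row_l _ _).
split; first by split=> //; rewrite !mulr_ge0// ltW.
split=> //.
- by move=> x; exact: kslice_smooth.
- move=> x z rz; have [xr|rx] := leP `|x| r; last exact: zero.
  apply: zG; apply: lt_le_trans (norm_row_r _ _).
  by have := lerB_dist z x; rewrite distrC; lra.
- move=> x z; apply: kslice_gb => //.
  by apply: gb_le (gG _) => //; exact: ltW.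
- move=> x y z l; rewrite dl_sub; [|exact: kslice_smooth|exact: kslice_smooth].
  rewrite /kslice (dl_pull l (slice_axis x) sG) (dl_pull l (slice_axis y) sG).
  rewrite -mulrBr cabsM cabs_real.
  have -> : `|\prod_(j <- l) (-1 : R)| = 1.
    elim: l => [|j l IH]; first by rewrite big_nil normr1.
    by rewrite big_cons normrM IH normrN1 mulr1.
  rewrite mul1r; set l' := map _ l.
  have sl' : size l' = size l by rewrite size_map.
  have := @smooth_lip R (d + d) (dl l' G) (A * (s2 s * h) ^+ (size l).+1 * Fs s (size l))
    (row_mx x (x - z)) (row_mx y (y - z)) (smooth_dl l' sG).
  move=> /(_ _)/le_trans; apply.
    move=> i Z; apply: (le_trans (gG Z (i :: l'))); rewrite /= sl'.
    have := FsD hs 1 (size l); rewrite add1n.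
    have -> : Fs s 1 = 1 by rewrite /Fs (_ : 1`! = 1)%N// powR1.
    rewrite mul1r => HF.
    apply: (le_trans (ler_wpM2l (mulr_ge0 A0 (exprn_ge0 _ (ltW h0))) HF)).
    by apply: eq_ler; rewrite exprMn; ring.
  have E : `|row_mx x (x - z) - row_mx y (y - z)| <= `|x - y|.
    rewrite row_mx_sub; apply: norm_row_le => //.
    by rewrite opprB addrA subrK.
  apply: (@le_trans _ _ ((d + d)%:R * (2 * (A * (s2 s * h) ^+ (size l).+1 * Fs s (size l))) * `|x - y|)).
    apply: ler_wpM2l => //; rewrite !mulr_ge0// ?exprn_ge0 ?(ltW sh0)//.
    exact: ltW (Fs_gt0 _ _).
  by apply: eq_ler; rewrite exprS; ring.
Qed.

(** Test functions of both variables; the form is the one needed to bound slices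
    uniformly. *)
Definition kernel_test G := csmooth G /\ exists h A r, [/\ 0 < h, 0 <= r,
  forall Z, gb s h A G Z & supp_in r G].

Lemma kernel_test_clip G : kernel_test G -> exists L r, clip L r (fun x => a (kslice G x)).
Proof.
move=> [sG [h [A [r [h0 r0 gG zG]]]]].
have HP := kslice_lipfam h0 r0 sG gG zG.
have [[h0' _ _] _] := HP.
have [C [C0 HC]] := Ddual_bound hs (2 * r) aD h0'.
by eexists; eexists; exact: (a_clip hs aD HP C0 HC).
Qed.

Lemma kernel_test_D G x : kernel_test G -> Dspace s (kslice G x).
Proof.
move=> [sG [h [A [r [h0 r0 gG zG]]]]].
exact: (lipfam_D hs x (kslice_lipfam h0 r0 sG gG zG)).
Qed.

Lemma kernel_test_comb G G' c : kernel_test G -> kernel_test G' -> kernel_test (fun Z => c * G Z + G' Z).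
Proof.
move=> [sG [h [A [r [h0 r0 gG zG]]]]] [sG' [h' [A' [r' [h0' r0' gG' zG']]]]].
split; first by apply: smooth_add => //; exact: smooth_scale.
exists (Num.max h h'), (cabs c * A + A'), (Num.max r r'); split.
- by rewrite lt_max h0.
- by rewrite le_max r0.
- move=> Z; apply: gb_add => //; first exact: smooth_scale.
    by apply: (gb_le (ltW h0) _ (lexx _) (gb_scale _ sG (gG Z))); rewrite le_max lexx.
  by apply: (gb_le (ltW h0') _ (lexx _) (gG' Z)); rewrite le_max lexx orbT.
- by move=> Z; rewrite gt_max => /andP[rZ rZ']; rewrite zG// zG'// mulr0 addr0.
Qed.

Lemma kernel_pair_lin G G' c : kernel_test G -> kernel_test G' ->
  kernel_pair (fun Z => c * G Z + G' Z) = c * kernel_pair G + kernel_pair G'.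
Proof.
move=> kG kG'; have [L [r cG]] := kernel_test_clip kG; have [L' [r' cG']] := kernel_test_clip kG'.
rewrite /kernel_pair -(intC_lin c cG cG'); congr integralC; apply/funext => x.
exact: (Dlin aD c (kernel_test_D x kG) (kernel_test_D x kG')).
Qed.

(** Only [|c1 - c2|] matters, not where [c1] and [c2] are: slices are functions of
    [x - y], so the estimates are translation invariant. *)
Lemma kernel_pair_le (R0 r h : R) : 0 <= r -> 0 < h -> exists C, 0 <= C /\
  forall (c1 c2 : 'rV[R]_d) G A, `|c1 - c2| <= R0 -> csmooth G ->
    (forall Z, gb s h A G Z) ->
    (forall x y, r < `|x - c1| -> G (row_mx x y) = 0) ->
    (forall x y, r < `|y - c2| -> G (row_mx x y) = 0) ->
    cabs (kernel_pair G) <= C * A.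
Proof.
move=> r0 h0; have [C [C0 HC]] := Ddual_bound hs (R0 + 2 * r) aD h0.
exists (2 * C * vol d r); split; first by rewrite !mulr_ge0// vol_ge0.
move=> c1 c2 G A c12 sG gG z1 z2.
have kG : kernel_test G.
  split=> //; exists h, A, (Num.max (`|c1| + r) (`|c2| + r)); split=> //.
    by rewrite le_max addr_ge0.
  move=> Z; rewrite -[Z]hsubmxK => rZ.
  have [|x1] := ltP r `|lsubmx Z - c1|; first exact: z1.
  have [|x2] := ltP r `|rsubmx Z - c2|; first exact: z2.
  move: rZ; rewrite ltNge => /negP; case; apply: norm_row_le.
    by rewrite le_max; apply/orP; left; have := lerB_dist (lsubmx Z) c1; lra.
  by rewrite le_max; apply/orP; right; have := lerB_dist (rsubmx Z) c2; lra.
have [L [rr cl]] := kernel_test_clip kG.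
have bd x : cabs (a (kslice G x)) <= C * A.
  have [xr|rx] := leP `|x - c1| r; last first.
    rewrite (_ : kslice G x = fun=> 0); last by apply/funext => z; exact: z1.
    rewrite (a_zero hs aD) cabs0; apply: mulr_ge0 => //; exact: gb_ge0 (gG 0).
  apply: HC; first exact: kslice_smooth.
    move=> z rz; apply: z2.
    have := lerB_dist z (x - c1 + (c1 - c2)).
    rewrite [`|z - _|]distrC (_ : x - c1 + (c1 - c2) - z = x - z - c2); last by rewrite addrA subrK addrAC.
    by have := ler_normD (x - c1) (c1 - c2); lra.
  by move=> z; exact: kslice_gb.
apply: (le_trans (intC_le_at (c := c1) cl r0 _ bd)); last by apply: eq_ler; ring.
move=> x rx; rewrite (_ : kslice G x = fun=> 0) ?(a_zero hs aD)//.
by apply/funext => z; exact: z1.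
Qed.

Lemma a_kernel_pair G : kernel_test G -> a (fun z => integralC (fun x => G (row_mx x (x - z)))) = kernel_pair G.
Proof.
move=> [sG [h [A [r [h0 r0 gG zG]]]]].
exact: (a_integral hs aD (kslice_lipfam h0 r0 sG gG zG)).
Qed.

End Kernels.

(** * Discrete Fourier analysis and finite differences *)

Section Exponentials.
Variable R : realType.

Lemma cexpiD (x y : R) : cexpi (x + y) = cexpi x * cexpi y.
Proof. by apply: ceq; rewrite !cparts /= ?cosD ?sinD//; ring. Qed.

Lemma cexpi0 : cexpi (0 : R) = 1.
Proof. by rewrite /cexpi cos0 sin0. Qed.

Lemma cexpiN (x : R) : cexpi (- x) = conjc (cexpi x).
Proof. by rewrite /cexpi cosN sinN. Qed.

Lemma cabs_cexpi (x : R) : cabs (cexpi x) = 1.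
Proof. by rewrite /cabs /Normc.normc /= cos2Dsin2 sqrtr1. Qed.

Lemma cexpi_neq0 (x : R) : cexpi x != 0.
Proof.
apply/eqP => H; have := cabs_cexpi x; rewrite H cabs0 => /eqP.
by rewrite eq_sym oner_eq0.
Qed.

Lemma cexpiMn (x : R) k : cexpi (k%:R * x) = cexpi x ^+ k.
Proof.
elim: k => [|k IH]; first by rewrite mul0r cexpi0 expr0.
by rewrite -natr1 mulrDl mul1r cexpiD IH exprSr.
Qed.

Lemma cexpi_2pi : cexpi (2 * pi : R) = 1.
Proof.
rewrite mulr_natl mulr2n cexpiD /cexpi cospi sinpi.
by apply: ceq; rewrite !cparts /=; ring.
Qed.

Lemma cabs_1Bcexpi (x : R) : cabs (1 - cexpi x) ^+ 2 = 4 * sin (x / 2) ^+ 2.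
Proof.
have E : x = x / 2 + x / 2 by field.
rewrite /cabs /Normc.normc /= {1 2}E cosD sinD sqr_sqrtr; last first.
  by rewrite addr_ge0// sqr_ge0.
have := cos2Dsin2 (x / 2); move: (cos (x / 2)) (sin (x / 2)) => c si H.
have Hc : c * c = 1 - si * si by rewrite -H; ring.
transitivity ((1 - (c * c - si * si)) ^+ 2 + 4 * (c * c) * (si * si)); first by ring.
by rewrite Hc; ring.
Qed.

(** The mean value theorem on [0, x / 2] and the duplication formula. *)
Lemma sin_ge_half (x : R) : 0 <= x -> x <= pi / 2 -> x / 2 <= sin x.
Proof.
move=> x0 xpi; have pi0 := pi_gt0 R.
have [|c /andP[c0 cx] E] := @mvt_eq R sin cos 0 (x / 2) (fun t => is_derive_sin t).
  by rewrite divr_ge0.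
rewrite sin0 !subr0 in E.
have mono : cos (x / 2) <= cos c.
  by rewrite leNgt ltr_cos -?leNgt// in_itv /=; apply/andP; split; lra.
have cp : 0 <= cos (x / 2) by apply: cos_ge0_pihalf; apply/andP; split; lra.
have s1 : cos (x / 2) * (x / 2) <= sin (x / 2) by rewrite E ler_wpM2r// divr_ge0.
have Ex : x = x / 2 + x / 2 by field.
have c2 : 1 / 2 <= cos (x / 2) ^+ 2.
  have cx0 : 0 <= cos x by apply: cos_ge0_pihalf; apply/andP; split; lra.
  move: cx0; rewrite {1}Ex cosD -!expr2.
  by have := cos2Dsin2 (x / 2); lra.
rewrite [in leRHS]Ex sinD.
have -> : sin (x / 2) * cos (x / 2) + cos (x / 2) * sin (x / 2) = 2 * (cos (x / 2) * sin (x / 2)) by ring.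
have H := ler_wpM2l cp s1.
have : (x / 2) * (1 / 2) <= cos (x / 2) * (cos (x / 2) * (x / 2)).
  rewrite mulrA -expr2 [leLHS]mulrC; apply: ler_wpM2r => //.
  by rewrite divr_ge0.
lra.
Qed.

Lemma cabs_1Bcexpi_ge (x : R) : `|x| <= pi -> `|x| / 2 <= cabs (1 - cexpi x).
Proof.
move=> xpi; rewrite -(@ler_pXn2r _ 2)// ?nnegrE ?divr_ge0 ?cabs_ge0//.
rewrite cabs_1Bcexpi.
have -> : sin (x / 2) ^+ 2 = sin (`|x| / 2) ^+ 2.
  by have [//|x0] := ger0P x; rewrite mulNr sinN sqrrN.
have h : `|x| / 2 / 2 <= sin (`|x| / 2).
  by apply: sin_ge_half; rewrite ?divr_ge0//; lra.
rewrite (_ : (_ / 2) ^+ 2 = 4 * (`|x| / 2 / 2) ^+ 2); last by field.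
by rewrite ler_wpM2l// ler_expn// !divr_ge0.
Qed.

(** A geometric sum whose ratio is a nontrivial [N]-th root of unity vanishes. *)
Lemma dft_orthogonality (N K k l : nat) : (k < N)%N -> (l < N)%N ->
  \sum_(j < N) cexpi ((j%:R - K%:R) * (k%:R - l%:R) * (2 * pi / N%:R) : R) =
  if k == l then N%:R else 0.
Proof.
move=> kN lN; have N0 : N%:R != 0 :> R by rewrite pnatr_eq0; lia.
pose b := (k%:R - l%:R) * (2 * pi / N%:R) : R.
have E (j : nat) : cexpi ((j%:R - K%:R) * (k%:R - l%:R) * (2 * pi / N%:R) : R) =
    cexpi (- (K%:R * b)) * cexpi b ^+ j.
  by rewrite -cexpiMn -cexpiD; congr cexpi; rewrite /b; ring.
under eq_bigr => j _ do rewrite E.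
rewrite -mulr_sumr; have [kl|kl] := eqVneq k l.
  rewrite /b kl subrr mul0r mulr0 oppr0 cexpi0 mul1r.
  by under eq_bigr => j _ do rewrite expr1n; rewrite sumr_const card_ord.
have bN : cexpi b ^+ N = 1.
  rewrite -cexpiMn (_ : N%:R * b = k%:R * (2 * pi) - l%:R * (2 * pi)); last first.
    by rewrite /b; field.
  by rewrite cexpiD cexpiN (cexpiMn (2 * pi) k) (cexpiMn (2 * pi) l) cexpi_2pi !expr1n conjc1 mulr1.
have b1 : cexpi b - 1 != 0.
  apply/eqP => H; have := cabs_1Bcexpi b.
  rewrite -cabsN opprB H cabs0 expr0n /= => /esym/eqP.
  rewrite mulf_eq0 pnatr_eq0 /= sqrf_eq0 => /eqP.
  have pi0 := pi_gt0 R.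
  have N0' : 0 < N%:R :> R by rewrite ltr0n; lia.
  have eb : b / 2 = (k%:R - l%:R) * (pi / N%:R) by rewrite /b; field.
  have key (i j : nat) : (i < N)%N -> (j < i)%N -> 0 < sin ((i%:R - j%:R) * (pi / N%:R) : R).
    move=> iN ji; apply: sin_gt0_pi; apply/andP; split.
      by rewrite mulr_gt0 ?divr_gt0// subr_gt0 ltr_nat.
    rewrite mulrA ltr_pdivrMr// mulrC ltr_pM2l//.
    have : (i%:R : R) < N%:R by rewrite ltr_nat.
    by have := ler0n R j; lra.
  rewrite eb; have [kl'|lk|e] := ltngtP k l; last by rewrite e eqxx in kl.
  - have := key l k lN kl'; rewrite -opprB mulNr => h1 h2.
    by rewrite sinN h2 oppr0 ltxx in h1.
  - by have := key k l kN lk => h1 h2; rewrite h2 ltxx in h1.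
have : (cexpi b - 1) * \sum_(j < N) cexpi b ^+ j = 0 by rewrite -subrX1 bN subrr.
by move=> /eqP; rewrite mulf_eq0 (negbTE b1) /= => /eqP ->; rewrite mulr0.
Qed.

(** Multiplying the sum by [1 - w] replaces [v] by its backward difference, which
    is of size [dt] times the derivative.  The bound is uniform in the mesh. *)
Lemma sum_by_parts (v : nat -> R -> R[i]) (B : nat -> R) (dt : R) (w : R[i]) (p m : nat) :
  0 < dt -> cabs w = 1 ->
  (forall q t, cder (v q : R^o -> R[i]) t 1 (v q.+1 t)) ->
  (forall q t, cabs (v q t) <= B q) ->
  (forall t, t <= 0 -> v 0%N t = 0) -> (forall t, m%:R * dt <= t -> v 0%N t = 0) ->
  cabs (\sum_(k < m) v 0%N (k%:R * dt) * w ^+ k) * cabs (1 - w) ^+ p <=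
  (m + p)%:R * (2 * dt) ^+ p * B p.
Proof.
move=> dt0 w1; elim: p v B m => [|p IH] v B m vD vB v0 vm.
  rewrite !expr0 !mulr1 addn0; apply: (le_trans (cabs_sum _ _ _)).
  apply: (@le_trans _ _ (\sum_(k < m) B 0%N)).
    by apply: ler_sum => k _; rewrite cabsM cabsX w1 expr1n mulr1.
  rewrite sumr_const card_ord -[leLHS]mulr_natl; exact: lexx.
pose v' q t := v q t + (- 1) * v q (t - dt).
have v'D q t : cder (v' q : R^o -> R[i]) t 1 (v' q.+1 t).
  apply: cder_add => //.
  have := @cder_pullback R R^o R^o (v q) (fun t => t - dt) t 1 1 1 (v q.+1 (t - dt)) _ (vD q (t - dt)).
  move=> /(_ _)/(cder_mul (cder_cst (- 1) t 1)) H.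
  apply: (cder_eq (H _)); last by rewrite (_ : Complex 1 0 = 1)//; ring.
  by move=> h; rewrite mulr1 addrA.
have v'B q t : cabs (v' q t) <= 2 * dt * B q.+1.
  have := @cder_mvt R (v q) (v q.+1) (t - dt) t (B q.+1) (vD q) (fun u _ => vB _ _).
  rewrite (_ : t - (t - dt) = dt); last by ring.
  rewrite (gtr0_norm dt0) /v' mulN1r => /le_trans; apply.
  by apply: eq_ler; ring.
have := IH v' (fun q => 2 * dt * B q.+1) m.+1 v'D v'B.
have z1 t : t <= 0 -> v' 0%N t = 0.
  by move=> t0; rewrite /v' !v0 ?mulr0 ?addr0//; lra.
have z2 t : m.+1%:R * dt <= t -> v' 0%N t = 0.
  rewrite -natr1 mulrDl mul1r => mt.
  by rewrite /v' !vm ?mulr0 ?addr0//; lra.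
move=> /(_ z1 z2).
have -> : \sum_(k < m.+1) v' 0%N (k%:R * dt) * w ^+ k =
    (1 - w) * \sum_(k < m) v 0%N (k%:R * dt) * w ^+ k.
  rewrite /v'; under eq_bigr => k _ do rewrite mulrDl.
  rewrite big_split /= mulrBl mul1r; congr (_ + _).
    by rewrite big_ord_recr /= (vm _ (lexx _)) mul0r addr0.
  rewrite big_ord_recl /= mul0r sub0r (v0 (- dt)) ?oppr_le0 ?(ltW dt0)// mulr0 mul0r add0r.
  rewrite mulr_sumr -sumrN; apply: eq_bigr => k _.
  rewrite /bump /= add1n exprS -natr1 mulrDl mul1r addrK; ring.
rewrite cabsM => H; apply: (le_trans (eq_ler _) (le_trans H (eq_ler _))).
  by rewrite [in LHS]exprS; ring.
by rewrite addSnnS [in RHS]exprS; ring.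
Qed.

(** Difference quotients of [v] vanish on a shorter grid, and the mean value
    theorem returns from them to the derivative one order higher. *)
Lemma grid_derivative (v : nat -> R -> R) (B : nat -> R) (dt : R) (m q : nat) t :
  0 < dt -> (forall q t, is_derive (t : R) 1 (v q) (v q.+1 t)) ->
  (forall q t, 0 <= t <= m%:R * dt -> `|v q t| <= B q) ->
  (forall k, (k <= m)%N -> v 0%N (k%:R * dt) = 0) ->
  (q < m)%N -> 0 <= t <= m%:R * dt -> `|v q t| <= q.+1%:R * dt * B q.+1.
Proof.
move=> dt0; elim: q v B m t => [|q IH] v B m t vD vB v0 qm /andP[t0 tm].
  pose k := Num.truncn (t / dt).
  have td : 0 <= t / dt by rewrite divr_ge0// ltW.
  have /andP[k1 k2] := Num.Theory.truncn_itv td.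
  have kt : k%:R * dt <= t by rewrite -ler_pdivlMr.
  have tk : t <= k%:R * dt + dt.
    by rewrite -{2}[dt]mul1r -mulrDl natr1 -ler_pdivrMr// ltW.
  have km : (k <= m)%N.
    rewrite -(ler_nat R) -(ler_pM2r dt0); exact: le_trans tm.
  have := @mvt_le R (v 0%N) (v 1%N) (k%:R * dt) t (B 1%N) (vD 0%N).
  rewrite v0// subr0 mul1r => H.
  have kd0 : 0 <= k%:R * dt by rewrite mulr_ge0// ltW.
  apply: (le_trans (H _)).
    rewrite (min_l kt) (max_r kt) => u /andP[u1 u2]; apply: vB.
    by rewrite (le_trans kd0)//= (le_trans u2).
  have B0 : 0 <= B 1%N.
    by apply: le_trans (vB 1%N t _); rewrite ?normr_ge0// t0.
  rewrite mulrC ler_wpM2r//.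
  by rewrite ger0_norm ?subr_ge0//; lra.
case: m qm vB v0 tm => // m qm vB v0 tm; rewrite ltnS in qm.
have mS : m.+1%:R * dt = m%:R * dt + dt by rewrite -natr1 mulrDl mul1r.
pose v' q t := dt^-1 * (v q (t + dt) - v q t).
have dtn : dt != 0 by rewrite gt_eqF.
have v'D q' t' : is_derive (t' : R) 1 (v' q') (v' q'.+1 t').
  have ds : is_derive t' 1 (fun u : R => u + dt) (1 : R).
    by apply: (is_derive_eq (is_deriveD (is_derive_id t' 1) (is_derive_cst dt t' 1))); rewrite addr0.
  have h := @is_derive1_comp R (v q') (fun u : R => u + dt) t' _ _ (vD q' (t' + dt)) ds.
  have h2 := is_deriveM (is_derive_cst dt^-1 t' (1 : R)) (is_deriveB h (vD q' t')).
  apply: (is_derive_eq h2); rewrite /GRing.scale /= mulr0 addr0 mulr1.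
  by rewrite /v'.
have mv q' t' : 0 <= t' <= m%:R * dt ->
    exists2 c, t' <= c <= t' + dt & v' q' t' = v q'.+1 c.
  move=> /andP[t0' tm'].
  have [|c ct E] := @mvt_eq R (v q') (v q'.+1) t' (t' + dt) (vD q'); first by lra.
  by exists c => //; rewrite /v' E addrAC subrr add0r mulrC mulfK.
have v'B q' t' : 0 <= t' <= m%:R * dt -> `|v' q' t'| <= B q'.+1.
  move=> tt; have [c /andP[c1 c2] ->] := mv q' t' tt.
  by apply: vB; rewrite mS; move: tt => /andP[]; lra.
have v'0 k : (k <= m)%N -> v' 0%N (k%:R * dt) = 0.
  move=> km; rewrite /v' (_ : k%:R * dt + dt = k.+1%:R * dt); last by rewrite -natr1 mulrDl mul1r.
  by rewrite !v0 ?subrr ?mulr0//; exact: leqW.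
have m2 : dt <= m%:R * dt.
  by rewrite -{1}[dt]mul1r ler_pM2r// ler1n; exact: leq_ltn_trans qm.
have [t' [tt' t1 t2]] : exists t', [/\ 0 <= t' <= m%:R * dt, t' <= t & t <= t' + dt].
  have [h|h] := leP t (m%:R * dt); first by exists t; split; [rewrite t0|by []|lra].
  by exists (t - dt); split; lra.
have [c /andP[c1 c2] Ec] := mv q t' tt'.
have IH' := IH v' (fun q => B q.+1) m t' v'D v'B v'0 qm tt'.
rewrite Ec in IH'.
have H := @mvt_le R (v q.+1) (v q.+2) c t (B q.+2) (vD q.+1).
have H2 : `|v q.+1 t - v q.+1 c| <= B q.+2 * dt.
  have B0 : 0 <= B q.+2.
    by apply: le_trans (vB q.+2 t _); rewrite ?normr_ge0// t0.
  apply: (le_trans (H _)).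
    move=> u /andP[u1 u2]; apply: vB; move: tt' => /andP[z1 z2].
    have u3 : t' <= u by apply: le_trans u1; rewrite le_min c1 t1.
    have u4 : u <= t' + dt by apply: (le_trans u2); rewrite ge_max c2 t2.
    by rewrite mS; lra.
  by rewrite ler_wpM2l// ler_norml; lra.
rewrite -[v q.+1 t](subrK (v q.+1 c)); apply: (le_trans (ler_normD _ _)).
rewrite -[q.+2%:R]natr1 2!mulrDl mul1r addrC; apply: lerD => //.
by rewrite mulrC.
Qed.

End Exponentials.

(** * Characters *)

Section Characters.
Variable R : realType.

Lemma is_derive_eq1 (V : normedModType R) (f : V -> R^o) x v (d d' : R^o) :
  is_derive x v f d -> d = d' -> is_derive x v f d'.
Proof. by move=> H <-. Qed.

Lemma cder_cexpi (V : normedModType R) (p : V -> R^o) x v (dp : R) :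
  is_derive x v p dp ->
  cder (fun y => cexpi (p y)) x v (Complex 0 1 * (Complex dp 0 * cexpi (p x))).
Proof.
move=> /is_derive_line Dp.
have p0 : p (0 *: v + x) = p x by rewrite scale0r add0r.
split; apply/is_derive_line.
- have := @is_derive1_comp R cos (fun h : R => p (h *: v + x)) 0 _ _
    (is_derive_cos (p (0 *: v + x))) Dp.
  by move=> /is_derive_eq1; apply; rewrite p0 !cparts /=; ring.
- have := @is_derive1_comp R sin (fun h : R => p (h *: v + x)) 0 _ _
    (is_derive_sin (p (0 *: v + x))) Dp.
  by move=> /is_derive_eq1; apply; rewrite p0 !cparts /=; ring.
Qed.

Lemma ccont_cexpi (V : normedModType R) (p : V -> R^o) : continuous p ->
  ccont (fun y => cexpi (p y)).
Proof.
move=> cp; split=> x /=.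
- exact: (@continuous_comp _ _ _ p cos x (cp x) (@continuous_cos R (p x))).
- exact: (@continuous_comp _ _ _ p sin x (cp x) (@continuous_sin R (p x))).
Qed.

Variable n : nat.
Implicit Types (m x y : 'rV[R]_n).

Lemma dotrD m x y : dotr m (x + y) = dotr m x + dotr m y.
Proof. by rewrite /dotr -big_split; apply: eq_bigr => i _; rewrite rowD mulrDr. Qed.

Lemma dotrZ m (h : R) x : dotr m (h *: x) = h * dotr m x.
Proof. by rewrite /dotr mulr_sumr; apply: eq_bigr => i _; rewrite rowZ mulrCA. Qed.

Lemma dotr_delta m i : dotr m (delta_mx 0 i) = m 0 i.
Proof.
rewrite /dotr (bigD1 i)//= rowE eqxx mulr1 big1 ?addr0// => j ji.
by rewrite rowE (negbTE ji) mulr0.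
Qed.

Lemma dotr_le m x : `|dotr m x| <= (\sum_i `|m 0 i|) * `|x|.
Proof.
rewrite mulr_suml; apply: (le_trans (ler_norm_sum _ _ _)).
by apply: ler_sum => i _; rewrite normrM ler_wpM2l// coord_le.
Qed.

Lemma dotr_cont m : continuous (dotr m : 'rV[R]_n -> R^o).
Proof.
apply: (@lipmap_cont R _ _ _ (\sum_i `|m 0 i|)) => x y.
have -> : dotr m x - dotr m y = dotr m (x - y).
  by rewrite dotrD -[X in dotr m x + dotr m X]scaleN1r dotrZ mulN1r.
exact: dotr_le.
Qed.

Lemma is_derive_dotr m i x : is_derive x (delta_mx 0 i) (dotr m : 'rV[R]_n -> R^o) (m 0 i).
Proof.
apply: (@is_derive_quad R _ _ _ _ _ 0) => t.
rewrite dotrD dotrZ dotr_delta mul0r (_ : _ - _ - _ = 0) ?normr0//; ring.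
Qed.

Definition ech m x : R[i] := cexpi (dotr m x).

Lemma ech_isD m i : isD i (ech m) (fun x => Complex (m 0 i) 0 * ech m x).
Proof. by move=> x; apply: cder_cexpi; exact: is_derive_dotr. Qed.

Lemma smooth_ech m : csmooth (ech m).
Proof.
suff H k (c : R[i]) : Cs k (fun x => c * ech m x).
  apply/csmoothP => k; rewrite (_ : ech m = fun x => 1 * ech m x); first exact: H.
  by apply/funext => x; rewrite mul1r.
have cc : ccont (fun x => c * ech m x).
  by apply: ccont_mul; [exact: ccont_cst|apply: ccont_cexpi; exact: dotr_cont].
elim: k c cc => [|k IH] c cc //.
split=> // i; exists (fun x => (c * Complex (m 0 i) 0) * ech m x).
  move=> x; apply: (cder_eq (cder_mul (cder_cst c x _) (ech_isD m i x))).
  by rewrite mul0r add0r; ring.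
by apply: IH; apply: ccont_mul; [exact: ccont_cst|apply: ccont_cexpi; exact: dotr_cont].
Qed.

Lemma dl_ech m l : dl l (ech m) = fun x => \prod_(i <- l) Complex (m 0 i) 0 * ech m x.
Proof.
elim: l => [|i l IH]; first by apply/funext => x; rewrite big_nil mul1r.
rewrite dl_cons IH (D1_scale i _ (smooth_ech m)).
rewrite (isD_D1 (ech_isD m i)); apply/funext => x.
by rewrite big_cons; ring.
Qed.

Lemma dl_ech_le m l x : cabs (dl l (ech m) x) <= `|m| ^+ size l.
Proof.
rewrite dl_ech cabsM cabs_cexpi mulr1.
elim: l => [|i l IH]; first by rewrite big_nil cabs1.
rewrite big_cons cabsM cabs_real exprS.
by apply: ler_pM => //; [exact: cabs_ge0|exact: coord_le].
Qed.

Variable s : R.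
Hypothesis hs : 1 < s.

Lemma gb_ech m x : gb s `|m| 1 (ech m) x.
Proof.
move=> l; apply: (le_trans (dl_ech_le m l x)); rewrite mul1r.
by rewrite ler_peMr ?exprn_ge0// Fs_ge1.
Qed.

(** A Gevrey radius independent of the frequency, paid for by a subexponential
    factor. *)
Lemma gb_ech_wexp m x c : 0 < c -> gb s (gK s c) (wexp s c `|m|) (ech m) x.
Proof.
move=> c0 l; apply: (le_trans (dl_ech_le m l x)).
by rewrite -mulrA mulrC; exact: pow_le_wexp.
Qed.

End Characters.

Section Tail.
Variables (R : realType) (n : nat).
Implicit Types (w : 'rV[R]_n -> R[i]) (x : 'rV[R]_n.+1).

Definition tl x : 'rV[R]_n := \row_j x 0 (@rshift 1 n j).
Definition hd : 'I_n.+1 := @lshift 1 n 0.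

Lemma tl_neq_hd j : (@rshift 1 n j == hd :> 'I_n.+1) = false.
Proof. by apply/negbTE/eqP => /(congr1 (@nat_of_ord _)). Qed.

Lemma tl_eq j k : (@rshift 1 n j == @rshift 1 n k :> 'I_n.+1) = (j == k).
Proof. by rewrite -!val_eqE /= eqn_add2l. Qed.

Lemma tl_cons t y : tl (cons1 t y) = y.
Proof. by apply/rowP => j; rewrite mxE cons1_tail. Qed.

Lemma tl_sub x y : `|tl x - tl y| <= `|x - y|.
Proof.
apply: norm_coordP => // j; rewrite rowB !mxE -rowB.
exact: coord_le.
Qed.

Lemma tl_cont : continuous tl.
Proof. by apply: (@lipmap_cont R _ _ _ 1) => x y; rewrite mul1r tl_sub. Qed.

Lemma tl_hd (h : R) x : tl (h *: delta_mx 0 hd + x) = tl x.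
Proof.
apply/rowP => j; rewrite mxE [RHS]mxE rowD rowZ rowE.
by rewrite tl_neq_hd mulr0 add0r.
Qed.

Lemma tl_tail (h : R) x j :
  tl (h *: delta_mx 0 (@rshift 1 n j : 'I_n.+1) + x) = h *: delta_mx 0 j + tl x.
Proof.
by apply/rowP => k; rewrite mxE rowD rowZ rowE tl_eq rowD rowZ rowE mxE.
Qed.

Lemma ord_cases (i : 'I_n.+1) : i = hd \/ exists j, i = @rshift 1 n j.
Proof.
case: (@fintype.splitP 1 n i) => j E; last by right; exists j; exact: val_inj.
by left; apply: val_inj; rewrite /= E ord1.
Qed.

Lemma isD_tl_hd w : isD hd (fun x => w (tl x)) (fun=> 0).
Proof.
move=> x; rewrite mulr0; split; apply/is_derive_line.
- rewrite (_ : (fun h : R => _) = cst (Re (w (tl x)) : R^o)); last first.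
    by apply/funext => h; rewrite tl_hd.
  exact: is_derive_cst.
- rewrite (_ : (fun h : R => _) = cst (Im (w (tl x)) : R^o)); last first.
    by apply/funext => h; rewrite tl_hd.
  exact: is_derive_cst.
Qed.

Lemma isD_tl w w' j : isD j w w' ->
  isD (@rshift 1 n j : 'I_n.+1) (fun x => w (tl x)) (fun x => w' (tl x)).
Proof.
move=> H x.
have := @cder_pullback R _ _ w tl x (delta_mx 0 (@rshift 1 n j : 'I_n.+1)) (delta_mx 0 j) 1 _ _ (H (tl x)).
move=> /(_ _)/cder_eq; apply; last by rewrite (_ : Complex 1 0 = 1)// mul1r.
by move=> h; rewrite mulr1 tl_tail.
Qed.

Lemma smooth_tl w : csmooth w -> csmooth (fun x => w (tl x)).
Proof.
move=> /csmoothP sw; apply/csmoothP => k; elim: k w sw => [|k IH] w sw.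
  exact: ccont_comp tl_cont (Cs_ccont (sw 0%N)).
split; first exact: ccont_comp tl_cont (Cs_ccont (sw 0%N)).
move=> i; case: (ord_cases i) => [->|[j ->]].
  by exists (fun=> 0); [exact: isD_tl_hd|exact: Cs_cst].
have sw' : csmooth w by apply/csmoothP.
exists (fun x => D1 j w (tl x)); first by apply: isD_tl; exact: smooth_isD.
by apply: IH => k'; have /csmoothP := smooth_D1 j sw'.
Qed.

Lemma dl_tl w l : csmooth w -> dl l (fun x => w (tl x)) = (fun=> 0) \/
  exists2 l', size l' = size l & dl l (fun x => w (tl x)) = fun x => dl l' w (tl x).
Proof.
move=> sw; elim: l => [|i l IH]; first by right; exists [::].
rewrite dl_cons; case: IH => [->|[l' sl' ->]]; first by left; rewrite D1_cst.
case: (ord_cases i) => [->|[j ->]].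
  by left; exact: (isD_D1 (isD_tl_hd _)).
right; exists (j :: l'); first by rewrite /= sl'.
by apply: isD_D1; apply: isD_tl; apply: smooth_isD; exact: smooth_dl.
Qed.

Lemma gb_tl s h A w x : 1 < s -> 0 <= h -> csmooth w -> gb s h A w (tl x) ->
  gb s h A (fun x => w (tl x)) x.
Proof.
move=> hs h0 sw gw l; case: (dl_tl l sw) => [->|[l' <- ->]]; last exact: gw.
rewrite cabs0 mulr_ge0//; last exact: ltW (Fs_gt0 _ _).
by rewrite mulr_ge0 ?exprn_ge0// (gb_ge0 gw).
Qed.

Lemma dotr_cons mu m x : dotr (cons1 mu m) x = mu * x 0 hd + dotr m (tl x).
Proof.
rewrite /dotr (@big_split_ord _ _ _ 1 n) /= big_ord1 cons1_head; congr (_ + _).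
by apply: eq_bigr => j _; rewrite cons1_tail mxE.
Qed.

Lemma ech_cons mu m x : ech (cons1 mu m) x = ech (cons1 mu 0) x * ech m (tl x).
Proof.
rewrite /ech !dotr_cons -cexpiD; congr (cexpi (_ + _)).
by rewrite /dotr [X in _ = _ + X]big1 ?addr0// => j _; rewrite mxE mul0r.
Qed.

Lemma norm_cons0 mu : `|cons1 mu (0 : 'rV[R]_n)| = `|mu|.
Proof.
apply/eqP; rewrite eq_le; apply/andP; split; last exact: cons1_norml.
have := cons1_distl mu 0 (0 : 'rV[R]_n).
by rewrite cons1_00 !subr0.
Qed.

Lemma cons1_delta t (y : 'rV[R]_n) : cons1 t y = t *: delta_mx 0 hd + cons1 0 y.
Proof.
apply/rowP => i; rewrite rowD rowZ rowE; case: (ord_cases i) => [->|[j ->]].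
  by rewrite !cons1_head eqxx mulr1 addr0.
by rewrite !cons1_tail tl_neq_hd mulr0 add0r.
Qed.

Lemma cons_axis t : axis_map (@cons1 R n t) (fun=> 1) (fun j => @rshift 1 n j : 'I_n.+1).
Proof.
split.
  by apply: (@lipmap_cont R _ _ _ 1) => x y; rewrite mul1r cons1_distr.
move=> x j h; rewrite mulr1.
apply/rowP => i; rewrite rowD rowZ rowE; case: (ord_cases i) => [->|[k ->]].
  by rewrite !cons1_head eq_sym tl_neq_hd mulr0 add0r.
by rewrite !cons1_tail rowD rowZ rowE tl_eq.
Qed.

Lemma perm_hd_tl (l : seq 'I_n.+1) : exists q l',
  perm_eq l (nseq q hd ++ [seq (@rshift 1 n j : 'I_n.+1) | j <- l']).
Proof.
elim: l => [|i l [q [l' pl]]]; first by exists 0%N, [::].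
case: (ord_cases i) => [->|[j ->]].
  by exists q.+1, l'; rewrite /= perm_cons.
exists q, (j :: l'); rewrite map_cons perm_sym.
have := perm_catCA (nseq q hd) [:: rshift 1 j : 'I_n.+1] [seq (@rshift 1 n j : 'I_n.+1) | j <- l'].
move=> /permPl/perm_trans; apply; rewrite /= perm_cons perm_sym; exact: pl.
Qed.

End Tail.

(** * Trigonometric interpolation in one variable *)

Section Interpolation.
Variables (R : realType) (s : R).
Hypothesis hs : 1 < s.

Lemma inv_sqr_telescope (x : R) : 0 <= x \/ x <= -1 ->
  (1 + `|x|) ^- 2 <= 2 * ((x + 1) / (1 + `|x + 1|) - x / (1 + `|x|)).
Proof.
move=> [x0|x1].
  rewrite !ger0_norm ?addr_ge0//.
  have a0 : 0 < 1 + x by lra.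
  have b0 : 0 < 1 + (x + 1) by lra.
  have -> : 2 * ((x + 1) / (1 + (x + 1)) - x / (1 + x)) = 2 / ((1 + x) * (1 + (x + 1))).
    by field; rewrite !gt_eqF.
  rewrite ler_pdivlMr ?mulr_gt0// mulrC ler_pdivrMr ?exprn_gt0//.
  by rewrite expr2 mulrCA ler_pM2l//; lra.
have x0 : x <= 0 by lra.
have x10 : x + 1 <= 0 by lra.
rewrite !ler0_norm//.
have a0 : 0 < 1 - x by lra.
have b0 : 0 < 1 - (x + 1) by lra.
have -> : 2 * ((x + 1) / (1 - (x + 1)) - x / (1 - x)) = 2 / ((1 - x) * (1 - (x + 1))).
  by field; rewrite !gt_eqF.
rewrite ler_pdivlMr ?mulr_gt0// mulrC ler_pdivrMr ?exprn_gt0//.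
by rewrite expr2 mulrCA ler_pM2l//; lra.
Qed.

(** The weight is at most a multiple of [(1 + |j - K|) ^ -2], whose sum
    telescopes. *)
Lemma weight_sum (c tau : R) : 0 < c -> 0 < tau -> exists2 Z : R, 0 <= Z &
  forall K, \sum_(j < K.*2.+1) wexp s (- c) (tau * `|j%:R - K%:R|) <= Z.
Proof.
move=> c0 tau0.
pose z := 2 + 2 * (tau ^- 2 * (gK s c ^+ 2 * Fs s 2)).
have z0 : 0 <= z.
  rewrite addr_ge0// mulr_ge0// mulr_ge0 ?invr_ge0 ?sqr_ge0//.
  by rewrite mulr_ge0 ?sqr_ge0// ltW// Fs_gt0.
exists (z * 4); first by rewrite mulr_ge0.
move=> K.
have le1 (x : R) : wexp s (- c) (tau * `|x|) <= z * (1 + `|x|) ^- 2.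
  have x0 := normr_ge0 x.
  rewrite wexpN -(ler_pM2r (_ : 0 < (1 + `|x|) ^+ 2)) ?exprn_gt0 ?ltr_wpDr//.
  rewrite mulfVK ?expf_neq0 ?gt_eqF ?ltr_wpDr// mulrC ler_pdivrMr ?wexp_gt0//.
  have := @pow_le_wexp R s hs c (tau * `|x|) 2 c0 (mulr_ge0 (ltW tau0) x0).
  have := @wexp_ge1 R s c (tau * `|x|) (ltW c0).
  set W := wexp _ _ _ => W1; rewrite exprMn => H.
  have {}H : `|x| ^+ 2 <= tau ^- 2 * (gK s c ^+ 2 * Fs s 2) * W.
    rewrite -mulrA [leRHS]mulrC ler_pdivlMr ?exprn_gt0// mulrC; exact: H.
  rewrite /z mulrDl -[2 * _ * W]mulrA.
  have : 0 <= (1 - `|x|) ^+ 2 by exact: sqr_ge0.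
  move: H; set Y := _ * W; rewrite !expr2; move: `|x| => y; nra.
pose G j : R := (j%:R - K%:R) / (1 + `|j%:R - K%:R|).
have G1 j : `|G j| <= 1.
  rewrite normrM normfV [`|1 + _|]ger0_norm ?addr_ge0// ler_pdivrMr ?ltr_wpDr//.
  by rewrite mul1r lerDr.
apply: (@le_trans _ _ (\sum_(j < K.*2.+1) z * (2 * (G j.+1 - G j)))).
  apply: ler_sum => j _; apply: (le_trans (le1 _)); apply: ler_wpM2l => //.
  rewrite /G -[j.+1%:R]natr1 addrAC; apply: inv_sqr_telescope.
  have [h|h] := leP K j; first by left; rewrite subr_ge0 ler_nat.
  have : (j.+1%:R : R) <= K%:R by rewrite ler_nat.
  by rewrite -natr1 => jK; right; lra.
rewrite -mulr_sumr ler_wpM2l// -mulr_sumr.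
rewrite -(big_mkord xpredT (fun j => G j.+1 - G j)) telescope_sumr//.
have := G1 K.*2.+1; have := G1 0%N; rewrite !ler_norml; lra.
Qed.

Variables (n K : nat) (L : R).
Hypothesis L0 : 0 < L.
Implicit Types (u v : 'rV[R]_n.+1 -> R[i]).
Let N := K.*2.+1.
Let dt : R := L / N%:R.
Let dt0 : 0 < dt. Proof. by rewrite divr_gt0// ltr0n. Qed.
Let N0 : N%:R != 0 :> R. Proof. by rewrite pnatr_eq0. Qed.
Let Ndt : N%:R * dt = L. Proof. by rewrite /dt mulrC divfK. Qed.

(** The frequencies are centred at 0: only then do the [N] points of the grid
    see decay in the frequency. *)
Definition freq (j : nat) : R := 2 * pi / L * (j%:R - K%:R).

Definition coef u (j : nat) (y : 'rV[R]_n) : R[i] :=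
  Complex N%:R^-1 0 *
  \sum_(k < N) cexpi (- (freq j * (k%:R * dt))) * u (cons1 (k%:R * dt) y).

(** Trigonometric interpolation of [u] in the first variable. *)
Definition interp u (x : 'rV[R]_n.+1) : R[i] :=
  \sum_(j < N) ech (cons1 (freq j) 0) x * coef u j (tl x).

Definition box_supp m (u : 'rV[R]_m -> R[i]) :=
  forall (x : 'rV[R]_m) i, x 0 i <= 0 \/ L <= x 0 i -> u x = 0.

Lemma smooth_cons u t : csmooth u -> csmooth (fun y => u (cons1 t y)).
Proof. by move=> su; exact: (smooth_pull (cons_axis n t) su). Qed.

Lemma smooth_coef u j : csmooth u -> csmooth (coef u j).
Proof.
move=> su; apply: smooth_scale; apply: smooth_sum => k; apply: smooth_scale.
exact: smooth_cons.
Qed.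

Lemma dl_cons1 u t l y : csmooth u -> dl l (fun y => u (cons1 t y)) y =
  dl [seq (@rshift 1 n j : 'I_n.+1) | j <- l] u (cons1 t y).
Proof.
move=> su; rewrite (dl_pull l (cons_axis n t) su).
by rewrite big1_eq (_ : Complex 1 0 = 1)// mul1r.
Qed.

Lemma box_coef u j : box_supp u -> box_supp (coef u j).
Proof.
move=> bu y i yi; rewrite /coef big1 ?mulr0// => k _.
by rewrite (bu _ (@rshift 1 n i)) ?mulr0// cons1_tail.
Qed.

(** The power of [i] turns iterated [D] into ordinary derivatives in the first
    variable. *)
Definition line u l (y : 'rV[R]_n) (q : nat) (t : R) : R[i] :=
  Complex 0 1 ^+ q * dl (nseq q (hd n) ++ l) u (t *: delta_mx 0 (hd n) + cons1 0 y).

Lemma cder_line u l y q t : csmooth u ->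
  cder (line u l y q : R^o -> R[i]) t 1 (line u l y q.+1 t).
Proof.
move=> su; have := cder_slice (hd n) (cons1 0 y) t (smooth_dl (nseq q (hd n) ++ l) su).
move=> /(cder_mul (cder_cst (Complex 0 1 ^+ q) t 1)) /cder_eq; apply.
by rewrite /line exprS mul0r add0r /=; ring.
Qed.

Lemma line_le u l y q t h A : (forall x, gb s h A u x) ->
  cabs (line u l y q t) <= A * h ^+ (q + size l) * Fs s (q + size l).
Proof.
move=> gu; rewrite /line cabsM cabsX cabs_i expr1n mul1r.
by have := gu (t *: delta_mx 0 (hd n) + cons1 0 y) (nseq q (hd n) ++ l); rewrite size_cat size_nseq.
Qed.

Lemma line0 u l y t : line u l y 0 t = dl l u (cons1 t y).
Proof. by rewrite /line expr0 mul1r -cons1_delta. Qed.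

Lemma freq_dt j : (j < N)%N -> `|freq j * dt| <= pi.
Proof.
move=> jN; have pi0 := pi_gt0 R; have Np : 0 < N%:R :> R by rewrite ltr0n.
have -> : freq j * dt = 2 * pi / N%:R * (j%:R - K%:R).
  by rewrite /freq /dt; field; rewrite N0 gt_eqF.
rewrite normrM ger0_norm ?divr_ge0 ?mulr_ge0 ?(ltW pi0)//.
rewrite mulrAC ler_pdivrMr// mulrC mulrA [leRHS]mulrC ler_wpM2r ?(ltW pi0)//.
have jK : `|j%:R - K%:R| <= K%:R :> R.
  have : (j%:R : R) <= (K + K)%:R by rewrite ler_nat addnn -ltnS.
  have := ler0n R j; rewrite natrD ler_norml; lra.
have -> : N%:R = K%:R + K%:R + 1 :> R by rewrite /N -addnn -natr1 natrD.
have := ler0n R K; lra.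
Qed.

(** Summing by parts [p] times gains [|freq j| ^ p]; the tail derivatives [l] only
    pass through. *)
Lemma coef_pow u h A j l y p : (j < N)%N -> 0 < h -> csmooth u ->
  (forall x, gb s h A u x) -> box_supp u ->
  `|freq j| ^+ p * cabs (dl l (coef u j) y) <=
  A * (s2 s * h) ^+ size l * Fs s (size l) * (8 * (s2 s * h)) ^+ p * Fs s p.
Proof.
move=> jN h0 su gu bu.
pose l' := [seq (@rshift 1 n j : 'I_n.+1) | j <- l].
have sl' : size l' = size l by rewrite size_map.
pose w : R[i] := cexpi (- (freq j * dt)).
have E : dl l (coef u j) y =
    Complex N%:R^-1 0 * \sum_(k < N) line u l' y 0 (k%:R * dt) * w ^+ k.
  rewrite /coef dl_scale; last first.
    by apply: smooth_sum => k; apply: smooth_scale; exact: smooth_cons.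
  congr (_ * _); rewrite dl_sum; last first.
    by move=> k; apply: smooth_scale; exact: smooth_cons.
  apply: eq_bigr => k _; rewrite dl_scale; last exact: smooth_cons.
  rewrite dl_cons1// line0 mulrC; congr (_ * _).
  by rewrite -cexpiMn; congr cexpi; ring.
have A0 := gb_ge0 (gu 0).
pose B q := A * h ^+ (q + size l) * Fs s (q + size l).
have lv q t : cabs (line u l' y q t) <= B q.
  by rewrite /B -sl'; exact: line_le.
have l0 t : t <= 0 \/ L <= t -> line u l' y 0 t = 0.
  move=> t0; rewrite line0 -dl_cons1//.
  rewrite (_ : (fun y => _) = fun=> 0); first by rewrite dl_cst; case: l {E l' sl' B lv}.
  by apply/funext => z; rewrite (bu _ (hd n))// cons1_head.
have := @sum_by_parts R (line u l' y) B dt w p N dt0 (cabs_cexpi _)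
  (fun q t => cder_line l' y q t su) lv.
have lL t : N%:R * dt <= t -> line u l' y 0 t = 0 by rewrite Ndt => Lt; apply: l0; right.
move=> /(_ (fun t t0 => l0 t (or_introl t0)) lL).
rewrite E cabsM cabs_real [`|N%:R^-1|]ger0_norm ?invr_ge0//.
set S := cabs _ => HS.
have S0 : 0 <= S by exact: cabs_ge0.
have wp : `|freq j| * (dt / 2) <= cabs (1 - w).
  apply: le_trans (cabs_1Bcexpi_ge _); last by rewrite normrN freq_dt.
  by rewrite normrN [`|freq j * dt|]normrM (ger0_norm (ltW dt0)) mulrA.
have dp : 0 < (dt / 2) ^+ p by rewrite exprn_gt0// divr_gt0.
have {HS}HS : S * `|freq j| ^+ p <= (N + p)%:R * 4 ^+ p * B p.
  rewrite -(ler_pM2r dp); apply: (le_trans _ (le_trans HS (eq_ler _))).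
    rewrite -mulrA ler_wpM2l// -exprMn ler_expn// mulr_ge0 ?divr_ge0//; exact: ltW.
  have -> : 2 * dt = 4 * (dt / 2) by field.
  by rewrite exprMn; ring.
have Np : 0 < N%:R :> R by rewrite ltr0n.
have Bp : B p <= A * ((s2 s * h) ^+ p * (s2 s * h) ^+ size l) * (Fs s p * Fs s (size l)).
  rewrite /B -mulrA -[leRHS]mulrA ler_wpM2l//.
  rewrite -exprD [(s2 s * h) ^+ _]exprMn [s2 s ^+ _ * _]mulrC -mulrA ler_wpM2l ?exprn_ge0 ?(ltW h0)//.
  exact: FsD.
have Np2 : (N + p)%:R <= N%:R * 2 ^+ p :> R.
  rewrite -natrX -natrM ler_nat.
  have := ltn_expl p (isT : 1 < 2)%N; move: (2 ^ p)%N => z pz.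
  have := leq_mul (leqnn N) pz; rewrite mulnS => /(leq_trans _); apply.
  by rewrite leq_add2l leq_pmull.
have B0 : 0 <= B p by exact: le_trans (cabs_ge0 _) (lv p 0).
have -> : `|freq j| ^+ p * (N%:R^-1 * S) = S * `|freq j| ^+ p / N%:R by ring.
rewrite ler_pdivrMr//; apply: (le_trans HS).
apply: (@le_trans _ _ (N%:R * 2 ^+ p * 4 ^+ p * B p)).
  by rewrite ler_wpM2r// ler_wpM2r ?exprn_ge0.
apply: (@le_trans _ _ (N%:R * 2 ^+ p * 4 ^+ p *
   (A * ((s2 s * h) ^+ p * (s2 s * h) ^+ size l) * (Fs s p * Fs s (size l))))).
  by apply: ler_wpM2l Bp; rewrite mulr_ge0 ?exprn_ge0// mulr_ge0 ?exprn_ge0// ltW.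
apply: eq_ler; rewrite [(8 * _) ^+ p]exprMn (_ : 8 = 2 * 4); last by ring.
by rewrite [(2 * 4) ^+ p]exprMn; ring.
Qed.

Lemma coef_gb u h A j y : (j < N)%N -> 0 < h -> csmooth u ->
  (forall x, gb s h A u x) -> box_supp u ->
  gb s (s2 s * h) (s2 s * A * wexp s (- sdec s (8 * (s2 s * h))) `|freq j|) (coef u j) y.
Proof.
move=> jN h0 su gu bu l.
have s20 : 0 < s2 s by apply: lt_le_trans (s2_ge1 hs).
have H0 : 0 < 8 * (s2 s * h) by rewrite mulr_gt0// mulr_gt0.
have := @wexp_le_of_pow R s hs `|freq j| (8 * (s2 s * h)) (cabs (dl l (coef u j) y))
  (A * (s2 s * h) ^+ size l * Fs s (size l)) (normr_ge0 _) H0 (cabs_ge0 _).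
move=> /(_ (fun p => coef_pow l y p jN h0 su gu bu)).
rewrite -/(sdec s _) wexpN -ler_pdivlMr ?wexp_gt0// => /le_trans; apply.
by apply: eq_ler; ring.
Qed.

Lemma smooth_interp u : csmooth u -> csmooth (interp u).
Proof.
move=> su; apply: smooth_sum => j; apply: smooth_mul; first exact: smooth_ech.
by apply: smooth_tl; exact: smooth_coef.
Qed.

Lemma gb_sum m (I : Type) (r : seq I) (F : I -> 'rV[R]_m -> R[i]) (A : I -> R) h x : 0 <= h ->
  (forall k, csmooth (F k)) -> (forall k, gb s h (A k) (F k) x) ->
  gb s h (\sum_(k <- r) A k) (fun x => \sum_(k <- r) F k x) x.
Proof.
move=> h0 sF gF; elim: r => [|k r IH].
  rewrite big_nil (_ : (fun x => _) = fun=> 0); last by apply/funext => z; rewrite big_nil.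
  by have := @gb_cst R s m h 0 x h0; rewrite cabs0.
rewrite big_cons (_ : (fun x => _) = fun x => F k x + \sum_(k <- r) F k x); last first.
  by apply/funext => z; rewrite big_cons.
by apply: gb_add => //; exact: smooth_sum.
Qed.

Lemma interp_gb u h A c x : 0 < h -> 0 < c -> csmooth u ->
  (forall x, gb s h A u x) -> box_supp u ->
  gb s (gK s c + s2 s * h)
    (\sum_(j < N) wexp s c `|freq j| *
       (s2 s * A * wexp s (- sdec s (8 * (s2 s * h))) `|freq j|)) (interp u) x.
Proof.
move=> h0 c0 su gu bu.
have s20 : 0 < s2 s by apply: lt_le_trans (s2_ge1 hs).
apply: gb_sum => [|j|j].
- by rewrite addr_ge0 ?gK_ge0// mulr_ge0// ltW.
- apply: smooth_mul; first exact: smooth_ech.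
  by apply: smooth_tl; exact: smooth_coef.
- apply: gb_mul => //; first exact: gK_ge0.
  + by rewrite mulr_ge0// ltW.
  + exact: smooth_ech.
  + by apply: smooth_tl; exact: smooth_coef.
  + by rewrite -(norm_cons0 n); exact: gb_ech_wexp.
  + apply: gb_tl => //; [by rewrite mulr_ge0// ltW|exact: smooth_coef|].
    exact: coef_gb.
Qed.

(** At the last point both sides vanish, by periodicity of the interpolant. *)
Lemma interp_grid u k y : box_supp u -> (k <= N)%N ->
  interp u (cons1 (k%:R * dt) y) = u (cons1 (k%:R * dt) y).
Proof.
move=> bu; have main i : (i < N)%N -> interp u (cons1 (i%:R * dt) y) = u (cons1 (i%:R * dt) y).
  move=> iN; rewrite /interp /coef tl_cons.
  under eq_bigr => j _ do rewrite mulrCA mulr_sumr.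
  rewrite -mulr_sumr exchange_big /=.
  rewrite (eq_bigr (fun k : 'I_N => (if i == k then N%:R else 0) * u (cons1 (k%:R * dt) y))).
    rewrite (bigD1 (Ordinal iN))//= eqxx big1 ?addr0; last first.
      move=> k'; rewrite -val_eqE /= eq_sym => /negbTE ->; exact: mul0r.
    rewrite mulrA (_ : Complex N%:R^-1 0 * N%:R = 1) ?mul1r//.
    apply: ceq; rewrite !cparts /=; last first.
      by rewrite mul0r addr0 (_ : Im N%:R = 0) ?mulr0//; elim: N => //= m IH; rewrite -natr1 Im_add IH addr0.
    rewrite mul0r subr0 (_ : Re N%:R = N%:R :> R) ?mulVf//.
    by elim: N => //= m IH; rewrite -!natr1 Re_add IH.
  move=> k' _; rewrite -(@dft_orthogonality R N K i k')// mulr_suml.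
  apply: eq_bigr => j _; rewrite [LHS]mulrA; congr (_ * _); rewrite /ech -cexpiD.
  congr cexpi; rewrite dotr_cons /dotr big1 ?addr0 => [|j' _]; last by rewrite mxE mul0r.
  rewrite cons1_head /freq /dt; field; rewrite N0 /= gt_eqF//.
rewrite leq_eqVlt => /orP[/eqP ->|]; last exact: main.
rewrite Ndt (bu (cons1 L y) (hd n)); last by rewrite cons1_head; right.
have := main 0%N (ltn0Sn _); rewrite mul0r (bu (cons1 0 y) (hd n)); last first.
  by rewrite cons1_head; left.
move=> <-; rewrite /interp; apply: eq_bigr => j _; rewrite !tl_cons; congr (_ * _).
rewrite /ech !dotr_cons !cons1_head !tl_cons !cexpiD mulr0 cexpi0; congr (_ * _).
rewrite (_ : freq j * L = j%:R * (2 * pi) - K%:R * (2 * pi)); last first.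
  by rewrite /freq; field; rewrite gt_eqF.
rewrite cexpiD cexpiN (cexpiMn (2 * pi) j) (cexpiMn (2 * pi) K).
by rewrite cexpi_2pi !expr1n conjc1 mulr1.
Qed.

(** In the first variable this is [grid_derivative] for every mixed derivative.
    The larger radius absorbs the shift of the order by one, and orders beyond
    the number of grid points are covered by the trivial bound. *)
Lemma grid_small v h A (x : 'rV[R]_n.+1) : 0 < h -> csmooth v -> (forall x, gb s h A v x) ->
  (forall k y, (k <= N)%N -> v (cons1 (k%:R * dt) y) = 0) ->
  0 <= x 0 (hd n) <= L ->
  gb s (2 * (s2 s * h)) ((1 + 2 * L * (s2 s * h)) / N%:R * A) v x.
Proof.
move=> h0 sv gv v0 xL l.
have s20 : 0 < s2 s by apply: lt_le_trans (s2_ge1 hs).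
have A0 := gb_ge0 (gv 0).
have Np : 0 < N%:R :> R by rewrite ltr0n.
have [q [l0 pl]] := perm_hd_tl l; rewrite (dl_perm sv pl).
pose l' := [seq (@rshift 1 n j : 'I_n.+1) | j <- l0].
pose y := tl x; pose t := x 0 (hd n).
have xE : x = cons1 t y.
  by rewrite {1}(cons1_eta x); congr cons1; apply/rowP => j; rewrite !mxE.
have sl : size l = (q + size l')%N by rewrite (perm_size pl) size_cat size_nseq.
pose k := (q + size l')%N.
pose B q := A * h ^+ (q + size l') * Fs s (q + size l').
have lv q' t' : cabs (line v l' y q' t') <= B q' by exact: line_le.
have B0 q' : 0 <= B q' by exact: le_trans (cabs_ge0 _) (lv q' 0).
have lE : cabs (line v l' y q t) = cabs (dl (nseq q (hd n) ++ l') v x).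
  by rewrite /line cabsM cabsX cabs_i expr1n mul1r -cons1_delta -xE.
rewrite -/l' -lE.
have v00 i : (i <= N)%N -> line v l' y 0 (i%:R * dt) = 0.
  move=> iN; rewrite line0 -dl_cons1//.
  rewrite (_ : (fun y => _) = fun=> 0); first by rewrite dl_cst; case: (l0).
  by apply/funext => z; exact: v0.
have dv q' t' := cder_line l' y q' t' sv.
have H : cabs (line v l' y q t) <= q.+1%:R / N%:R * (2 * (L * B q.+1) + B q).
  have [qN|qN] := ltnP q N.
    have HR : `|Re (line v l' y q t)| <= q.+1%:R * dt * B q.+1.
      apply: (@grid_derivative R (fun q t => Re (line v l' y q t)) B dt N q t) => //.
      - by move=> q' t'; have [] := dv q' t'.
      - by move=> q' t' _; apply: le_trans (cabs_Re _) (lv _ _).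
      - by move=> i iN; rewrite v00.
      - by rewrite Ndt.
    have HI : `|Im (line v l' y q t)| <= q.+1%:R * dt * B q.+1.
      apply: (@grid_derivative R (fun q t => Im (line v l' y q t)) B dt N q t) => //.
      - by move=> q' t'; have [] := dv q' t'.
      - by move=> q' t' _; apply: le_trans (cabs_Im _) (lv _ _).
      - by move=> i iN; rewrite v00.
      - by rewrite Ndt.
    apply: (le_trans (cabs_le_ReIm _)); apply: (le_trans (lerD HR HI)).
    rewrite mulrDr; apply: (@le_trans _ _ (q.+1%:R / N%:R * (2 * (L * B q.+1)))).
      by apply: eq_ler; rewrite /dt; ring.
    by rewrite lerDl mulr_ge0// divr_ge0.
  apply: (le_trans (lv _ _)).
  apply: (@le_trans _ _ (q.+1%:R / N%:R * B q)).
    by rewrite ler_peMl// ler_pdivlMr// mul1r ler_nat (leq_trans qN).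
  by rewrite ler_wpM2l ?divr_ge0// lerDr mulr_ge0// mulr_ge0// ltW.
apply: (le_trans H); rewrite sl -/k.
have F1 : Fs s 1 = 1 by rewrite /Fs powR1.
have Bq1 : B q.+1 <= (s2 s * h) * (A * (s2 s * h) ^+ k * Fs s k).
  rewrite /B addSn -/k.
  have := FsD hs k 1; rewrite addn1 F1 mulr1 => hF.
  apply: (@le_trans _ _ (A * h ^+ k.+1 * (s2 s ^+ k.+1 * Fs s k))).
    by rewrite ler_wpM2l// mulr_ge0 ?exprn_ge0 ?(ltW h0).
  by apply: eq_ler; rewrite [(s2 s * h) ^+ k]exprMn !exprS; ring.
have Bq : B q <= A * (s2 s * h) ^+ k * Fs s k.
  rewrite /B -/k ler_wpM2r ?(ltW (Fs_gt0 _ _))// ler_wpM2l// ler_expn ?(ltW h0)//.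
  by rewrite ler_peMl ?(ltW h0)// s2_ge1.
have kq : q.+1%:R <= 2 ^+ k :> R.
  by rewrite -natrX ler_nat; apply: leq_trans (ltn_expl q (isT : 1 < 2)%N) _; rewrite leq_exp2l// leq_addr.
set Y := A * (s2 s * h) ^+ k * Fs s k in Bq1 Bq.
have Y0 : 0 <= Y by exact: le_trans (B0 q) Bq.
have sh0 : 0 < s2 s * h by rewrite mulr_gt0.
apply: (@le_trans _ _ (2 ^+ k / N%:R * (2 * (L * (s2 s * h * Y)) + Y))).
  apply: ler_pM.
  - by rewrite divr_ge0.
  - by rewrite addr_ge0// mulr_ge0// mulr_ge0// ltW.
  - by rewrite ler_wpM2r ?invr_ge0.
  - apply: lerD => //; rewrite ler_wpM2l// ler_wpM2l// ltW//.
apply: eq_ler; rewrite /Y [(2 * (s2 s * h)) ^+ k]exprMn; ring.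
Qed.

End Interpolation.

(** * Functionals of subexponential growth on characters *)

Section TensorBound.
Variables (R : realType) (s : R).
Hypothesis hs : 1 < s.

Lemma wexp_half (c X : R) : wexp s (c / 2) X * wexp s (- c) X = wexp s (- (c / 2)) X.
Proof.
have E : c / 2 + - c = - (c / 2) by field.
by rewrite -wexpD E.
Qed.

(** Unlike test functions, these include the characters. *)
Definition gevb n (v : 'rV[R]_n -> R[i]) :=
  csmooth v /\ exists h A, 0 < h /\ forall x, gb s h A v x.

Lemma gevb_comb n (f g : 'rV[R]_n -> R[i]) c : gevb f -> gevb g ->
  gevb (fun x => c * f x + g x).
Proof.
move=> [sf [h [A [h0 gf]]]] [sg [h' [A' [h'0 gg]]]].
have sc := smooth_scale c sf; split; first exact: smooth_add.
exists (Num.max h h'), (cabs c * A + A'); split; first by rewrite lt_max h0.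
move=> x; apply: gb_add => //.
- apply: gb_scale => //; apply: (gb_le (ltW h0) _ (lexx _) (gf x)) => //.
  by rewrite le_max lexx.
- by apply: (gb_le (ltW h'0) _ (lexx _) (gg x)) => //; rewrite le_max lexx orbT.
Qed.

Lemma gevb_mul n (f g : 'rV[R]_n -> R[i]) : gevb f -> gevb g -> gevb (fun x => f x * g x).
Proof.
move=> [sf [h [A [h0 gf]]]] [sg [h' [A' [h'0 gg]]]].
split; first exact: smooth_mul.
exists (h + h'), (A * A'); split; first exact: addr_gt0.
by move=> x; apply: gb_mul => //; exact: ltW.
Qed.

Lemma gevb_cst n (c : R[i]) : gevb (fun _ : 'rV[R]_n => c).
Proof.
split; first exact: smooth_cst.
by exists 1, (cabs c); split=> // x; exact: gb_cst.
Qed.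

Lemma gevb_ech n (m : 'rV[R]_n) : gevb (ech m).
Proof.
split; first exact: smooth_ech.
exists (`|m| + 1), 1; split; first by rewrite ltr_wpDl.
by move=> x; apply: (gb_le _ _ (lexx _) (gb_ech hs m x)) => //; rewrite lerDl.
Qed.

Lemma gevb_tl n (w : 'rV[R]_n -> R[i]) : gevb w -> gevb (fun x => w (tl x)).
Proof.
move=> [sw [h [A [h0 gw]]]]; split; first exact: smooth_tl.
by exists h, A; split=> // x; apply: gb_tl => //; exact: ltW.
Qed.

Lemma gevb_sum n (I : Type) (r : seq I) (F : I -> 'rV[R]_n -> R[i]) :
  (forall k, gevb (F k)) -> gevb (fun x => \sum_(k <- r) F k x).
Proof.
move=> gF; elim: r => [|k r IH].
  rewrite (_ : (fun x => _) = fun=> 0); first exact: gevb_cst.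
  by apply/funext => x; rewrite big_nil.
rewrite (_ : (fun x => _) = fun x => 1 * F k x + \sum_(k <- r) F k x).
  exact: gevb_comb.
by apply/funext => x; rewrite big_cons mul1r.
Qed.

Definition gevb_linear n (T : ('rV[R]_n -> R[i]) -> R[i]) :=
  forall f g c, gevb f -> gevb g -> T (fun x => c * f x + g x) = c * T f + T g.

Definition in_box n (L : R) (x : 'rV[R]_n) := forall i, 0 <= x 0 i <= L.

Definition gevb_cont n L (T : ('rV[R]_n -> R[i]) -> R[i]) :=
  forall h, 0 < h -> exists C, 0 <= C /\ forall v A, gevb v ->
    (forall x, in_box L x -> gb s h A v x) -> cabs (T v) <= C * A.

Lemma gevb_linear0 n T : gevb_linear T -> T (fun _ : 'rV[R]_n => 0) = 0.
Proof.
move=> linT; have := linT _ _ 1 (gevb_cst n 0) (gevb_cst n 0).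
rewrite (_ : (fun x : 'rV_n => 1 * 0 + 0) = fun=> 0); last first.
  by apply/funext => x; rewrite mulr0 addr0.
by rewrite mul1r => /eqP; rewrite -subr_eq0 opprD addrA subrr sub0r oppr_eq0 => /eqP.
Qed.

Lemma gevb_linear_sum n T (I : Type) (r : seq I) (F : I -> 'rV[R]_n -> R[i]) :
  gevb_linear T -> (forall k, gevb (F k)) ->
  T (fun x => \sum_(k <- r) F k x) = \sum_(k <- r) T (F k).
Proof.
move=> linT gF; elim: r => [|k r IH].
  rewrite big_nil; transitivity (T (fun=> 0)); last exact: gevb_linear0.
  congr T.
  by apply/funext => x; rewrite big_nil.
rewrite (_ : (fun x => _) = fun x => 1 * F k x + \sum_(k <- r) F k x); last first.
  by apply/funext => x; rewrite big_cons mul1r.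
by rewrite linT ?big_cons ?mul1r ?IH//; exact: gevb_sum.
Qed.

Lemma arch_inv (Y e : R) : 0 <= Y -> 0 < e -> exists K : nat, Y / K.*2.+1%:R <= e.
Proof.
move=> Y0 e0; exists (Num.truncn (Y / e)).
have Ye : 0 <= Y / e by rewrite divr_ge0// ltW.
have /andP[_ k2] := Num.Theory.truncn_itv Ye.
rewrite ler_pdivrMr// mulrC -ler_pdivrMr//; apply: (le_trans (ltW k2)).
by rewrite ler_nat ltnS -addnn leq_addr.
Qed.

(** Expanding the first variable over the interpolation frequencies reduces the
    number of variables by one: the decay of the coefficients beats the growth of
    [T] on characters.  Continuity serves only to remove the interpolation error,
    so its constant does not enter the bound; this is what makes the bound uniform
    over a family of functionals. *)
Theorem tensor_bound n L h : 0 < L -> 0 < h -> exists ep C, [/\ 0 < ep, 0 <= C &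
  forall T M, 0 <= M -> gevb_linear T -> gevb_cont L T ->
    (forall m : 'rV[R]_n, cabs (T (ech m)) <= M * \prod_i wexp s ep `|m 0 i|) ->
  forall u A, csmooth u -> (forall x, gb s h A u x) -> box_supp L u ->
    cabs (T u) <= C * M * A].
Proof.
move=> L0; elim: n h => [|n IH] h h0.
  exists 1, 1; split=> // T M M0 linT _ Tm u A su gu _.
  have uE : u = fun x => u 0 * ech 0 x + 0.
    apply/funext => x; rewrite addr0 /ech (_ : dotr 0 x = 0) ?cexpi0 ?mulr1.
      by congr u; apply/rowP => -[].
    by rewrite /dotr big_ord0.
  have T0 := gevb_linear0 linT.
  rewrite uE linT; [|exact: gevb_ech|exact: gevb_cst].
  rewrite T0 addr0 cabsM mul1r mulrC.
  have := Tm 0; rewrite big_ord0 mulr1 => H.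
  apply: ler_pM => //; [exact: cabs_ge0|exact: cabs_ge0|].
  by have := gu 0 [::]; rewrite /= expr0 Fs0 !mulr1.
have s20 : 0 < s2 s by apply: lt_le_trans (s2_ge1 hs).
have sh0 : 0 < s2 s * h by rewrite mulr_gt0.
have [ep' [C' [ep'0 C'0 IHT]]] := IH (s2 s * h) sh0.
pose kp := sdec s (8 * (s2 s * h)).
have kp0 : 0 < kp by apply: sdec_gt0 => //; rewrite mulr_gt0.
have kp2 : 0 < kp / 2 by rewrite divr_gt0.
have tau0 : 0 < 2 * pi / L :> R by rewrite divr_gt0// mulr_gt0// pi_gt0.
have [Z Z0 HZ] := weight_sum hs kp2 tau0.
have freqE K j : `|freq K L j| = 2 * pi / L * `|j%:R - K%:R|.
  by rewrite /freq normrM (gtr0_norm tau0).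
pose ep := Num.min ep' (kp / 2).
exists ep, (C' * s2 s * Z); split.
- by rewrite lt_min ep'0.
- by rewrite !mulr_ge0// ltW.
move=> T M M0 linT contT Tm u A su gu bu.
have A0 := gb_ge0 (gu 0).
pose Tmu mu w := T (fun x => ech (cons1 mu 0) x * w (tl x)).
have gw mu (w : 'rV[R]_n -> R[i]) : gevb w -> gevb (fun x => ech (cons1 mu 0) x * w (tl x)).
  by move=> gvw; apply: gevb_mul; [exact: gevb_ech|exact: gevb_tl].
have Tmu_lin mu : gevb_linear (Tmu mu).
  move=> f g c gf gg; rewrite /Tmu.
  rewrite -linT; [|exact: gw|exact: gw].
  by congr T; apply/funext => x; ring.
have Tmu_cont mu : gevb_cont L (Tmu mu).
  move=> h1 h10; have hm0 : 0 < `|mu| + h1 by rewrite ltr_wpDl.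
  have [C1 [C10 H1]] := contT _ hm0.
  exists C1; split=> // v B gv bv; apply: H1; first exact: gw.
  move=> x xL; rewrite -[B]mul1r; have [sv _] := gv.
  apply: gb_mul => //; [exact: ltW|exact: smooth_ech|exact: smooth_tl| |].
    by rewrite -(norm_cons0 n); exact: gb_ech.
  apply: gb_tl => //; first exact: ltW.
  by apply: bv => i; rewrite mxE.
have Tmu_exp mu m : cabs (Tmu mu (ech m)) <=
    M * wexp s ep `|mu| * \prod_i wexp s ep' `|m 0 i|.
  rewrite /Tmu (_ : (fun x => _) = ech (cons1 mu m)); last first.
    by apply/funext => x; rewrite [RHS]ech_cons.
  apply: (le_trans (Tm _)); rewrite -mulrA ler_wpM2l//.
  rewrite (@big_split_ord _ _ _ 1 n) /= big_ord1 cons1_head.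
  apply: ler_wpM2l; first exact: ltW (wexp_gt0 _ _ _).
  apply: ler_prod => j _.
  rewrite cons1_tail (ltW (wexp_gt0 _ _ _)) /=.
  by apply: wexp_le_c; rewrite ge_min lexx.
have Mw (mu : R) : 0 <= M * wexp s ep `|mu| by rewrite mulr_ge0// ltW// wexp_gt0.
have Tcoef K (j : 'I_K.*2.+1) : cabs (Tmu (freq K L j) (coef K L u j)) <=
    C' * s2 s * M * A * wexp s (- (kp / 2)) (2 * pi / L * `|j%:R - K%:R|).
  have sc := smooth_coef K L j su.
  have gc x := coef_gb hs L0 x (ltn_ord j) h0 su gu bu.
  have bc := box_coef K j bu.
  have := IHT _ _ (Mw _) (Tmu_lin (freq K L j)) (Tmu_cont (freq K L j)) (Tmu_exp (freq K L j)) _ _ sc gc bc.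
  move=> /le_trans; apply; rewrite -freqE -/kp.
  set X := `|freq _ _ _|.
  apply: (@le_trans _ _ (C' * s2 s * M * A * (wexp s (kp / 2) X * wexp s (- kp) X))).
    apply: (@le_trans _ _ (C' * s2 s * M * A * (wexp s ep X * wexp s (- kp) X))).
      by apply: eq_ler; ring.
    apply: ler_wpM2l; first by rewrite !mulr_ge0// ltW.
    apply: ler_wpM2r; first exact: ltW (wexp_gt0 _ _ _).
    by apply: wexp_le_c; rewrite ge_min lexx orbT.
  by rewrite wexp_half.
have Tint K : cabs (T (interp K L u)) <= C' * s2 s * Z * M * A.
  rewrite /interp gevb_linear_sum//; last first.
    move=> j; apply: gw; split; first exact: smooth_coef.
    exists (s2 s * h), (s2 s * A * wexp s (- kp) `|freq K L j|).
    by split=> // x; exact: coef_gb.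
  apply: (le_trans (cabs_sum _ _ _)).
  apply: (@le_trans _ _ (\sum_(j < K.*2.+1) C' * s2 s * M * A *
     wexp s (- (kp / 2)) (2 * pi / L * `|j%:R - K%:R|))).
    by apply: ler_sum => j _; exact: Tcoef.
  rewrite -mulr_sumr; apply: (@le_trans _ _ (C' * s2 s * M * A * Z)).
    by rewrite ler_wpM2l ?HZ// !mulr_ge0// ltW.
  by apply: eq_ler; ring.
pose h2 := gK s (kp / 2) + s2 s * h.
have h20 : 0 < h2 by rewrite ltr_wpDl ?gK_ge0.
pose A2 := s2 s * A * Z + A.
have A20 : 0 <= A2 by rewrite addr_ge0// !mulr_ge0// ltW.
have gint K x : gb s h2 (s2 s * A * Z) (interp K L u) x.
  have H := interp_gb hs K L0 x h0 kp2 su gu bu.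
  apply: (gb_le (ltW h20) (lexx _) _ H) => //.
  apply: (@le_trans _ _ (\sum_(j < K.*2.+1) s2 s * A *
     wexp s (- (kp / 2)) (2 * pi / L * `|j%:R - K%:R|))).
    apply: ler_sum => j _; rewrite -/kp -freqE mulrCA.
    by rewrite wexp_half.
  by rewrite -mulr_sumr ler_wpM2l ?HZ// mulr_ge0// ltW.
have [C3 [C30 H3]] := contT (2 * (s2 s * h2)) (mulr_gt0 (ltr0Sn _ _) (mulr_gt0 s20 h20)).
apply/ler_addgt0Pr => e e0.
pose Y := C3 * ((1 + 2 * L * (s2 s * h2)) * A2).
have Y0 : 0 <= Y.
  rewrite !mulr_ge0// addr_ge0// mulr_ge0// ?mulr_ge0 ?(ltW L0) ?(ltW h20)//; exact: ltW.
have [K HK] := arch_inv Y0 e0.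
have si := smooth_interp K L su.
pose v x := -1 * u x + interp K L u x.
have gu' : gevb u by split=> //; exists h, A.
have gi' : gevb (interp K L u) by split=> //; exists h2, (s2 s * A * Z).
have gv' : gevb v by exact: gevb_comb.
have gv x : gb s h2 A2 v x.
  rewrite /A2 addrC; apply: gb_add => //; first exact: smooth_scale.
  rewrite -[A]mul1r -[X in X * A](_ : cabs (-1) = 1); last by rewrite cabsN cabs1.
  apply: gb_scale => //; apply: (gb_le (ltW h0) _ (lexx _) (gu x)) => //.
  rewrite /h2 ler_wpDl ?gK_ge0//; first by rewrite ler_peMl ?(ltW h0)// s2_ge1.
have v0 k y : (k <= K.*2.+1)%N -> v (cons1 (k%:R * (L / K.*2.+1%:R)) y) = 0.
  by move=> kN; rewrite /v interp_grid// mulN1r addNr.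
have Hv : cabs (T v) <= Y / K.*2.+1%:R.
  have /H3 : gevb v by [].
  move=> /(_ ((1 + 2 * L * (s2 s * h2)) / K.*2.+1%:R * A2)).
  move=> /(_ _)/le_trans; apply; last by apply: eq_ler; rewrite /Y; ring.
  by move=> x xL; apply: grid_small => //; case: gv'.
have Ev : T v = - T u + T (interp K L u) by rewrite /v linT// mulN1r.
have -> : T u = T (interp K L u) - T v by rewrite Ev; ring.
apply: (le_trans (cabsB _ _)); apply: lerD; first exact: Tint.
exact: le_trans Hv HK.
Qed.

End TensorBound.

(** * Functions on the doubled space *)

Section MixedPullbacks.
Variables (R : realType) (d : nat).
Implicit Types (t : 'rV[R]_d) (Z : 'rV[R]_(d + d)).

(** All the substitutions used on the doubled space, such as [x], [y - t] and
    [x - y], are of this form. *)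
Definition lc (al be : R) t Z : 'rV[R]_d := al *: lsubmx Z + be *: rsubmx Z + t.

Lemma lc_row al be t x y : lc al be t (row_mx x y) = al *: x + be *: y + t.
Proof. by rewrite /lc row_mxKl row_mxKr. Qed.

Lemma lcE al be t Z k :
  lc al be t Z 0 k = al * Z 0 (lshift d k) + be * Z 0 (rshift d k) + t 0 k.
Proof. by rewrite !rowD !rowZ !mxE. Qed.

Lemma lc_axis al be t : axis_map (lc al be t)
  (fun j => match fintype.split j with inl _ => al | inr _ => be end)
  (fun j => match fintype.split j with inl k => k | inr k => k end).
Proof.
split.
  apply: (@lipmap_cont R _ _ _ (`|al| + `|be|)) => X Y.
  apply: norm_coordP => [|k]; first by rewrite mulr_ge0// addr_ge0.
  rewrite rowB !lcE (_ : _ - _ = al * (X - Y) 0 (lshift d k) + be * (X - Y) 0 (rshift d k)).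
    rewrite mulrDl; apply: (le_trans (ler_normD _ _)).
    by rewrite !normrM; apply: lerD; apply: ler_wpM2l => //; exact: coord_le.
  by rewrite !rowB; ring.
move=> X j h; apply/rowP => k; rewrite lcE [RHS]rowD [in RHS]rowZ rowE lcE !rowD !rowZ !rowE.
case: split_ordP => i ->.
  rewrite eq_lshift [rshift d k == _]eq_rlshift /= mulr0n; ring.
rewrite eq_rshift [lshift d k == _]eq_lrshift /= mulr0n; ring.
Qed.

Lemma shift_axis n (t : 'rV[R]_n) : axis_map (fun x => x + t) (fun=> 1) id.
Proof.
split.
  apply: (@lipmap_cont R _ _ _ 1) => x y.
  by rewrite opprD addrACA subrr addr0 mul1r.
by move=> x j h; rewrite mulr1 addrA.
Qed.

Lemma lsub_rsub_norm Z : `|lsubmx Z| <= `|Z| /\ `|rsubmx Z| <= `|Z|.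
Proof.
by rewrite -{2 4}[Z]hsubmxK; split; [exact: norm_row_l|exact: norm_row_r].
Qed.

Variable s : R.
Hypothesis hs : 1 < s.

Lemma lc_coef_le (al be : R) (j : 'I_(d + d)) : `|al| <= 1 -> `|be| <= 1 ->
  `|match fintype.split j with inl _ => al | inr _ => be end| <= 1.
Proof. by case: fintype.split. Qed.

Lemma smooth_lc al be t (f : 'rV[R]_d -> R[i]) : csmooth f ->
  csmooth (fun Z => f (lc al be t Z)).
Proof. by move=> sf; exact: (smooth_pull (lc_axis al be t) sf). Qed.

Lemma gb_lc al be t h A (f : 'rV[R]_d -> R[i]) Z : `|al| <= 1 -> `|be| <= 1 ->
  csmooth f -> gb s h A f (lc al be t Z) -> gb s h A (fun Z => f (lc al be t Z)) Z.
Proof.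
move=> a1 b1 sf gf; apply: (gb_pull (lc_axis al be t) sf _ gf) => j.
exact: lc_coef_le.
Qed.

Lemma smooth_shift n (t : 'rV[R]_n) (f : 'rV[R]_n -> R[i]) : csmooth f ->
  csmooth (fun x => f (x + t)).
Proof. by move=> sf; exact: (smooth_pull (shift_axis t) sf). Qed.

Lemma gb_shift n (t : 'rV[R]_n) h A (f : 'rV[R]_n -> R[i]) x : csmooth f ->
  gb s h A f (x + t) -> gb s h A (fun x => f (x + t)) x.
Proof.
by move=> sf gf; apply: (gb_pull (shift_axis t) sf _ gf) => j; rewrite normr1.
Qed.

(** Outside the ball, an open set, all derivatives vanish. *)
Lemma gb_cut n (x0 : 'rV[R]_n) r h A (G : 'rV[R]_n -> R[i]) : 0 <= h -> 0 <= A ->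
  csmooth G -> (forall x, r < `|x - x0| -> G x = 0) ->
  (forall x, `|x - x0| <= r -> gb s h A G x) -> forall x, gb s h A G x.
Proof.
move=> h0 A0 sG G0 gG x; have [xr|rx] := leP `|x - x0| r; first exact: gG.
move=> l; rewrite (@dl_ball0 R n G x (`|x - x0| - r) l x sG); first 1 last.
- move=> z xz; apply: G0; have := ler_distD z x x0; lra.
- by rewrite subrr normr0 subr_gt0.
by rewrite cabs0 mulr_ge0 ?mulr_ge0 ?exprn_ge0// ltW// Fs_gt0.
Qed.

Lemma norm_row_gt (x y : 'rV[R]_d) r : r < `|row_mx x y| -> r < `|x| \/ r < `|y|.
Proof.
move=> rxy; have [xr|] := leP `|x| r; last by left.
have [yr|] := leP `|y| r; last by right.
by move: rxy; rewrite ltNge norm_row_le.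
Qed.

End MixedPullbacks.

Section Growth.
Variables (R : realType) (s : R).
Hypothesis hs : 1 < s.
Variables (d : nat) (B : 'rV[R]_(d + d) -> R[i]).

Lemma enorm_ge0 n (x : 'rV[R]_n) : 0 <= enorm x. Proof. exact: sqrtr_ge0. Qed.

Lemma enorm_le n (x : 'rV[R]_n) : enorm x <= n%:R * `|x|.
Proof.
rewrite -(@ger0_norm _ (n%:R * `|x|)) ?mulr_ge0// -sqrtr_sqr.
apply: ler_wsqrtr; apply: (@le_trans _ _ (\sum_(i < n) `|x| ^+ 2)).
  by apply: ler_sum => i _; rewrite -[leLHS]real_normK ?num_real// ler_expn ?coord_le.
rewrite sumr_const card_ord -[leLHS]mulr_natl exprMn ler_wpM2r ?sqr_ge0//.
by rewrite -natrX ler_nat; case: n x => // n _; rewrite leq_pmulr.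
Qed.

(** Both [B] and [1 / B] satisfy this for every positive rate. *)
Definition subexp_gb n (F : 'rV[R]_n -> R[i]) := forall e, 0 < e -> exists h C,
  [/\ 0 < h, 0 <= C & forall Z, gb s h (C * wexp s e `|Z|) F Z].

Let s0 : 0 < s. Proof. exact: lt_trans hs. Qed.

Lemma growth_subexp_gb : csmooth B -> (forall Z, B Z != 0) -> growthB B s ->
  subexp_gb B /\ subexp_gb (fun Z => (B Z)^-1).
Proof.
move=> sB B0 gB.
have key e : 0 < e -> exists h C, [/\ 0 < h, 0 <= C &
    forall Z al, cabs (Dmulti al (fun Z => (B Z)^-1) Z) / ((mfact al)%:R `^ s * h ^+ mlen al)
      + cabs (Dmulti al B Z) / ((mfact al)%:R `^ s * h ^+ mlen al) <= C * wexp s e `|Z|].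
  move=> e0; pose D := d%:R `^ s^-1 : R.
  have D0 : 0 <= D by exact: powR_ge0.
  pose e' := e / (2 * D + 1).
  have e'0 : 0 < e' by rewrite divr_gt0// ltr_wpDl// mulr_ge0.
  have [h h0 /lty_bound[C C0 HC]] := gB e' e'0.
  exists h, C; split=> // Z al; rewrite -{1 2}[Z]hsubmxK.
  set x := lsubmx Z; set y := rsubmx Z.
  have := le_trans (ereal_sup_ubound _) HC; set S := [set w | _].
  set P := _ + _.
  move=> /(_ (expR (- (e' * (enorm x `^ s^-1 + enorm y `^ s^-1))) * P)%:E).
  move=> /(_ (ex_intro _ al (ex_intro _ x (ex_intro _ y erefl)))).
  rewrite lee_fin expRN mulrC ler_pdivrMr ?expR_gt0// => /le_trans; apply.
  rewrite ler_wpM2l// ler_expR.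
  have [lZ rZ] := lsub_rsub_norm Z.
  have E (z : 'rV[R]_d) : `|z| <= `|Z| -> enorm z `^ s^-1 <= D * `|Z| `^ s^-1.
    move=> zZ; rewrite -powRM//; apply: ge0_ler_powR.
    - by rewrite invr_ge0 ltW.
    - by rewrite nnegrE enorm_ge0.
    - by rewrite nnegrE mulr_ge0.
    - by apply: (le_trans (enorm_le z)); exact: ler_wpM2l.
  apply: (@le_trans _ _ (e' * (2 * D * `|Z| `^ s^-1))).
    apply: ler_wpM2l; first exact: ltW e'0.
    by rewrite -mulrA [2 * _]mulr_natl [leRHS]mulr2n; apply: lerD; exact: E.
  rewrite mulrA ler_wpM2r ?powR_ge0// /e' mulrAC ler_pdivrMr ?ltr_wpDl ?mulr_ge0//.
  by rewrite ler_wpM2l ?(ltW e0)// lerDl.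
have P0 h al z : 0 < h -> 0 <= cabs z / ((mfact al)%:R `^ s * h ^+ mlen (al : multi_index (d + d))).
  move=> h0; rewrite divr_ge0 ?cabs_ge0// mulr_ge0 ?exprn_ge0 ?(ltW h0)//; exact: powR_ge0.
split=> e /key [h [C [h0 C0 H]]]; exists h, C; split=> // Z.
- apply: gb_of_Dmulti => // al; apply: le_trans (H Z al); rewrite lerDr; exact: P0.
- apply: gb_of_Dmulti => //; first exact: smooth_inv.
  by move=> al; apply: le_trans (H Z al); rewrite lerDl; exact: P0.
Qed.

Lemma subexp_gb_ball n (F : 'rV[R]_n -> R[i]) e : subexp_gb F -> 0 < e -> exists h C, [/\ 0 < h, 0 <= C &
  forall t Z, `|Z| <= t + 1 -> 0 <= t -> gb s h (C * wexp s e t) F Z].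
Proof.
move=> gF e0; have e20 : 0 < e / 2 by rewrite divr_gt0.
have [h [C [h0 C0 H]]] := gF _ e20.
exists h, (C * wexp s e 1); split=> //; first by rewrite mulr_ge0// ltW// wexp_gt0.
move=> t Z Zt t0; apply: (gb_le (ltW h0) (lexx _) _ (H Z)).
rewrite -mulrA; apply: ler_wpM2l; first exact: C0.
apply: (le_trans (wexp_mono hs (ltW e20) (normr_ge0 _) Zt)).
have E : 2 * (e / 2) = e by field.
have := @wexp_add R s hs (e / 2) t 1 (ltW e20) t0 ler01.
rewrite E => H1; apply: (le_trans H1); exact: eq_ler (mulrC _ _).
Qed.

End Growth.

Section DoubledTestFunctions.
Variables (R : realType) (s : R).
Hypothesis hs : 1 < s.
Variable d : nat.
Implicit Types (G : 'rV[R]_(d + d) -> R[i]) (f g : 'rV[R]_d -> R[i]).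

Lemma kernel_testE G : kernel_test s G <-> Dspace s G.
Proof.
split=> [[sG [h [A [r [h0 r0 gG Gr]]]]]|/(DspaceP hs) [sG [[r Gr] [h [A [h0 gG]]]]]].
  by apply/(DspaceP hs); split=> //; split; [exists r|exists h, A].
split=> //; exists h, A, `|r|; split=> //.
by apply: supp_in_le Gr; exact: ler_norm.
Qed.

Lemma kernel_test_mulB B G : csmooth B -> subexp_gb s B -> kernel_test s G -> kernel_test s (fun Z => B Z * G Z).
Proof.
move=> sB gB [sG [h [A [r [h0 r0 gG Gr]]]]].
have [hB [C [hB0 C0 HB]]] := gB 1 ltr01.
have A0 := gb_ge0 (gG 0).
have W0 : 0 <= C * wexp s 1 r by rewrite mulr_ge0// ltW// wexp_gt0.
split; first exact: smooth_mul.
exists (hB + h), (C * wexp s 1 r * A), r; split=> //.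
- exact: addr_gt0.
- apply: (gb_cut (x0 := 0) (r := r)).
  + by rewrite addr_ge0// ltW.
  + exact: mulr_ge0.
  + exact: smooth_mul.
  + by move=> Z; rewrite subr0 => /Gr ->; rewrite mulr0.
  + move=> Z; rewrite subr0 => Zr; apply: gb_mul => //; [exact: ltW|exact: ltW|].
    apply: (gb_le (ltW hB0) (lexx _) _ (HB Z)); apply: (ler_wpM2l C0).
    exact: wexp_mono ler01 (normr_ge0 _) Zr.
- by move=> Z /Gr ->; rewrite mulr0.
Qed.

(** With the conjugate on the first variable, integrating [tens phi psi] against
    the kernel gives the pairing of the image of [phi] with [psi]. *)
Definition tens f g : 'rV[R]_(d + d) -> R[i] :=
  fun Z => f (lc 0 1 0 Z) * conjc (g (lc 1 0 0 Z)).

Lemma tens_row f g x y : tens f g (row_mx x y) = f y * conjc (g x).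
Proof. by rewrite /tens !lc_row !scale0r !scale1r add0r !addr0. Qed.

Lemma gb_tens h h' A A' f g : 0 <= h -> 0 <= h' -> csmooth f -> csmooth g ->
  (forall x, gb s h A f x) -> (forall x, gb s h' A' g x) ->
  csmooth (tens f g) /\ forall Z, gb s (h + h') (A * A') (tens f g) Z.
Proof.
move=> h0 h'0 sf sg gf gg.
have n01 : `|0 : R| <= 1 by rewrite normr0.
have n11 : `|1 : R| <= 1 by rewrite normr1.
have s1 := smooth_lc 0 1 0 sf; have s2' := smooth_lc 1 0 0 sg.
have s2 := smooth_conj s2'.
split; first exact: smooth_mul.
move=> Z; apply: gb_mul => //; first exact: gb_lc.
by apply: gb_conj => //; exact: gb_lc.
Qed.

Lemma kernel_test_tens f g : Dspace s f -> Dspace s g -> kernel_test s (tens f g).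
Proof.
move=> /(DspaceP hs) [sf [[r fr] [h [A [h0 gf]]]]].
move=> /(DspaceP hs) [sg [[r' gr] [h' [A' [h'0 gg]]]]].
have [st gt] := gb_tens (ltW h0) (ltW h'0) sf sg gf gg.
split=> //; exists (h + h'), (A * A'), (Num.max 0 (Num.max r r')); split=> //.
- exact: addr_gt0.
- by rewrite le_max lexx.
move=> Z; rewrite -[Z]hsubmxK tens_row => /norm_row_gt; rewrite !gt_max.
move=> [/andP[_ /andP[_ /gr ->]]|/andP[_ /andP[/fr -> _]]].
  by rewrite conjc0 mulr0.
by rewrite mul0r.
Qed.

End DoubledTestFunctions.

(** * The sesquilinear form of a positive functional *)

Section PositiveForm.
Variables (R : realType) (s : R).
Hypothesis hs : 1 < s.
Variables (d : nat) (B : 'rV[R]_(d + d) -> R[i]).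
Hypotheses (sB : csmooth B) (gB : subexp_gb s B).
Variable a : ('rV[R]_d -> R[i]) -> R[i].
Hypothesis aD : Ddual s a.
Implicit Types (f g phi psi : 'rV[R]_d -> R[i]).

Lemma conv_smooth phi x : csmooth phi ->
  csmooth (fun z => B (row_mx x (x - z)) * phi (x - z)).
Proof.
move=> sp; rewrite (_ : (fun z => _) = kslice (fun Z => B Z * phi (lc 0 1 0 Z)) x); last first.
  by apply/funext => z; rewrite /kslice lc_row scale0r scale1r add0r addr0.
by apply: kslice_smooth; apply: smooth_mul => //; exact: smooth_lc.
Qed.

Lemma conv_gb phi x z h A h' A' : 0 <= h -> 0 <= h' -> csmooth phi ->
  gb s h A B (row_mx x (x - z)) -> gb s h' A' phi (x - z) ->
  gb s (h + h') (A * A') (fun z => B (row_mx x (x - z)) * phi (x - z)) z.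
Proof.
move=> h0 h'0 sp gb1 gb2.
rewrite (_ : (fun z => _) = kslice (fun Z => B Z * phi (lc 0 1 0 Z)) x); last first.
  by apply/funext => w; rewrite /kslice lc_row scale0r scale1r add0r addr0.
have sl := smooth_lc 0 1 0 sp.
apply: kslice_gb; first exact: smooth_mul.
apply: gb_mul => //; apply: gb_lc => //; rewrite ?normr0 ?normr1//.
by rewrite lc_row scale0r scale1r add0r addr0.
Qed.

Lemma conv_D phi x : Dspace s phi ->
  Dspace s (fun z => B (row_mx x (x - z)) * phi (x - z)).
Proof.
move=> /(DspaceP hs) [sp [[r pr] [h [A [h0 gp]]]]].
have A0 := gb_ge0 (gp 0).
have [hB [C [hB0 C0 HB]]] := gB ltr01.
have sc := conv_smooth x sp.
have z0 z : `|x| + `|r| < `|z| -> B (row_mx x (x - z)) * phi (x - z) = 0.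
  move=> xz; rewrite pr ?mulr0//; have := ler_norm r.
  by have := ler_distD x z 0; rewrite !subr0 distrC; lra.
apply/(DspaceP hs); split=> //; split; first by exists (`|x| + `|r|).
have W0 := ltW (wexp_gt0 s 1 (2 * `|x| + `|r|)).
exists (hB + h), (C * wexp s 1 (2 * `|x| + `|r|) * A); split; first exact: addr_gt0.
apply: (gb_cut (x0 := 0) (r := `|x| + `|r|)) => //.
- by rewrite addr_ge0// ltW.
- by apply: mulr_ge0 => //; apply: mulr_ge0.
- by move=> z; rewrite subr0; exact: z0.
move=> z; rewrite subr0 => zr; apply: conv_gb => //; [exact: ltW|exact: ltW|].
apply: (gb_le (ltW hB0) (lexx _) _ (HB _)); apply: (ler_wpM2l C0).
apply: (wexp_mono hs ler01 (normr_ge0 _)); apply: norm_row_le.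
  by have := normr_ge0 x; have := normr_ge0 r; lra.
by apply: (le_trans (ler_normB _ _)); lra.
Qed.

Definition Qf phi psi : R[i] := kernel_pair a (fun Z => B Z * tens phi psi Z).

Lemma Qf_sesqui phi psi : Dspace s phi ->
  sesqui_pair (regular_dual (convB B a phi)) psi = Qf phi psi.
Proof.
move=> Dp; rewrite /sesqui_pair /regular_dual /Qf /kernel_pair; congr integralC.
apply/funext => x; rewrite /convB mulrC -(a_scale hs aD); last exact: conv_D.
by congr a; apply/funext => z; rewrite /kslice tens_row; ring.
Qed.

Lemma kernel_test_Bt phi psi : Dspace s phi -> Dspace s psi -> kernel_test s (fun Z => B Z * tens phi psi Z).
Proof. by move=> Dp Dq; apply: kernel_test_mulB => //; exact: kernel_test_tens. Qed.

(** Sesquilinearity, in the form used for polarization. *)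
Lemma Qf_expand phi psi c : Dspace s phi -> Dspace s psi ->
  Qf (fun x => c * psi x + phi x) (fun x => c * psi x + phi x) =
  c * Qf psi phi + (conjc c * Qf phi psi + (c * conjc c * Qf psi psi + Qf phi phi)).
Proof.
move=> Dp Dq; have k1 := kernel_test_Bt Dq Dp; have k2 := kernel_test_Bt Dp Dq.
have k3 := kernel_test_Bt Dq Dq; have k4 := kernel_test_Bt Dp Dp.
have k34 := kernel_test_comb (c * conjc c) k3 k4.
have k234 := kernel_test_comb (conjc c) k2 k34.
rewrite /Qf -(kernel_pair_lin hs aD _ k3 k4) -(kernel_pair_lin hs aD _ k2 k34) -(kernel_pair_lin hs aD _ k1 k234).
congr kernel_pair; apply/funext => Z; rewrite /tens rmorphD rmorphM /=; ring.
Qed.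

Hypothesis pos : positive_convB B (Dspace s) a.

Lemma Qf_ge0 phi : Dspace s phi -> 0 <= Qf phi phi.
Proof. by move=> Dp; rewrite -Qf_sesqui//; exact: pos. Qed.

Lemma complex_ge0 (z : R[i]) : 0 <= z -> 0 <= Re z /\ Im z = 0.
Proof. by case: z => x y; rewrite lecE /= => /andP[/eqP -> ->]. Qed.

(** The four choices of [c] among the fourth roots of unity suffice. *)
Lemma polarization_le (u v p q : R[i]) : 0 <= p -> 0 <= q ->
  (forall c, 0 <= c * v + (conjc c * u + (c * conjc c * q + p))) ->
  cabs u <= cabs p + cabs q.
Proof.
move=> /complex_ge0[p1 p2] /complex_ge0[q1 q2] H.
have K al be : 0 <= al * Re v - be * Im v + (al * Re u + be * Im u +
      ((al * al + be * be) * Re q + Re p)) /\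
    al * Im v + be * Re v + (al * Im u - be * Re u) = 0.
  have [] := complex_ge0 (H (Complex al be)).
  rewrite 3!Re_add 3!Im_add 4!Re_mul 4!Im_mul p2 q2 /= => h1 h2.
  by split; [move: h1|move: h2]; lra.
have [a1 a2] := K 1 0; have [b1 b2] := K (-1) 0.
have [c1 c2] := K 0 1; have [d1 d2] := K 0 (-1).
apply: (@le_trans _ _ (Re p + Re q)); last first.
  by apply: lerD; apply: le_trans (cabs_Re _); exact: ler_norm.
apply: (le_trans (cabs_le_ReIm _)).
have P1 : `|Re u| <= (Re p + Re q) / 2 by rewrite ler_norml; lra.
have P2 : `|Im u| <= (Re p + Re q) / 2 by rewrite ler_norml; lra.
lra.
Qed.

Lemma Qf_le phi psi : Dspace s phi -> Dspace s psi ->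
  cabs (Qf phi psi) <= cabs (Qf phi phi) + cabs (Qf psi psi).
Proof.
move=> Dp Dq; apply: (@polarization_le _ (Qf psi phi)); try exact: Qf_ge0.
move=> c; rewrite -Qf_expand//; apply: Qf_ge0.
by apply: Dspace_add => //; exact: Dspace_scale.
Qed.

End PositiveForm.

(** * Localized estimates *)

Lemma wexp0 (R : realType) (s c : R) : 1 < s -> wexp s c 0 = 1.
Proof.
by move=> hs; rewrite /wexp powR0 ?mulr0 ?expR0// invr_neq0// gt_eqF// (lt_trans _ hs).
Qed.

Opaque wexp.

Section LocalizedEstimate.
Variables (R : realType) (s : R).
Hypothesis hs : 1 < s.
Variables (d : nat) (B : 'rV[R]_(d + d) -> R[i]).
Hypotheses (sB : csmooth B) (B0 : forall Z, B Z != 0).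
Hypotheses (gB : subexp_gb s B) (gBV : subexp_gb s (fun Z => (B Z)^-1)).
Variable a : ('rV[R]_d -> R[i]) -> R[i].
Hypothesis aD : Ddual s a.
Hypothesis pos : positive_convB B (Dspace s) a.
Variables (r : 'rV[R]_d -> R) (hr : R).
Hypotheses (hr0 : 0 < hr) (sr : csmooth (cx r)) (gr : forall x, gb s hr 1 (cx r) x).
Hypothesis r1 : forall x, 1 <= `|x| -> r x = 0.
Implicit Types (f g : 'rV[R]_d -> R[i]) (t : 'rV[R]_d).

Lemma dotr_row (m Z : 'rV[R]_(d + d)) :
  dotr m Z = dotr (lsubmx m) (lsubmx Z) + dotr (rsubmx m) (rsubmx Z).
Proof.
by rewrite /dotr big_split_ord /=; congr (_ + _); apply: eq_bigr => i _; rewrite !mxE.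
Qed.

Lemma wexp_prod (ep : R) n (m : 'rV[R]_n) : 0 <= ep ->
  wexp s ep `|m| <= \prod_i wexp s ep `|m 0 i|.
Proof.
move=> ep0; have ge1 (x : R) : 1 <= wexp s ep x by exact: wexp_ge1.
have prod1 (P : pred 'I_n) : 1 <= \prod_(i | P i) wexp s ep `|m 0 i|.
  by apply: (big_ind (fun z => 1 <= z)) => // x y x1 y1; rewrite -[1]mulr1 ler_pM.
have [mz|nz] := eqVneq (mx_norm m) 0.
  by rewrite [`|m|]mz wexp0 ?prod1.
have [[i j] /= Hi] := mx_norm_neq0 nz; rewrite ord1 in Hi.
rewrite [`|m|]Hi (bigD1 j)//= -[leLHS]mulr1.
by apply: ler_wpM2l (prod1 _); exact: le_trans ler01 (ge1 _).
Qed.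

(** On these test functions the kernel is controlled by positivity alone. *)
Definition wave (m t x : 'rV[R]_d) : R[i] := ech m x * cx r (x - t).

Lemma smooth_wave m t : csmooth (wave m t).
Proof. by apply: smooth_mul; [exact: smooth_ech|exact: smooth_shift]. Qed.

Lemma gb_wave m t x ep : 0 < ep -> gb s (gK s ep + hr) (wexp s ep `|m|) (wave m t) x.
Proof.
move=> ep0; rewrite -[wexp s ep _]mulr1.
apply: gb_mul => //; [exact: gK_ge0|exact: ltW|exact: smooth_ech|exact: smooth_shift| |].
  exact: gb_ech_wexp.
exact: gb_shift.
Qed.

Lemma wave0 m t x : 1 <= `|x - t| -> wave m t x = 0.
Proof. by move=> xt; rewrite /wave /cx r1// mulr0. Qed.

Lemma wave_D m t : Dspace s (wave m t).
Proof.
apply/(DspaceP hs); split; first exact: smooth_wave.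
split.
  exists (`|t| + 1) => x tx; apply: wave0.
  by have := ler_distD t x 0; rewrite !subr0; lra.
exists (gK s 1 + hr), (wexp s 1 `|m|); split; first by rewrite ltr_wpDl ?gK_ge0.
by move=> x; exact: gb_wave.
Qed.

Definition cut t := tens (wave 0 0) (wave 0 t).

Lemma ech0 x : ech (0 : 'rV[R]_d) x = 1.
Proof. by rewrite /ech /dotr big1 ?cexpi0// => i _; rewrite mxE mul0r. Qed.

Lemma cut_row t x y : cut t (row_mx x y) = cx r y * cx r (x - t).
Proof.
rewrite /cut tens_row /wave !ech0 !mul1r subr0; congr (_ * _).
by rewrite /cx /= oppr0.
Qed.

Lemma smooth_cut t : csmooth (cut t).
Proof.
apply: smooth_mul; first by apply: smooth_lc; exact: smooth_wave.
by apply: smooth_conj; apply: smooth_lc; exact: smooth_wave.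
Qed.

Lemma gb_cut1 t Z : gb s (hr + hr) 1 (cut t) Z.
Proof.
have g0 t' x : gb s hr 1 (wave 0 t') x.
  rewrite (_ : wave 0 t' = fun x => cx r (x - t')); first exact: gb_shift.
  by apply/funext => y; rewrite /wave ech0 mul1r.
rewrite -[X in gb _ _ X _ _]mulr1.
have [_] := gb_tens hs (ltW hr0) (ltW hr0) (smooth_wave 0 0) (smooth_wave 0 t) (g0 0) (g0 t).
exact.
Qed.

Lemma cut0 t x y : 1 <= `|x - t| \/ 1 <= `|y| -> cut t (row_mx x y) = 0.
Proof. by rewrite cut_row /cx; move=> [/r1 ->|/r1 ->]; rewrite ?mul0r ?mulr0. Qed.

Lemma cut0Z t Z : 1 < `|Z - row_mx t 0| -> cut t Z = 0.
Proof.
rewrite -[Z]hsubmxK row_mx_sub subr0 => /norm_row_gt[h|h]; apply: cut0.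
  by left; exact: ltW.
by right; exact: ltW.
Qed.

Lemma norm_near t u (Z : 'rV[R]_(d + d)) : `|u| <= `|t| ->
  `|Z - row_mx t u| <= 1 -> `|Z| <= `|t| + 1.
Proof.
move=> ut h; have := ler_distD (row_mx t u) Z 0; rewrite !subr0.
have : `|row_mx t u| <= `|t| by exact: norm_row_le.
lra.
Qed.

Lemma norm0t t : `|0 : 'rV[R]_d| <= `|t|. Proof. by rewrite normr0. Qed.

(** Bounding the diagonal is where translation invariance enters: the weight of
    [B] costs only a subexponential factor in the position [t]. *)
Lemma Qf_wave_le e ep : 0 < e -> 0 < ep -> exists C, 0 <= C /\ forall m t,
  cabs (Qf B a (wave m t) (wave m t)) <= C * (wexp s e `|t| * wexp s ep `|m|).
Proof.
move=> e0 ep0; have ep20 : 0 < ep / 2 by rewrite divr_gt0.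
have [hB [CB [hB0 CB0 HB]]] := subexp_gb_ball hs gB e0.
pose hw := gK s (ep / 2) + hr.
have hw0 : 0 < hw by rewrite ltr_wpDl ?gK_ge0.
have h0 : 0 < hB + (hw + hw) by apply: addr_gt0 => //; exact: addr_gt0.
have [C1 [C10 H1]] := kernel_pair_le hs aD 0 ler01 h0.
exists (C1 * CB); split; first exact: mulr_ge0.
move=> m t; have [st gt] := gb_tens hs (ltW hw0) (ltW hw0) (smooth_wave m t) (smooth_wave m t)
  (fun x => gb_wave m t x ep20) (fun x => gb_wave m t x ep20).
have W : wexp s (ep / 2) `|m| * wexp s (ep / 2) `|m| = wexp s ep `|m|.
  by rewrite -wexpD (_ : ep / 2 + ep / 2 = ep)//; field.
rewrite {}W in gt.
have z0 x y : 1 < `|x - t| \/ 1 < `|y - t| ->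
    B (row_mx x y) * tens (wave m t) (wave m t) (row_mx x y) = 0.
  rewrite tens_row => -[h|h]; first by rewrite (wave0 m (ltW h)) conjc0 !mulr0.
  by rewrite (wave0 m (ltW h)) mul0r mulr0.
have := H1 t t (fun Z => B Z * tens (wave m t) (wave m t) Z)
  (CB * wexp s e `|t| * wexp s ep `|m|).
rewrite subrr normr0 => /(_ (lexx _) (smooth_mul sB st)) H.
rewrite -mulrA [CB * _]mulrA; apply: H.
- apply: (gb_cut (x0 := row_mx t t) (r := 1)).
  + exact: ltW.
  + by rewrite !mulr_ge0// ltW// wexp_gt0.
  + exact: smooth_mul.
  + by move=> Z; rewrite -[Z]hsubmxK row_mx_sub => /norm_row_gt; exact: z0.
  + move=> Z Zt; apply: gb_mul => //; [exact: ltW|by rewrite addr_ge0// ltW|].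
    by apply: HB => //; apply: norm_near Zt.
- by move=> x y h; apply: z0; left.
- by move=> x y h; apply: z0; right.
Qed.

(** The squared cutoff splits as one factor for the functional [boxed] and one for
    the function [divided] to which it is applied. *)
Definition Jker f t Z : R[i] := f (lc 1 (- 1) 0 Z) * (cut t Z * cut t Z).

Lemma lc1N x y : lc 1 (- 1) 0 (row_mx x y) = x - y :> 'rV[R]_d.
Proof. by rewrite lc_row scale1r scaleN1r addr0. Qed.

Lemma kernel_pair_scale c G : kernel_test s G -> kernel_pair a (fun Z => c * G Z) = c * kernel_pair a G.
Proof.
move=> kG; transitivity (kernel_pair a (fun Z => (c - 1) * G Z + G Z)).
  by congr kernel_pair; apply/funext => Z; ring.
by rewrite (kernel_pair_lin hs aD _ kG kG); ring.
Qed.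

(** The shift carries the support of [cut t], around [(t, 0)], to the box with
    sides [0, 2]. *)
Definition corner t : 'rV[R]_(d + d) := row_mx (const_mx 1 - t) (const_mx 1).
Definition boxed t (v : 'rV[R]_(d + d) -> R[i]) Z := B Z * (cut t Z * v (Z + corner t)).

Lemma boxed_gb t h v Z hB A Av : 0 <= h -> 0 <= hB -> csmooth v -> gb s hB A B Z ->
  gb s h Av v (Z + corner t) -> gb s (hB + ((hr + hr) + h)) (A * Av) (boxed t v) Z.
Proof.
move=> h0 hB0 sv gBZ gv; have hr2 : 0 <= hr + hr by rewrite addr_ge0// ltW.
have sv' := smooth_shift (corner t) sv; have sc := smooth_cut t.
apply: gb_mul => //; [by rewrite addr_ge0|exact: smooth_mul|].
rewrite -[Av]mul1r; apply: gb_mul => //; first exact: gb_cut1.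
exact: gb_shift.
Qed.

Lemma boxed_smooth t v : csmooth v -> csmooth (boxed t v).
Proof.
move=> sv; apply: smooth_mul => //; apply: smooth_mul; first exact: smooth_cut.
exact: smooth_shift.
Qed.

Lemma boxed0 t v Z : 1 < `|Z - row_mx t 0| -> boxed t v Z = 0.
Proof. by move=> /cut0Z h; rewrite /boxed h mul0r mulr0. Qed.

(** The box is the image of the support of the cutoff. *)
Lemma boxed_le t h : 0 < h -> exists h' A', [/\ 0 < h', 0 <= A' &
  forall v Av, csmooth v -> 0 <= Av -> (forall x, in_box 2 x -> gb s h Av v x) ->
    forall Z, gb s h' (A' * Av) (boxed t v) Z].
Proof.
move=> h0; have [hB [CB [hB0 CB0 HB]]] := subexp_gb_ball hs gB ltr01.
exists (hB + ((hr + hr) + h)), (CB * wexp s 1 `|t|); split.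
- by rewrite !addr_gt0.
- by rewrite mulr_ge0// ltW// wexp_gt0.
move=> v Av sv Av0 gv; have W := ltW (wexp_gt0 s 1 `|t|).
apply: (gb_cut (x0 := row_mx t 0) (r := 1)).
- by rewrite !addr_ge0// ltW.
- by rewrite !mulr_ge0.
- exact: boxed_smooth.
- by move=> Z; exact: boxed0.
move=> Z Zt; apply: boxed_gb => //; [exact: ltW|exact: ltW| |].
  by apply: HB => //; apply: norm_near Zt; exact: norm0t.
apply: gv => i; have := coord_le (Z - row_mx t 0) i; rewrite rowB rowD.
have -> : corner t 0 i = 1 - (row_mx t 0 : 'rV[R]_(d + d)) 0 i.
  rewrite -(@fintype.splitK d d i); case: (fintype.split i) => j /=.
    by rewrite /corner !row_mxEl !mxE.
  by rewrite /corner !row_mxEr !mxE subr0.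
by move=> /le_trans/(_ Zt); rewrite ler_norml; lra.
Qed.

Lemma boxed_kernel_test t v : gevb s v -> kernel_test s (boxed t v).
Proof.
move=> [sv [h [Av [h0 gv]]]]; have [h' [A' [h'0 A'0 H]]] := boxed_le t h0.
split; first exact: boxed_smooth.
exists h', (A' * Av), (`|t| + 1); split=> //.
- by apply: H => //; exact: gb_ge0 (gv 0).
move=> Z tZ; apply: boxed0; rewrite ltNge; apply/negP => /(norm_near (norm0t t)).
by rewrite leNgt tZ.
Qed.

Lemma boxed_lin t : gevb_linear s (fun v => kernel_pair a (boxed t v)).
Proof.
move=> f g c gf gg; rewrite -(kernel_pair_lin hs aD _ (boxed_kernel_test t gf) (boxed_kernel_test t gg)).
by congr kernel_pair; apply/funext => Z; rewrite /boxed; ring.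
Qed.

Lemma boxed_cont t : gevb_cont s 2 (fun v => kernel_pair a (boxed t v)).
Proof.
move=> h h0; have [h' [A' [h'0 A'0 H]]] := boxed_le t h0.
have [C [C0 HC]] := kernel_pair_le hs aD `|t| ler01 h'0.
exists (C * A'); split; first exact: mulr_ge0.
move=> v A gv bv; have [sv _] := gv; rewrite -mulrA.
apply: (HC t 0); rewrite ?subr0//.
- exact: boxed_smooth.
- apply: H => //; apply: gb_ge0 (bv 0 _) => i; rewrite mxE lexx /=; exact: ler0n.
- by move=> x y h1; rewrite /boxed cut0 ?mul0r ?mulr0//; left; exact: ltW.
- by move=> x y h1; rewrite /boxed cut0 ?mul0r ?mulr0//; right; rewrite subr0 in h1; exact: ltW.
Qed.

(** A character on the doubled space is a product of characters, so the value on
    it is an off-diagonal value of the form. *)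
Lemma boxed_ech t m : exists2 c, cabs c = 1 &
  kernel_pair a (boxed t (ech m)) = c * Qf B a (wave (rsubmx m) 0) (wave (- lsubmx m) t).
Proof.
exists (cexpi (dotr m (corner t))); first exact: cabs_cexpi.
rewrite /Qf -kernel_pair_scale; last by apply: kernel_test_Bt => //; exact: wave_D.
congr kernel_pair; apply/funext => Z; rewrite -[Z]hsubmxK /boxed tens_row cut_row.
rewrite {1}/ech dotrD cexpiD dotr_row row_mxKl row_mxKr cexpiD.
have cM (z w : R[i]) : conjc (z * w) = conjc z * conjc w by exact: rmorphM.
rewrite /wave subr0 cM.
have -> : conjc (ech (- lsubmx m) (lsubmx Z)) = cexpi (dotr (lsubmx m) (lsubmx Z)).
  rewrite /ech -cexpiN; congr cexpi; rewrite /dotr -sumrN; apply: eq_bigr => i _.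
  by rewrite !mxE mulNr opprK.
have -> : conjc (cx r (lsubmx Z - t)) = cx r (lsubmx Z - t) by rewrite /cx /= oppr0.
by rewrite /ech; ring.
Qed.

Let n11 : `|1 : R| <= 1. Proof. by rewrite normr1. Qed.
Let nN1 : `|-1 : R| <= 1. Proof. by rewrite normrN1. Qed.

Definition divided f t Z : R[i] := (B Z)^-1 * (f (lc 1 (- 1) 0 Z) * cut t Z).

Lemma boxed_divided f t : boxed t (fun Z => divided f t (Z - corner t)) = Jker f t.
Proof.
apply/funext => Z; rewrite /boxed /divided /Jker addrK.
have := mulfV (B0 Z); move: (B Z) (B Z)^-1 (cut t Z) (f _) => b b' k z E.
by rewrite -[RHS]mul1r -E; ring.
Qed.

Lemma smooth_divided f t : csmooth f -> csmooth (divided f t).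
Proof.
move=> sf; apply: smooth_mul; first exact: smooth_inv.
by apply: smooth_mul; [exact: smooth_lc|exact: smooth_cut].
Qed.

(** On the support of the cutoff [x - y] differs from [t] by at most 2, which turns
    the decay of [f] into decay in [t]. *)
Lemma gb_divided c h e : 0 < c -> 0 < h -> 0 < e -> exists h' C, [/\ 0 < h', 0 <= C &
  forall f A t Z, csmooth f -> decay_gb s c h A f ->
    gb s h' (C * A * (wexp s e `|t| * wexp s (- (c / 2)) `|t|)) (divided f t) Z].
Proof.
move=> c0 h0 e0; have [hV [CV [hV0 CV0 HV]]] := subexp_gb_ball hs gBV e0.
have W2 := ltW (wexp_gt0 s c 2).
exists (hV + (h + (hr + hr))), (CV * wexp s c 2); split.
- by rewrite !addr_gt0.
- by rewrite mulr_ge0.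
move=> f A t Z sf gf.
have A0 : 0 <= A by move: (gb_ge0 (gf 0)); rewrite (pmulr_lge0 _ (wexp_gt0 _ _ _)).
have [We Wc] := (ltW (wexp_gt0 s e `|t|), ltW (wexp_gt0 s (- (c / 2)) `|t|)).
move: Z; apply: (gb_cut (x0 := row_mx t 0) (r := 1)).
- by rewrite !addr_ge0// ltW.
- exact: mulr_ge0 (mulr_ge0 (mulr_ge0 CV0 W2) A0) (mulr_ge0 We Wc).
- exact: smooth_divided.
- by move=> Z /cut0Z h1; rewrite /divided h1 !mulr0.
move=> Z Zt; have -> : CV * wexp s c 2 * A * (wexp s e `|t| * wexp s (- (c / 2)) `|t|) =
    CV * wexp s e `|t| * (A * (wexp s c 2 * wexp s (- (c / 2)) `|t|) * 1).
  by move: (wexp s c 2) (wexp s e _) (wexp s _ _) => X Y W; ring.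
have sl := smooth_lc 1 (- 1) 0 sf; have sc := smooth_cut t.
have hr2 : 0 <= hr + hr by rewrite addr_ge0// ltW.
have hh : 0 <= h + (hr + hr) by rewrite addr_ge0// ltW.
apply: gb_mul => //; [exact: ltW|exact: smooth_inv|exact: smooth_mul| |].
  by apply: HV => //; apply: norm_near Zt; exact: norm0t.
apply: gb_mul => //; [exact: ltW| |exact: gb_cut1].
apply: gb_lc => //.
apply: (gb_le (ltW h0) (lexx _) _ (gf _)); apply: (ler_wpM2l A0).
rewrite -[Z]hsubmxK lc1N; set x := lsubmx Z; set y := rsubmx Z.
have [xt yt] : `|x - t| <= 1 /\ `|y| <= 1.
  move: Zt; rewrite -[Z]hsubmxK row_mx_sub subr0 => Zt.
  by split; apply: le_trans Zt; [exact: norm_row_l|exact: norm_row_r].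
have txy : `|t| <= `|x - y| + 2.
  have -> : t = (x - y) + (y - (x - t)) by rewrite opprB addrA subrK addrC subrK.
  apply: (le_trans (ler_normD _ _)); rewrite lerD2l.
  by apply: (le_trans (ler_normB _ _)); rewrite -[2]/(1 + 1) lerD.
have c20 : 0 <= c / 2 by rewrite divr_ge0// ltW.
have := le_trans (wexp_mono hs c20 (normr_ge0 t) txy)
  (wexp_add hs c20 (normr_ge0 (x - y)) (ler0n R 2)).
have -> : 2 * (c / 2) = c by field.
rewrite !wexpN => H.
have P1 := wexp_gt0 s c `|x - y|; have P2 := wexp_gt0 s (c / 2) `|t|.
move: P1 P2 H; move: (wexp s c _) (wexp s (c / 2) _) (wexp s c 2) => X Y W P1 P2 H.
rewrite ler_pdivlMr// mulrC ler_pdivrMr//.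
by rewrite mulrC.
Qed.

(** [Jker f t] is the functional [boxed t] applied to [divided f t].  On characters
    polarization bounds this functional by diagonal values, so [tensor_bound]
    applies, uniformly in [t] up to subexponential factors; these are smaller than
    the decay inherited from [f]. *)
Lemma Jker_le c h : 0 < c -> 0 < h -> exists C, 0 <= C /\ forall f A t,
  csmooth f -> decay_gb s c h A f ->
  cabs (kernel_pair a (Jker f t)) <= C * A * wexp s (- (c / 4)) `|t|.
Proof.
move=> c0 h0; have e0 : 0 < c / 8 by rewrite divr_gt0.
have [h' [C1 [h'0 C10 H1]]] := gb_divided c0 h0 e0.
have [ep [C2 [ep0 C20 H2]]] := tensor_bound hs (d + d) (ltr0n R 2) h'0.
have [C3 [C30 H3]] := Qf_wave_le e0 ep0.
exists (C2 * (2 * C3) * C1); split; first by rewrite !mulr_ge0.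
move=> f A t sf gf; have W0 := ltW (wexp_gt0 s (c / 8) `|t|).
have su : csmooth (fun Z => divided f t (Z - corner t)).
  by apply: smooth_shift; exact: smooth_divided.
have M0 : 0 <= 2 * C3 * wexp s (c / 8) `|t| by rewrite !mulr_ge0.
have := H2 _ _ M0 (boxed_lin t) (boxed_cont t) _ _ _ su
  (fun Z => gb_shift (smooth_divided t sf) (H1 f A t _ sf gf)).
rewrite boxed_divided => /(_ _ _)/le_trans; apply.
- move=> m; have [k k1 ->] := boxed_ech t m; rewrite cabsM k1 mul1r.
  have e80 := ltW e0.
  apply: (le_trans (Qf_le hs sB gB aD pos (wave_D _ _) (wave_D _ _))).
  apply: (le_trans (lerD (H3 _ _) (H3 _ _))).
  have [lm rm] := lsub_rsub_norm m.
  have ml : wexp s ep `|- lsubmx m| <= \prod_i wexp s ep `|m 0 i|.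
    apply: le_trans (wexp_prod m (ltW ep0)); rewrite normrN.
    exact: wexp_mono (ltW ep0) (normr_ge0 _) lm.
  have mr : wexp s ep `|rsubmx m| <= \prod_i wexp s ep `|m 0 i|.
    apply: le_trans (wexp_prod m (ltW ep0)).
    exact: wexp_mono (ltW ep0) (normr_ge0 _) rm.
  have t0 : wexp s (c / 8) `|0 : 'rV[R]_d| <= wexp s (c / 8) `|t|.
    by apply: (wexp_mono hs e80 (normr_ge0 _)); exact: norm0t.
  have g1 := ltW (wexp_gt0 s ep `|rsubmx m|).
  have g2 := ltW (wexp_gt0 s (c / 8) `|0 : 'rV[R]_d|).
  have X1 := ler_wpM2l C30 (ler_pM g2 g1 t0 mr).
  have X2 := ler_wpM2l C30 (ler_wpM2l W0 ml).
  apply: (le_trans (lerD X1 X2)); apply: eq_ler; ring.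
- move=> Z i Zi; rewrite /divided.
  suff -> : cut t (Z - corner t) = 0 by rewrite !mulr0.
  rewrite -[Z - _]hsubmxK; apply: cut0; move: Zi.
  rewrite -(@fintype.splitK d d i); case: (fintype.split i) => j /= Zi.
    left; apply: le_trans (coord_le _ j); rewrite rowB mxE rowB.
    rewrite /corner row_mxEl rowB mxE ler_normr.
    by move: Zi => [Zi|Zi]; apply/orP; [right|left]; lra.
  right; apply: le_trans (coord_le _ j); rewrite mxE rowB.
  rewrite /corner row_mxEr mxE ler_normr.
  by move: Zi => [Zi|Zi]; apply/orP; [right|left]; lra.
apply: eq_ler.
have -> : - (c / 4) = c / 8 + (c / 8 + - (c / 2)) by field.
by rewrite 2!wexpD; ring.
Qed.

End LocalizedEstimate.

(** * Reconstruction from the localized pieces *)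

Section IntegralComplements.
Variable R : realType.

Lemma integralRn_ge0 n (f : 'rV[R]_n -> R) : (forall x, 0 <= f x) -> 0 <= integralRn f.
Proof.
elim: n f => [|n IH] f f0 /=; first exact: f0.
by apply: Rintegral_ge0 => t _; apply: IH => y; exact: f0.
Qed.

Lemma clip0 n : clip 0 0 (fun _ : 'rV[R]_n => 0 : R[i]).
Proof. by split=> // x y; rewrite subrr cabs0 mul0r. Qed.

Lemma intC_scale n L r (f : 'rV[R]_n -> R[i]) c : clip L r f ->
  integralC (fun x => c * f x) = c * integralC f.
Proof.
move=> cf; transitivity (integralC (fun x => (c - 1) * f x + f x)).
  by congr integralC; apply/funext => x; ring.
by rewrite (intC_lin _ cf cf); ring.
Qed.

Lemma intC0 n : integralC (fun _ : 'rV[R]_n => 0 : R[i]) = 0.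
Proof.
transitivity (integralC (fun _ : 'rV[R]_n => 0 * 0 : R[i])).
  by congr integralC; apply/funext => x; rewrite mul0r.
by rewrite (intC_scale 0 (clip0 n)) mul0r.
Qed.

Lemma intC_wle n (f : 'rV[R]_n -> R[i]) L r e : 0 <= e -> clip L r f ->
  (forall x, cabs (f x) <= e * wn x) -> cabs (integralC f) <= 2 * (e * W1 R ^+ n).
Proof.
move=> e0 cf fe; rewrite -[integralC f]subr0 -(intC0 n).
apply: intC_approx (clip0 n) _ => // [e' e'0|x]; last by rewrite subr0.
by exists f, L, r; split=> // x; rewrite subrr cabs0 mulr_ge0 ?(ltW e'0)// ltW// wn_gt0.
Qed.

Lemma clip_shiftC n L r (f : 'rV[R]_n -> R[i]) c : clip L r f ->
  clip L (r + `|c|) (fun x => f (x + c)).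
Proof.
move=> cf; have [L0 r0 _ f0] := cf; apply: (clip_shift _ cf); first exact: addr_ge0.
move=> x rx; apply: f0; have := ler_normB x c; lra.
Qed.

Variable s : R.
Hypothesis hs : 1 < s.

Lemma D_clip n (f : 'rV[R]_n -> R[i]) : Dspace s f -> exists L r, clip L r f.
Proof.
move=> /(DspaceP hs) [sf [[r fr] [h [A [h0 gf]]]]].
have A0 := gb_ge0 (gf 0).
exists (n%:R * (2 * (A * h))), `|r|; split=> //.
- by rewrite !mulr_ge0// ltW.
- move=> x y; apply: smooth_lip => // i z.
  by have := gf z [:: i]; rewrite /= /Fs powR1 mulr1 expr1.
- by move=> x rx; apply: fr; apply: le_lt_trans rx; exact: ler_norm.
Qed.

Lemma wexp_le_wn n c : 0 < c -> exists2 Z, 0 <= Z &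
  forall x : 'rV[R]_n, wexp s (- c) `|x| <= Z * wn x.
Proof.
move=> c0; pose Z := 2 ^+ n * (1 + gK s c ^+ (2 * n) * Fs s (2 * n)).
have K0 : 0 <= gK s c ^+ (2 * n) * Fs s (2 * n).
  by rewrite mulr_ge0 ?exprn_ge0 ?gK_ge0// ltW// Fs_gt0.
exists Z; first by rewrite mulr_ge0 ?exprn_ge0// addr_ge0.
move=> x; have wE : (wn x)^-1 = \prod_i (1 + x 0 i ^+ 2).
  by rewrite /wn -prodfV; apply: eq_bigr => i _; rewrite /w1 invrK /oneDsqr.
have w0 := wn_gt0 x; have e0 := wexp_gt0 s c `|x|.
rewrite wexpN -[leRHS]invrK lef_pV2 ?posrE ?invr_gt0//; last first.
  by rewrite mulr_gt0// /Z mulr_gt0 ?exprn_gt0// ltr_pwDl.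
rewrite invfM wE; have Z0 : 0 < Z by rewrite /Z mulr_gt0 ?exprn_gt0// ltr_pwDl.
rewrite mulrC ler_pdivrMr//.
have X0 := normr_ge0 x.
apply: (@le_trans _ _ ((1 + `|x| ^+ 2) ^+ n)).
  have -> : (1 + `|x| ^+ 2) ^+ n = \prod_(i < n) (1 + `|x| ^+ 2).
    by rewrite prodr_const card_ord.
  apply: ler_prod => i _.
  rewrite addr_ge0 ?sqr_ge0//= lerD2l -[leLHS]real_normK ?num_real//.
  by apply: ler_expn => //; exact: coord_le.
have y0 : 0 <= `|x| ^+ 2 by exact: sqr_ge0.
apply: (@le_trans _ _ (2 ^+ n * (1 + (`|x| ^+ 2) ^+ n))).
  have [y1|y1] := leP (`|x| ^+ 2) 1.
    apply: (@le_trans _ _ (2 ^+ n)); first by apply: ler_expn; lra.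
    by rewrite ler_peMr ?exprn_ge0// lerDl exprn_ge0.
  apply: (@le_trans _ _ ((2 * `|x| ^+ 2) ^+ n)); first by apply: ler_expn; lra.
  by rewrite exprMn ler_wpM2l ?exprn_ge0// lerDr.
rewrite -exprM [leRHS]mulrC /Z -mulrA ler_wpM2l ?exprn_ge0//.
have := pow_le_wexp hs (2 * n) c0 X0; have := wexp_ge1 s `|x| (ltW c0).
move: K0; move: (gK s c ^+ _ * _) (wexp s c _) (`|x| ^+ _) => K W Y K0 W1 H.
by rewrite mulrDl mul1r; apply: lerD.
Qed.

End IntegralComplements.

Section Reconstruction.
Variables (R : realType) (s : R).
Hypothesis hs : 1 < s.
Variables (d : nat) (B : 'rV[R]_(d + d) -> R[i]).
Hypotheses (sB : csmooth B) (B0 : forall Z, B Z != 0).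
Hypotheses (gB : subexp_gb s B) (gBV : subexp_gb s (fun Z => (B Z)^-1)).
Variable a : ('rV[R]_d -> R[i]) -> R[i].
Hypothesis aD : Ddual s a.
Hypothesis pos : positive_convB B (Dspace s) a.
Variables (r : 'rV[R]_d -> R) (hr : R).
Hypotheses (hr0 : 0 < hr) (sr : csmooth (cx r)) (gr : forall x, gb s hr 1 (cx r) x).
Hypothesis r1 : forall x, 1 <= `|x| -> r x = 0.
Hypothesis rpos : 0 < r 0.
Implicit Types (f g : 'rV[R]_d -> R[i]) (t : 'rV[R]_d).

Lemma cx_D : Dspace s (cx r).
Proof.
apply/(DspaceP hs); split=> //; split; last by exists hr, 1.
by exists 1 => x x1; rewrite /cx r1// ltW.
Qed.

Lemma D_mul n (f g : 'rV[R]_n -> R[i]) : gevb s f -> Dspace s g -> Dspace s (fun x => f x * g x).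
Proof.
move=> [sf [h [A [h0 gf]]]] /(DspaceP hs) [sg [[q' gq] [h' [A' [h'0 gg]]]]].
apply/(DspaceP hs); split; first exact: smooth_mul.
split; first by exists q' => x /gq ->; rewrite mulr0.
exists (h + h'), (A * A'); split; first exact: addr_gt0.
by move=> x; apply: gb_mul => //; exact: ltW.
Qed.

Lemma D_gevb n (f : 'rV[R]_n -> R[i]) : Dspace s f -> gevb s f.
Proof. by move=> /(DspaceP hs) [sf [_ gf]]; split. Qed.

Lemma gevb_diff f : gevb s f -> gevb s (fun Z : 'rV[R]_(d + d) => f (lc 1 (- 1) 0 Z)).
Proof.
move=> [sf [h [A [h0 gf]]]]; split; first exact: smooth_lc.
by exists h, A; split=> // Z; apply: gb_lc => //; rewrite ?normr1 ?normrN1.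
Qed.

Definition sqbump x : R[i] := cx r x * cx r x.

Lemma sqbump_D : Dspace s sqbump. Proof. exact: D_mul (D_gevb cx_D) cx_D. Qed.

Definition autocorr (w : 'rV[R]_d) : R[i] := integralC (fun x => sqbump x * sqbump (x - w)).

Let G0 (Z : 'rV[R]_(d + d)) := tens sqbump (fun x => conjc (sqbump x)) Z.

Let conj_D f : Dspace s f -> Dspace s (fun x => conjc (f x)).
Proof.
move=> /(DspaceP hs) [sf [[q fq] [h [A [h0 gf]]]]].
apply/(DspaceP hs); split; first exact: smooth_conj.
split; first by exists q => x /fq ->; rewrite conjc0.
by exists h, A; split=> // x; exact: gb_conj.
Qed.

Let G0_slice x : kslice G0 x = fun w => sqbump x * sqbump (x - w).
Proof. by apply/funext => w; rewrite /kslice /G0 tens_row conjcK mulrC. Qed.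

Let G0_kernel_test : kernel_test s G0.
Proof. by apply: kernel_test_tens => //; [exact: sqbump_D|apply: conj_D; exact: sqbump_D]. Qed.

Let G0_fam : exists h A L q q', lipfam s h A L q q' (kslice G0).
Proof.
have [sG [h [A [q [h0 q0 gG Gq]]]]] := G0_kernel_test.
exists (s2 s * h), A, ((d + d)%:R * (2 * (A * (s2 s * h)))), q, (2 * q).
exact: kslice_lipfam.
Qed.

Lemma autocorr_clip w : exists L q, clip L q (fun x => sqbump x * sqbump (x - w)).
Proof.
have [h [A [L [q [q' F]]]]] := G0_fam.
have := lipfam_clip [::] w F => /= C; eexists; exists q.
by under eq_fun do rewrite -[_ * _]/((fun w => sqbump _ * sqbump (_ - w)) w) -G0_slice; exact: C.
Qed.

Lemma autocorr_D : Dspace s autocorr.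
Proof.
have [h [A [L [q [q' F]]]]] := G0_fam; have [[h0 _ _] _] := F.
have E : autocorr = fun z => integralC (fun x => kslice G0 x z).
  by apply/funext => z; congr integralC; apply/funext => x; rewrite G0_slice.
have [sN _] := lipfam_int_dl F; have [rN gN] := lipfam_int F.
rewrite E; apply/(DspaceP hs); split=> //; split; first by exists q'.
by exists h, (2 * A * vol d q).
Qed.

Lemma Re_sqbump x y : Re (sqbump x * sqbump y) = (r x * r y) ^+ 2.
Proof. by rewrite /sqbump /cx !Re_mul !Im_mul /=; ring. Qed.

Definition mass : R[i] := integralC autocorr.

(** The integrand is nonnegative and positive at the origin. *)
Lemma mass_neq0 : mass != 0.
Proof.
have [L [q cN]] := D_clip hs autocorr_D; have [L0 q0 _ _] := cN.
have N0 w : 0 <= Re (autocorr w).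
  by apply: integralRn_ge0 => x; rewrite Re_sqbump sqr_ge0.
have N00 : 0 < Re (autocorr 0).
  have [L' [q' c']] := autocorr_clip 0; have [L'0 q'0 _ _] := c'.
  apply: (lipn_int_gt0 L'0 q'0 (clip_Re c')) => [x|].
    by rewrite Re_sqbump sqr_ge0.
  by rewrite Re_sqbump subr0 exprn_gt0// mulr_gt0.
have := lipn_int_gt0 L0 q0 (clip_Re cN) N0 N00.
by apply: contraTneq => m0; rewrite -[integralRn _]/(Re mass) m0 ltxx.
Qed.

Definition spread f (Z : 'rV[R]_(d + d)) : R[i] :=
  f (lc 1 (- 1) 0 Z) * autocorr (lc 0 1 0 Z).

Lemma spread_slice f t : kslice (spread f) t = fun z => f z * autocorr (t - z).
Proof.
apply/funext => z; rewrite /kslice /spread lc1N lc_row scale0r scale1r add0r addr0.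
by rewrite opprB addrC subrK.
Qed.

Let n01 : `|0 : R| <= 1. Proof. by rewrite normr0. Qed.
Let n11 : `|1 : R| <= 1. Proof. by rewrite normr1. Qed.
Let nN1 : `|-1 : R| <= 1. Proof. by rewrite normrN1. Qed.

Lemma diff_kernel_test f g : Dspace s f -> Dspace s g ->
  kernel_test s (fun Z : 'rV[R]_(d + d) => f (lc 1 (- 1) 0 Z) * g (lc 0 1 0 Z)).
Proof.
move=> /(DspaceP hs) [sf [[q fq] [h [A [h0 gf]]]]].
move=> /(DspaceP hs) [sg [[q' gq] [h' [A' [h'0 gg]]]]].
have s1 := smooth_lc 1 (- 1) 0 sf; have s2' := smooth_lc 0 1 0 sg.
split; first exact: smooth_mul.
exists (h + h'), (A * A'), (`|q| + `|q'|); split.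
- exact: addr_gt0.
- exact: addr_ge0.
- move=> Z; apply: gb_mul => //; [exact: ltW|exact: ltW| |].
    by apply: gb_lc => //; exact: gf.
  by apply: gb_lc => //; exact: gg.
have [nq nq'] := (ler_norm q, ler_norm q').
have [pq pq'] := (normr_ge0 q, normr_ge0 q').
move=> Z; rewrite -[Z]hsubmxK lc1N lc_row scale0r scale1r add0r addr0.
set x := lsubmx Z; set y := rsubmx Z => /norm_row_gt[h1|h1].
  have [qy|qy] := ltP q' `|y|; first by rewrite (gq y qy) mulr0.
  rewrite fq ?mul0r//; have := ler_distD y x 0; rewrite !subr0; lra.
by rewrite gq ?mulr0//; lra.
Qed.

Lemma Jker_kernel_test f t : Dspace s f -> kernel_test s (Jker r f t).
Proof.
move=> Df; have Dc : Dspace s (cut r t).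
  by apply/(kernel_testE hs); apply: kernel_test_tens => //; exact: (wave_D hs hr0 sr gr r1).
apply/(kernel_testE hs); apply: D_mul; first by apply: gevb_diff; exact: D_gevb.
exact: D_mul (D_gevb Dc) Dc.
Qed.

(** Carrying out the integral in [x] leaves a convolution square of the cutoff,
    evaluated at [t - z]. *)
Lemma kernel_pair_Jker f t : Dspace s f -> kernel_pair a (Jker r f t) = a (kslice (spread f) t).
Proof.
move=> Df; rewrite -(a_kernel_pair hs aD (Jker_kernel_test t Df)) spread_slice; congr a.
apply/funext => z; have [L [q c]] := autocorr_clip (t - z).
rewrite /autocorr -(intC_shift (- z) c).
have c' := clip_shiftC (- z) c.
rewrite -(intC_scale (f z) c'); congr integralC; apply/funext => x.
rewrite /Jker lc1N cut_row opprB addrC subrK /sqbump.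
rewrite (_ : x - z - (t - z) = x - t); last by rewrite opprB addrA subrK.
ring.
Qed.

Lemma spread_kernel_test f : Dspace s f -> kernel_test s (spread f).
Proof. by move=> Df; apply: diff_kernel_test => //; exact: autocorr_D. Qed.

(** Carrying out the integral in [t] leaves a constant. *)
Lemma kernel_pair_spread f : Dspace s f -> kernel_pair a (spread f) = mass * a f.
Proof.
move=> Df; rewrite -(a_kernel_pair hs aD (spread_kernel_test Df)) -(a_scale hs aD _ Df); congr a.
apply/funext => z; have [L [q c]] := D_clip hs autocorr_D.
rewrite /mass mulrC -(intC_shift (- z) c) -(intC_scale (f z) (clip_shiftC (- z) c)).
congr integralC; apply/funext => t.
exact: (congr1 (fun F => F z) (spread_slice f t)).
Qed.

(** Integrating the localized pieces over all positions gives [mass * a f], and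
    their decay makes the integral converge with the right bound. *)
Theorem positive_bound c h : 0 < c -> 0 < h -> exists C, 0 <= C /\ forall f A,
  Dspace s f -> decay_gb s c h A f -> cabs (a f) <= C * A.
Proof.
move=> c0 h0; have [C [C0 HJ]] := Jker_le hs sB B0 gB gBV aD pos hr0 sr gr r1 c0 h0.
have c40 : 0 < c / 4 by rewrite divr_gt0.
have [Z Z0 HZ] := wexp_le_wn hs d c40.
have m0 : 0 < cabs mass.
  by rewrite lt_def cabs_ge0 andbT; apply: contra mass_neq0 => /eqP /cabs_eq0 ->.
exists ((cabs mass)^-1 * (2 * (C * Z * W1 R ^+ d))); split.
  by rewrite mulr_ge0 ?invr_ge0 ?cabs_ge0// !mulr_ge0// exprn_ge0// W1_ge0.
move=> f A Df gf; have A0 : 0 <= A.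
  by move: (gb_ge0 (gf 0)); rewrite (pmulr_lge0 _ (wexp_gt0 _ _ _)).
have [sf _] := proj1 (DspaceP hs _) Df.
rewrite -[leRHS]mulrA ler_pdivlMl// -cabsM -kernel_pair_spread// /kernel_pair.
have [L [q cJ]] := kernel_test_clip hs aD (spread_kernel_test Df).
have e0 : 0 <= C * A * Z by rewrite !mulr_ge0.
have := intC_wle e0 cJ _; move=> /(_ _)/le_trans; apply; last by apply: eq_ler; ring.
move=> t; rewrite -kernel_pair_Jker//; apply: (le_trans (HJ f A t sf gf)).
by rewrite -[leRHS]mulrA; apply: ler_wpM2l (HZ t); exact: mulr_ge0.
Qed.

End Reconstruction.

(** * Truncation and extension by continuity *)

Section Cutoffs.
Variables (R : realType) (s : R).
Hypothesis hs : 1 < s.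
Variable d : nat.
Variables (r : 'rV[R]_d -> R) (hr : R).
Hypotheses (hr0 : 0 < hr) (sr : csmooth (cx r)) (gr : forall x, gb s hr 1 (cx r) x).
Hypothesis r1 : forall x, 1 <= `|x| -> r x = 0.
Hypothesis rpos : 0 < r 0.
Implicit Types (f g : 'rV[R]_d -> R[i]).

Lemma scale_axis (k : R) : axis_map (fun x : 'rV[R]_d => k *: x) (fun=> k) id.
Proof.
split.
  apply: (@lipmap_cont R _ _ _ `|k|) => x y.
  by rewrite -scalerBr normrZ.
by move=> x j h; rewrite scalerDr scalerA mulrC.
Qed.

Definition chi (j : nat) (x : 'rV[R]_d) : R[i] :=
  Complex (r 0)^-1 0 * cx r (j.+1%:R^-1 *: x).

Definition trunc j f x : R[i] := chi j x * f x.

Let k0 j : 0 < j.+1%:R^-1 :> R. Proof. by rewrite invr_gt0 ltr0n. Qed.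
Let k1 j : j.+1%:R^-1 <= 1 :> R. Proof. by rewrite invf_le1 ?ltr0n// ler1n. Qed.

Lemma smooth_chi j : csmooth (chi j).
Proof. by apply: smooth_scale; exact: (smooth_pull (scale_axis _) sr). Qed.

Lemma gb_chi j x : gb s hr (r 0)^-1 (chi j) x.
Proof.
have k1' : `|j.+1%:R^-1 : R| <= 1 by rewrite ger0_norm ?k1// ltW.
have G : gb s hr 1 (fun x => cx r (j.+1%:R^-1 *: x)) x.
  exact: (gb_pull (scale_axis j.+1%:R^-1) sr (fun=> k1') (gr _)).
have := gb_scale (Complex (r 0)^-1 0) (smooth_pull (scale_axis j.+1%:R^-1) sr) G.
by rewrite cabs_real ger0_norm ?invr_ge0 ?(ltW rpos)// mulr1.
Qed.

Lemma chi_supp j x : j.+1%:R <= `|x| -> chi j x = 0.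
Proof.
move=> jx; have y1 : 1 <= `|j.+1%:R^-1 *: x|.
  by rewrite normrZ ger0_norm ?(ltW (k0 j))// mulrC ler_pdivlMr ?mul1r ?ltr0n.
by rewrite /chi /cx (r1 y1) mulr0.
Qed.

Definition chiK : R := (d%:R * (2 * hr) + 1) / r 0.

Lemma chiK_ge0 : 0 <= chiK.
Proof. by rewrite divr_ge0 ?(ltW rpos)// addr_ge0// !mulr_ge0// ltW. Qed.

Lemma gb_1Bchi j x : gb s hr (chiK * (1 + `|x|) / j.+1%:R) (fun x => 1 - chi j x) x.
Proof.
set k : R := j.+1%:R^-1; have kk0 := k0 j; have kk1 := k1 j; rewrite -/k in kk0 kk1.
have ri0 : 0 <= (r 0)^-1 by rewrite invr_ge0 ltW.
have X0 := normr_ge0 x.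
move=> [|i l].
  rewrite -[size _]/0%N -[dl _ _ _]/(1 - chi j x) expr0 Fs0 !mulr1.
  have -> : 1 - chi j x = Complex (r 0)^-1 0 * (cx r 0 - cx r (k *: x)).
    rewrite /chi -/k mulrBr; congr (_ - _); rewrite /cx.
    by apply: ceq; rewrite !cparts /= ?mulVf ?gt_eqF//; ring.
  have H : cabs (cx r 0 - cx r (k *: x)) <= d%:R * (2 * hr) * `|0 - k *: x|.
    apply: smooth_lip => // i z; have := gr z [:: i].
    by rewrite /= /Fs powR1 mul1r mulr1 expr1.
  rewrite cabsM cabs_real (ger0_norm ri0) /chiK.
  rewrite sub0r normrN normrZ (gtr0_norm kk0) in H.
  apply: (le_trans (ler_wpM2l ri0 H)).
  have -> : (d%:R * (2 * hr) + 1) / r 0 * (1 + `|x|) * k =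
     (r 0)^-1 * ((d%:R * (2 * hr) + 1) * (k * (1 + `|x|))) by ring.
  apply: ler_wpM2l => //; apply: ler_pM.
  - by rewrite !mulr_ge0// ltW.
  - by rewrite mulr_ge0// ltW.
  - by rewrite lerDl.
  - by rewrite ler_pM2l// lerDr.
rewrite (@dl_sub R d (i :: l) _ _ (smooth_cst _ 1) (smooth_chi j)) dl_cst sub0r cabsN.
rewrite /chi dl_scale; last exact: (smooth_pull (scale_axis _) sr).
rewrite (dl_pull _ (scale_axis _) sr) map_id cabsM [cabs (_ * _)]cabsM !cabs_real (ger0_norm ri0).
rewrite big_const_seq count_predT -/k; set q := size (i :: l).
have -> : iter q ( *%R k) 1 = k ^+ q by elim: q => [|q IH]; rewrite ?expr0// iterS IH exprS.
have kq : `|k ^+ q| <= k.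
  rewrite ger0_norm ?exprn_ge0 ?(ltW kk0)// /q /= exprS ler_piMr ?(ltW kk0)//.
  by rewrite exprn_ile1// ltW.
have g := gr (k *: x) (i :: l); rewrite -/q mul1r in g.
have -> : chiK * (1 + `|x|) * k * hr ^+ q * Fs s q =
    ((d%:R * (2 * hr) + 1) * (1 + `|x|)) * ((r 0)^-1 * (k * (hr ^+ q * Fs s q))).
  by rewrite /chiK; ring.
have P : 0 <= (r 0)^-1 * (k * (hr ^+ q * Fs s q)).
  by rewrite !mulr_ge0 ?exprn_ge0 ?(ltW hr0) ?(ltW kk0)// ltW// Fs_gt0.
apply: (@le_trans _ _ ((r 0)^-1 * (k * (hr ^+ q * Fs s q)))).
  by apply: (ler_wpM2l ri0); exact: (ler_pM (normr_ge0 _) (cabs_ge0 _) kq g).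
rewrite ler_peMl// mulr_ege1 ?lerDl// lerDr; apply: mulr_ge0 => //.
by rewrite mulr_ge0// ltW.
Qed.

Lemma trunc_lin j f g c :
  trunc j (fun x => c * f x + g x) = fun x => c * trunc j f x + trunc j g x.
Proof. by apply/funext => x; rewrite /trunc; ring. Qed.

Lemma trunc_D j f : gevb s f -> Dspace s (trunc j f).
Proof.
move=> [sf [h [A [h0 gf]]]]; have sc := smooth_chi j.
apply/(DspaceP hs); split; first exact: smooth_mul.
split; first by exists j.+1%:R => x jx; rewrite /trunc chi_supp ?mul0r// ltW.
exists (hr + h), ((r 0)^-1 * A); split; first exact: addr_gt0.
by move=> x; apply: gb_mul => //; [exact: ltW|exact: ltW|exact: gb_chi].
Qed.

(** Since [chi j 0 = 1], the factor [1 - chi j x] is at most of order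
    [|x| / (j + 1)]; giving up half of the decay absorbs [|x|]. *)
Lemma trunc_diff c h : 0 < c -> 0 < h -> exists K, 0 <= K /\ forall f A j,
  csmooth f -> decay_gb s c h A f ->
  decay_gb s (c / 2) (hr + h) (K * A / j.+1%:R) (fun x => f x - trunc j f x).
Proof.
move=> c0 h0; have c20 : 0 < c / 2 by rewrite divr_gt0.
exists (chiK * (1 + gK s (c / 2))); split.
  by rewrite mulr_ge0 ?chiK_ge0// addr_ge0// gK_ge0.
move=> f A j sf gf x; have A0 : 0 <= A.
  by move: (gb_ge0 (gf 0)); rewrite (pmulr_lge0 _ (wexp_gt0 _ _ _)).
have kk0 := ltW (k0 j); have s1 := smooth_sub (smooth_cst d 1) (smooth_chi j).
rewrite (_ : (fun x => _) = fun x => (1 - chi j x) * f x); last first.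
  by apply/funext => y; rewrite /trunc mulrBl mul1r.
have hh : 0 <= hr + h by rewrite addr_ge0// ltW.
apply: (gb_le hh (lexx _) _ (gb_mul hs (ltW hr0) (ltW h0) s1 sf (gb_1Bchi j x) (gf x))).
have H : (1 + `|x|) * wexp s (- c) `|x| <= (1 + gK s (c / 2)) * wexp s (- (c / 2)) `|x|.
  have -> : - c = - (c / 2) + - (c / 2) by field.
  rewrite wexpD mulrA; apply: ler_wpM2r; first exact: ltW (wexp_gt0 _ _ _).
  rewrite wexpN ler_pdivrMr ?wexp_gt0// mulrDl mul1r; apply: lerD.
    exact: wexp_ge1 (ltW c20).
  by have := pow_le_wexp hs 1 c20 (normr_ge0 x); rewrite /Fs powR1 mulr1 !expr1.
have Kc := chiK_ge0; move: H Kc kk0 A0.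
move: `|x| (wexp s (- c) _) (wexp s (- (c / 2)) _) (gK _ _) chiK (j.+1%:R^-1) => X W V G K k H K0 kk A0.
have -> : K * (1 + X) * k * (A * W) = K * A * k * ((1 + X) * W) by ring.
have -> : K * (1 + G) * A * k * V = K * A * k * ((1 + G) * V) by ring.
by apply: ler_wpM2l => //; rewrite !mulr_ge0.
Qed.

End Cutoffs.

Section Extension.
Variables (R : realType) (s : R).
Hypothesis hs : 1 < s.

(** The limit is the supremum of the lower bounds [u j - M / (j + 1)]. *)
Lemma harmonic_limit (u : nat -> R) M :
  (forall j k, `|u j - u k| <= M / j.+1%:R + M / k.+1%:R) ->
  exists l, forall j, `|u j - l| <= M / j.+1%:R.
Proof.
move=> uM; pose S := [set x | exists j, x = u j - M / j.+1%:R]%classic.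
have S0 : S !=set0 by exists (u 0%N - M / 1); exists 0%N.
have ubS j : ubound S (u j + M / j.+1%:R).
  move=> _ [k ->]; have := uM j k; rewrite ler_norml.
  by move: (M / _) (M / _) (u j) (u k) => x y v w; lra.
have hS : has_sup S by split=> //; exists (u 0%N + M / 1); exact: ubS.
exists (sup S) => j; rewrite ler_norml.
have h1 : sup S <= u j + M / j.+1%:R by apply: ge_sup.
have h2 : u j - M / j.+1%:R <= sup S by apply: ub_le_sup; [exact: hS.2|exists j].
by move: h1 h2; move: (M / _) (u j) => x v; lra.
Qed.

Lemma harmonic_limitC (u : nat -> R[i]) M :
  (forall j k, cabs (u j - u k) <= M / j.+1%:R + M / k.+1%:R) ->
  exists l, forall j, cabs (u j - l) <= 2 * M / j.+1%:R.
Proof.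
move=> uM.
have [l1 H1] : exists l, forall j, `|Re (u j) - l| <= M / j.+1%:R.
  apply: harmonic_limit => j k; apply: le_trans (uM j k).
  by rewrite -[- Re (u k)]Re_opp -Re_add; exact: cabs_Re.
have [l2 H2] : exists l, forall j, `|Im (u j) - l| <= M / j.+1%:R.
  apply: harmonic_limit => j k; apply: le_trans (uM j k).
  by rewrite -[- Im (u k)]Im_opp -Im_add; exact: cabs_Im.
exists (Complex l1 l2) => j; apply: (le_trans (cabs_le_ReIm _)).
rewrite Re_add Im_add Re_opp Im_opp /=; apply: (le_trans (lerD (H1 j) (H2 j))).
by apply: eq_ler; ring.
Qed.

Lemma le_harmonic (x C M : R) : (forall j : nat, x <= C + M / j.+1%:R) -> x <= C.
Proof.
move=> H; apply/ler_addgt0Pr => e e0.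
have M0 : 0 <= `|M| by [].
have [K HK] := arch_inv M0 e0; apply: (le_trans (H K.*2)); rewrite lerD2l.
by apply: le_trans HK; rewrite ler_wpM2r ?invr_ge0// ler_norm.
Qed.

Variable d : nat.
Variables (r : 'rV[R]_d -> R) (hr : R).
Hypotheses (hr0 : 0 < hr) (sr : csmooth (cx r)) (gr : forall x, gb s hr 1 (cx r) x).
Hypothesis r1 : forall x, 1 <= `|x| -> r x = 0.
Hypothesis rpos : 0 < r 0.
Implicit Types (f g : 'rV[R]_d -> R[i]).
Local Notation trunc := (trunc r).

Lemma decay_gb_gevb c h A f : 0 < c -> 0 < h -> csmooth f -> decay_gb s c h A f -> gevb s f.
Proof.
move=> c0 h0 sf gf; split=> //; exists h, A; split=> // x.
have A0 : 0 <= A by move: (gb_ge0 (gf 0)); rewrite (pmulr_lge0 _ (wexp_gt0 _ _ _)).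
apply: (gb_le (ltW h0) (lexx _) _ (gf x)).
rewrite -[leRHS]mulr1; apply: (ler_wpM2l A0).
rewrite wexpN invf_le1 ?wexp_gt0//; exact: wexp_ge1 (ltW c0).
Qed.

Lemma S_gevb f : Sspace s f -> gevb s f.
Proof.
by move=> /(SspaceP hs) [sf [c [h [A [c0 h0 gf]]]]]; exact: decay_gb_gevb c0 h0 sf gf.
Qed.

Lemma S_trunc_D j f : Sspace s f -> Dspace s (trunc j f).
Proof. by move=> /S_gevb gf; exact: (trunc_D hs hr0 sr gr r1 rpos). Qed.

Variable a : ('rV[R]_d -> R[i]) -> R[i].
Hypothesis aD : Ddual s a.
Hypothesis aB : forall c h, 0 < c -> 0 < h -> exists C, 0 <= C /\ forall f A,
  Dspace s f -> decay_gb s c h A f -> cabs (a f) <= C * A.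

Definition trunc_lim f l := exists M, forall j, cabs (a (trunc j f) - l) <= M / j.+1%:R.

Lemma trunc_lim_unique f l l' : trunc_lim f l -> trunc_lim f l' -> l = l'.
Proof.
move=> [M HM] [M' HM']; apply/eqP; rewrite -subr_eq0; apply/eqP/cabs_eq0.
apply: le_anti; rewrite cabs_ge0 andbT; apply: (@le_harmonic _ _ (M + M')) => j.
rewrite add0r mulrDl -cabsN opprB.
rewrite (_ : l' - l = (a (trunc j f) - l) - (a (trunc j f) - l')); last by ring.
exact: le_trans (cabsB _ _) (lerD (HM j) (HM' j)).
Qed.

Lemma decay_gb_sub c h A A' f g : csmooth f -> csmooth g -> decay_gb s c h A f -> decay_gb s c h A' g ->
  decay_gb s c h (A + A') (fun x => f x - g x).
Proof.
move=> sf sg gf gg x; rewrite mulrDl.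
rewrite (_ : (fun x => _) = fun x => f x + -1 * g x); last first.
  by apply/funext => y; rewrite mulN1r.
apply: gb_add => //; first exact: smooth_scale.
rewrite -[X in gb _ _ X](_ : cabs (-1) * (A' * wexp s (- c) `|x|) = _); last first.
  by rewrite cabsN cabs1 mul1r.
exact: gb_scale.
Qed.

Lemma trunc_lim_ex c h A f : 0 < c -> 0 < h -> csmooth f -> decay_gb s c h A f ->
  exists l, trunc_lim f l.
Proof.
move=> c0 h0 sf gf; have gv := decay_gb_gevb c0 h0 sf gf.
have c20 : 0 < c / 2 by rewrite divr_gt0.
have [K [K0 HK]] := trunc_diff hs hr0 sr gr rpos c0 h0.
have [C [C0 HC]] := aB c20 (addr_gt0 hr0 h0).
have sc j : csmooth (trunc j f).
  by have := trunc_D hs hr0 sr gr r1 rpos j gv => /(DspaceP hs) [].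
have [|l Hl] := @harmonic_limitC (fun j => a (trunc j f)) (C * (K * A)).
  move=> j k; have Dj := trunc_D hs hr0 sr gr r1 rpos j gv.
  have Dk := trunc_D hs hr0 sr gr r1 rpos k gv.
  rewrite -(a_sub aD Dj Dk).
  rewrite (_ : _ + _ = C * (K * A / k.+1%:R + K * A / j.+1%:R)); last by ring.
  apply: HC.
    rewrite (_ : (fun x => _) = fun x => 1 * trunc j f x + -1 * trunc k f x).
      exact: Dspace_comb.
    by apply/funext => x; rewrite mul1r mulN1r.
  rewrite (_ : (fun x => _) = fun x => (f x - trunc k f x) - (f x - trunc j f x)).
    by apply: decay_gb_sub; [exact: smooth_sub|exact: smooth_sub|exact: HK|exact: HK].
  by apply/funext => x; ring.
by exists l, (2 * (C * (K * A))).
Qed.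

(** The value 0 outside of the space is the convention of [Sdual]. *)
Definition ext f : R[i] :=
  if pselect (Sspace s f) then xget 0 [set l | trunc_lim f l]%classic else 0.

Lemma ext_lim f : Sspace s f -> trunc_lim f (ext f).
Proof.
move=> Sf; rewrite /ext; case: (pselect (Sspace s f)) => // Sf'.
have /(SspaceP hs) [sf [c [h [A [c0 h0 gf]]]]] := Sf.
have [l Hl] := trunc_lim_ex c0 h0 sf gf.
by apply: (@xgetPex _ 0 [set l | trunc_lim f l]%classic); exists l.
Qed.

Lemma extE f l : Sspace s f -> trunc_lim f l -> ext f = l.
Proof. by move=> Sf; exact: trunc_lim_unique (ext_lim Sf). Qed.

Lemma ext_linear f g c : Sspace s f -> Sspace s g ->
  ext (fun x => c * f x + g x) = c * ext f + ext g.
Proof.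
move=> Sf Sg; have S1 : Sspace s (fun x => c * f x + g x).
  have := Sspace_comb hs c 1 Sf Sg.
  by under eq_fun do rewrite mul1r.
apply: extE => //; have [M HM] := ext_lim Sf; have [M' HM'] := ext_lim Sg.
exists (cabs c * M + M') => j.
rewrite trunc_lin.
rewrite (Dlin aD c (S_trunc_D j Sf) (S_trunc_D j Sg)).
rewrite (_ : _ - _ = c * (a (trunc j f) - ext f) + (a (trunc j g) - ext g)); last by ring.
apply: (le_trans (cabsD _ _)); rewrite cabsM mulrDl -mulrA.
by apply: lerD => //; apply: ler_wpM2l => //; exact: cabs_ge0.
Qed.

Lemma ext_D f : Dspace s f -> ext f = a f.
Proof.
move=> Df; have Sf := D_sub_S hs Df; apply: extE => //.
have /(SspaceP hs) [sf [c [h [A [c0 h0 gf]]]]] := Sf.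
have c20 : 0 < c / 2 by rewrite divr_gt0.
have [K [K0 HK]] := trunc_diff hs hr0 sr gr rpos c0 h0.
have [C [C0 HC]] := aB c20 (addr_gt0 hr0 h0).
exists (C * (K * A)) => j; have Dj := S_trunc_D j Sf.
rewrite -cabsN opprB -(a_sub aD Df Dj) -mulrA; apply: HC; last exact: HK.
rewrite (_ : (fun x => _) = fun x => 1 * f x + -1 * trunc j f x).
  exact: Dspace_comb.
by apply/funext => x; rewrite mul1r mulN1r.
Qed.

Lemma ext_Sdual : Sdual s ext.
Proof.
apply: (Sdual_intro hs); first by move=> f g c; exact: ext_linear.
  move=> c h c0 h0; have c20 : 0 < c / 2 by rewrite divr_gt0.
  have [K [K0 HK]] := trunc_diff hs hr0 sr gr rpos c0 h0.
  have [C [C0 HC]] := aB c20 (addr_gt0 hr0 h0).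
  exists (C * (1 + K)) => f A sf gf.
  have A0 : 0 <= A by move: (gb_ge0 (gf 0)); rewrite (pmulr_lge0 _ (wexp_gt0 _ _ _)).
  have Sf : Sspace s f by apply/(SspaceP hs); split=> //; exists c, h, A.
  have [M HM] := ext_lim Sf; apply: (@le_harmonic _ _ M) => j.
  have Dj := S_trunc_D j Sf; have [sj _] := proj1 (DspaceP hs _) Dj.
  rewrite -[ext f](subrK (a (trunc j f))) addrC; apply: (le_trans (cabsD _ _)).
  rewrite -[cabs (ext f - _)]cabsN opprB; apply: lerD (HM j).
  rewrite -mulrA; apply: HC => //.
  rewrite (_ : trunc j f = fun x => f x - (f x - trunc j f x)); last first.
    by apply/funext => x; rewrite subKr.
  rewrite mulrDl mul1r; apply: decay_gb_sub => //; first exact: smooth_sub.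
    apply: (decay_gb_le _ (ltW h0) _ (lexx _) gf); first by lra.
    by rewrite lerDr ltW.
  apply: (decay_gb_le (lexx _) _ (lexx _) _ (HK f A j sf gf)).
    by rewrite addr_ge0// ltW.
  rewrite ler_pdivrMr ?ltr0n// ler_peMr ?ler1n//; exact: mulr_ge0.
by move=> f nf; rewrite /ext; case: (pselect (Sspace s f)).
Qed.

Lemma ext_restrict : restrictD s ext = a.
Proof.
apply/funext => f; rewrite /restrictD /patch; case: ifPn => [|/negP nf].
  by rewrite inE => /ext_D.
have [_ [_ a0]] := aD; rewrite a0// => Df; apply: nf; exact/mem_set.
Qed.

End Extension.

(** * Positivity on the larger space *)

Lemma wexpN_le1 (R : realType) (s c X : R) : 0 <= c -> wexp s (- c) X <= 1.
Proof. by move=> c0; rewrite wexpN (invf_le1 (wexp_gt0 _ _ _)); exact: wexp_ge1. Qed.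

Section SpacePositivity.
Variables (R : realType) (s : R).
Hypothesis hs : 1 < s.
Variables (d : nat) (B : 'rV[R]_(d + d) -> R[i]).
Hypotheses (sB : csmooth B) (gB : subexp_gb s B).
Implicit Types (phi : 'rV[R]_d -> R[i]) (b : ('rV[R]_d -> R[i]) -> R[i]).

(** Half of the decay of [phi] is traded for a factor growing with [x], which the
    other occurrence of the test function absorbs. *)
Lemma conv_decay_gb c h : 0 < c -> 0 < h -> exists h' C, [/\ 0 < h', 0 <= C &
  forall phi A x, csmooth phi -> decay_gb s c h A phi ->
    decay_gb s (c / 8) h' (C * A * wexp s (c / 2) `|x|)
      (fun z => B (row_mx x (x - z)) * phi (x - z))].
Proof.
move=> c0 h0; have c80 : 0 < c / 8 by rewrite divr_gt0.
have [hB [C [hB0 C0 HB]]] := gB c80.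
exists (hB + h), C; split=> //; first exact: addr_gt0.
move=> phi A x sp gp z.
have A0 : 0 <= A by move: (gb_ge0 (gp 0)); rewrite (pmulr_lge0 _ (wexp_gt0 _ _ _)).
have hh : 0 <= hB + h by rewrite addr_ge0// ltW.
apply: (gb_le hh (lexx _) _ (conv_gb hs sB (ltW hB0) (ltW h0) sp (HB _) (gp _))).
set y := x - z; have [x0 y0] := (normr_ge0 x, normr_ge0 y).
have E4 : 2 * (c / 8) = c / 4 by field.
have H1 : wexp s (c / 8) `|row_mx x y| <= wexp s (c / 4) `|x| * wexp s (c / 4) `|y|.
  rewrite -E4; apply: le_trans (wexp_add hs (ltW c80) x0 y0).
  apply: (wexp_mono hs (ltW c80) (normr_ge0 _)).
  by apply: norm_row_le; rewrite ?lerDl ?lerDr.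
have H2 : wexp s (c / 8) `|z| <= wexp s (c / 4) `|x| * wexp s (c / 4) `|y|.
  rewrite -E4; apply: le_trans (wexp_add hs (ltW c80) x0 y0).
  apply: (wexp_mono hs (ltW c80) (normr_ge0 _)).
  by rewrite (_ : z = x - y) ?ler_normB// /y subKr.
have c20 : 0 < c / 2 by rewrite divr_gt0.
have H3 : wexp s (c / 4) `|y| * (wexp s (c / 4) `|y| * wexp s (- c) `|y|) <= 1.
  rewrite -!wexpD; have -> : c / 4 + (c / 4 + - c) = - (c / 2) by field.
  exact: (wexpN_le1 s _ (ltW c20)).
have E2 : wexp s (c / 2) `|x| = wexp s (c / 4) `|x| * wexp s (c / 4) `|x|.
  by rewrite -wexpD; have -> : c / 4 + c / 4 = c / 2 by field.
rewrite E2 [wexp s (- (c / 8)) _]wexpN.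
have P1 := wexp_gt0 s (c / 8) `|z|; have P2 := wexp_gt0 s (c / 4) `|x|.
have P3 := wexp_gt0 s (c / 4) `|y|; have P4 := wexp_gt0 s (- c) `|y|.
move: H1 H2 H3 P1 P2 P3 P4 => {E2 E4}.
move: (wexp s (c / 8) `|z|) (wexp s (c / 8) `|row_mx x y|) (wexp s (c / 4) `|x|)
  (wexp s (c / 4) `|y|) (wexp s (- c) `|y|) => U V X Y W H1 H2 H3 U0 X0 Y0 W0.
have -> : C * V * (A * W) = C * A * (V * W) by ring.
have -> : C * A * (X * X) / U = C * A * (X * X / U) by ring.
apply: ler_wpM2l; first exact: mulr_ge0.
rewrite ler_pdivlMr//; apply: (@le_trans _ _ ((X * Y) * W * (X * Y))).
  apply: (le_trans (ler_wpM2r (ltW U0) (ler_wpM2r (ltW W0) H1))).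
  by apply: ler_wpM2l H2; apply: mulr_ge0 (ltW W0); rewrite mulr_ge0// ltW.
rewrite (_ : X * Y * W * (X * Y) = X * X * (Y * (Y * W))); last by ring.
by rewrite ler_piMr// mulr_ge0// ltW.
Qed.

Lemma conv_S phi x : Sspace s phi -> Sspace s (fun z => B (row_mx x (x - z)) * phi (x - z)).
Proof.
move=> /(SspaceP hs) [sp [c [h [A [c0 h0 gp]]]]].
have [h' [C [h'0 C0 H]]] := conv_decay_gb c0 h0.
apply/(SspaceP hs); split; first exact: conv_smooth.
exists (c / 8), h', (C * A * wexp s (c / 2) `|x|); split=> //; first by rewrite divr_gt0.
exact: H.
Qed.

Lemma restrictDE b phi : Dspace s phi -> restrictD s b phi = b phi.
Proof. by move=> Dp; rewrite /restrictD /patch mem_set. Qed.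

Lemma restrict_Ddual b : Sdual s b -> Ddual s (restrictD s b).
Proof.
move=> bS; apply: (Ddual_intro hs).
- move=> f g c Df Dg; rewrite !restrictDE//.
    by apply: (Slin bS); exact: D_sub_S.
  have := Dspace_comb hs c 1 Df Dg.
  by under eq_fun do rewrite mul1r.
- move=> q h h0; have [C [C0 HC]] := Sdual_bound hs bS ltr01 h0.
  exists (C * wexp s 1 `|q|) => f A sf fq gf.
  have A0 := gb_ge0 (gf 0).
  have Df : Dspace s f.
    by apply/(DspaceP hs); split=> //; split; [exists q|exists h, A].
  rewrite restrictDE// -mulrA; apply: HC => // x.
  have W0 x' := ltW (wexp_gt0 s 1 x').
  have x1 : `|x| <= `|q| -> gb s h (wexp s 1 `|q| * A * wexp s (- (1)) `|x|) f x.
    move=> xq; apply: (gb_le (ltW h0) (lexx _) _ (gf x)).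
    rewrite mulrAC ler_peMl// wexpN ler_pdivlMr ?wexp_gt0// mul1r.
    exact: (wexp_mono hs ler01 (normr_ge0 _)).
  have [xq|qx] := leP `|x| `|q|; first exact: x1.
  move=> l; rewrite (dl_supp l sf fq) ?cabs0; last exact: le_lt_trans (ler_norm _) qx.
  apply: mulr_ge0 (ltW (Fs_gt0 _ _)); apply: mulr_ge0 (exprn_ge0 _ (ltW h0)).
  by apply: mulr_ge0 (ltW (wexp_gt0 _ _ _)); exact: mulr_ge0.
- move=> f nf; rewrite /restrictD /patch; case: ifPn => //.
  by rewrite inE.
Qed.

Lemma convB_D_clip a phi psi : Ddual s a -> Dspace s phi -> Dspace s psi ->
  exists L q, clip L q (fun x => convB B a phi x * conjc (psi x)).
Proof.
move=> aD Dp Dq; have [L [q c]] := kernel_test_clip hs aD (kernel_test_Bt hs sB gB Dp Dq).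
exists L, q; rewrite (_ : (fun x => _) = fun x => a (kslice (fun Z => B Z * tens phi psi Z) x))//.
apply/funext => x; rewrite /convB mulrC -(a_scale hs aD); last exact: conv_D.
by congr a; apply/funext => z; rewrite /kslice tens_row; ring.
Qed.

Lemma convB_restrict b phi : Dspace s phi ->
  convB B (restrictD s b) phi = convB B b phi.
Proof. by move=> Dp; apply/funext => x; rewrite /convB restrictDE//; exact: conv_D. Qed.

Variables (r : 'rV[R]_d -> R) (hr : R).
Hypotheses (hr0 : 0 < hr) (sr : csmooth (cx r)) (gr : forall x, gb s hr 1 (cx r) x).
Hypothesis r1 : forall x, 1 <= `|x| -> r x = 0.
Hypothesis rpos : 0 < r 0.

Definition diag_form b phi x : R[i] := convB B b phi x * conjc (phi x).

(** Each of the two occurrences of [phi] is truncated in turn. *)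
Lemma diag_form_trunc b phi : Sdual s b -> Sspace s phi -> exists E, 0 <= E /\
  forall j x, cabs (diag_form b phi x - diag_form b (trunc r j phi) x) <=
    E / j.+1%:R * wn x.
Proof.
move=> bS Sp; have /(SspaceP hs) [sp [c [h [A [c0 h0 gp]]]]] := Sp.
have A0 : 0 <= A by move: (gb_ge0 (gp 0)); rewrite (pmulr_lge0 _ (wexp_gt0 _ _ _)).
have c20 : 0 < c / 2 by rewrite divr_gt0.
have h20 : 0 < hr + h by exact: addr_gt0.
have [K [K0 HK]] := trunc_diff hs hr0 sr gr rpos c0 h0.
have [h' [C [h'0 C0 HC]]] := conv_decay_gb c20 h20.
have c80 : 0 < c / 2 / 8 by rewrite divr_gt0.
have [C' [C'0 HC']] := Sdual_bound hs bS c80 h'0.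
have c40 : 0 < c / 4 by rewrite divr_gt0.
have [Z Z0 HZ] := wexp_le_wn hs d c40.
pose A1 := (1 + K) * A.
have A10 : 0 <= A1 by rewrite mulr_ge0// addr_ge0.
exists (2 * (C' * C * (K * A) * A1) * Z); split; first by do ?[apply: mulr_ge0 => //].
move=> j x; set pj := trunc r j phi.
have Dj : Dspace s pj by exact: (S_trunc_D hs hr0 sr gr r1 rpos).
have Sj := D_sub_S hs Dj; have [sj _] := proj1 (DspaceP hs _) Dj.
have k0 : 0 <= j.+1%:R^-1 :> R by rewrite invr_ge0.
have gd := HK phi A j sp gp.
have g1 : decay_gb s (c / 2) (hr + h) A1 phi.
  apply: (decay_gb_le _ (ltW h0) _ _ gp); first by lra.
    by rewrite lerDr ltW.
  by rewrite /A1 ler_peMl// lerDl.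
have gj : decay_gb s (c / 2) (hr + h) A1 pj.
  rewrite (_ : pj = fun x => phi x - (phi x - pj x)); last first.
    by apply/funext => y; rewrite subKr.
  rewrite /A1 mulrDl mul1r; apply: decay_gb_sub => //; first exact: smooth_sub.
    apply: (decay_gb_le _ (ltW h0) _ (lexx _) gp); first by lra.
    by rewrite lerDr ltW.
  apply: (decay_gb_le (lexx _) _ (lexx _) _ gd); first exact: ltW.
  rewrite ler_pdivrMr ?ltr0n// ler_peMr ?ler1n//; exact: mulr_ge0.
have sd : csmooth (fun x => phi x - pj x) by exact: smooth_sub.
have conv_le f A' : csmooth f -> decay_gb s (c / 2) (hr + h) A' f ->
    cabs (convB B b f x) <= C' * (C * A' * wexp s (c / 2 / 2) `|x|).
  by move=> sf gf; apply: HC'; [exact: conv_smooth|exact: HC].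
have val_le f A' : decay_gb s (c / 2) (hr + h) A' f -> cabs (f x) <= A' * wexp s (- (c / 2)) `|x|.
  by move=> gf; have := gf x [::]; rewrite -[size _]/0%N expr0 Fs0 !mulr1.
have linB : convB B b phi x - convB B b pj x = convB B b (fun x => phi x - pj x) x.
  rewrite /convB.
  rewrite (_ : (fun z => B _ * (phi _ - pj _)) = fun z => -1 * (B (row_mx x (x - z)) * pj (x - z))
     + B (row_mx x (x - z)) * phi (x - z)); last by apply/funext => z; ring.
  by rewrite (Slin bS)//; [ring|exact: conv_S|exact: conv_S].
have W : wexp s (c / 2 / 2) `|x| * wexp s (- (c / 2)) `|x| <= Z * wn x.
  apply: le_trans (HZ x); rewrite -wexpD.
  have -> : c / 2 / 2 + - (c / 2) = - (c / 4) by field.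
  exact: lexx.
have W1 := ltW (wexp_gt0 s (c / 2 / 2) `|x|); have W2 := ltW (wexp_gt0 s (- (c / 2)) `|x|).
have Ka : 0 <= K * A / j.+1%:R by rewrite !mulr_ge0.
have T1 : cabs ((convB B b phi x - convB B b pj x) * conjc (phi x)) <=
    C' * C * (K * A / j.+1%:R) * A1 * (Z * wn x).
  rewrite linB cabsM cabs_conj.
  apply: (le_trans (ler_pM (cabs_ge0 _) (cabs_ge0 _) (conv_le _ _ sd gd) (val_le _ _ g1))).
  move: W W1 W2; move: (wexp s (c / 2 / 2) _) (wexp s (- (c / 2)) _) (Z * _) => U V Y H _ _.
  rewrite (_ : _ * (A1 * V) = C' * C * (K * A / j.+1%:R) * A1 * (U * V)); last by ring.
  by apply: ler_wpM2l H; do ?[apply: mulr_ge0 => //].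
have T2 : cabs (convB B b pj x * conjc (phi x - pj x)) <=
    C' * C * (K * A / j.+1%:R) * A1 * (Z * wn x).
  rewrite cabsM cabs_conj.
  apply: (le_trans (ler_pM (cabs_ge0 _) (cabs_ge0 _) (conv_le _ _ sj gj) (val_le _ _ gd))).
  move: W W1 W2; move: (wexp s (c / 2 / 2) _) (wexp s (- (c / 2)) _) (Z * _) => U V Y H _ _.
  rewrite (_ : _ * (_ * V) = C' * C * (K * A / j.+1%:R) * A1 * (U * V)); last by ring.
  by apply: ler_wpM2l H; do ?[apply: mulr_ge0 => //].
rewrite (_ : diag_form b phi x - diag_form b pj x =
   (convB B b phi x - convB B b pj x) * conjc (phi x) +
   convB B b pj x * conjc (phi x - pj x)); last first.
  by rewrite /diag_form rmorphB /=; ring.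
apply: (le_trans (cabsD _ _)); apply: (le_trans (lerD T1 T2)).
by apply: eq_ler; ring.
Qed.

Lemma diag_form_clip b j phi : Sdual s b -> Sspace s phi ->
  exists L q, clip L q (diag_form b (trunc r j phi)).
Proof.
move=> bS Sp; have Dj : Dspace s (trunc r j phi) by exact: (S_trunc_D hs hr0 sr gr r1 rpos).
have := convB_D_clip (restrict_Ddual bS) Dj Dj.
by rewrite convB_restrict.
Qed.

(** The scalar [k] serves the normalizing constant of twisted convolution. *)
Lemma diag_int_trunc b phi k : Sdual s b -> Sspace s phi -> exists E,
  forall j, cabs (integralC (fun x => k * diag_form b phi x) -
    k * integralC (diag_form b (trunc r j phi))) <= E / j.+1%:R.
Proof.
move=> bS Sp; have [E [E0 HE]] := diag_form_trunc bS Sp.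
have cl j : exists L q, clip L q (fun x => k * diag_form b (trunc r j phi) x).
  have [L [q c]] := diag_form_clip j bS Sp.
  exists (cabs k * L), q; case: c => L0 q0 cL cq; split=> //.
  - by rewrite mulr_ge0// cabs_ge0.
  - by move=> x y; rewrite -mulrBr cabsM -mulrA; apply: ler_wpM2l; [exact: cabs_ge0|].
  - by move=> x /cq ->; rewrite mulr0.
have ap j x : cabs (k * diag_form b phi x - k * diag_form b (trunc r j phi) x) <=
    cabs k * E / j.+1%:R * wn x.
  by rewrite -mulrBr cabsM -!mulrA mulrA; rewrite -mulrA; apply: ler_wpM2l;
    [exact: cabs_ge0|rewrite mulrA; exact: HE].
exists (2 * (cabs k * E * W1 R ^+ d)) => j.
have [L [q c]] := diag_form_clip j bS Sp; rewrite -(intC_scale k c).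
have [L' [q' c']] := cl j.
have kE : 0 <= cabs k * E by rewrite mulr_ge0// cabs_ge0.
have := intC_approx _ _ c' (ap j); move=> /(_ _ _)/le_trans; apply.
- move=> e e0; have [i Hi] := arch_inv kE e0; have [L2 [q2 c2]] := cl i.*2.
  exists (fun x => k * diag_form b (trunc r i.*2 phi) x), L2, q2; split=> // x.
  by apply: (le_trans (ap _ _)); apply: ler_wpM2r Hi; exact: ltW (wn_gt0 _).
- by rewrite divr_ge0.
by apply: eq_ler; ring.
Qed.

Lemma diag_int_scale b phi k : Sdual s b -> Sspace s phi ->
  integralC (fun x => k * diag_form b phi x) = k * integralC (diag_form b phi).
Proof.
move=> bS Sp; have [E HE] := diag_int_trunc k bS Sp.
have [E' HE'] := diag_int_trunc 1 bS Sp.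
apply/eqP; rewrite -subr_eq0; apply/eqP/cabs_eq0/le_anti; rewrite cabs_ge0 andbT.
apply: (@le_harmonic _ _ _ (E + cabs k * E')) => j; rewrite add0r mulrDl.
have H1 := HE j; have := HE' j; rewrite mul1r.
under eq_fun do rewrite mul1r.
move=> H2; set I1 := integralC _ in H1 *; set I2 := integralC _ in H2 *.
set I3 := integralC _ in H1 H2.
rewrite (_ : I1 - k * I2 = (I1 - k * I3) - k * (I2 - I3)); last by ring.
apply: (le_trans (cabsB _ _)); apply: lerD H1 _; rewrite cabsM -mulrA.
by apply: ler_wpM2l H2; exact: cabs_ge0.
Qed.

Lemma positive_extends b : Sdual s b ->
  (forall phi, Dspace s phi -> 0 <= integralC (diag_form b phi)) ->
  forall phi, Sspace s phi -> 0 <= integralC (diag_form b phi).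
Proof.
move=> bS pos phi Sp; have [E] := diag_int_trunc 1 bS Sp.
under eq_fun do rewrite mul1r.
move=> HE; set z := integralC _ in HE *.
have P j := complex_ge0 (pos _ (S_trunc_D hs hr0 sr gr r1 rpos j Sp)).
have h1 : - Re z <= 0.
  apply: (@le_harmonic _ _ _ E) => j; rewrite add0r; apply: le_trans (HE j).
  have [p1 _] := P j; have := cabs_Re (z - 1 * integralC (diag_form b (trunc r j phi))).
  by rewrite mul1r Re_add Re_opp ler_norml; move: p1; lra.
have h2 : `|Im z| <= 0.
  apply: (@le_harmonic _ _ _ E) => j; rewrite add0r; apply: le_trans (HE j).
  have [_ p2] := P j; have := cabs_Im (z - 1 * integralC (diag_form b (trunc r j phi))).
  by rewrite mul1r Im_add Im_opp p2 subr0.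
move: h1 h2; rewrite normr_le0 oppr_le0; case: z {HE} => u v /= h1 /eqP ->.
by rewrite lecE /= eqxx.
Qed.

End SpacePositivity.

Section PositiveSpaces.
Variables (R : realType) (s : R).
Hypothesis hs : 1 < s.
Variables (d : nat) (B : 'rV[R]_(d + d) -> R[i]).
Hypotheses (sB : csmooth B) (B0 : forall Z, B Z != 0).
Hypotheses (gB : subexp_gb s B) (gBV : subexp_gb s (fun Z => (B Z)^-1)).

Lemma DBplus_SBplus : DBplus B s = restrictD s @` SBplus B s.
Proof.
have [r [hr [hr0 sr gr [_ rpos r1]]]] := bump_exists hs d.
apply/seteqP; split=> [a [aD pos]|_ [b [bS pos] <-]].
  have aB c h := @positive_bound R s hs d B sB B0 gB gBV a aD pos r hr hr0 sr gr r1 rpos c h.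
  have eS := ext_Sdual hs hr0 sr gr r1 rpos aD aB.
  have eR := ext_restrict hs hr0 sr gr r1 rpos aD aB.
  exists (ext s r a) => //; split=> // phi Sp.
  apply: (positive_extends hs sB gB hr0 sr gr r1 rpos eS) => // psi Dp.
  by rewrite /diag_form -(convB_restrict hs sB gB _ Dp) eR; exact: pos.
split; first exact: restrict_Ddual.
move=> phi Dp; rewrite (convB_restrict hs sB gB _ Dp); apply: pos; exact: D_sub_S.
Qed.

End PositiveSpaces.

(** * Exponentials of quadratic forms *)

Section QuadraticPhase.
Variables (R : realType) (s : R).
Hypothesis hs : 1 < s.
Variable n : nat.

Definition coordC (k : 'I_n) : 'rV[R]_n -> R[i] := fun x => Complex (x 0 k) 0.

Lemma coordC_isD k i : isD i (coordC k) (fun=> - Complex 0 1 * Complex (i == k)%:R 0).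
Proof.
move=> x; rewrite mulrA mulrN -mulNr iiN mul1r; split; last exact: is_derive_cst.
apply: (@is_derive_quad R _ _ _ _ _ 0) => t /=.
by rewrite rowD rowZ rowE [k == i]eq_sym addrK subrr normr0 mul0r.
Qed.

Lemma smooth_coordC k : csmooth (coordC k).
Proof.
apply/csmoothP => -[|m].
  apply: (@lip_ccont _ _ _ 1) => x y; rewrite mul1r /coordC.
  rewrite (_ : _ - _ = Complex (x 0 k - y 0 k) 0); last by apply: ceq; rewrite !cparts /= ?subrr.
  by rewrite cabs_real -rowB; exact: coord_le.
split.
  apply: (@lip_ccont _ _ _ 1) => x y; rewrite mul1r /coordC.
  rewrite (_ : _ - _ = Complex (x 0 k - y 0 k) 0); last by apply: ceq; rewrite !cparts /= ?subrr.
  by rewrite cabs_real -rowB; exact: coord_le.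
move=> i; exists (fun=> - Complex 0 1 * Complex (i == k)%:R 0); first exact: coordC_isD.
exact: Cs_cst.
Qed.

(** Each derivative falling on the coordinate removes one letter from the word. *)
Lemma dl_coord_mul k g l : csmooth g -> exists ws : seq (seq 'I_n),
  [/\ (size ws <= size l)%N, all (fun w => (size w).+1 == size l) ws &
   dl l (fun x => coordC k x * g x) = fun x => coordC k x * dl l g x +
     \sum_(w <- ws) - Complex 0 1 * dl w g x].
Proof.
move=> sg; elim: l => [|i l [ws [sz aw E]]].
  by exists [::]; split=> //; apply/funext => x; rewrite big_nil addr0.
have sl w : csmooth (dl w g) by exact: smooth_dl.
have s1 : csmooth (fun x => coordC k x * dl l g x).
  by apply: smooth_mul; [exact: smooth_coordC|].
have s2 : csmooth (fun x => \sum_(w <- ws) - Complex 0 1 * dl w g x).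
  by apply: smooth_sum => w; exact: smooth_scale.
have D : D1 i (dl l (fun x => coordC k x * g x)) = fun x =>
    (- Complex 0 1 * Complex (i == k)%:R 0) * dl l g x + coordC k x * dl (i :: l) g x +
    \sum_(w <- ws) - Complex 0 1 * dl (i :: w) g x.
  rewrite E (D1_add i s1 s2) (D1_mul i (smooth_coordC k) (sl l)) (isD_D1 (coordC_isD k i)).
  apply/funext => x; congr (_ + _).
  have := @dl_sum R n _ ws (fun w x => - Complex 0 1 * dl w g x) [:: i].
  rewrite /= => -> => [|w]; last exact: smooth_scale.
  by apply: eq_bigr => w _; rewrite (D1_scale i _ (sl w)).
have aw' : all (fun w => (size w).+1 == size (i :: l)) (map (cons i) ws).
  by rewrite all_map; apply: sub_all aw => w /= /eqP ->.
have [ik|ik] := eqVneq i k.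
  exists (l :: map (cons i) ws); split.
  - by rewrite /= size_map ltnS.
  - by rewrite /= eqxx.
  rewrite dl_cons D; apply/funext => x; rewrite big_cons big_map ik eqxx.
  by rewrite (_ : Complex 1%:R 0 = 1)//; ring.
exists (map (cons i) ws); split=> //; first by rewrite size_map /= ltnW.
rewrite dl_cons D; apply/funext => x; rewrite big_map (negbTE ik).
by rewrite (_ : Complex 0%:R 0 = 0)//; ring.
Qed.

Variables (q : 'rV[R]_n -> R) (c : 'I_n -> R) (tau : 'I_n -> 'I_n).
Hypothesis qcont : continuous (q : 'rV[R]_n -> R^o).
Hypothesis c2 : forall j, `|c j| <= 2.
(** [q] is a quadratic form whose partial derivatives are single coordinates. *)
Hypothesis qD : forall Z j (t : R), q (t *: delta_mx 0 j + Z) = q Z + t * (c j * Z 0 (tau j)).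

Let P Z := cexpi (q Z).

Lemma phase_isD j : isD j P (fun Z => Complex (c j) 0 * (coordC (tau j) Z * P Z)).
Proof.
move=> Z; have D : is_derive Z (delta_mx 0 j) (q : 'rV[R]_n -> R^o) (c j * Z 0 (tau j)).
  apply: (@is_derive_quad R _ _ _ _ _ 0) => t;
    rewrite qD mul0r (_ : _ - _ - _ = 0) ?normr0//; ring.
apply: (cder_eq (cder_cexpi D)); congr (_ * _); rewrite mulrA; congr (_ * _).
by apply: ceq; rewrite !cparts /=; ring.
Qed.

Lemma smooth_phase : csmooth P.
Proof.
have cP : ccont P by exact: ccont_cexpi.
apply/csmoothP => k; elim: k => [|k IH] //.
split=> // j; exists (fun Z => Complex (c j) 0 * (coordC (tau j) Z * P Z)).
  exact: phase_isD.
apply: Cs_mul; first exact: Cs_cst.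
by apply: Cs_mul => //; have /csmoothP := smooth_coordC (tau j).
Qed.

(** One derivative of [exp (i q)] multiplies it by a coordinate; by induction this
    costs a factor [|Z|] plus the number of letters already in the word. *)
Lemma phase_pow l Z : cabs (dl l P Z) <= 2 ^+ size l * (`|Z| + (size l)%:R) ^+ size l.
Proof.
have [k] := ubnP (size l); elim: k l => // k IH l; rewrite ltnS => lk.
have X0 := normr_ge0 Z.
case/lastP: l lk => [|l j]; first by rewrite !expr0 mulr1 cabs_cexpi.
rewrite size_rcons => lk; rewrite dl_rcons (isD_D1 (phase_isD j)).
have [ws [sz aw E]] := dl_coord_mul (tau j) l smooth_phase.
rewrite dl_scale; last by apply: smooth_mul; [exact: smooth_coordC|exact: smooth_phase].
rewrite {}E cabsM cabs_real; set m := size l in lk sz aw *.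
have Y0 : 0 <= `|Z| + m%:R by rewrite addr_ge0.
have H1 : cabs (coordC (tau j) Z * dl l P Z) <= `|Z| * (2 ^+ m * (`|Z| + m%:R) ^+ m).
  rewrite cabsM cabs_real; apply: ler_pM => //; [exact: cabs_ge0|exact: coord_le|].
  exact: IH.
have H2 : cabs (\sum_(w <- ws) - Complex 0 1 * dl w P Z) <= 2 ^+ m * (`|Z| + m%:R) ^+ m.
  apply: (le_trans (cabs_sum _ _ _)).
  case: (posnP m) => [m0|m0].
    move: sz; rewrite m0 leqn0 size_eq0 => /eqP ->.
    by rewrite big_nil !expr0 mulr1.
  apply: (@le_trans _ _ (\sum_(w <- ws) 2 ^+ m.-1 * (`|Z| + m%:R) ^+ m.-1)).
    rewrite big_seq [leRHS]big_seq; apply: ler_sum => w /(allP aw) /eqP sw.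
    rewrite cabsM cabsN cabs_i mul1r.
    have wk : (size w < k)%N by rewrite sw; exact: ltnW.
    apply: (le_trans (IH _ wk)); rewrite -sw /=.
    apply: ler_wpM2l; first exact: exprn_ge0.
    by apply: ler_expn; rewrite ?addr_ge0// lerD2l ler_nat.
  rewrite big_const_seq count_predT iter_addr addr0 -[leLHS]mulr_natl.
  have Em (x : R) : x ^+ m = x * x ^+ m.-1 by rewrite -exprS prednK.
  rewrite (Em 2) (Em (`|Z| + m%:R)).
  have mY : (size ws)%:R <= `|Z| + m%:R by apply: ler_wpDl => //; rewrite ler_nat.
  have T0 : 0 <= 2 ^+ m.-1 * (`|Z| + m%:R) ^+ m.-1 :> R.
    by rewrite mulr_ge0// exprn_ge0.
  rewrite (_ : 2 * _ * (_ * _) = 2 * (`|Z| + m%:R) * (2 ^+ m.-1 * (`|Z| + m%:R) ^+ m.-1)); last by ring.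
  apply: ler_wpM2r => //; lra.
have S0 : 0 <= 2 ^+ m * (`|Z| + m%:R) ^+ m by rewrite mulr_ge0// exprn_ge0.
apply: (@le_trans _ _ (2 * ((`|Z| + 1) * (2 ^+ m * (`|Z| + m%:R) ^+ m)))).
  apply: ler_pM => //; [exact: cabs_ge0|]; apply: (le_trans (cabsD _ _)).
  by rewrite mulrDl mul1r; exact: lerD.
rewrite 2!exprS -mulrA; apply: ler_wpM2l => //.
rewrite mulrCA; apply: ler_wpM2l; first exact: exprn_ge0.
apply: ler_pM.
- by rewrite addr_ge0.
- exact: exprn_ge0.
- by rewrite lerD2l ler1n.
- by apply: ler_expn => //; rewrite lerD2l ler_nat.
Qed.

Lemma subexp_gb_phase : subexp_gb s P.
Proof.
move=> e e0; pose H := 4 * (gK s e + expR 1).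
have H0 : 0 < H by rewrite mulr_gt0// ltr_wpDl ?gK_ge0// expR_gt0.
exists H, 2; split=> // Z l; set k := size l.
have X0 := normr_ge0 Z; have W1 := wexp_ge1 s `|Z| (ltW e0).
have Fk1 := Fs_ge1 hs k.
apply: (le_trans (phase_pow l Z)); rewrite -/k.
have E0 := expR_gt0 (1 : R); have K0 := gK_ge0 s e.
have HX : `|Z| ^+ k <= (gK s e + expR 1) ^+ k * Fs s k * wexp s e `|Z|.
  apply: (le_trans (pow_le_wexp hs k e0 X0)).
  apply: ler_wpM2r; first exact: ltW (wexp_gt0 _ _ _).
  apply: ler_wpM2r; first exact: ltW (Fs_gt0 _ _).
  by apply: ler_expn => //; rewrite lerDl ltW.
have Hk : k%:R ^+ k <= (gK s e + expR 1) ^+ k * Fs s k * wexp s e `|Z| :> R.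
  apply: (le_trans (expr_le_fact_expR k (ler0n R k))).
  have -> : expR k%:R = expR 1 ^+ k :> R by rewrite -expRM_natl mulr1.
  rewrite mulrC; apply: (@le_trans _ _ ((gK s e + expR 1) ^+ k * Fs s k)).
    apply: ler_pM; [exact: exprn_ge0 (ltW E0)|exact: ler0n| |].
      by apply: ler_expn; [exact: ltW|rewrite lerDr].
    rewrite /Fs -[leLHS]powRr1//; apply: ler_powR; last exact: ltW.
    by rewrite ler1n fact_gt0.
  by rewrite ler_peMr// mulr_ge0 ?exprn_ge0 ?addr_ge0 ?(ltW E0)// ltW// Fs_gt0.
have Hs : (`|Z| + k%:R) ^+ k <= 2 ^+ k * (`|Z| ^+ k + k%:R ^+ k).
  have [h|h] := leP `|Z| k%:R.
    apply: (@le_trans _ _ ((2 * k%:R) ^+ k)); first by apply: ler_expn; [rewrite addr_ge0|lra].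
    by rewrite exprMn ler_wpM2l ?exprn_ge0// lerDr exprn_ge0.
  apply: (@le_trans _ _ ((2 * `|Z|) ^+ k)); first by apply: ler_expn; [rewrite addr_ge0|lra].
  by rewrite exprMn ler_wpM2l ?exprn_ge0// lerDl exprn_ge0.
have p2 : 0 <= 2 ^+ k :> R by exact: exprn_ge0.
apply: (le_trans (ler_wpM2l p2 Hs)).
apply: (le_trans (ler_wpM2l p2 (ler_wpM2l p2 (lerD HX Hk)))).
rewrite /H exprMn (_ : 4 = 2 * 2); last by ring.
rewrite exprMn; move: (wexp s e _) (Fs s k) ((gK s e + expR 1) ^+ k) (2 ^+ k) => w F G t.
by apply: eq_ler; ring.
Qed.

Lemma phase_inv Z : (P Z)^-1 = conjc (P Z).
Proof.
apply: (mulfI (cexpi_neq0 (q Z))); rewrite mulfV ?cexpi_neq0//.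
by rewrite -cexpiN -cexpiD subrr cexpi0.
Qed.

Lemma subexp_gb_phaseV : subexp_gb s (fun Z => (P Z)^-1).
Proof.
under eq_fun do rewrite phase_inv.
move=> e /subexp_gb_phase [h [C [h0 C0 H]]]; exists h, C; split=> // Z.
by apply: gb_conj => //; exact: smooth_phase.
Qed.

End QuadraticPhase.

(** * Twisted convolution *)

Section TwistedConvolution.
Variables (R : realType) (s : R).
Hypothesis hs : 1 < s.
Variable d : nat.
Implicit Types (X Y : 'rV[R]_(d + d)) (Z : 'rV[R]_((d + d) + (d + d))).

Definition tphase Z : R := 2 * symp (lsubmx Z) (rsubmx Z).
Definition tker Z : R[i] := cexpi (tphase Z).

Lemma dotrC n (x y : 'rV[R]_n) : dotr x y = dotr y x.
Proof. by apply: eq_bigr => i _; rewrite mulrC. Qed.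

Lemma sub_lshift m n (t : R) i (Z : 'rV[R]_(m + n)) :
  lsubmx (t *: delta_mx 0 (lshift n i) + Z) = t *: delta_mx 0 i + lsubmx Z /\
  rsubmx (t *: delta_mx 0 (lshift n i) + Z) = rsubmx Z.
Proof.
split; apply/rowP => k; rewrite mxE rowD rowZ rowE.
  by rewrite eq_lshift rowD rowZ rowE mxE.
by rewrite eq_rlshift mulr0 add0r mxE.
Qed.

Lemma sub_rshift m n (t : R) i (Z : 'rV[R]_(m + n)) :
  lsubmx (t *: delta_mx 0 (rshift m i) + Z) = lsubmx Z /\
  rsubmx (t *: delta_mx 0 (rshift m i) + Z) = t *: delta_mx 0 i + rsubmx Z.
Proof.
split; apply/rowP => k; rewrite mxE rowD rowZ rowE.
  by rewrite eq_lrshift mulr0 add0r mxE.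
by rewrite eq_rshift rowD rowZ rowE mxE.
Qed.

Definition tau (j : 'I_((d + d) + (d + d))) : 'I_((d + d) + (d + d)) :=
  match fintype.split j with
  | inl i => match fintype.split i with
             | inl k => rshift (d + d) (rshift d k)
             | inr k => rshift (d + d) (lshift d k)
             end
  | inr i => match fintype.split i with
             | inl k => lshift (d + d) (rshift d k)
             | inr k => lshift (d + d) (lshift d k)
             end
  end.

Definition tsign (j : 'I_((d + d) + (d + d))) : R :=
  match fintype.split j with
  | inl i => if fintype.split i is inl _ then - 2 else 2
  | inr i => if fintype.split i is inl _ then 2 else - 2
  end.

Lemma tsign_le j : `|tsign j| <= 2.
Proof.
rewrite /tsign; case: (fintype.split j) => i; case: (fintype.split i) => k;
  by rewrite ?normrN ger0_norm.
Qed.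

Lemma splitL m n (i : 'I_m) : fintype.split (lshift n i) = inl i.
Proof. exact: (unsplitK (inl i)). Qed.

Lemma splitR m n (i : 'I_n) : fintype.split (rshift m i) = inr i.
Proof. exact: (unsplitK (inr i)). Qed.

Lemma tphase_step Z j (t : R) :
  tphase (t *: delta_mx 0 j + Z) = tphase Z + t * (tsign j * Z 0 (tau j)).
Proof.
rewrite /tphase /tsign /tau /symp.
case: (split_ordP j) => i ->; rewrite ?splitL ?splitR; case: (split_ordP i) => k ->;
  rewrite ?splitL ?splitR.
- have [-> ->] := sub_lshift t (lshift d k) Z.
  have [-> ->] := sub_lshift t k (lsubmx Z).
  rewrite [dotr (_ + _) _]dotrC dotrD dotrZ dotr_delta !mxE [dotr (rsubmx _) _]dotrC; ring.
- have [-> ->] := sub_lshift t (rshift d k) Z.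
  have [-> ->] := sub_rshift t k (lsubmx Z).
  rewrite dotrD dotrZ dotr_delta !mxE; ring.
- have [-> ->] := sub_rshift t (lshift d k) Z.
  have [-> ->] := sub_lshift t k (rsubmx Z).
  rewrite [dotr (_ + _) _]dotrC dotrD dotrZ dotr_delta !mxE
    [dotr (rsubmx _) (lsubmx _)]dotrC; ring.
- have [-> ->] := sub_rshift t (rshift d k) Z.
  have [-> ->] := sub_rshift t k (rsubmx Z).
  rewrite dotrD dotrZ dotr_delta !mxE; ring.
Qed.

Let co (i : 'I_(d + d)) : 'rV[R]_((d + d) + (d + d)) -> R[i] := coordC (lshift (d + d) i).
Let co' (i : 'I_(d + d)) : 'rV[R]_((d + d) + (d + d)) -> R[i] := coordC (rshift (d + d) i).

Lemma tphase_cont : continuous (tphase : 'rV[R]_((d + d) + (d + d)) -> R^o).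
Proof.
pose F Z : R[i] := \sum_(i <- index_enum 'I_d) Complex 2 0 *
  (co' (lshift d i) Z * co (rshift d i) Z + - 1 * (co (lshift d i) Z * co' (rshift d i) Z)).
have sF : csmooth F.
  apply: smooth_sum => i; apply: smooth_scale; apply: smooth_add.
    by apply: smooth_mul; exact: smooth_coordC.
  by apply: smooth_scale; apply: smooth_mul; exact: smooth_coordC.
have [cF _] := smooth_ccont sF.
rewrite (_ : tphase = fun Z => Re (F Z))//; apply/funext => Z.
rewrite /tphase /symp /dotr -sumrB mulr_sumr /F.
rewrite (big_morph (@complex.Re R) (@Re_add R) (erefl : Re 0 = 0)).
apply: eq_bigr => i _; rewrite !mxE /co /co' /coordC mulN1r.
by rewrite !Re_mul !Re_add !Re_opp !Re_mul !Im_add !Im_opp !Im_mul /=; ring.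
Qed.

Lemma twisted_convE a phi X :
  twisted_conv a phi X = Complex ((2 / pi) `^ (d%:R / 2)) 0 * convB tker a phi X.
Proof.
rewrite /twisted_conv /convB; congr (_ * a _); apply/funext => Y.
by rewrite /tker /tphase row_mxKl row_mxKr mulrC.
Qed.

Lemma twisted_pair_ge0 a phi z :
  integralC (fun X => Complex ((2 / pi) `^ (d%:R / 2)) 0 * diag_form tker a phi X) =
    Complex ((2 / pi) `^ (d%:R / 2)) 0 * z ->
  (0 <= sesqui_pair (regular_dual (twisted_conv a phi)) phi) = (0 <= z).
Proof.
move=> E; rewrite /sesqui_pair /regular_dual.
rewrite (_ : (fun X => _) = fun X =>
   Complex ((2 / pi) `^ (d%:R / 2)) 0 * diag_form tker a phi X); last first.
  by apply/funext => X; rewrite twisted_convE /diag_form mulrA.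
by rewrite E pmulr_rge0// ltcE /= eqxx /= powR_gt0// divr_gt0// pi_gt0.
Qed.

Let sT : csmooth tker := smooth_phase tphase_cont tphase_step.
Let gT : subexp_gb s tker := subexp_gb_phase hs tphase_cont tsign_le tphase_step.
Let gTV : subexp_gb s (fun Z => (tker Z)^-1) := subexp_gb_phaseV hs tphase_cont tsign_le tphase_step.

Lemma Dplus_DBplus : Dplus (d := d) s = DBplus tker s.
Proof.
apply/seteqP; split=> a [aD pos]; split=> // phi Dp; have := pos phi Dp;
  have [L [q c]] := convB_D_clip hs sT gT aD Dp Dp;
  by rewrite (twisted_pair_ge0 (intC_scale _ c)).
Qed.

Lemma Splus_SBplus : Splus (d := d) s = SBplus tker s.
Proof.
have [r [hr [hr0 sr gr [_ rpos r1]]]] := bump_exists hs (d + d).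
apply/seteqP; split=> b [bS pos]; split=> // phi Sp; have := pos phi Sp;
  by rewrite (twisted_pair_ge0 (diag_int_scale hs sT gT hr0 sr gr r1 rpos _ bS Sp)).
Qed.

Lemma Dplus_Splus : Dplus s = restrictD s @` Splus (d := d) s.
Proof.
rewrite Dplus_DBplus Splus_SBplus; apply: DBplus_SBplus => // Z; exact: cexpi_neq0.
Qed.

End TwistedConvolution.

Theorem theorem3p4 (R : realType) (d : nat) (s : R) (hs : 1 < s) :
  (forall B : 'rV[R]_(d + d) -> R[i],
     gevrey s B ->
     (forall Z, B Z != 0) ->
     growthB B s ->
     DBplus B s = restrictD s @` SBplus B s) /\
  Dplus s = restrictD s @` Splus (d := d) s.
Proof.
split; last exact: Dplus_Splus.
move=> B [sB _] B0 gB; have sB' : csmooth B by exact: CSmooth.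
have [g1 g2] := growth_subexp_gb hs sB' B0 gB.
exact: DBplus_SBplus.
Qed.
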